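(* Let $R$ be a non-constant rational function whose Julia set $J_R$ and Fatou set $F_R$ are non-empty, $B = C(\hat{\mathbb{C}})$, $A = C(J_R)$ and $I = \{b \in B : b|_{J_R} = 0\}$. Then the (closed two-sided) ideal $\mathcal{I}(I)$ generated by $I$ in $\mathcal{O}_R(\hat{\mathbb{C}})$ is Morita equivalent to $\mathcal{O}_R(F_R)$, and the quotient algebra $\mathcal{O}_R(\hat{\mathbb{C}})/\mathcal{I}(I)$ is canonically isomorphic to $\mathcal{O}_R = \mathcal{O}_R(J_R)$.
   Context: A rational function $R = P/Q$ ($P,Q$ relatively prime complex polynomials) is regarded as a map of the Riemann sphere $\hat{\mathbb{C}}$ to itself. The Fatou set $F_R$ is the maximal open subset of $\hat{\mathbb{C}}$ on which the iterates $(R^n)_n$ are equicontinuous; the Julia set is $J_R = \hat{\mathbb{C}} \setminus F_R$. Both are completely invariant: $R^{-1}(J_R) = J_R = R(J_R)$, $R^{-1}(F_R)=F_R = R(F_R)$. The branch index $e(x)$ at $x \in \hat{\mathbb{C}}$ is the integer $n\ge 1$ such that, in appropriate local charts, $R(z) = R(x) + c(z-x)^n + (\text{higher terms})$ with $c \neq 0$. For $E = \hat{\mathbb{C}}$, $J_R$ or $F_R$, let $\operatorname{graph} R|_E = \{(x,y)\in E\times E : y = R(x)\}$. Then $Z_E = C_0(\operatorname{graph} R|_E)$ (which is $C(\operatorname{graph} R|_E)$ when $E$ is compact) is a Hilbert bimodule over $D_E = C_0(E)$ with $(a\cdot f\cdot b)(x,y) = a(x)f(x,y)b(y)$, inner product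 $(f|g)(y) = \sum_{x \in R^{-1}(y)} e(x)\overline{f(x,y)}g(x,y)$, and left action $\phi : D_E \to L(Z_E)$. $\mathcal{O}_R(E)$ is the Cuntz-Pimsner algebra of $Z_E$. For a full Hilbert bimodule $Z$ over a $C^*$-algebra $D$ with injective left action $\phi : D \to L(Z)$ ($L(Z)$ = adjointable operators, $K(Z)$ = closed span of the rank one operators $\theta_{\xi,\eta}(\zeta) = \xi(\eta|\zeta)$), the Cuntz-Pimsner algebra $\mathcal{O}_Z$ is the universal $C^*$-algebra generated by $i(a)$ ($a \in D$, $i$ a $*$-homomorphism) and $S_\xi$ ($\xi \in Z$, linear in $\xi$) satisfying $i(a)S_\xi = S_{\phi(a)\xi}$, $S_\xi i(a) = S_{\xi a}$, $S_\xi^* S_\eta = i((\xi|\eta))$, and $i(a) = i_K(\phi(a))$ for $a \in \phi^{-1}(K(Z))$, where $i_K(\theta_{\xi,\eta}) = S_\xi S_\eta^*$. One identifies $i(a)$ with $a$, so $I \subset B \subset \mathcal{O}_R(\hat{\mathbb{C}})$. ''Canonically'' refers to the isomorphism induced by restriction of functions $b \mapsto b|_{J_R}$ on $B$ and $f \mapsto f|_{\operatorname{graph} R|_{J_R}}$ on $C(\operatorname{graph} R)$. *)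

(* Defs.v *)
From HB Require Import structures.
From mathcomp Require Import all_boot all_order all_algebra complex.
From mathcomp Require Import all_classical all_reals.
From mathcomp Require Import topology normedtype one_point_compactification.

Set Implicit Arguments.
Unset Strict Implicit.
Unset Printing Implicit Defensive.

Import Order.TTheory GRing.Theory Num.Theory numFieldNormedType.Exports.

Local Open Scope classical_set_scope.
Local Open Scope ring_scope.

(* The library topologises a variable numClosedFieldType but not the concrete
   type R[i]; this gives R[i] the topology of its norm. *)
#[warning="-redundant-canonical-projection"]
HB.instance Definition _ (R : realType) :=
  NormedModule.copy (complex R) (complex R)^o.

(* Complex *-algebras; neither a unit nor commutativity is assumed. *)
HB.mixin Record Lmodule_isStarAlgebra (R : realType) A
    & GRing.Lmodule (complex R) A := {
  smul : A -> A -> A;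
  star : A -> A;
  smulA : associative smul;
  smulDl : left_distributive smul +%R;
  smulDr : right_distributive smul +%R;
  smulZl : forall (a : complex R) (x y : A), smul (a *: x) y = a *: smul x y;
  smulZr : forall (a : complex R) (x y : A), smul x (a *: y) = a *: smul x y;
  starD : {morph star : x y / x + y};
  starZ : forall (a : complex R) (x : A), star (a *: x) = a^* *: star x;
  starM : forall x y : A, star (smul x y) = smul (star y) (star x);
  starK : involutive star
}.

#[short(type="starAlgType")]
HB.structure Definition StarAlgebra (R : realType) :=
  {A of GRing.Lmodule (complex R) A & Lmodule_isStarAlgebra R A}.

Notation "x ** y" := (smul x y) (at level 40, left associativity) : ring_scope.

(* As for every normed module over complex R, norms are (real) elements of
   complex R. *)
HB.mixin Record StarAlgebra_isCStar (R : realType) A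
    & CompleteNormedModule (complex R) A & StarAlgebra R A := {
  ler_norm_smul : forall x y : A, `|x ** y| <= `|x| * `|y|;
  norm_cstar : forall x : A, `|star x ** x| = `|x| ^+ 2
}.

#[short(type="cstarAlgType")]
HB.structure Definition CStarAlgebra (R : realType) :=
  {A of CompleteNormedModule (complex R) A & StarAlgebra R A
   & StarAlgebra_isCStar R A}.

Definition is_star_hom (R : realType) (A B : starAlgType R) (f : A -> B) :=
  [/\ {morph f : x y / x + y}, forall (c : complex R) x, f (c *: x) = c *: f x,
      {morph f : x y / x ** y} & {morph f : x / star x}].

Definition is_star_iso (R : realType) (A B : starAlgType R) (f : A -> B) :=
  is_star_hom f /\ bijective f.

Section star_theory.
Context {R : realType}.
Implicit Types A : starAlgType R.

Lemma star0 A : star (0 : A) = 0.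
Proof. by rewrite -[X in star X](scale0r (0 : A)) starZ conjC0 scale0r. Qed.

Lemma starN A (x : A) : star (- x) = - star x.
Proof. by rewrite -scaleN1r starZ rmorphN1 scaleN1r. Qed.

Lemma norm_star (A : cstarAlgType R) (x : A) : `|star x| = `|x|.
Proof.
have le y : `|y : A| <= `|star y|.
  have [/eqP|y0] := eqVneq `|y| 0; first by rewrite normr_eq0 => /eqP ->; rewrite normr0.
  have : `|y| * `|y| <= `|star y| * `|y| by rewrite -expr2 -norm_cstar ler_norm_smul.
  by rewrite ler_pM2r// lt0r y0/=.
by apply/le_anti; rewrite le andbT (le_trans (le (star x)))// starK.
Qed.

Lemma star_continuous (A : cstarAlgType R) : continuous (@star R A).
Proof.
move=> x; apply/cvgrPdist_lt => e e0; near=> y.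
rewrite -starN -starD norm_star; near: y.
exact: (@cvgr_dist_lt _ _ _ _ _ id).
Unshelve. all: by end_near. Qed.

End star_theory.

Section complex_complete.
Context {R : realType}.
Local Notation C := (complex R).

Lemma Re_le_norm (z : C) : (`|complex.Re z|%:C)%C <= `|z|.
Proof. exact: normc_ge_Re. Qed.

Lemma Im_le_norm (z : C) : (`|complex.Im z|%:C)%C <= `|z|.
Proof.
have := normc_ge_Re (z * 'i%C).
by rewrite ReiNIm normrN normrM (_ : `|'i%C| = 1 :> C) ?mulr1// normc_def/= expr0n/= expr1n add0r sqrtr1.
Qed.

Lemma norm_ReE (z : C) : `|z| = ((complex.Re `|z|)%:C)%C.
Proof. by rewrite RRe_real ?normr_real. Qed.

Lemma Re_norm_continuous : continuous (fun z : C => complex.Re `|z| : R).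
Proof.
move=> z; have FF : Filter (nbhs z) by exact: nbhs_filter.
apply/cvgrPdist_lt => e e0; have e0' : 0 < (e%:C)%C :> C by rewrite ltcR.
have /cvgrPdist_lt/(_ _ e0') : w @[w --> z] --> z by [].
apply: (@filterS _ (nbhs z)) => w zw; rewrite -ltcR; apply: le_lt_trans zw.
have real_norm (x : R) : (`|x|%:C)%C = `|(x%:C)%C| :> C.
  by rewrite normc_def/= expr0n/= addr0 sqrtr_sqr.
by rewrite real_norm rmorphB/= -!norm_ReE ler_dist_dist.
Qed.

Lemma complex_cauchy_cvg (F : set_system C) :
  ProperFilter F -> cauchy F -> cvg F.
Proof.
move=> FF /cauchy_ballP Fc.
have part (g : C -> R) : (forall x y, (`|g x - g y|%:C)%C <= `|x - y| :> C) ->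
    cvg (g @ F).
  move=> gle; apply: R_complete; apply/cauchy_ballP => e e0.
  have e0' : 0 < (e%:C)%C :> C by rewrite ltcR.
  have := Fc _ e0'; rewrite !near_simpl => -[[P Q] /= [FP FQ] PQ].
  exists (g @` P, g @` Q) => /=.
    by split; [apply: filterS FP|apply: filterS FQ] => x ?; exists x.
  move=> [x y] /= [[u Pu <-] [v Qv <-]].
  have /= := PQ (u, v) (conj Pu Qv); rewrite -!ball_normE/= => uv.
  by rewrite -ltcR; apply: le_lt_trans uv; exact: gle.
have ReD (x y : C) : complex.Re x - complex.Re y = complex.Re (x - y) by case: x y => [? ?] [].
have ImD (x y : C) : complex.Im x - complex.Im y = complex.Im (x - y) by case: x y => [? ?] [].
have /cvg_ex[a Fa] : cvg (@complex.Re R @ F).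
  by apply: part => x y; rewrite ReD Re_le_norm.
have /cvg_ex[b Fb] : cvg (@complex.Im R @ F).
  by apply: part => x y; rewrite ImD Im_le_norm.
apply/cvg_ex; exists (a +i* b)%C; apply/cvgrPdist_lt => e e0.
have [r er] : exists r : R, e = (r%:C)%C by exists (complex.Re e); rewrite RRe_real// gtr0_real.
have r0 : 0 < r / 2 by rewrite divr_gt0// -ltcR -er.
have dec z : (a +i* b)%C - z =
    ((a - complex.Re z)%:C)%C + 'i%C * ((b - complex.Im z)%:C)%C.
  by case: z => u v; simpc.
near=> z; rewrite dec.
apply: (le_lt_trans (ler_normD _ _)).
rewrite normrM (_ : `|'i%C| = 1 :> C) ?mul1r; last by rewrite normc_def/= expr0n/= expr1n add0r sqrtr1.
rewrite !normc_def/= !expr0n/= !addr0 !sqrtr_sqr -raddfD/= er ltcR [r]splitr ltrD//.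
- near: z; move/cvgrPdist_lt : Fa; exact.
- near: z; move/cvgrPdist_lt : Fb; exact.
Unshelve. all: by end_near. Qed.

End complex_complete.

(* C_0(A) for a subset A of a topological space T, with its subspace topology.
   An element is represented by its extension by 0 to T, so that equality of
   elements is equality of functions on A. *)
Section C0.
Context {R : realType} {T : topologicalType}.
Local Notation C := (complex R).
Implicit Types (A : set T) (f g : T -> C).

Definition is_C0 A f : Prop :=
  [/\ forall x, ~ A x -> f x = 0,
      {within A, continuous f} &
      forall e : C, 0 < e -> exists K : set T,
        [/\ compact K, K `<=` A & forall x, A x -> ~ K x -> `|f x| < e]].

Definition C0_pred A : {pred T -> C} := fun f => `[< is_C0 A f >].

Record C0 A := MkC0 { C0_fun :> T -> C; _ : C0_pred A C0_fun }.

HB.instance Definition _ A := [isSub for @C0_fun A].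
HB.instance Definition _ A := [Choice of C0 A by <:].

Lemma C0P A (f : C0 A) : is_C0 A f.
Proof. by case: f => f /= /asboolP. Qed.

Lemma is_C0_0 A : is_C0 A (0 : T -> C).
Proof.
split=> //; first exact: cst_continuous.
by move=> e e0; exists set0; split => //; [exact: compact0|move=> x _ _; rewrite normr0].
Qed.

Lemma is_C0D A f g : is_C0 A f -> is_C0 A g -> is_C0 A (f + g).
Proof.
move=> [f0 /subspace_continuousP fc fv] [g0 /subspace_continuousP gc gv]; split.
- by move=> x Ax; rewrite /GRing.add/= f0// g0// addr0.
- by apply/subspace_continuousP => x Ax; exact: cvgD (fc x Ax) (gc x Ax).
- move=> e e0; have e20 : 0 < e / 2 by rewrite divr_gt0.
  have [K [cK KA Kf]] := fv _ e20; have [L [cL LA Lg]] := gv _ e20.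
  exists (K `|` L); split; [exact: compactU|by rewrite subUset|].
  move=> x Ax /not_orP[Kx Lx]; rewrite (le_lt_trans (ler_normD _ _))//.
  by rewrite [e]splitr ltrD// ?Kf// Lg.
Qed.

Lemma is_C0_bounded A f : is_C0 A f -> exists M : C, 0 < M /\ forall x, `|f x| <= M.
Proof.
move=> [f0 fc fv]; have [K [cK KA Kf]] := fv 1 ltr01.
have : compact ((fun x => complex.Re `|f x|) @` K).
  apply: continuous_compact => //; apply/subspace_continuousP => x Kx.
  have /subspace_continuousP/(_ x Kx) fx := continuous_subspaceW KA fc.
  by apply: (cvg_comp _ _ fx); exact: Re_norm_continuous.
move=> /compact_bounded[M [_ HM]].
have M1 : 0 < ((`|M| + 1)%:C)%C :> C by rewrite ltcR ltr_wpDl.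
exists ((`|M| + 1)%:C)%C; split => // x.
have [Kx|Kx] := pselect (K x).
  rewrite norm_ReE lecR; apply: (le_trans (ler_norm _)); apply: HM; last by exists x.
  by rewrite (le_lt_trans (ler_norm _))// ltrDl.
have [Ax|Ax] := pselect (A x); last by rewrite f0// normr0 ltW.
rewrite ltW// (lt_le_trans (Kf x Ax Kx))//.
by rewrite (_ : 1 = (1%:C)%C)// lecR lerDr.
Qed.

Lemma is_C0M A f g : {within A, continuous g} ->
  (exists M : C, 0 < M /\ forall x, A x -> `|g x| <= M) ->
  is_C0 A f -> is_C0 A (fun x => g x * f x).
Proof.
move=> /subspace_continuousP gc [M [M0 gM]] [f0 /subspace_continuousP fc fv]; split.
- by move=> x Ax; rewrite f0// mulr0.
- by apply/subspace_continuousP => x Ax; exact: cvgM (gc x Ax) (fc x Ax).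
- move=> e e0; have eM : 0 < e / M by rewrite divr_gt0.
  have [K [cK KA Kf]] := fv _ eM; exists K; split => // x Ax Kx.
  rewrite normrM; apply: (@le_lt_trans _ _ (M * `|f x|)).
    by rewrite ler_wpM2r// gM.
  by rewrite mulrC -ltr_pdivlMr// Kf.
Qed.

Lemma is_C0Z A (c : C) f : is_C0 A f -> is_C0 A (c *: f).
Proof.
move=> f0; apply: (@is_C0M A f (cst c)) => //; first exact: cst_continuous.
by exists (`|c| + 1); split; [rewrite ltr_wpDl|move=> x _; rewrite lerDl].
Qed.

Lemma is_C0_star A f : is_C0 A f -> is_C0 A (fun x => (f x)^*).
Proof.
move=> [f0 /subspace_continuousP fc fv]; split.
- by move=> x Ax; rewrite f0// conjC0.
- apply/subspace_continuousP => x Ax; apply/cvgrPdist_lt => e e0.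
  move/cvgrPdist_lt : (fc x Ax) => /(_ e e0); apply: filterS => y.
  by rewrite -rmorphB norm_conjC.
- move=> e e0; have [K [cK KA Kf]] := fv _ e0.
  by exists K; split => // x Ax Kx; rewrite norm_conjC Kf.
Qed.

Lemma C0_submod_closed A : submod_closed (C0_pred A).
Proof.
split; first by apply/asboolP; exact: is_C0_0.
by move=> a f g /asboolP f0 /asboolP g0; apply/asboolP/is_C0D => //; exact: is_C0Z.
Qed.

HB.instance Definition _ A :=
  GRing.isSubmodClosed.Build C (T -> C) (C0_pred A) (C0_submod_closed A).
HB.instance Definition _ A := [SubChoice_isSubLmodule of C0 A by <:].

Lemma is_C0_restrict (A B F : set T) f : closed F -> B `&` F = A ->
  is_C0 B f -> is_C0 A (f \_ A).
Proof.
move=> cF AE [f0 fc fv]; have AB : A `<=` B by rewrite -AE => x [].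
split.
- by move=> x Ax; rewrite patchN// notin_setE.
- apply: (@subspace_eq_continuous _ A C f); last exact: continuous_subspaceW fc.
  by move=> x Ax; rewrite /from_subspace patchT.
- move=> e e0; have [K [cK KB Kf]] := fv _ e0; exists (K `&` F); split.
  + exact: compact_closedI.
  + by move=> x [/KB Bx Fx]; rewrite -AE.
  + move=> x Ax KFx; rewrite patchT ?inE//.
    have [Bx Fx] : (B `&` F) x by rewrite AE.
    by apply: Kf => // Kx; exact: KFx.
Qed.

(* The restriction map C_0(B) -> C_0(A) to a relatively closed subset A of B. *)
Definition C0_restrict (A B F : set T) (cF : closed F) (AE : B `&` F = A)
    (f : C0 B) : C0 A :=
  MkC0 (asboolT (is_C0_restrict cF AE (C0P f))).

(* The element of C_0(A) given by f; 0 if f is not in C_0(A). *)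
Definition mkC0 A f : C0 A := insubd 0 f.

Lemma mkC0E A f : is_C0 A f -> mkC0 A f = f :> (T -> C).
Proof. by move=> /asboolP fA; rewrite /mkC0 insubdK. Qed.

End C0.

Arguments C0 R {T} A.

Section C0_cstar.
Context {R : realType} {T : topologicalType} (A : set T).
Local Notation C := (complex R).
Local Notation D := (@C0 R T A).
Implicit Types f g h : D.

Definition C0_norm f : C := ((sup (range (fun x => complex.Re `|f x|)))%:C)%C.

Lemma C0_norm_ub f x : `|f x| <= C0_norm f.
Proof.
rewrite norm_ReE lecR; apply: ub_le_sup; last by exists x.
have [M [M0 fM]] := is_C0_bounded (C0P f).
exists (complex.Re M) => _ [y _ <-].
by rewrite -lecR -norm_ReE RRe_real// gtr0_real.
Qed.

Lemma C0_norm_le f (M : C) : 0 <= M -> (forall x, `|f x| <= M) -> C0_norm f <= M.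
Proof.
move=> M0 fM; have ME : M = ((complex.Re M)%:C)%C by rewrite RRe_real// ger0_real.
rewrite ME lecR; have [->|/set0P ne] := eqVneq (range (fun x => complex.Re `|f x|)) set0.
  by rewrite sup0 -lecR -ME.
by apply: ge_sup => // _ [y _ <-]; rewrite -lecR -norm_ReE -ME.
Qed.

Lemma C0_norm_ge0 f : 0 <= C0_norm f.
Proof.
have [TE|/set0P[_ [x _ _]]] := eqVneq (range (fun x => complex.Re `|f x|)) set0.
  by rewrite /C0_norm TE sup0.
exact: le_trans (normr_ge0 _) (C0_norm_ub f x).
Qed.

Let valE f : C0_fun f = val f. Proof. by []. Qed.
Let valZ (c : C) f : val (c *: f) = c *: val f. Proof. exact: GRing.valZ. Qed.

Lemma C0_fun0 x : (0 : D) x = 0. Proof. by rewrite valE raddf0. Qed.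
Lemma C0_funD f g x : (f + g) x = f x + g x. Proof. by rewrite valE raddfD. Qed.
Lemma C0_funN f x : (- f) x = - f x. Proof. by rewrite valE raddfN. Qed.
Lemma C0_funZ (c : C) f x : (c *: f) x = c * f x.
Proof. by rewrite valE valZ. Qed.

Lemma C0_ext f g : f =1 g -> f = g.
Proof. by move=> fg; apply: val_inj; apply/funext. Qed.

Let normD f g : C0_norm (f + g) <= C0_norm f + C0_norm g.
Proof.
apply: C0_norm_le => [|x]; first by rewrite addr_ge0 ?C0_norm_ge0.
by rewrite C0_funD (le_trans (ler_normD _ _))// lerD ?C0_norm_ub.
Qed.

Let normZ (c : C) f : C0_norm (c *: f) = `|c| * C0_norm f.
Proof.
have le (a : C) g : C0_norm (a *: g) <= `|a| * C0_norm g.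
  apply: C0_norm_le => [|x]; first by rewrite mulr_ge0 ?C0_norm_ge0.
  by rewrite C0_funZ normrM ler_wpM2l ?C0_norm_ub.
apply/le_anti; rewrite le/=; have [->|c0] := eqVneq c 0.
  by rewrite normr0 mul0r C0_norm_ge0.
rewrite -ler_pdivlMl ?normr_gt0//; apply: le_trans (_ : C0_norm (c^-1 *: (c *: f)) <= _).
  by rewrite scalerA mulVf// scale1r.
by rewrite (le_trans (le _ _))// normfV.
Qed.

Let norm0_eq0 f : C0_norm f = 0 -> f = 0.
Proof.
move=> f0; apply: C0_ext => x; apply/eqP; rewrite -normr_le0 -f0; exact: C0_norm_ub.
Qed.

HB.instance Definition _ :=
  @Lmodule_isNormed.Build C D C0_norm normD normZ norm0_eq0.

Lemma C0_normE f : `|f| = C0_norm f. Proof. by []. Qed.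

Let C0_complete (F : set_system D) : ProperFilter F -> cauchy F -> cvg F.
Proof.
move=> FF /cauchy_ballP Fc.
have Fc' (e : C) : 0 < e -> exists P, F P /\ forall f g, P f -> P g -> `|f - g| < e.
  move=> e0; have e20 : 0 < e / 2 by rewrite divr_gt0.
  have := Fc _ e20; rewrite !near_simpl => -[[P Q] /= [FP FQ] PQ].
  exists (P `&` Q); split; first exact: filterI.
  move=> f g [Pf Qf] [Pg Qg].
  by have := PQ (f, g) (conj Pf Qg) => /=; rewrite -ball_normE/= => /lt_trans; apply; rewrite gtr_pMr// invf_lt1// ltr1n.
have lim x : cvg ((fun f : D => f x) @ F).
  apply: complex_cauchy_cvg; apply/cauchy_ballP => e e0.
  have [P [FP Pe]] := Fc' _ e0.
  exists ((fun f : D => f x) @` P, (fun f : D => f x) @` P) => /=.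
    by split; apply: (@filterS _ F _ P) => // f ?; exists f.
  move=> [u v] /= [[f Pf <-] [g Pg <-]]; rewrite -ball_normE/=.
  by apply: le_lt_trans (Pe f g Pf Pg); exact: (C0_norm_ub (f - g)).
have {lim} /choice[l Fl] : forall x, exists l : C, (fun f : D => f x) @ F --> l.
  by move=> x; apply/cvg_ex; exact: lim.
have unif (e : C) : 0 < e -> exists P, F P /\ forall f, P f -> forall x, `|l x - f x| <= e.
  move=> e0; have [P [FP Pe]] := Fc' _ e0; exists P; split => // f Pf x.
  apply/ler_addgt0Pr => d d0.
  have /cvgrPdist_lt/(_ _ d0) /= Fd := Fl x.
  have [g [Pg gd]] := filter_ex (filterI FP Fd).
  rewrite (_ : l x - f x = (l x - g x) + (g - f) x); last by rewrite C0_funD C0_funN addrA subrK.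
  rewrite (le_trans (ler_normD _ _))// addrC lerD ?(ltW gd)// ltW//.
  by apply: le_lt_trans (Pe g f Pg Pf); exact: C0_norm_ub.
have lC0 : is_C0 A l.
  split.
  - move=> x Ax; apply/eqP; rewrite -normr_le0.
    apply/ler_addgt0Pr => d d0; rewrite add0r.
    have [P [FP Pd]] := unif _ d0; have [f Pf] := filter_ex FP.
    by have := Pd f Pf x; have [-> //] := C0P f; rewrite subr0.
  - apply/subspace_continuousP => x Ax; apply/cvgrPdist_lt => e e0.
    have e20 : 0 < e / 2 by rewrite divr_gt0.
    have e40 : 0 < e / 2 / 2 by rewrite divr_gt0.
    have [P [FP Pe]] := unif _ e40; have [f Pf] := filter_ex FP.
    have [_ /subspace_continuousP/(_ x Ax)/cvgrPdist_lt/(_ _ e40) + _] := C0P f.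
    apply: filterS => y fxy.
    rewrite (_ : l x - l y = (l x - f x) + (f x - f y) - (l y - f y)); last first.
      by rewrite opprB (addrA (l x - f x)) subrK addrA subrK.
    rewrite (le_lt_trans (ler_normB _ _))// [ltRHS]splitr ltr_leD//.
      by rewrite (le_lt_trans (ler_normD _ _))// [ltRHS]splitr ler_ltD// Pe.
    by rewrite (le_trans (Pe _ Pf _))// [leRHS]splitr lerDl ltW.
  - move=> e e0; have e20 : 0 < e / 2 by rewrite divr_gt0.
    have [P [FP Pe]] := unif _ e20; have [f Pf] := filter_ex FP.
    have [_ _ /(_ _ e20)[K [cK KA Kf]]] := C0P f.
    exists K; split => // x Ax Kx; rewrite -(subrK (f x) (l x)).
    rewrite (le_lt_trans (ler_normD _ _))// [ltRHS]splitr ler_ltD ?Pe//.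
    exact: Kf.
apply/cvg_ex; exists (mkC0 A l); apply/cvgrPdist_le => e e0.
have [P [FP Pe]] := unif _ e0; apply: filterS FP => f Pf.
by rewrite C0_normE C0_norm_le ?ltW// => x; rewrite C0_funD C0_funN mkC0E// Pe.
Qed.

HB.instance Definition _ := Uniform_isComplete.Build D C0_complete.

Let bounded_within f : exists M : C, 0 < M /\ forall x, A x -> `|f x| <= M.
Proof.
by have [M [M0 fM]] := is_C0_bounded (C0P f); exists M; split => // x _; exact: fM.
Qed.

Lemma is_C0_mul f g : is_C0 A (fun x => f x * g x).
Proof.
by apply: is_C0M (C0P g) => //; have [] := C0P f.
Qed.

Definition C0_mul f g : D := MkC0 (asboolT (is_C0_mul f g)).
Definition C0_star f : D := MkC0 (asboolT (is_C0_star (C0P f))).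

Lemma C0_mulE f g x : C0_mul f g x = f x * g x. Proof. by []. Qed.
Lemma C0_starE f x : C0_star f x = (f x)^*. Proof. by []. Qed.

Let mulA : associative C0_mul.
Proof. by move=> f g h; apply: C0_ext => x; exact: mulrA. Qed.
Let mulDl : left_distributive C0_mul +%R.
Proof. by move=> f g h; apply: C0_ext => x; exact: mulrDl. Qed.
Let mulDr : right_distributive C0_mul +%R.
Proof. by move=> f g h; apply: C0_ext => x; exact: mulrDr. Qed.
Let mulZl (c : C) f g : C0_mul (c *: f) g = c *: C0_mul f g.
Proof. by apply: C0_ext => x; rewrite C0_funZ !C0_mulE C0_funZ mulrA. Qed.
Let mulZr (c : C) f g : C0_mul f (c *: g) = c *: C0_mul f g.
Proof. by apply: C0_ext => x; rewrite C0_funZ !C0_mulE C0_funZ mulrCA. Qed.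
Let sD : {morph C0_star : f g / f + g}.
Proof. by move=> f g; apply: C0_ext => x; exact: rmorphD. Qed.
Let sZ (c : C) f : C0_star (c *: f) = c^* *: C0_star f.
Proof. by apply: C0_ext => x; exact: rmorphM. Qed.
Let sM f g : C0_star (C0_mul f g) = C0_mul (C0_star g) (C0_star f).
Proof. by apply: C0_ext => x; rewrite !C0_mulE !C0_starE C0_mulE rmorphM mulrC. Qed.
Let sK : involutive C0_star.
Proof. by move=> f; apply: C0_ext => x; exact: conjCK. Qed.

HB.instance Definition _ := @Lmodule_isStarAlgebra.Build R D
  C0_mul C0_star mulA mulDl mulDr mulZl mulZr sD sZ sM sK.

Let norm_mul f g : `|f ** g| <= `|f| * `|g|.
Proof.
rewrite !C0_normE; apply: C0_norm_le => [|x]; first by rewrite mulr_ge0 ?C0_norm_ge0.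
by rewrite C0_mulE normrM ler_pM ?C0_norm_ub.
Qed.

Let norm_cs f : `|star f ** f| = `|f| ^+ 2.
Proof.
apply/le_anti/andP; split.
  rewrite !C0_normE; apply: C0_norm_le => [|x]; first by rewrite exprn_ge0 ?C0_norm_ge0.
  by rewrite C0_mulE C0_starE normrM norm_conjC -expr2 lerXn2r ?nnegrE ?C0_norm_ge0 ?C0_norm_ub.
rewrite -[leRHS]sqrtCK lerXn2r ?nnegrE ?sqrtC_ge0//.
apply: C0_norm_le => [|x]; first by rewrite sqrtC_ge0.
rewrite -(@ler_pXn2r _ 2)// ?nnegrE ?sqrtC_ge0// sqrtCK.
have := C0_norm_ub (star f ** f) x.
by rewrite C0_mulE C0_starE normrM norm_conjC -expr2.
Qed.

HB.instance Definition _ := @StarAlgebra_isCStar.Build R D norm_mul norm_cs.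

End C0_cstar.

Section ideals.
Context {R : realType} (A : cstarAlgType R).
Local Notation C := (complex R).

Definition is_closed_ideal (K : set A) : Prop :=
  [/\ closed K, K 0, forall x y, K x -> K y -> K (x + y),
      forall (c : C) x, K x -> K (c *: x) &
      forall x y, K x -> K (x ** y) /\ K (y ** x)].

(* Closed ideals of a C*-algebra are automatically self-adjoint; that this is
   part of the structure only saves proving it in general. *)
Record starIdeal := StarIdeal {
  ideal_set :> set A;
  ideal_closed_ideal : is_closed_ideal ideal_set;
  ideal_star : forall x, ideal_set x -> ideal_set (star x)
}.

Definition generated_ideal (S : set A) : set A :=
  \bigcap_(K in [set K | is_closed_ideal K /\ S `<=` K]) K.

Lemma generated_ideal_closed_ideal S : is_closed_ideal (generated_ideal S).
Proof.
split.
- by apply: closed_bigI => K [[]].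
- by move=> K [[]].
- by move=> x y Sx Sy K KS; have [[_ _ + _ _] _] := KS; apply; [exact: Sx|exact: Sy].
- by move=> c x Sx K KS; have [[_ _ _ + _] _] := KS; apply; exact: Sx.
- move=> x y Sx; split=> K KS; have [[_ _ _ _ KM] _] := KS.
    by have [] := KM x y (Sx K KS).
  by have [] := KM x y (Sx K KS).
Qed.

Lemma generated_ideal_star S : (forall x, S x -> S (star x)) ->
  forall x, generated_ideal S x -> generated_ideal S (star x).
Proof.
move=> Sstar x Sx K [[cK K0 KD KZ KM] SK].
apply: (Sx [set y | K (star y)]); split; last by move=> y Sy; apply/SK/Sstar.
split=> /=.
- by apply: preimage_closed cK => y _; exact: star_continuous.
- by rewrite star0.
- by move=> y z Ky Kz; rewrite starD; exact: KD.
- by move=> c y Ky; rewrite starZ; exact: KZ.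
- by move=> y z Ky; rewrite !starM; have [] := KM _ (star z) Ky.
Qed.

Definition generated_starIdeal (S : set A) (hS : forall x, S x -> S (star x)) :=
  StarIdeal (generated_ideal_closed_ideal S) (generated_ideal_star hS).

Definition ideal_pred (K : starIdeal) : {pred A} := fun x => `[< ideal_set K x >].

Lemma ideal_predP (K : starIdeal) x : reflect (ideal_set K x) (x \in ideal_pred K).
Proof. exact: asboolP. Qed.

Lemma ideal_submod_closed K : submod_closed (ideal_pred K).
Proof.
have [_ K0 KD KZ _] := ideal_closed_ideal K.
split; first exact/ideal_predP.
by move=> a x y /ideal_predP Kx /ideal_predP Ky; apply/ideal_predP/KD => //; exact: KZ.
Qed.

HB.instance Definition _ (K : starIdeal) :=
  GRing.isSubmodClosed.Build C A (ideal_pred K) (ideal_submod_closed K).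

End ideals.

(* A closed ideal as a C*-algebra in its own right. *)
Section ideal_alg.
Context {R : realType} (A : cstarAlgType R) (K : starIdeal A).
Local Notation C := (complex R).

Record ideal_alg := IdealAlg { ideal_val :> A; _ : ideal_pred K ideal_val }.

HB.instance Definition _ := [isSub for ideal_val].
HB.instance Definition _ := [Choice of ideal_alg by <:].
HB.instance Definition _ := [SubChoice_isSubLmodule of ideal_alg by <:].

Implicit Types x y z : ideal_alg.

Lemma ideal_algP x : ideal_set K x. Proof. by case: x => x /= /asboolP. Qed.

Let valE x : ideal_val x = val x. Proof. by []. Qed.
Let valZ (c : C) x : val (c *: x) = c *: val x. Proof. exact: GRing.valZ. Qed.

Lemma ideal_val0 : ideal_val 0 = 0. Proof. by rewrite valE raddf0. Qed.
Lemma ideal_valD x y : ideal_val (x + y) = ideal_val x + ideal_val y.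
Proof. by rewrite !valE raddfD. Qed.
Lemma ideal_valB x y : ideal_val (x - y) = ideal_val x - ideal_val y.
Proof. by rewrite !valE raddfB. Qed.
Lemma ideal_valZ (c : C) x : ideal_val (c *: x) = c *: ideal_val x.
Proof. by rewrite !valE valZ. Qed.
Lemma ideal_val_inj : injective ideal_val. Proof. exact: val_inj. Qed.

Let norm x : C := `|ideal_val x|.
Let normD x y : norm (x + y) <= norm x + norm y.
Proof. by rewrite /norm ideal_valD ler_normD. Qed.
Let normZ (c : C) x : norm (c *: x) = `|c| * norm x.
Proof. by rewrite /norm ideal_valZ normrZ. Qed.
Let norm0_eq0 x : norm x = 0 -> x = 0.
Proof. by move=> /normr0_eq0 x0; apply: ideal_val_inj; rewrite x0 ideal_val0. Qed.

HB.instance Definition _ :=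
  @Lmodule_isNormed.Build C ideal_alg norm normD normZ norm0_eq0.

Lemma ideal_normE x : `|x| = `|ideal_val x|. Proof. by []. Qed.

Let complete (F : set_system ideal_alg) : ProperFilter F -> cauchy F -> cvg F.
Proof.
move=> FF /cauchy_ballP Fc.
have /cvg_ex[l Fl] : cvg (ideal_val @ F).
  apply: cauchy_cvg; apply/cauchy_ballP => e e0.
  have := Fc _ e0; rewrite !near_simpl => -[[P Q] /= [FP FQ] PQ].
  exists (ideal_val @` P, ideal_val @` Q) => /=.
    by split; [apply: (@filterS _ F _ P)|apply: (@filterS _ F _ Q)] => // x ?; exists x.
  move=> [x y] /= [[u Pu <-] [v Qv <-]].
  have /= := PQ (u, v) (conj Pu Qv).
  by rewrite -!ball_normE/= ideal_normE ideal_valB.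
have Kl : ideal_set K l.
  have [cK _ _ _ _] := ideal_closed_ideal K.
  by apply: (@closed_cvg _ A F FF ideal_val (ideal_set K) cK _ l Fl); apply: nearW => x; exact: ideal_algP.
apply/cvg_ex; exists (IdealAlg (asboolT Kl)); apply/cvgrPdist_lt => e e0.
move/cvgrPdist_lt : Fl => /(_ e e0); apply: filterS => x.
by rewrite ideal_normE ideal_valB.
Qed.

HB.instance Definition _ := Uniform_isComplete.Build ideal_alg complete.

Let mul_subproof x y : ideal_set K (ideal_val x ** ideal_val y).
Proof.
have [_ _ _ _ KM] := ideal_closed_ideal K.
by have [] := KM _ (ideal_val y) (ideal_algP x).
Qed.

Definition ideal_mul x y : ideal_alg := IdealAlg (asboolT (mul_subproof x y)).
Definition ideal_alg_star x : ideal_alg :=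
  IdealAlg (asboolT (ideal_star (ideal_algP x))).

Let valM x y : ideal_val (ideal_mul x y) = ideal_val x ** ideal_val y.
Proof. by []. Qed.
Let valS x : ideal_val (ideal_alg_star x) = star (ideal_val x).
Proof. by []. Qed.

Let mulA : associative ideal_mul.
Proof. by move=> x y z; apply: ideal_val_inj; exact: smulA. Qed.
Let mulDl : left_distributive ideal_mul +%R.
Proof. by move=> x y z; apply: ideal_val_inj; rewrite !(valM, ideal_valD) smulDl. Qed.
Let mulDr : right_distributive ideal_mul +%R.
Proof. by move=> x y z; apply: ideal_val_inj; rewrite !(valM, ideal_valD) smulDr. Qed.
Let mulZl (c : C) x y : ideal_mul (c *: x) y = c *: ideal_mul x y.
Proof. by apply: ideal_val_inj; rewrite !(valM, ideal_valZ) smulZl. Qed.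
Let mulZr (c : C) x y : ideal_mul x (c *: y) = c *: ideal_mul x y.
Proof. by apply: ideal_val_inj; rewrite !(valM, ideal_valZ) smulZr. Qed.
Let sD : {morph ideal_alg_star : x y / x + y}.
Proof. by move=> x y; apply: ideal_val_inj; rewrite !(valS, ideal_valD) starD. Qed.
Let sZ (c : C) x : ideal_alg_star (c *: x) = c^* *: ideal_alg_star x.
Proof. by apply: ideal_val_inj; rewrite !(valS, ideal_valZ) starZ. Qed.
Let sM x y : ideal_alg_star (ideal_mul x y) =
  ideal_mul (ideal_alg_star y) (ideal_alg_star x).
Proof. by apply: ideal_val_inj; exact: starM. Qed.
Let sK : involutive ideal_alg_star.
Proof. by move=> x; apply: ideal_val_inj; exact: starK. Qed.

HB.instance Definition _ := @Lmodule_isStarAlgebra.Build R ideal_alg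
  ideal_mul ideal_alg_star mulA mulDl mulDr mulZl mulZr sD sZ sM sK.

Let norm_mul x y : `|x ** y| <= `|x| * `|y|.
Proof. exact: ler_norm_smul. Qed.
Let norm_cs x : `|star x ** x| = `|x| ^+ 2.
Proof. exact: norm_cstar. Qed.

HB.instance Definition _ :=
  @StarAlgebra_isCStar.Build R ideal_alg norm_mul norm_cs.

End ideal_alg.

(* The quotient *-algebra A / K. A *-isomorphism of C*-algebras is just a
   bijective *-homomorphism, so the quotient norm is not recorded. *)
Section quotient.
Context {R : realType} (A : cstarAlgType R) (K : starIdeal A).
Local Notation C := (complex R).

Definition ideal_quotient : Type := {ideal_quot (ideal_pred K)}.
HB.instance Definition _ := GRing.Zmodule.on ideal_quotient.

Definition quot_map (x : A) : ideal_quotient :=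
  \pi_({ideal_quot (ideal_pred K)})%qT x.

Lemma quot_mapP x y : quot_map x = quot_map y <-> ideal_set K (x - y).
Proof.
split=> [/eqP|Kxy]; first by rewrite -Quotient.idealrBE => /ideal_predP.
by apply/eqP; rewrite -Quotient.idealrBE; apply/ideal_predP.
Qed.

Let quot_map0 : quot_map 0 = 0. Proof. exact: raddf0. Qed.
Lemma quot_mapD x y : quot_map (x + y) = quot_map x + quot_map y.
Proof. exact: raddfD. Qed.

Let rep (u : ideal_quotient) : A := repr u.
Let repK u : quot_map (rep u) = u. Proof. exact: reprK. Qed.
Let repP x : ideal_set K (rep (quot_map x) - x). Proof. by apply/quot_mapP; rewrite repK. Qed.

Definition quot_scale (c : C) (u : ideal_quotient) := quot_map (c *: rep u).
Definition quot_mul (u v : ideal_quotient) := quot_map (rep u ** rep v).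
Definition quot_star (u : ideal_quotient) := quot_map (star (rep u)).

Let scaleE (c : C) x : quot_scale c (quot_map x) = quot_map (c *: x).
Proof.
apply/quot_mapP; rewrite -scalerBr.
by have [_ _ _ KZ _] := ideal_closed_ideal K; exact: KZ.
Qed.

Let smulNl (x y : A) : (- x) ** y = - (x ** y).
Proof. by rewrite -scaleN1r smulZl scaleN1r. Qed.
Let smulNr (x y : A) : x ** (- y) = - (x ** y).
Proof. by rewrite -scaleN1r smulZr scaleN1r. Qed.

Let mulE x y : quot_mul (quot_map x) (quot_map y) = quot_map (x ** y).
Proof.
apply/quot_mapP; have [_ _ KD _ KM] := ideal_closed_ideal K.
rewrite -(subrK (x ** rep (quot_map y)) (_ ** _)) -addrA.
rewrite -smulNl -smulDl -smulNr -smulDr; apply: KD.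
  by have [] := KM _ (rep (quot_map y)) (repP x).
by have [] := KM _ x (repP y).
Qed.

Let starE x : quot_star (quot_map x) = quot_map (star x).
Proof. by apply/quot_mapP; rewrite -starN -starD; exact/ideal_star. Qed.

Let scA (a b : C) u : quot_scale a (quot_scale b u) = quot_scale (a * b) u.
Proof. by rewrite -[u]repK !scaleE scalerA. Qed.
Let sc1 : left_id (1 : C) quot_scale.
Proof. by move=> u; rewrite -[u]repK !scaleE scale1r. Qed.
Let scDr : right_distributive quot_scale +%R.
Proof.
by move=> a u v; rewrite -[u]repK -[v]repK -quot_mapD !scaleE scalerDr quot_mapD.
Qed.
Let scDl u : {morph quot_scale^~ u : a b / a + b}.
Proof. by move=> a b; rewrite -[u]repK !scaleE scalerDl quot_mapD. Qed.

HB.instance Definition _ :=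
  @GRing.Zmodule_isLmodule.Build C ideal_quotient quot_scale scA sc1 scDr scDl.

Lemma quot_mapZ (c : C) x : quot_map (c *: x) = c *: quot_map x.
Proof. exact/esym/scaleE. Qed.

Let mulA : associative quot_mul.
Proof. by move=> u v w; rewrite -[u]repK -[v]repK -[w]repK !mulE smulA. Qed.
Let mulDl : left_distributive quot_mul +%R.
Proof.
move=> u v w; rewrite -[u]repK -[v]repK -[w]repK -quot_mapD !mulE -quot_mapD.
by rewrite smulDl.
Qed.
Let mulDr : right_distributive quot_mul +%R.
Proof.
move=> u v w; rewrite -[u]repK -[v]repK -[w]repK -quot_mapD !mulE -quot_mapD.
by rewrite smulDr.
Qed.
Let mulZl (c : C) u v : quot_mul (c *: u) v = c *: quot_mul u v.
Proof. by rewrite -[u]repK -[v]repK -quot_mapZ !mulE smulZl quot_mapZ. Qed.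
Let mulZr (c : C) u v : quot_mul u (c *: v) = c *: quot_mul u v.
Proof. by rewrite -[u]repK -[v]repK -quot_mapZ !mulE smulZr quot_mapZ. Qed.
Let sD : {morph quot_star : u v / u + v}.
Proof.
by move=> u v; rewrite -[u]repK -[v]repK -quot_mapD !starE starD quot_mapD.
Qed.
Let sZ (c : C) u : quot_star (c *: u) = c^* *: quot_star u.
Proof. by rewrite -[u]repK -quot_mapZ !starE starZ quot_mapZ. Qed.
Let sM u v : quot_star (quot_mul u v) = quot_mul (quot_star v) (quot_star u).
Proof. by rewrite -[u]repK -[v]repK !(mulE, starE) starM. Qed.
Let sK : involutive quot_star.
Proof. by move=> u; rewrite -[u]repK !starE starK. Qed.

HB.instance Definition _ := @Lmodule_isStarAlgebra.Build R ideal_quotient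
  quot_mul quot_star mulA mulDl mulDr mulZl mulZr sD sZ sM sK.

Lemma quot_map_star_hom : is_star_hom quot_map.
Proof.
split; [exact: quot_mapD|exact: quot_mapZ| |].
- by move=> x y; rewrite -mulE.
- by move=> x; rewrite -starE.
Qed.

Lemma quot_map_surj u : exists x, quot_map x = u.
Proof. by exists (rep u). Qed.

End quotient.

Section hilbert_modules.
Context {R : realType}.
Local Notation C := (complex R).

Definition closed_span (V : normedModType C) (S : set V) : set V :=
  \bigcap_(W in [set W : set V | [/\ closed W, W 0,
      forall x y, W x -> W y -> W (x + y),
      forall (c : C) x, W x -> W (c *: x) & S `<=` W]]) W.

(* The norm ||x|| = ||(x|x)||^(1/2) of a Hilbert module. *)
Definition ip_norm (B : cstarAlgType R) (X : Type) (ip : X -> X -> B) (x : X) : C :=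
  sqrtC `|ip x x|.

Definition ip_complete (B : cstarAlgType R) (X : lmodType C)
    (ip : X -> X -> B) : Prop :=
  forall u : nat -> X,
    (forall e : C, 0 < e -> exists N, forall m n, (N <= m)%N -> (N <= n)%N ->
       ip_norm ip (u m - u n) < e) ->
    exists l, forall e : C, 0 < e -> exists N, forall n, (N <= n)%N ->
       ip_norm ip (u n - l) < e.

Definition full_ip (B : cstarAlgType R) (X : Type) (ip : X -> X -> B) : Prop :=
  closed_span [set b | exists x y, b = ip x y] = [set: B].

(* Positivity of (x|x) is expressed as (x|x) = b^* b. *)
Record is_right_hilbert_module (B : cstarAlgType R) (X : lmodType C)
    (act : X -> B -> X) (ip : X -> X -> B) : Prop := {
  ractDl : forall x y b, act (x + y) b = act x b + act y b;
  ractDr : forall x a b, act x (a + b) = act x a + act x b;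
  ractZl : forall (c : C) x b, act (c *: x) b = c *: act x b;
  ractZr : forall (c : C) x b, act x (c *: b) = c *: act x b;
  ractM : forall x a b, act x (a ** b) = act (act x a) b;
  ripD : forall x y z, ip x (y + z) = ip x y + ip x z;
  ripZ : forall (c : C) x y, ip x (c *: y) = c *: ip x y;
  ripM : forall x y b, ip x (act y b) = ip x y ** b;
  rip_star : forall x y, star (ip x y) = ip y x;
  rip_pos : forall x, exists b, ip x x = star b ** b;
  rip_def : forall x, ip x x = 0 -> x = 0;
  rip_complete : ip_complete ip
}.

Record is_left_hilbert_module (A : cstarAlgType R) (X : lmodType C)
    (act : A -> X -> X) (ip : X -> X -> A) : Prop := {
  lactDl : forall a b x, act (a + b) x = act a x + act b x;
  lactDr : forall a x y, act a (x + y) = act a x + act a y;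
  lactZl : forall (c : C) a x, act (c *: a) x = c *: act a x;
  lactZr : forall (c : C) a x, act a (c *: x) = c *: act a x;
  lactM : forall a b x, act (a ** b) x = act a (act b x);
  lipD : forall x y z, ip (x + y) z = ip x z + ip y z;
  lipZ : forall (c : C) x y, ip (c *: x) y = c *: ip x y;
  lipM : forall a x y, ip (act a x) y = a ** ip x y;
  lip_star : forall x y, star (ip x y) = ip y x;
  lip_pos : forall x, exists a, ip x x = star a ** a;
  lip_def : forall x, ip x x = 0 -> x = 0;
  lip_complete : ip_complete ip
}.

(* Strong Morita equivalence: an imprimitivity bimodule exists. *)
Definition morita_equivalent (A B : cstarAlgType R) : Prop :=
  exists (X : lmodType C) (lact : A -> X -> X) (ract : X -> B -> X)
    (lip : X -> X -> A) (rip : X -> X -> B),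
  [/\ is_left_hilbert_module lact lip /\ full_ip lip,
      is_right_hilbert_module ract rip /\ full_ip rip,
      forall a x b, ract (lact a x) b = lact a (ract x b),
      (forall a x y, rip (lact a x) y = rip x (lact (star a) y)) /\
      (forall b x y, lip (ract x b) y = lip x (ract y (star b))) &
      forall x y z, lact (lip x y) z = ract x (rip y z)].

End hilbert_modules.

(* The operations of a Hilbert bimodule over D, without its axioms; bimod_ip is
   the D-valued inner product, linear in its second argument. *)
Record bimodule (R : realType) (D : cstarAlgType R) := Bimodule {
  bimod_sort :> lmodType (complex R);
  bimod_ip : bimod_sort -> bimod_sort -> D;
  bimod_ract : bimod_sort -> D -> bimod_sort;
  bimod_lact : D -> bimod_sort -> bimod_sort
}.

Section cuntz_pimsner.
Context {R : realType} {D : cstarAlgType R} (Z : bimodule D).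
Local Notation C := (complex R).

Definition rank_one (xi eta : Z) : Z -> Z :=
  fun zeta => bimod_ract xi (bimod_ip eta zeta).

Definition is_adjoint (T T' : Z -> Z) : Prop :=
  forall xi eta, bimod_ip (T xi) eta = bimod_ip xi (T' eta).

(* K(Z): the closure, in operator norm, of the finite sums of rank one
   operators inside the adjointable operators. *)
Definition is_compact_op (T : Z -> Z) : Prop :=
  (exists T', is_adjoint T T') /\
  forall e : C, 0 < e -> exists s : seq (Z * Z), forall zeta,
    ip_norm (@bimod_ip R D Z) (T zeta - \sum_(p <- s) rank_one p.1 p.2 zeta)
      <= e * ip_norm (@bimod_ip R D Z) zeta.

(* iK is a *-homomorphism on K(Z); its values elsewhere are irrelevant. *)
Definition is_compact_hom (A : cstarAlgType R) (iK : (Z -> Z) -> A) : Prop :=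
  forall T U, is_compact_op T -> is_compact_op U ->
  [/\ iK (fun x => T x + U x) = iK T + iK U,
      forall c : C, iK (fun x => c *: T x) = c *: iK T,
      iK (T \o U) = iK T ** iK U &
      is_adjoint T U -> iK U = star (iK T)].

Record covariant_rep (A : cstarAlgType R) := CovariantRep {
  rep_i : D -> A;
  rep_S : Z -> A;
  rep_i_hom : is_star_hom rep_i;
  rep_SD : forall xi eta, rep_S (xi + eta) = rep_S xi + rep_S eta;
  rep_SZ : forall (c : C) xi, rep_S (c *: xi) = c *: rep_S xi;
  rep_iS : forall a xi, rep_i a ** rep_S xi = rep_S (bimod_lact a xi);
  rep_Si : forall a xi, rep_S xi ** rep_i a = rep_S (bimod_ract xi a);
  rep_SS : forall xi eta, star (rep_S xi) ** rep_S eta = rep_i (bimod_ip xi eta);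
  rep_covariant : exists iK : (Z -> Z) -> A,
    [/\ is_compact_hom iK,
        forall xi eta, iK (rank_one xi eta) = rep_S xi ** star (rep_S eta) &
        forall a, is_compact_op (bimod_lact a) -> rep_i a = iK (bimod_lact a)]
}.

Definition is_closed_subalgebra (A : cstarAlgType R) (B : set A) : Prop :=
  [/\ closed B, B 0, forall x y, B x -> B y -> B (x + y) /\ B (x ** y),
      forall (c : C) x, B x -> B (c *: x) & forall x, B x -> B (star x)].

(* A C*-algebra O, together with i and S, is the Cuntz-Pimsner algebra of Z. *)
Definition is_cuntz_pimsner (O : cstarAlgType R) (rho : covariant_rep O) : Prop :=
  (forall B : set O, is_closed_subalgebra B ->
     (forall a, B (rep_i rho a)) -> (forall xi, B (rep_S rho xi)) ->
     B = [set: O]) /\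
  (forall (A : cstarAlgType R) (sigma : covariant_rep A),
     exists f : O -> A, [/\ is_star_hom f,
       forall a, f (rep_i rho a) = rep_i sigma a &
       forall xi, f (rep_S rho xi) = rep_S sigma xi]).

Lemma rep_image_star (O : cstarAlgType R) (rho : covariant_rep O) (I : set D) :
  (forall a, I a -> I (star a)) ->
  forall x, (rep_i rho @` I) x -> (rep_i rho @` I) (star x).
Proof.
move=> Istar _ [a Ia <-]; exists (star a); first exact: Istar.
by have [_ _ _ ->] := rep_i_hom rho.
Qed.

End cuntz_pimsner.


(* Some z is the point z of C and None is infinity. *)
Definition riemann_sphere (R : realType) : topologicalType :=
  one_point_compactification (complex R).

Section rational_dynamics.
Context {R : realType}.
Local Notation C := (complex R).
Local Notation sphere := (riemann_sphere R).

Definition rational_map (P Q : {poly C}) (z : sphere) : sphere :=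
  match z with
  | Some w => if Q.[w] == 0 then None else Some (P.[w] / Q.[w])
  | None => let d := (maxn (size P) (size Q)).-1 in
            if Q`_d == 0 then None else Some (P`_d / Q`_d)
  end.

Definition chordal_dist (z w : sphere) : C :=
  match z, w with
  | Some a, Some b =>
      2 * `|a - b| / (sqrtC (1 + `|a| ^+ 2) * sqrtC (1 + `|b| ^+ 2))
  | Some a, None | None, Some a => 2 / sqrtC (1 + `|a| ^+ 2)
  | None, None => 0
  end.

Definition equicontinuous_iterates (f : sphere -> sphere) (x : sphere) : Prop :=
  forall e : C, 0 < e ->
    \forall y \near x, forall n, chordal_dist (iter n f y) (iter n f x) < e.

Definition fatou (f : sphere -> sphere) : set sphere :=
  \bigcup_(U in [set U | open U /\ forall x, U x -> equicontinuous_iterates f x]) U.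

Definition julia (f : sphere -> sphere) : set sphere := ~` fatou f.

(* The chart around p: z |-> z if p is finite and z |-> 1/z if p is infinity;
   the value at the point outside the domain of the chart is arbitrary. *)
Definition chart (p z : sphere) : C :=
  match p, z with
  | Some _, Some w => w
  | None, Some w => w^-1
  | _, None => 0
  end.

(* In charts, f z = f x + c (z - x)^n + (higher terms) with c != 0. *)
Definition is_branch_index (f : sphere -> sphere) (x : sphere) (n : nat) : Prop :=
  (0 < n)%N /\ exists c : C, c != 0 /\
    (chart (f x) (f z) - chart (f x) (f x)) / (chart x z - chart x x) ^+ n
      @[z --> x^'] --> c.

Definition branch_index (f : sphere -> sphere) (x : sphere) : nat :=
  xget 0%N [set n | is_branch_index f x n].

Definition graph_on (f : sphere -> sphere) (E : set sphere) : set (sphere * sphere) :=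
  [set p | [/\ E p.1, E p.2 & p.2 = f p.1]].

Lemma is_C0_graphM f (E : set sphere) (a : C0 R E)
    (xi : C0 R (graph_on f E)) (g : sphere * sphere -> sphere) :
  continuous g -> (forall p, graph_on f E p -> E (g p)) ->
  is_C0 (graph_on f E) (fun p => a (g p) * xi p).
Proof.
move=> cg gE; apply: is_C0M (C0P xi); last first.
  by have [M [M0 aM]] := is_C0_bounded (C0P a); exists M; split => // p _; exact: aM.
apply/subspace_continuousP => p Gp.
have [_ /subspace_continuousP/(_ _ (gE _ Gp)) ac _] := C0P a.
apply: (@cvg_comp _ _ _ g a _ (within E (nbhs (g p)))) => //.
move=> P; rewrite /within/= => /cg.
by rewrite /nbhs/=; apply: filterS => q Pq Gq; apply/Pq/gE.
Qed.

Section bimodule_of_map.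
Variables (f : sphere -> sphere) (E : set sphere).
Local Notation D := (C0 R E).
Local Notation Z := (C0 R (graph_on f E)).

(* (xi|eta)(y) = \sum_(x in f^-1(y)) e(x) conj(xi(x,y)) eta(x,y). The fibres of
   a non-constant rational map are finite and this function of y is in C_0(E);
   mkC0 only spares proving the latter here. *)
Definition graph_ip (xi eta : Z) : D :=
  mkC0 E (fun y => \sum_(x \in f @^-1` [set y])
    (branch_index f x)%:R * (xi (x, y))^* * eta (x, y)).

Let fst_E p : graph_on f E p -> E p.1. Proof. by case. Qed.
Let snd_E p : graph_on f E p -> E p.2. Proof. by case. Qed.

Definition graph_lact (a : D) (xi : Z) : Z :=
  MkC0 (asboolT (is_C0_graphM a xi (fun p => cvg_fst) fst_E)).

Definition graph_ract (xi : Z) (b : D) : Z :=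
  MkC0 (asboolT (is_C0_graphM b xi (fun p => cvg_snd) snd_E)).

Definition graph_bimodule : bimodule D := Bimodule graph_ip graph_ract graph_lact.

End bimodule_of_map.

Definition vanishing_on (J : set sphere) : set (C0 R [set: sphere]) :=
  [set b | forall x, J x -> b x = 0].

Lemma vanishing_on_star J (b : C0 R [set: sphere]) :
  vanishing_on J b -> vanishing_on J (star b).
Proof. by move=> b0 x Jx; rewrite C0_starE b0// conjC0. Qed.

(* The ideal of O generated by {b in C(sphere) : b|_J = 0}. *)
Definition ideal_of_vanishing (f : sphere -> sphere) (J : set sphere)
    (O : cstarAlgType R) (rho : covariant_rep (graph_bimodule f [set: sphere]) O) :
    starIdeal O :=
  generated_starIdeal (rep_image_star (rho := rho) (@vanishing_on_star J)).

Section restriction_to_julia.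
Variable f : sphere -> sphere.

Lemma closed_julia : closed (julia f).
Proof. by apply: open_closedC; apply: bigcup_open => U []. Qed.

Definition julia_restrict : C0 R [set: sphere] -> C0 R (julia f) :=
  C0_restrict closed_julia (setTI _).

Let closed_julia2 : closed (julia f `*` julia f).
Proof.
apply: closedI.
  by apply: (@preimage_closed _ _ fst _ _ closed_julia) => p _; exact: cvg_fst.
by apply: (@preimage_closed _ _ snd _ _ closed_julia) => p _; exact: cvg_snd.
Qed.

Let graph_juliaE : graph_on f [set: sphere] `&` (julia f `*` julia f) =
  graph_on f (julia f).
Proof. by apply/seteqP; split => -[x y] /=; [case=> -[_ _ yE] []|case]. Qed.

Definition julia_graph_restrict :
    C0 R (graph_on f [set: sphere]) -> C0 R (graph_on f (julia f)) :=
  C0_restrict closed_julia2 graph_juliaE.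

Lemma julia_restrictE b x : julia f x -> julia_restrict b x = b x.
Proof. by move=> Jx; rewrite /= patchT ?inE. Qed.

Lemma julia_graph_restrictE xi p :
  graph_on f (julia f) p -> julia_graph_restrict xi p = xi p.
Proof. by move=> Gp; rewrite /= patchT ?inE. Qed.

End restriction_to_julia.

End rational_dynamics.

(* Main.v *)
(* Write F and J for the Fatou and Julia sets, O for the algebra of the sphere and K for
   the ideal of O generated by the functions vanishing on J.

   For E the sphere, F or J, the set E has no isolated point among the branch points of f
   in E; for J this is because near an isolated branch point of J the iterates of f would
   omit two points and hence be normal.  Therefore a function in C_0(E) whose left action
   on Z_E is compact vanishes at the branch points.  Conversely, a function vanishing
   there is a uniform limit of functions acting as finite sums of rank one operators
   (theta_(u,v) with u, v supported where f is injective), so the covariance relation is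
   a relation between finitely many S_xi, which is preserved by restricting functions to J
   and by extending functions from F by 0.

   Cutoffs in C_0(F) increasing to 1 form an approximate unit of K, so O / K is a
   C*-algebra, and restriction of functions to J induces O -> O_J, with an inverse
   O_J -> O / K obtained by extending functions from J to the sphere.

   Extension by 0 gives psi : O_F -> O.  The limits of the products with cutoffs make the
   functions on the sphere and on its graph act on O_F by multipliers, which yields
   chi : O -> M(O_F) with chi (psi x) = left multiplication by x.  Hence psi is isometric;
   its range is a closed ideal, namely K, and K is isomorphic to O_F. *)

Require Import Defs.
From HB Require Import structures.
From mathcomp Require Import all_boot all_order all_algebra complex.
From mathcomp Require Import finmap numfun sequences lra ring.
From mathcomp Require Import all_classical all_reals.
From mathcomp Require Import topology normedtype one_point_compactification.

Set Implicit Arguments.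
Unset Strict Implicit.
Unset Printing Implicit Defensive.

Import Order.TTheory GRing.Theory Num.Theory numFieldNormedType.Exports.

Local Open Scope classical_set_scope.
Local Open Scope ring_scope.

(** * Norms and square roots in C*-algebras *)

(** Universality yields homomorphisms but no injectivity, and each of them asks for covariance on
    all of K(Z). For a Toeplitz representation the map on K(Z) is forced by its action on the S_xi,
    so covariance only asks i(a) to lie in the closed span of the products S_xi S_eta^* whenever a
    acts compactly. This is where branch points enter: at a branch point c isolated in J, a function
    with a(c) != 0 could act compactly on Z_J without its relation coming from one on the sphere.
    Such a c cannot be periodic, being then superattracting; so two successive preimages of c lie in
    J but off the orbit of c, and these are the omitted values. Normality is then proved by hand for
    quotients of polynomials, with ultrafilter limits.

    Injectivity is bought by explicit inverses: one for the quotient, chi for psi. A map out of O_J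
    must land in a C*-algebra, hence the norm on O / K, whose C*-identity comes from the cutoffs.
    Spectral theory is avoided: homomorphisms contract because a self-adjoint element of norm < 1 is
    a mean of two unitaries. *)

Lemma le_of_eq (R : realType) (x y : R) : x = y -> x <= y.
Proof. by move=> ->. Qed.

Section real_norm.
Context {R : realType}.
Local Notation C := (complex R).

(* Norms of normed modules over C are real elements of C; nm is their real part. *)
Definition nm (V : normedModType C) (x : V) : R := complex.Re `|x|.

Section normed.
Context {V : normedModType C}.
Implicit Types x y : V.

Lemma normE x : `|x| = ((nm x)%:C)%C.
Proof. by rewrite /nm RRe_real ?normr_real. Qed.

Lemma nm_ge0 x : 0 <= nm x.
Proof. by rewrite -lecR -normE; exact: normr_ge0. Qed.

Lemma nmD x y : nm (x + y) <= nm x + nm y.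
Proof. by rewrite -lecR rmorphD/= -!normE ler_normD. Qed.

Lemma nmN x : nm (- x) = nm x.
Proof. by rewrite /nm normrN. Qed.

Lemma nmB x y : nm (x - y) = nm (y - x).
Proof. by rewrite /nm distrC. Qed.

Lemma nm_tri x y z : nm (x - z) <= nm (x - y) + nm (y - z).
Proof. by rewrite (_ : x - z = (x - y) + (y - z)) ?nmD// addrA subrK. Qed.

Lemma nm0 : nm (0 : V) = 0.
Proof. by rewrite /nm normr0. Qed.

Lemma nm0_eq0 x : nm x = 0 -> x = 0.
Proof. by move=> x0; apply/eqP; rewrite -normr_eq0 normE x0. Qed.

Lemma nm_small_eq0 x : (forall e : R, 0 < e -> nm x <= e) -> x = 0.
Proof.
move=> h; apply: nm0_eq0; apply/le_anti; rewrite nm_ge0 andbT.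
by apply/ler_addgt0Pr => e e0; rewrite add0r h.
Qed.

Lemma nm_sum (I : Type) (s : seq I) (P : pred I) (F : I -> V) :
  nm (\sum_(i <- s | P i) F i) <= \sum_(i <- s | P i) nm (F i).
Proof.
elim/big_ind2 : _ => //; first by rewrite nm0.
by move=> x a y b xa yb; rewrite (le_trans (nmD _ _))// lerD.
Qed.

Lemma nm_cvgP (T : Type) (F : set_system T) (FF : Filter F) (u : T -> V) l :
  u @ F --> l <-> forall e : R, 0 < e -> \forall t \near F, nm (l - u t) < e.
Proof.
split=> [/cvgrPdist_lt h e e0|h].
  have e0' : 0 < (e%:C)%C :> C by rewrite ltcR.
  by apply: filterS (h _ e0') => t; rewrite normE ltcR.
apply/cvgrPdist_lt => e e0.
have eE : e = ((complex.Re e)%:C)%C by rewrite RRe_real// gtr0_real.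
have : 0 < complex.Re e by rewrite -ltcR -eE.
by move=> /h; apply: filterS => t; rewrite eE normE ltcR.
Qed.

Lemma nm_nbhsP x (U : set V) :
  nbhs x U <-> exists2 e : R, 0 < e & forall y, nm (x - y) < e -> U y.
Proof.
split=> [/nbhs_normP[e /= e0 eU]|[e e0 eU]].
  have eE : e = ((complex.Re e)%:C)%C by rewrite RRe_real// gtr0_real.
  exists (complex.Re e); first by rewrite -ltcR -eE.
  by move=> y xy; apply: eU; rewrite /ball_/= normE eE ltcR.
apply/nbhs_normP; exists (e%:C)%C => /=; first by rewrite ltcR.
by move=> y; rewrite /ball_/= normE ltcR => /eU.
Qed.

Lemma closed_nm (W : set V) x : closed W ->
  (forall e : R, 0 < e -> exists2 y, W y & nm (x - y) < e) -> W x.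
Proof.
move=> cW h; apply: cW => U /nm_nbhsP[e e0 eU]; have [y Wy xy] := h e e0.
by exists y; split => //; exact: eU.
Qed.

Lemma nm_closedI (W : set V) :
  (forall x, (forall e : R, 0 < e -> exists2 y, W y & nm (x - y) < e) -> W x) ->
  closed W.
Proof.
move=> h x clx; apply: h => e e0.
have [|y [Wy xy]] := clx [set y | nm (x - y) < e]; last by exists y.
by apply/nm_nbhsP; exists e.
Qed.

End normed.

Lemma nmZ (V : normedModType C) (c : C) (x : V) : nm (c *: x) = nm c * nm x.
Proof. by apply: (@complexI R); rewrite rmorphM/= -!normE normrZ. Qed.

Lemma nmM (x y : C) : nm (x * y) = nm x * nm y.
Proof. by apply: (@complexI R); rewrite rmorphM/= -!normE normrM. Qed.

Lemma nm1 : nm (1 : C) = 1.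
Proof. by rewrite /nm normr1. Qed.

Lemma nm_nat n : nm (n%:R : C) = n%:R.
Proof. by apply: (@complexI R); rewrite -normE normr_nat rmorph_nat. Qed.

Lemma nmX (x : C) n : nm (x ^+ n) = nm x ^+ n.
Proof. by elim: n => [|n ih]; rewrite ?expr0 ?nm1// !exprS nmM ih. Qed.

Lemma nmV (x : C) : nm (x^-1) = (nm x)^-1.
Proof. by apply: (@complexI R); rewrite fmorphV -!normE normfV. Qed.

Lemma nmJ (x : C) : nm (x^*) = nm x.
Proof. by rewrite /nm norm_conjC. Qed.

Lemma nmR (r : R) : nm ((r%:C)%C : C) = `|r|.
Proof. by rewrite /nm normc_def/= expr0n/= addr0 sqrtr_sqr. Qed.

Lemma nm_cauchy (V : completeNormedModType C) (u : nat -> V) :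
  (forall e : R, 0 < e -> exists N, forall m n, (N <= m)%N -> (N <= n)%N ->
     nm (u m - u n) < e) -> exists l : V, u @ \oo --> l.
Proof.
move=> h; suff /cvg_ex : cvg (u @ \oo) by [].
apply: cauchy_cvg; apply/cauchy_ballP => e e0.
have eE : e = ((complex.Re e)%:C)%C by rewrite RRe_real// gtr0_real.
have [|N hN] := h (complex.Re e); first by rewrite -ltcR -eE.
exists (u @` [set n | (N <= n)%N], u @` [set n | (N <= n)%N]) => /=.
  by split; exists N => // n Nn; exists n.
move=> [x y] /= [[m Nm <-] [n Nn <-]]; rewrite -ball_normE/=.
by rewrite normE eE ltcR; exact: hN.
Qed.

Lemma geometric_small (r : R) (K : R) (e : R) : 0 <= r -> r < 1 -> 0 < e ->
  exists N, forall n, (N <= n)%N -> r ^+ n * K < e.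
Proof.
move=> r0 r1 e0.
have : (fun n => r ^+ n * K) @ \oo --> (0 : R).
  rewrite -[X in _ --> X](mul0r K); apply: cvgM; last exact: cvg_cst.
  by apply: cvg_expr; rewrite ger0_norm.
move=> /cvgrPdist_lt/(_ _ e0)[N _ hN]; exists N => n Nn.
by have := hN n Nn; rewrite /= sub0r normrN => /(le_lt_trans (ler_norm _)).
Qed.

End real_norm.

Section cstar_basics.
Context {R : realType} {A : cstarAlgType R}.
Local Notation C := (complex R).
Implicit Types x y z a : A.

Lemma smulN x y : x ** (- y) = - (x ** y).
Proof. by rewrite -scaleN1r smulZr scaleN1r. Qed.
Lemma smulNl x y : (- x) ** y = - (x ** y).
Proof. by rewrite -scaleN1r smulZl scaleN1r. Qed.
Lemma smulBr x y z : x ** (y - z) = x ** y - x ** z.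
Proof. by rewrite smulDr smulN. Qed.
Lemma smulBl x y z : (x - y) ** z = x ** z - y ** z.
Proof. by rewrite smulDl smulNl. Qed.
Lemma smul0 x : x ** 0 = 0.
Proof. by rewrite -[in LHS](scale0r 0) smulZr scale0r. Qed.
Lemma smul0l x : 0 ** x = 0.
Proof. by rewrite -[in LHS](scale0r 0) smulZl scale0r. Qed.
Lemma starB x y : star (x - y) = star x - star y.
Proof. by rewrite starD starN. Qed.

Lemma smul_sumr (I : Type) (s : seq I) (F : I -> A) x :
  x ** (\sum_(i <- s) F i) = \sum_(i <- s) x ** F i.
Proof. by elim/big_rec2 : _ => [|i y z _ <-]; rewrite ?smul0 ?smulDr. Qed.
Lemma smul_suml (I : Type) (s : seq I) (F : I -> A) x :
  (\sum_(i <- s) F i) ** x = \sum_(i <- s) F i ** x.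
Proof. by elim/big_rec2 : _ => [|i y z _ <-]; rewrite ?smul0l ?smulDl. Qed.
Lemma star_sum (I : Type) (s : seq I) (F : I -> A) :
  star (\sum_(i <- s) F i) = \sum_(i <- s) star (F i).
Proof. by elim/big_rec2 : _ => [|i y z _ <-]; rewrite ?star0 ?starD. Qed.

Lemma nm_smul x y : nm (x ** y) <= nm x * nm y.
Proof. by rewrite -lecR rmorphM/= -!normE ler_norm_smul. Qed.
Lemma nm_star x : nm (star x) = nm x.
Proof. by rewrite /nm norm_star. Qed.
Lemma nm_cstar x : nm (star x ** x) = nm x ^+ 2.
Proof. by apply: (@complexI R); rewrite rmorphXn/= -!normE norm_cstar. Qed.
Lemma nm_cstarr x : nm (x ** star x) = nm x ^+ 2.
Proof. by rewrite -{1}[x]starK nm_cstar nm_star. Qed.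

Lemma cstar_eq0 x : star x ** x = 0 -> x = 0.
Proof.
move=> x0; apply: nm0_eq0; apply/eqP; rewrite -sqrf_eq0.
by rewrite -nm_cstar x0 nm0.
Qed.

End cstar_basics.

Section star_hom_contractive.
Context {R : realType}.
Local Notation C := (complex R).

(* The fixed point of w |-> (a^2 + w^2)/2 is 1 - sqrt(1 - a^2). *)
Lemma cstar_sqrt (A : cstarAlgType R) (a : A) : star a = a -> nm a < 1 ->
  exists w : A, [/\ star w = w, w ** a = a ** w & w + w = a ** a + w ** w].
Proof.
move=> sa a1; pose r := nm a ^+ 2.
have a0 := nm_ge0 a.
have r0 : 0 <= r by rewrite /r; nra.
have r1 : r < 1 by rewrite /r; nra.
pose g (w : A) : A := (2^-1 : C) *: (a ** a + w ** w).
have nh : nm (2^-1 : C) = 2^-1.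
  by rewrite nmV nm_nat.
(* Since r = |a|^2 < 1, g maps the ball of radius r to itself, by (r + r^2)/2 <= r, and contracts it
   by the factor r. *)
have nmg w : nm w <= r -> nm (g w) <= r.
  move=> wr; rewrite /g nmZ nh.
  have := nmD (a ** a) (w ** w); have := nm_smul a a; have := nm_smul w w.
  have := nm_ge0 w; rewrite /r in wr r1 *; nra.
have lip w v : nm w <= r -> nm v <= r -> nm (g w - g v) <= r * nm (w - v).
  move=> wr vr; rewrite /g -scalerBr nmZ nh.
  have -> : a ** a + w ** w - (a ** a + v ** v) = w ** (w - v) + (w - v) ** v.
    by rewrite smulBr smulBl addrA subrK opprD addrACA subrr add0r.
  have := nmD (w ** (w - v)) ((w - v) ** v).
  have := nm_smul w (w - v); have := nm_smul (w - v) v.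
  have := nm_ge0 (w - v); nra.
pose u n := iter n g 0.
have ur n : nm (u n) <= r by elim: n => [|n ih]; rewrite ?nm0//=; exact: nmg.
have us n : star (u n) = u n.
  elim: n => [|n ih]; rewrite /= ?star0// /g starZ starD !starM sa ih.
  by rewrite fmorphV/= conjC_nat.
have uc n : u n ** a = a ** u n.
  elim: n => [|n ih]; rewrite /= ?smul0 ?smul0l// /g smulZl smulZr smulDl smulDr.
  by rewrite !smulA -[u n ** u n ** a]smulA ih smulA ih.
have step n : nm (u n.+1 - u n) <= r ^+ n * 1.
  elim: n => [|n ih]; first by rewrite expr0 mul1r subr0; apply: le_trans (ur 1%N) (ltW _).
  have h : nm (u n.+2 - u n.+1) <= _ := lip _ _ (ur n.+1) (ur n).
  by apply: le_trans h _; rewrite exprS -mulrA ler_wpM2l.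
have tail n k : nm (u (n + k)%N - u n) <= r ^+ n * (1 - r ^+ k) / (1 - r).
  elim: k => [|k ih]; first by rewrite addn0 subrr nm0 expr0 subrr mulr0 mul0r.
  apply: le_trans (nm_tri _ (u (n + k)%N) _) _; rewrite addnS.
  apply: le_trans (lerD (step _) ih) _.
  rewrite exprD exprS; set x := r ^+ n; set y := r ^+ k.
  rewrite le_eqVlt; apply/orP; left; apply/eqP; field.
  by rewrite subr_eq0 eq_sym lt_eqF.
have [w uw] : exists w : A, u @ \oo --> w.
  apply: nm_cauchy => e e0.
  have [N hN] := @geometric_small _ r (2 / (1 - r)) e r0 r1 e0.
  exists N => m n Nm Nn.
  have t k : (N <= k)%N -> nm (u k - u N) <= r ^+ N * (1 / (1 - r)).
    move=> Nk; rewrite -(subnKC Nk); apply: le_trans (tail _ _) _.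
    rewrite mulrA; apply: ler_wpM2r; first by rewrite invr_ge0 subr_ge0 ltW.
    rewrite ler_wpM2l ?exprn_ge0// gerBl exprn_ge0//.
  apply: le_lt_trans (hN N (leqnn _)).
  rewrite -(subrKA (u N)) (le_trans (nmD _ _))//.
  rewrite [X in _ + X]nmB; have := t _ Nm; have := t _ Nn; lra.
have lim_eq (h : A -> A) : (forall n, h (u n) = 0) ->
    (exists2 K, 0 < K & forall v, nm v <= 1 + nm w -> nm (h w - h v) <= K * nm (w - v)) -> h w = 0.
  move=> hu [K K0 hK]; apply: nm_small_eq0 => e e0.
  have : \forall n \near \oo, nm (w - u n) < Num.min (e / K) 1.
    by move/nm_cvgP : uw; apply; rewrite lt_min ltr01 divr_gt0.
  move=> [N _ /(_ N (leqnn N))/=]; rewrite lt_min => /andP[wN1 wN2].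
  have := hK (u N); rewrite hu subr0; move=> /(_ _)/le_trans; apply.
    have := nmD (u N - w) w; rewrite subrK nmB; lra.
  by rewrite mulrC -ler_pdivlMr// ltW.
have w0 := nm_ge0 w.
exists w; split.
- apply/eqP; rewrite -subr_eq0; apply/eqP; apply: (lim_eq (fun v => star v - v)).
    by move=> n; rewrite us subrr.
  exists 2 => // v _; rewrite opprD addrACA -opprD -starB.
  apply: le_trans (nmD _ _) _; rewrite nmN nm_star; lra.
- apply/eqP; rewrite -subr_eq0; apply/eqP; apply: (lim_eq (fun v => v ** a - a ** v)).
    by move=> n; rewrite uc subrr.
  exists 2 => // v _; rewrite opprD addrACA -opprD -smulBl -smulBr.
  apply: le_trans (nmD _ _) _; rewrite nmN.
  have := nm_smul (w - v) a; have := nm_smul a (w - v); have := nm_ge0 (w - v); nra.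
- apply/eqP; rewrite -subr_eq0; apply/eqP.
  have gE v : v + v - (a ** a + v ** v) = (2 : C) *: (v - g v).
    rewrite scalerBr /g scalerA mulfV ?pnatr_eq0// scale1r.
    by rewrite scaler_nat mulr2n.
  suff : w - g w = 0 by rewrite gE => ->; rewrite scaler0.
  apply: nm_small_eq0 => e e0.
  have wr : nm w <= r.
    apply/ler_addgt0Pr => d d0; move/nm_cvgP : uw => /(_ d d0)[N _ /(_ N (leqnn N))/= wN].
    have := nmD (w - u N) (u N); rewrite subrK; have := ur N; lra.
  have e3 : 0 < e / 3 by rewrite divr_gt0.
  move/nm_cvgP : uw => /(_ _ e3)[N _ hN].
  have h1 := hN N (leqnn N); have h2 := hN N.+1 (leqnSn N); rewrite /= in h1 h2.
  have := nm_tri w (u N.+1) (g w); have := lip _ _ (ur N) wr.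
  rewrite [nm (u N - w)]nmB -/(u N.+1); have := nm_ge0 (w - u N); rewrite /=; nra.
Qed.

End star_hom_contractive.

Section star_hom_norm.
Context {R : realType}.
Local Notation C := (complex R).

Lemma conjCR (r : R) : ((r%:C)%C : C)^* = (r%:C)%C.
Proof. exact: conjc_real. Qed.

(** Let star a = a and |a| < 1. The element w of [cstar_sqrt] gives v = f w with b^2 + (1 - v)^2 = 1
    for b = f a, so b + i(1 - v) and b - i(1 - v) are unitaries of the unitization with mean b.
    Hence |b x| <= |x|, and x = b yields |b| <= 1. Scaling and the C*-identity give the general
    case. *)
Lemma star_hom_contr (A B : cstarAlgType R) (f : A -> B) : is_star_hom f ->
  forall x, nm (f x) <= nm x.
Proof.
move=> [fD fZ fM fS].
have sa1 a : star a = a -> nm a < 1 -> nm (f a) <= 1.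
  move=> sa a1; have [w [sw wa ww]] := cstar_sqrt sa a1.
  set b := f a; set v := f w.
  have sb : star b = b by rewrite -fS sa.
  have sv : star v = v by rewrite -fS sw.
  have vb : v ** b = b ** v by rewrite -!fM wa.
  have vv : v + v = b ** b + v ** v by rewrite -!fM -!fD ww.
  (* Left multiplication by b + c(1 - v) is isometric for c = i and c = -i; it is spelled out
     because 1 need not exist in B. *)
  have unit c x : c * c^* = 1 -> c^* = - c :> C ->
      nm (b ** x + c *: (x - v ** x)) = nm x.
    move=> cc cN; apply/eqP; rewrite -(@eqrXn2 _ 2) ?nm_ge0// -!nm_cstar; apply/eqP.
    congr nm; set p := b ** x; set y := x - v ** x.
    have py : star p ** y = star y ** p.
      rewrite /p /y starB !starM sb sv smulBr smulBl !smulA; congr (_ - _).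
      by rewrite -(smulA _ b v) -vb !smulA.
    have ppyy : star p ** p + star y ** y = star x ** x.
      rewrite /p /y starB !starM sb sv smulBr !smulBl !smulA.
      rewrite -(smulA _ b b) -(smulA _ v v) opprB [X in _ + X]addrC addrA.
      rewrite [_ ** x + (_ - _)]addrA -smulDl -smulDr -vv smulDr smulDl addrK.
      by rewrite addrCA subrr addr0.
    rewrite starD starZ smulDl !smulDr !smulZl !smulZr scalerA [c^* * c]mulrC cc.
    rewrite scale1r cN py scaleNr -ppyy; set q := c *: _.
    by rewrite -addrA [q + _]addrA subrr add0r.
  have key x : nm (b ** x) <= nm x.
    have ci : 'i * ('i)^* = 1 :> C by rewrite conjCi mulrN -expr2 sqrCi opprK.
    have h1 := unit 'i x ci (conjCi _).
    have h2 : nm (b ** x + (- 'i) *: (x - v ** x)) = nm x.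
      by apply: unit; rewrite rmorphN/= ?mulrNN// conjCi.
    have : b ** x + b ** x = (b ** x + 'i *: (x - v ** x)) +
        (b ** x + (- 'i) *: (x - v ** x)).
      by rewrite addrACA scaleNr subrr addr0.
    move=> /(congr1 (@nm R B)) e2.
    have := nmD (b ** x + 'i *: (x - v ** x)) (b ** x + (- 'i) *: (x - v ** x)).
    rewrite -e2 h1 h2 -mulr2n -scaler_nat nmZ nm_nat; lra.
  have := key b; rewrite -{1}sb nm_cstar; have := nm_ge0 b; nra.
have sa2 a : star a = a -> nm (f a) <= nm a.
  move=> sa; apply/ler_addgt0Pr => e e0; set t := nm a + e.
  have t0 : 0 < t by rewrite /t ltr_wpDl// nm_ge0.
  have tE : nm ((t%:C)%C : C) = t by rewrite nmR gtr0_norm.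
  have := @sa1 ((t%:C)%C^-1 *: a); rewrite starZ sa fZ !nmZ nmV tE.
  have -> : ((t%:C)%C^-1 : C)^* = (t%:C)%C^-1.
    by apply: conj_Creal; rewrite realV ger0_real// lecR ltW.
  rewrite mulrC ltr_pdivrMr// mul1r => /(_ erefl).
  by rewrite mulrC ler_pdivrMr// mul1r; apply; rewrite /t ltrDl.
move=> x; rewrite -(@ler_pXn2r _ 2) ?nnegrE ?nm_ge0// -!nm_cstar -fS -fM.
by apply: sa2; rewrite starM starK.
Qed.

Lemma star_hom0 (A B : starAlgType R) (f : A -> B) : is_star_hom f -> f 0 = 0.
Proof. by move=> [_ fZ _ _]; rewrite -(scale0r (0 : A)) fZ scale0r. Qed.

Lemma star_homN (A B : starAlgType R) (f : A -> B) x : is_star_hom f -> f (- x) = - f x.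
Proof. by move=> [_ fZ _ _]; rewrite -scaleN1r fZ scaleN1r. Qed.

Lemma star_homB (A B : starAlgType R) (f : A -> B) x y : is_star_hom f ->
  f (x - y) = f x - f y.
Proof. by move=> fh; case: (fh) => fD _ _ _; rewrite fD star_homN. Qed.

Lemma star_hom_lip (A B : cstarAlgType R) (f : A -> B) : is_star_hom f ->
  forall x y, nm (f x - f y) <= nm (x - y).
Proof. by move=> fh x y; rewrite -star_homB// star_hom_contr. Qed.

Lemma star_hom_comp (A B D : starAlgType R) (f : A -> B) (g : B -> D) :
  is_star_hom f -> is_star_hom g -> is_star_hom (g \o f).
Proof.
move=> [fD fZ fM fS] [gD gZ gM gS]; split.
- by move=> x y; rewrite /= fD gD.
- by move=> c x; rewrite /= fZ gZ.
- by move=> x y; rewrite /= fM gM.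
- by move=> x; rewrite /= fS gS.
Qed.

Lemma closed_preim (V W : normedModType C) (K : R) (g : V -> W) (P : set W) :
  (forall x y, nm (g x - g y) <= K * nm (x - y)) -> closed P ->
  closed [set x | P (g x)].
Proof.
move=> lip cP; apply: nm_closedI => x h; apply: (closed_nm cP) => e e0.
have K0 : 0 < `|K| + 1 by rewrite ltr_wpDl.
have [|y Py xy] := h (e / (`|K| + 1)); first by rewrite divr_gt0.
exists (g y) => //; apply: le_lt_trans (lip _ _) _.
have := xy; rewrite ltr_pdivlMr//; have := ler_norm K; have := nm_ge0 (x - y); nra.
Qed.

Lemma closed_eq (V W : normedModType C) (K : R) (g h : V -> W) :
  (forall x y, nm (g x - g y) <= K * nm (x - y)) ->
  (forall x y, nm (h x - h y) <= K * nm (x - y)) ->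
  closed [set x | g x = h x].
Proof.
move=> lg lh; apply: nm_closedI => x hx; apply/eqP; rewrite -subr_eq0; apply/eqP.
apply: nm_small_eq0 => e e0; set k := `|K| + 1.
have K0 : 0 < k by rewrite ltr_wpDl.
have [|y /= ghy xy] := hx (e / 2 / k); first by rewrite !divr_gt0.
have := nm_tri (g x) (g y) (h x); rewrite [in X in _ <= X]ghy.
have := lg x y; have := lh y x; rewrite [nm (y - x)]nmB.
have := xy; rewrite ltr_pdivlMr//; have := ler_norm K; have := nm_ge0 (x - y).
rewrite ghy /k; nra.
Qed.

Lemma smul_lipl (A : cstarAlgType R) (a x y : A) : nm (a ** x - a ** y) <= nm a * nm (x - y).
Proof. by rewrite -smulBr nm_smul. Qed.
Lemma smul_lipr (A : cstarAlgType R) (a x y : A) : nm (x ** a - y ** a) <= nm a * nm (x - y).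
Proof. by rewrite -smulBl mulrC nm_smul. Qed.
Lemma star_lip (A : cstarAlgType R) (x y : A) : nm (star x - star y) <= 1 * nm (x - y).
Proof. by rewrite -starB nm_star mul1r. Qed.

Definition closed_subspace (V : normedModType C) (W : set V) := [/\ closed W, W 0,
  forall x y, W x -> W y -> W (x + y) & forall (c : C) x, W x -> W (c *: x)].

Section span.
Context {V : normedModType C}.

Lemma closed_span_subspace (S : set V) : closed_subspace (closed_span S).
Proof.
split.
- by apply: closed_bigI => W [].
- by move=> W [].
- by move=> x y hx hy W WS; have [_ _ WD _ _] := WS; apply: WD; [exact: hx|exact: hy].
- by move=> c x hx W WS; have [_ _ _ WZ _] := WS; apply: WZ; exact: hx.
Qed.

Lemma sub_closed_span (S : set V) : S `<=` closed_span S.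
Proof. by move=> x Sx W [_ _ _ _ SW]; exact: SW. Qed.

Lemma closed_span_min (S W : set V) : closed_subspace W -> S `<=` W ->
  closed_span S `<=` W.
Proof. by move=> [cW W0 WD WZ] SW x; apply; split. Qed.

(** The scalar c' may differ from c so that conjugate-linear maps such as [star] are covered. *)
Lemma closed_subspace_preim (U : normedModType C) (K : R) (g : U -> V) (W : set V) :
  (forall x y, nm (g x - g y) <= K * nm (x - y)) ->
  (forall x y, g (x + y) = g x + g y) ->
  (forall c x, exists c', g (c *: x) = c' *: g x) ->
  closed_subspace W -> closed_subspace [set x | W (g x)].
Proof.
move=> lip gD gZ [cW W0 WD WZ]; split => /=.
- exact: closed_preim lip cW.
- by have [c' /=] := gZ 0 0; rewrite scale0r => ->; rewrite (_ : g 0 = 0) ?scaler0//;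
     apply: (addrI (g 0)); rewrite -gD !addr0.
- by move=> x y Wx Wy; rewrite gD; exact: WD.
- by move=> c x Wx; have [c' ->] := gZ c x; exact: WZ.
Qed.

Lemma closed_subspace_sum (W : set V) (I : Type) (s : seq I) (F : I -> V) :
  closed_subspace W -> (forall i, W (F i)) -> W (\sum_(i <- s) F i).
Proof. by move=> [_ W0 WD _] WF; apply: big_ind => // i _. Qed.

Lemma closed_subspaceN (W : set V) x : closed_subspace W -> W x -> W (- x).
Proof. by move=> [_ _ _ WZ] Wx; rewrite -scaleN1r; exact: WZ. Qed.

Lemma closed_subspace0 : closed_subspace [set (0 : V)].
Proof.
split => //=; last by move=> c x ->; rewrite scaler0.
- apply: nm_closedI => x h; apply: nm_small_eq0 => e e0.
  by have [_ /= -> ] := h e e0; rewrite subr0 => /ltW.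
- by move=> x y -> ->; rewrite addr0.
Qed.

End span.

End star_hom_norm.

(** * Covariance of Toeplitz representations *)

Section toeplitz.
Context {R : realType} {D : cstarAlgType R} (Z : bimodule D).
Local Notation C := (complex R).
Local Notation ip := (@bimod_ip R D Z).
Local Notation ract := (@bimod_ract R D Z).
Local Notation lact := (@bimod_lact R D Z).

(** Cauchy-Schwarz is required outright: for the modules Z_E it is checked fibre by fibre, in place
    of a derivation from positivity. *)
Record pre_hilbert : Prop := {
  ph_D : forall x y z, ip x (y + z) = ip x y + ip x z;
  ph_Z : forall (c : C) x y, ip x (c *: y) = c *: ip x y;
  ph_M : forall x y b, ip x (ract y b) = ip x y ** b;
  ph_star : forall x y, star (ip x y) = ip y x;
  ph_CS : forall x y, nm (ip x y) ^+ 2 <= nm (ip x x) * nm (ip y y);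
  ph_ractN : forall x b, ract (- x) b = - ract x b
}.

Definition hn (x : Z) : R := Num.sqrt (nm (ip x x)).

Lemma ip_normE x : ip_norm ip x = ((hn x)%:C)%C.
Proof.
rewrite /ip_norm normE /hn -[in LHS](@sqr_sqrtr _ (nm _)) ?nm_ge0// rmorphXn/=.
by rewrite sqrCK// lecR sqrtr_ge0.
Qed.

Lemma hn_ge0 x : 0 <= hn x. Proof. exact: sqrtr_ge0. Qed.

Lemma hn_sqr x : hn x ^+ 2 = nm (ip x x).
Proof. by rewrite sqr_sqrtr ?nm_ge0. Qed.

Record toeplitz (A : cstarAlgType R) (i : D -> A) (S : Z -> A) : Prop := {
  tp_hom : is_star_hom i;
  tp_SD : forall xi eta, S (xi + eta) = S xi + S eta;
  tp_SZ : forall (c : C) xi, S (c *: xi) = c *: S xi;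
  tp_iS : forall a xi, i a ** S xi = S (lact a xi);
  tp_Si : forall a xi, S xi ** i a = S (ract xi a);
  tp_SS : forall xi eta, star (S xi) ** S eta = i (ip xi eta)
}.

Lemma rep_toeplitz (A : cstarAlgType R) (rho : covariant_rep Z A) :
  toeplitz (rep_i rho) (rep_S rho).
Proof. by case: rho => i S *; split. Qed.

Section rep.
Context {A : cstarAlgType R} {i : D -> A} {S : Z -> A} (T : toeplitz i S).

Definition compact_span : set A :=
  closed_span [set t | exists xi eta, t = S xi ** star (S eta)].
Local Notation W := compact_span.

Lemma tp_nm xi : nm (S xi) <= hn xi.
Proof.
rewrite -(@ler_pXn2r _ 2) ?nnegrE ?nm_ge0 ?hn_ge0// hn_sqr -nm_cstar (tp_SS T).
exact: (star_hom_contr (tp_hom T)).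
Qed.

Lemma tp_S0 : S 0 = 0.
Proof. by rewrite -[in LHS](scale0r (0 : Z)) (tp_SZ T) scale0r. Qed.

Lemma tp_SN xi : S (- xi) = - S xi.
Proof. by rewrite -scaleN1r (tp_SZ T) scaleN1r. Qed.

Lemma tp_sum (I : Type) (s : seq I) (F : I -> Z) :
  S (\sum_(j <- s) F j) = \sum_(j <- s) S (F j).
Proof. by elim/big_rec2 : _ => [|j y z _ <-]; rewrite ?tp_S0 ?(tp_SD T). Qed.

Lemma tp_SSS xi eta zeta : S xi ** star (S eta) ** S zeta = S (rank_one xi eta zeta).
Proof. by rewrite -smulA (tp_SS T) (tp_Si T). Qed.

Lemma compact_span_subspace : closed_subspace W.
Proof. exact: closed_span_subspace. Qed.

Lemma compact_span_SS xi eta : W (S xi ** star (S eta)).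
Proof. by apply: sub_closed_span; exists xi, eta. Qed.

Lemma compact_span_star t : W t -> W (star t).
Proof.
apply: (@closed_span_min _ _ _ [set t | W (star t)]).
  apply: closed_subspace_preim compact_span_subspace.
  - exact: star_lip.
  - exact: starD.
  - by move=> c x; exists c^*; rewrite starZ.
by move=> _ [xi [eta ->]] /=; rewrite starM starK; exact: compact_span_SS.
Qed.

Lemma compact_span_mul t u : W t -> W u -> W (t ** u).
Proof.
move=> Wt Wu; move: t Wt; apply: (@closed_span_min _ _ _ [set t | W (t ** u)]).
  apply: closed_subspace_preim compact_span_subspace.
  - exact: smul_lipr.
  - by move=> x y; rewrite smulDl.
  - by move=> c x; exists c; rewrite smulZl.
move=> _ [xi [eta ->]] /=; move: u Wu.
apply: (@closed_span_min _ _ _ [set u | W (S xi ** star (S eta) ** u)]).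
  apply: closed_subspace_preim compact_span_subspace.
  - exact: smul_lipl.
  - by move=> x y; rewrite smulDr.
  - by move=> c x; exists c; rewrite smulZr.
by move=> _ [xi' [eta' ->]] /=; rewrite smulA tp_SSS; exact: compact_span_SS.
Qed.

(** Such a t kills the whole span, which contains star t, so t t^* = 0. This makes an element of the
    span determined by its action on the S_zeta. *)
Lemma compact_span_eq0 t : W t -> (forall zeta, t ** S zeta = 0) -> t = 0.
Proof.
move=> Wt tS; have tW u : W u -> t ** u = 0.
  apply: (@closed_span_min _ _ _ [set u | [set 0] (t ** u)]).
    apply: closed_subspace_preim (@closed_subspace0 _ _).
    - exact: smul_lipl.
    - by move=> x y; rewrite smulDr.
    - by move=> c x; exists c; rewrite smulZr.
  by move=> _ [xi [eta ->]] /=; rewrite smulA tS smul0l.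
by rewrite -[t]starK (@cstar_eq0 _ _ (star t)) ?star0// starK tW//; exact: compact_span_star.
Qed.

Lemma compact_span_inj t u : W t -> W u -> (forall zeta, t ** S zeta = u ** S zeta) ->
  t = u.
Proof.
move=> Wt Wu tu; apply/eqP; rewrite -subr_eq0; apply/eqP/compact_span_eq0.
  have [_ _ WD _] := compact_span_subspace.
  by apply: WD => //; exact: closed_subspaceN compact_span_subspace _.
by move=> zeta; rewrite smulBl tu subrr.
Qed.

Hypothesis PH : pre_hilbert.

Lemma ip_Dl x y z : ip (x + y) z = ip x z + ip y z.
Proof. by rewrite -(ph_star PH) (ph_D PH) starD !(ph_star PH). Qed.
Lemma ip_Zl (c : C) x y : ip (c *: x) y = c^* *: ip x y.
Proof. by rewrite -(ph_star PH) (ph_Z PH) starZ (ph_star PH). Qed.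
Lemma ip_0r x : ip x 0 = 0.
Proof. by rewrite -[in LHS](scale0r (0 : Z)) (ph_Z PH) scale0r. Qed.
Lemma ip_sumr (I : Type) (s : seq I) (F : I -> Z) x :
  ip x (\sum_(j <- s) F j) = \sum_(j <- s) ip x (F j).
Proof. by elim/big_rec2 : _ => [|j y z _ <-]; rewrite ?ip_0r ?(ph_D PH). Qed.

Lemma hn_CS x y : nm (ip x y) <= hn x * hn y.
Proof.
rewrite -(@ler_pXn2r _ 2) ?nnegrE ?nm_ge0 ?mulr_ge0 ?hn_ge0// exprMn !hn_sqr.
exact: ph_CS.
Qed.

Lemma hnD x y : hn (x + y) <= hn x + hn y.
Proof.
rewrite -(@ler_pXn2r _ 2) ?nnegrE ?addr_ge0 ?hn_ge0// hn_sqr.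
rewrite ip_Dl !(ph_D PH).
have h1 := hn_CS x y; have h2 := hn_CS y x; have h3 := hn_CS x x; have h4 := hn_CS y y.
have n1 := nmD (ip x x + ip x y) (ip y x + ip y y).
have n2 := nmD (ip x x) (ip x y); have n3 := nmD (ip y x) (ip y y); nra.
Qed.

Lemma hnN x : hn (- x) = hn x.
Proof. by rewrite /hn -scaleN1r ip_Zl (ph_Z PH) !nmZ nmJ nmN nm1 !mul1r. Qed.

Implicit Types s : seq (Z * Z).

Definition fr_op s zeta : Z := \sum_(p <- s) rank_one p.1 p.2 zeta.
Definition fr_el s : A := \sum_(p <- s) S p.1 ** star (S p.2).
Definition fr_swap s : seq (Z * Z) := [seq (p.2, p.1) | p <- s].
Definition fr_opp s : seq (Z * Z) := [seq (- p.1, p.2) | p <- s].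

Lemma fr_elS s zeta : fr_el s ** S zeta = S (fr_op s zeta).
Proof.
by rewrite /fr_el /fr_op smul_suml tp_sum; apply: eq_bigr => p _; rewrite tp_SSS.
Qed.

Lemma fr_el_span s : W (fr_el s).
Proof.
by apply: closed_subspace_sum compact_span_subspace _ => p; exact: compact_span_SS.
Qed.

Lemma fr_el_star s : star (fr_el s) = fr_el (fr_swap s).
Proof.
rewrite /fr_el star_sum /fr_swap big_map; apply: eq_bigr => p _.
by rewrite starM starK.
Qed.

Lemma fr_op_adj s x y : ip x (fr_op s y) = ip (fr_op (fr_swap s) x) y.
Proof.
rewrite -[RHS](ph_star PH) /fr_op !ip_sumr star_sum /fr_swap big_map.
apply: eq_bigr => p _; rewrite /rank_one !(ph_M PH) starM !(ph_star PH).
by [].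
Qed.

Lemma fr_op_cat s1 s2 zeta : fr_op (s1 ++ s2) zeta = fr_op s1 zeta + fr_op s2 zeta.
Proof. by rewrite /fr_op big_cat. Qed.
Lemma fr_op_opp s zeta : fr_op (fr_opp s) zeta = - fr_op s zeta.
Proof.
rewrite /fr_op /fr_opp big_map -sumrN; apply: eq_bigr => p _.
by rewrite /rank_one (ph_ractN PH).
Qed.
Lemma fr_el_cat s1 s2 : fr_el (s1 ++ s2) = fr_el s1 + fr_el s2.
Proof. by rewrite /fr_el big_cat. Qed.
Lemma fr_el_opp s : fr_el (fr_opp s) = - fr_el s.
Proof.
rewrite /fr_el /fr_opp big_map -sumrN; apply: eq_bigr => p _.
by rewrite tp_SN smulNl.
Qed.

(* With u = t t^*, the power u^n t is again of finite rank, with coefficients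
   controlled by the operator norm; |u^(2^k)| = |u|^(2^k) then gives |u| <= M^2. *)
Lemma fr_el_norm s (M : R) : 0 < M -> (forall zeta, hn (fr_op s zeta) <= M * hn zeta) ->
  nm (fr_el s) <= M.
Proof.
move=> M0 sM; set t := fr_el s; pose u := t ** star t.
pose G zeta := fr_op s (fr_op (fr_swap s) zeta).
have uS zeta : u ** S zeta = S (G zeta).
  by rewrite /u -smulA fr_el_star fr_elS /t fr_elS.
(* The adjoint has the same bound: for z = T^* zeta, Cauchy-Schwarz gives |z|^2 = |(T z | zeta)| <=
   M |z| |zeta|. *)
have sM' zeta : hn (fr_op (fr_swap s) zeta) <= M * hn zeta.
  set z := fr_op _ _; have := hn_CS (fr_op s z) zeta.
  have -> : ip (fr_op s z) zeta = ip z z.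
    by rewrite -(ph_star PH) fr_op_adj (ph_star PH).
  rewrite -hn_sqr; have := sM z; have := hn_ge0 z; have := hn_ge0 zeta.
  have := hn_ge0 (fr_op s z); case: (ltrP 0 (hn z)) => [z0|]; last first.
    by move=> z0 _ h _ _ _; apply: (le_trans z0); rewrite mulr_ge0// ltW.
  move=> g0 z0' _ h1 h2; rewrite -(ler_pM2r z0) -expr2; apply: le_trans h2 _.
  by rewrite mulrAC ler_wpM2r// mulrC [X in _ <= X]mulrC; rewrite [X in _ <= X]mulrC mulrC.
have GM zeta : hn (G zeta) <= M ^+ 2 * hn zeta.
  apply: le_trans (sM _) _; rewrite expr2 -mulrA ler_wpM2l//; exact: ltW.
have GnM n zeta : hn (iter n G zeta) <= M ^+ 2 ^+ n * hn zeta.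
  elim: n => [|n ih]; first by rewrite expr0 mul1r.
  rewrite iterS; apply: le_trans (GM _) _; rewrite [_ ^+ n.+1]exprS -mulrA ler_wpM2l//.
  by rewrite exprn_ge0// ltW.
(* [pw n] is u^(n+1), as the algebra has no u^0; hence the shifts by one below. *)
pose pw n := iter n (smul u) u.
have su : star u = u by rewrite /u starM starK.
have pwM m n : pw m ** pw n = pw (m + n).+1.
  by elim: m => [//|m ih]; rewrite /pw iterS -smulA ih.
have pw_star n : star (pw n) = pw n.
  elim: n => [//|n ih]; rewrite {1}/pw iterS starM ih su.
  by rewrite -[u in LHS]/(pw 0) pwM addn0.
have pw2 k : nm (pw (2 ^ k).-1) = nm u ^+ (2 ^ k).
  elim: k => [|k ih]; first by rewrite expr1.
  rewrite expnS mul2n -addnn exprD -ih -expr2 -nm_cstar pw_star pwM; congr (nm (pw _)).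
  by have := expn_gt0 2 k; case: (2 ^ k)%N => // n _; rewrite addnS.
pose K : R := \sum_(p <- s) hn p.1 * hn p.2.
have K0 : 0 <= K by apply: sumr_ge0 => p _; rewrite mulr_ge0 ?hn_ge0.
have pwt n : nm (pw n) <= M ^+ 2 ^+ n * K * nm t.
  have -> : pw n = iter n (smul u) t ** star t.
    elim: n => [//|n ih]; by rewrite /pw !iterS -smulA -ih.
  have -> : iter n (smul u) t = \sum_(p <- s) S (iter n G p.1) ** star (S p.2).
    elim: n => [//|n ih]; rewrite iterS ih smul_sumr; apply: eq_bigr => p _.
    by rewrite smulA uS.
  apply: le_trans (nm_smul _ _) _; rewrite nm_star ler_wpM2r ?nm_ge0//.
  apply: le_trans (nm_sum _ _ _) _; rewrite /K big_distrr/=.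
  apply: ler_sum => p _; apply: le_trans (nm_smul _ _) _; rewrite nm_star mulrA.
  apply: ler_pM; rewrite ?nm_ge0 ?tp_nm//.
  by apply: le_trans (tp_nm _) _; exact: GnM.
(* If |u| > M^2, then |u|^(2^k) <= (M^2)^(2^k - 1) K |t| fails for large k. *)
have uM : nm u <= M ^+ 2.
  rewrite leNgt; apply/negP => Mu.
  have M20 : 0 < M ^+ 2 by rewrite exprn_gt0.
  have u0 : 0 < nm u by exact: lt_trans Mu.
  have [|||N hN] := @geometric_small _ (M ^+ 2 / nm u) (K * nm t) (M ^+ 2).
  - by rewrite divr_ge0// ltW.
  - by rewrite ltr_pdivrMr// mul1r.
  - by [].
  have := hN (2 ^ N)%N (ltnW (ltn_expl _ (ltnSn 1))); apply/negP; rewrite -leNgt.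
  rewrite expr_div_n mulrAC ler_pdivlMr ?exprn_gt0// -pw2.
  apply: le_trans (ler_wpM2l (ltW M20) (pwt _)) _.
  by rewrite !mulrA -exprS prednK ?expn_gt0.
by rewrite -(@ler_pXn2r _ 2) ?nnegrE ?nm_ge0 ?(ltW M0)// -nm_cstarr.
Qed.

(** Finite-rank approximants of T' with error 2^-n give a Cauchy sequence in A, because [fr_el_norm]
    bounds norms in A by operator norms. The limit is the value of i_K at T'. *)
Lemma compact_elt (T' : Z -> Z) : is_compact_op T' ->
  exists2 t, W t & forall zeta, t ** S zeta = S (T' zeta).
Proof.
move=> [_ cT].
have cT' (e : R) : 0 < e -> exists s, forall zeta, hn (T' zeta - fr_op s zeta) <= e * hn zeta.
  move=> e0; have [|s hs] := cT (e%:C)%C; first by rewrite ltcR.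
  by exists s => zeta; have := hs zeta; rewrite !ip_normE -rmorphM/= lecR.
have e2 n : 0 < (2^-1 : R) ^+ n by rewrite exprn_gt0// invr_gt0.
have /choice[s hs] := fun n => cT' _ (e2 n).
have near m n : nm (fr_el (s m) - fr_el (s n)) <= 2^-1 ^+ m + 2^-1 ^+ n.
  rewrite -fr_el_opp -fr_el_cat; apply: fr_el_norm; first by rewrite addr_gt0.
  move=> zeta; rewrite fr_op_cat fr_op_opp mulrDl.
  have -> : fr_op (s m) zeta - fr_op (s n) zeta =
      - (T' zeta - fr_op (s m) zeta) + (T' zeta - fr_op (s n) zeta).
    by rewrite opprB addrA subrK.
  by apply: le_trans (hnD _ _) _; rewrite hnN lerD.
have small (e : R) : 0 < e -> exists N, forall n, (N <= n)%N -> 2^-1 ^+ n < e.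
  move=> e0; have [||N hN] := @geometric_small _ (2^-1) 1 e _ _ e0; [lra|lra|].
  by exists N => n /hN; rewrite mulr1.
have [t ht] : exists t : A, (fun n => fr_el (s n)) @ \oo --> t.
  apply: nm_cauchy => e e0; have [|N hN] := small (e / 2); first by rewrite divr_gt0.
  exists N => m n Nm Nn; apply: le_lt_trans (near _ _) _.
  by have := hN _ Nm; have := hN _ Nn; lra.
have appr (e : R) : 0 < e -> exists2 n, nm (t - fr_el (s n)) < e & 2^-1 ^+ n < e.
  move=> e0; move/nm_cvgP : ht => /(_ e e0)[N1 _ h1]; have [N2 h2] := small e e0.
  exists (maxn N1 N2); first by apply: (h1 (maxn N1 N2)); exact: leq_maxl.
  by apply: h2; exact: leq_maxr.
exists t.
  have [cW _ _ _] := compact_span_subspace.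
  apply: (closed_nm cW) => e e0; have [n hn _] := appr e e0.
  by exists (fr_el (s n)) => //; exact: fr_el_span.
move=> zeta; apply/eqP; rewrite -subr_eq0; apply/eqP/nm_small_eq0 => e e0.
have h0 := hn_ge0 zeta.
have k0 : 0 < hn zeta + hn zeta + 1 by lra.
have [|n h1 h2] := appr (e / (hn zeta + hn zeta + 1)); first by rewrite divr_gt0.
rewrite ltr_pdivlMr// in h1; rewrite ltr_pdivlMr// in h2.
have := nm_tri (t ** S zeta) (fr_el (s n) ** S zeta) (S (T' zeta)).
rewrite -smulBl fr_elS -tp_SN -(tp_SD T).
have := nm_smul (t - fr_el (s n)) (S zeta); have := tp_nm zeta.
have h3 : hn (fr_op (s n) zeta - T' zeta) <= 2^-1 ^+ n * hn zeta.
  by rewrite -hnN opprB.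
have := tp_nm (fr_op (s n) zeta - T' zeta).
have t0 := nm_ge0 (t - fr_el (s n)); move: (e2 n) h2 h3; set E := 2^-1 ^+ n => E0 h2 h3.
move=> h4 h5 h6 h7; apply: (le_trans h7).
have := ler_wpM2l t0 h5; lra.
Qed.

(** The only possible i_K: [compact_span_inj] leaves at most one such t, and [compact_elt] provides
    it for compact T'. Elsewhere the value is 0. *)
Definition compact_lift (T' : Z -> Z) : A :=
  xget 0 [set t | W t /\ forall zeta, t ** S zeta = S (T' zeta)].

Lemma compact_liftE T' t : W t -> (forall zeta, t ** S zeta = S (T' zeta)) ->
  compact_lift T' = t.
Proof.
move=> Wt tS; rewrite /compact_lift; case: xgetP => [u _ [Wu uS]|/(_ t)[]//].
by apply: compact_span_inj => // zeta; rewrite uS tS.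
Qed.

Lemma compact_lift_hom : is_compact_hom compact_lift.
Proof.
move=> T1 T2 /compact_elt[t Wt tS] /compact_elt[u Wu uS].
rewrite (compact_liftE Wt tS) (compact_liftE Wu uS).
have [_ _ WD WZ] := compact_span_subspace; split.
- by apply: compact_liftE => [|zeta]; [exact: WD|rewrite smulDl tS uS (tp_SD T)].
- by move=> c; apply: compact_liftE => [|zeta]; [exact: WZ|rewrite smulZl tS (tp_SZ T)].
- apply: compact_liftE => [|zeta]; first exact: compact_span_mul.
  by rewrite -smulA uS tS.
- move=> adj; apply: compact_span_inj => //; first exact: compact_span_star.
  move=> zeta; apply/eqP; rewrite -subr_eq0; apply/eqP; set d := _ - _.
  (* Adjointness makes S_xi^* d vanish for all xi, hence also v d for v in the span; expanding one
     factor of d^* d leaves only terms of that kind. *)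
  have Sd xi : star (S xi) ** d = 0.
    rewrite /d smulBr uS (tp_SS T) smulA -starM tS (tp_SS T) adj subrr.
    by [].
  have Wd v : W v -> v ** d = 0.
    apply: (@closed_span_min _ _ _ [set v | [set 0] (v ** d)]).
      apply: closed_subspace_preim (@closed_subspace0 _ _).
      - exact: smul_lipr.
      - by move=> x y; rewrite smulDl.
      - by move=> c x; exists c; rewrite smulZl.
    by move=> _ [xi [eta ->]] /=; rewrite -smulA Sd smul0.
  apply: cstar_eq0; rewrite {1}/d starB smulBl !starM -!smulA.
  by rewrite !Wd ?smul0 ?subrr//; [rewrite starK|exact: compact_span_star].
Qed.

(** i(a) and the lift of the left action of a agree on every S_xi; once i(a) lies in the span, they
    are equal. *)
Lemma toeplitz_covariant :
  (forall a, is_compact_op (lact a) -> W (i a)) ->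
  exists iK : (Z -> Z) -> A,
    [/\ is_compact_hom iK,
        forall xi eta, iK (rank_one xi eta) = S xi ** star (S eta) &
        forall a, is_compact_op (lact a) -> i a = iK (lact a)].
Proof.
move=> Wi; exists compact_lift; split; first exact: compact_lift_hom.
- move=> xi eta; apply: compact_liftE; first exact: compact_span_SS.
  exact: tp_SSS.
- by move=> a ca; apply/esym/compact_liftE; [exact: Wi|exact: tp_iS].
Qed.

End rep.

Definition covariant_of_toeplitz (PH : pre_hilbert) (A : cstarAlgType R) (i : D -> A)
    (S : Z -> A) (T : toeplitz i S)
    (h : forall a, is_compact_op (lact a) -> @compact_span A S (i a)) : covariant_rep Z A :=
  CovariantRep (tp_hom T) (tp_SD T) (tp_SZ T) (tp_iS T) (tp_Si T) (tp_SS T)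
    (toeplitz_covariant T PH h).

End toeplitz.

(** * Quotients and multipliers of C*-algebras *)

Section sequential_completeness.
Context {R : realType} (V : normedModType (complex R)).
Local Notation C := (complex R).

(** A Cauchy filter contains nested sets Q n of diameter below 2^-n; points chosen in them form a
    Cauchy sequence whose limit is the limit of the filter. *)
Lemma seq_complete :
  (forall u : nat -> V,
    (forall e : R, 0 < e -> exists N, forall m n, (N <= m)%N -> (N <= n)%N ->
       nm (u m - u n) < e) -> exists l : V, u @ \oo --> l) ->
  forall F : set_system V, ProperFilter F -> cauchy F -> cvg F.
Proof.
move=> sc F FF /cauchy_ballP Fc.
have Fc' (e : R) : 0 < e -> exists P, F P /\ forall x y, P x -> P y -> nm (x - y) < e.
  move=> e0; have e20 : 0 < ((e / 2)%:C)%C :> C by rewrite ltcR divr_gt0.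
  have := Fc _ e20; rewrite !near_simpl => -[[P Q] /= [FP FQ] PQ].
  exists (P `&` Q); split; first exact: filterI.
  move=> x y [Px Qx] [Py Qy].
  have := PQ (x, x) (conj Px Qx); have := PQ (x, y) (conj Px Qy).
  rewrite -ball_normE/= normE ltcR => xy _; apply: (lt_trans xy).
  by rewrite ltr_pdivrMr// ltr_pMr// ltr1n.
have e2 n : 0 < (2^-1 : R) ^+ n by rewrite exprn_gt0// invr_gt0.
have /choice[P hP] := fun n => Fc' _ (e2 n).
pose Q := fix Q n := if n is m.+1 then Q m `&` P m.+1 else P 0%N.
have FQ n : F (Q n).
  by elim: n => [|n ih] /=; [have [] := hP 0%N|apply: filterI ih _; have [] := hP n.+1].
have QP n : Q n `<=` P n by case: n => [//|n x []].
have Qle m n : (m <= n)%N -> Q n `<=` Q m.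
  by elim: n => [|n ih]; [rewrite leqn0 => /eqP ->|rewrite leq_eqVlt => /orP[/eqP -> //|/ih h x [/h]]].
have uex n : exists x, Q n x by exact: filter_ex (FQ n).
have /choice[u hu] := uex.
have small (e : R) : 0 < e -> exists N, 2^-1 ^+ N < e.
  move=> e0; have [||N hN] := @geometric_small _ (2^-1) 1 e _ _ e0; [lra|lra|].
  by exists N; have := hN _ (leqnn N); rewrite mulr1.
have [l ul] : exists l : V, u @ \oo --> l.
  apply: sc => e e0; have [N hN] := small e e0; exists N => m n Nm Nn.
  apply: lt_trans hN; have [_] := hP N; apply; apply/QP; exact: Qle (hu _).
apply/cvg_ex; exists l; apply/(@nm_cvgP _ _ _ F _ id) => e e0.
have [|N hN] := small (e / 2); first by rewrite divr_gt0.
move/nm_cvgP : ul => /(_ (e / 2)) [|M _ hM]; first by rewrite divr_gt0.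
apply: filterS (FQ N) => x Qx.
have := hM (maxn N M) (leq_maxr _ _); rewrite /= => h.
have := nm_tri l (u (maxn N M)) x; have : nm (u (maxn N M) - x) < 2^-1 ^+ N.
  by have [_] := hP N; apply; apply/QP => //; exact: Qle (leq_maxl _ _) _ (hu _).
lra.
Qed.

End sequential_completeness.

Section cstar_quotient.
Context {R : realType} {A : cstarAlgType R}.
Local Notation C := (complex R).

(* A need not have a unit: the second condition says that 1 - u is a contraction. *)
Definition approx_unital (K : starIdeal A) := forall k, ideal_set K k -> forall e : R, 0 < e ->
  exists2 u, ideal_set K u & [/\ star u = u, forall y, nm (y - y ** u) <= nm y & nm (k - k ** u) < e].

Variables (K : starIdeal A) (HK : approx_unital K).

(** HK is an argument of the type so that the C*-identity, whose proof uses it, can become an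
    instance. *)
Definition qalg of approx_unital K : Type := ideal_quotient K.
Local Notation Q := (qalg HK).
HB.instance Definition _ := StarAlgebra.copy Q (ideal_quotient K).

Definition qmap (x : A) : Q := quot_map K x.

Lemma qmap_hom : is_star_hom qmap.
Proof. exact: quot_map_star_hom. Qed.
Lemma qmap_surj (u : Q) : exists x, qmap x = u.
Proof. exact: quot_map_surj. Qed.
Lemma qmap_eq x y : qmap x = qmap y <-> ideal_set K (x - y).
Proof. exact: quot_mapP. Qed.

Let qD x y : qmap (x + y) = qmap x + qmap y. Proof. by have [h _ _ _] := qmap_hom. Qed.
Let qZ (c : C) x : qmap (c *: x) = c *: qmap x. Proof. have [_ h _ _] := qmap_hom. exact: h. Qed.
Let qM x y : qmap (x ** y) = qmap x ** qmap y. Proof. by have [_ _ h _] := qmap_hom. Qed.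
Let qS x : qmap (star x) = star (qmap x). Proof. by have [_ _ _ h] := qmap_hom. Qed.
Let qB x y : qmap (x - y) = qmap x - qmap y. Proof. exact: star_homB qmap_hom. Qed.

Let fib (u : Q) : set R := [set nm x | x in [set x | qmap x = u]].
Definition qn (u : Q) : R := inf (fib u).

Let fib_has_inf u : has_inf (fib u).
Proof.
split; first by have [x <-] := qmap_surj u; exists (nm x), x.
by exists 0 => _ [x _ <-]; exact: nm_ge0.
Qed.

Let qn_le x : qn (qmap x) <= nm x.
Proof. by apply: ge_inf; [have [] := fib_has_inf (qmap x)|exists x]. Qed.

Let qn_lt u (e : R) : 0 < e -> exists2 x, qmap x = u & nm x < qn u + e.
Proof.
by move=> e0; have [_ [x xu <-] xe] := inf_adherent e0 (fib_has_inf u); exists x.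
Qed.

Let qn_ge0 u : 0 <= qn u.
Proof. by apply: lb_le_inf; [have [] := fib_has_inf u|move=> _ [x _ <-]; exact: nm_ge0]. Qed.

Let norm (u : Q) : C := ((qn u)%:C)%C.

Let normD (u v : Q) : norm (u + v) <= norm u + norm v.
Proof.
rewrite /norm -rmorphD/= lecR; apply/ler_addgt0Pr => e e0.
have e20 : 0 < e / 2 by rewrite divr_gt0.
have [x <- hx] := qn_lt u e20; have [y <- hy] := qn_lt v e20.
rewrite -qD; have := qn_le (x + y); have := nmD x y; lra.
Qed.

Let normZ (c : C) (u : Q) : norm (c *: u) = `|c| * norm u.
Proof.
have le (a : C) v : qn (a *: v) <= nm a * qn v.
  apply/ler_addgt0Pr => e e0; have a0 := nm_ge0 a.
  have a1 : 0 < nm a + 1 by rewrite ltr_wpDl.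
  have [|x <- hx] := @qn_lt v (e / (nm a + 1)); first by rewrite divr_gt0.
  rewrite -qZ; apply: le_trans (qn_le _) _; rewrite nmZ.
  apply: le_trans (ler_wpM2l a0 (ltW hx)) _; rewrite mulrDr lerD2l mulrA ler_pdivrMr//.
  by rewrite mulrC ler_pM2l// lerDl.
rewrite /norm normE -rmorphM/=; congr (_%:C)%C; apply/le_anti; rewrite le/=.
have [->|c0] := eqVneq c 0; first by rewrite nm0 mul0r.
have c1 : 0 < nm c by rewrite lt_neqAle nm_ge0 andbT eq_sym; apply: contra_neq c0 => /nm0_eq0.
rewrite -ler_pdivlMl// -nmV; apply: le_trans (le _ _).
by rewrite scalerA mulVf// scale1r.
Qed.

Let norm0_eq0 (u : Q) : norm u = 0 -> u = 0.
Proof.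
move=> /complexI u0; have [x xu] := qmap_surj u.
have [cK K0 _ _ _] := ideal_closed_ideal K.
rewrite -xu -(star_hom0 qmap_hom); apply/qmap_eq; rewrite subr0.
apply: (closed_nm cK) => e e0; have [y yu] := qn_lt u e0; rewrite u0 add0r => ye.
by exists (x - y); [apply/qmap_eq; rewrite xu yu|rewrite subKr].
Qed.

HB.instance Definition _ := @Lmodule_isNormed.Build C Q norm normD normZ norm0_eq0.

Let nmQ (u : Q) : nm u = qn u. Proof. by []. Qed.

Let complete (F : set_system Q) : ProperFilter F -> cauchy F -> cvg F.
Proof.
apply: seq_complete => u cu.
have e2 n : 0 < (2^-1 : R) ^+ n by rewrite exprn_gt0// invr_gt0.
have /choice[g hg] := fun n => cu _ (e2 n).
(* Along the subsequence k the increments have quotient norm below 2^-n, so they lift to elements of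
   norm below 2^-n, and the partial sums of the lifts converge in A. *)
pose k := fix k n := if n is m.+1 then maxn (k m).+1 (g m.+1) else g 0%N.
have gk n : (g n <= k n)%N by case: n => // n; exact: leq_maxr.
have kS n : (k n < k n.+1)%N by exact: leq_maxl.
have kn n : (n <= k n)%N by elim: n => // n /leq_ltn_trans; exact.
pose v n := u (k n).
have vS n : nm (v n.+1 - v n) < 2^-1 ^+ n.
  by apply: hg; [exact: leq_trans (gk n) (ltnW (kS n))|exact: gk].
have lift n : exists y, qmap y = v n.+1 - v n /\ nm y < 2^-1 ^+ n.
  have [|y yv yn] := @qn_lt (v n.+1 - v n) (2^-1 ^+ n - qn (v n.+1 - v n)).
    by rewrite subr_gt0 -nmQ vS.
  by exists y; split => //; rewrite addrC subrK in yn.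
have /choice[y hy] := lift; have [x0 hx0] := qmap_surj (v 0%N).
pose x := fix x n := if n is m.+1 then x m + y m else x0.
have xv n : qmap (x n) = v n.
  by elim: n => [//|n ih] /=; rewrite qD ih (hy n).1 addrC subrK.
have tail n j : nm (x (n + j)%N - x n) <= 2 * 2^-1 ^+ n * (1 - 2^-1 ^+ j).
  elim: j => [|j ih]; first by rewrite addn0 subrr nm0 expr0 subrr mulr0.
  rewrite addnS /= addrAC; apply: le_trans (nmD _ _) _.
  have [_ hyn] := hy (n + j)%N; have := ltW hyn; rewrite exprD exprS.
  set a := 2^-1 ^+ n in ih *; set b := 2^-1 ^+ j in ih *; nra.
have [l xl] : exists l : A, x @ \oo --> l.
  apply: nm_cauchy => e e0.
  have [||N hN] := @geometric_small _ (2^-1) 4 e _ _ e0; [lra|lra|].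
  have t j : (N <= j)%N -> nm (x j - x N) <= 2 * 2^-1 ^+ N.
    move=> Nj; rewrite -(subnKC Nj); apply: le_trans (tail _ _) _.
    have h1 := ltW (e2 N); have h2 := ltW (e2 (j - N)%N); nra.
  exists N => m n Nm Nn; apply: le_lt_trans (hN N (leqnn _)).
  apply: le_trans (nm_tri _ (x N) _) _; rewrite [X in _ + X]nmB.
  have := t _ Nm; have := t _ Nn; lra.
exists (qmap l); apply/nm_cvgP => e e0.
have e30 : 0 < e / 3 by rewrite divr_gt0.
have [N1 h1] := cu _ e30.
move/nm_cvgP : xl => /(_ _ e30)[N2 _ h2].
exists N1 => // n Nn /=.
have := nm_tri (qmap l) (v (maxn N1 N2)) (u n).
have : nm (qmap l - v (maxn N1 N2)) <= nm (l - x (maxn N1 N2)) by rewrite -xv -qB nmQ qn_le.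
have := h2 (maxn N1 N2) (leq_maxr _ _); rewrite /=.
have := h1 (k (maxn N1 N2)) n (leq_trans (leq_maxl _ _) (kn _)) Nn; rewrite -/(v _).
lra.
Qed.

HB.instance Definition _ := Uniform_isComplete.Build Q complete.

Let norm_mul (u v : Q) : `|u ** v| <= `|u| * `|v|.
Proof.
rewrite !normE -rmorphM/= lecR !nmQ; apply/ler_addgt0Pr => d d0.
have u0 := qn_ge0 u; have v0 := qn_ge0 v.
have s0 : 0 < qn u + qn v + 1 by lra.
pose e := Num.min 1 (d / (qn u + qn v + 1)).
have e0 : 0 < e by rewrite lt_min ltr01 divr_gt0.
have [e1 ed] : e <= 1 /\ e * (qn u + qn v + 1) <= d.
  by split; [rewrite ge_min lexx|rewrite -ler_pdivlMr// ge_min lexx orbT].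
have [x xu hx] := qn_lt u e0; have [y yv hy] := qn_lt v e0.
rewrite -[in X in X <= _]xu -[in X in X <= _]yv -qM; apply: le_trans (qn_le _) _.
have := nm_smul x y; have := nm_ge0 x; have := nm_ge0 y; nra.
Qed.

(** Let x lift u and let z be a nearly minimal lift of u^* u, so that x^* x = z + k with k in K.
    Replacing x by x(1 - p) does not change u, and |x(1 - p)|^2 <= |x^* x (1 - p)| <= |z| + |k(1 -
    p)| by contractivity of 1 - p on either side; p makes the last term small. *)
Let norm_cs (u : Q) : `|star u ** u| = `|u| ^+ 2.
Proof.
rewrite !normE -rmorphXn/=; congr (_%:C)%C; rewrite !nmQ; apply/le_anti/andP; split.
  have := norm_mul (star u) u; rewrite !normE -rmorphM/= lecR !nmQ => /le_trans; apply.
  rewrite expr2 ler_wpM2r//; apply/ler_addgt0Pr => e e0.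
  by have [x <- hx] := qn_lt u e0; rewrite -qS; apply: le_trans (qn_le _) _; rewrite nm_star ltW.
apply/ler_addgt0Pr => e e0; have e20 : 0 < e / 2 by rewrite divr_gt0.
have [x xu] := qmap_surj u; have [z zu hz] := qn_lt (star u ** u) e20.
have Kk : ideal_set K (star x ** x - z) by apply/qmap_eq; rewrite qM qS xu zu.
have [p Kp [ps p1 pk]] := HK Kk e20.
have p1' y : nm (y - p ** y) <= nm y.
  by rewrite -nm_star starB starM ps -[in X in _ <= X]nm_star p1.
have [_ _ _ KZ KM] := ideal_closed_ideal K.
have xpu : qmap (x - x ** p) = u.
  rewrite -[RHS]xu; apply/qmap_eq; rewrite addrAC subrr add0r -scaleN1r.
  by apply: KZ; have [] := KM _ x Kp.
have : qn u <= nm (x - x ** p) by rewrite -[in X in X <= _]xpu qn_le.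
have : nm (x - x ** p) ^+ 2 <= nm (star x ** x - star x ** x ** p).
  rewrite -nm_cstar; apply: le_trans (p1' _); apply: le_of_eq.
  by congr nm; rewrite starB starM ps smulBl !smulBr !smulA.
have : nm (star x ** x - star x ** x ** p) <= nm (z - z ** p) +
    nm ((star x ** x - z) - (star x ** x - z) ** p).
  rewrite [X in _ <= X]addrC; apply: le_trans (nmD _ _); apply: le_of_eq; congr nm.
  rewrite smulBl; set X := star x ** x; set Xp := X ** p; set zp := z ** p.
  have -> : X - z - (Xp - zp) = X - Xp - (z - zp) by rewrite opprD addrACA -opprD.
  by rewrite subrK.
have := p1 z; have := qn_ge0 u; have := nm_ge0 (x - x ** p); nra.
Qed.

HB.instance Definition _ := @StarAlgebra_isCStar.Build R Q norm_mul norm_cs.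

End cstar_quotient.

Section multipliers.
Context {R : realType} {A : cstarAlgType R}.
Local Notation C := (complex R).

Definition adj_fun (L M : A -> A) := forall x y : A, star (L x) ** y = star x ** M y.

(** M(A) realized as the adjointable operators of A over itself with inner product x^* y. Linearity
    and right A-linearity follow from the adjoint ([mult_fD], [mult_fZ], [mult_fM]); the bound
    provides the operator norm. *)
Definition mult_pred : {pred A -> A} :=
  fun L : A -> A => `[< (exists M, adj_fun L M) /\ exists k : R, forall x, nm (L x) <= k * nm x >].

Record mult := Mult { mfun :> A -> A; _ : mult_pred mfun }.

HB.instance Definition _ := [isSub for mfun].
HB.instance Definition _ := [Choice of mult by <:].

Lemma multP (L : mult) : (exists M, adj_fun L M) /\ exists k : R, forall x, nm (L x) <= k * nm x.
Proof. by case: L => L /= /asboolP. Qed.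

Lemma adj_fun_sym (L M : A -> A) : adj_fun L M -> adj_fun M L.
Proof. by move=> LM x y; rewrite -[LHS]starK starM starK -LM starM starK. Qed.

Lemma smul_inj (x y : A) : (forall z, star x ** z = star y ** z) -> x = y.
Proof.
move=> h; apply/eqP; rewrite -subr_eq0; apply/eqP/cstar_eq0.
by rewrite starB smulBl h subrr.
Qed.

Lemma mult_pred_closed : submod_closed mult_pred.
Proof.
split.
  apply/asboolP; split; first by exists (fun=> 0) => x y; rewrite /= star0 smul0 smul0l.
  by exists 0 => x; rewrite nm0 mul0r.
move=> c L M /asboolP[[L' LL'] [k kL]] /asboolP[[M' MM'] [j jM]]; apply/asboolP; split.
  exists (fun y => c^* *: L' y + M' y) => x y /=.
  by rewrite starD starZ smulDl smulZl LL' MM' smulDr smulZr.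
exists (nm c * k + j) => x /=; apply: le_trans (nmD _ _) _.
by rewrite mulrDl lerD// nmZ -mulrA ler_wpM2l ?nm_ge0.
Qed.

HB.instance Definition _ := GRing.isSubmodClosed.Build C (A -> A) mult_pred mult_pred_closed.
HB.instance Definition _ := [SubChoice_isSubLmodule of mult by <:].

Let valE (L : mult) : mfun L = val L. Proof. by []. Qed.
Let valZ (c : C) (L : mult) : val (c *: L) = c *: val L. Proof. exact: GRing.valZ. Qed.
Lemma mult0 x : (0 : mult) x = 0. Proof. by rewrite valE raddf0. Qed.
Lemma multD (L M : mult) x : (L + M) x = L x + M x. Proof. by rewrite valE raddfD. Qed.
Lemma multB (L M : mult) x : (L - M) x = L x - M x. Proof. by rewrite valE raddfB. Qed.
Lemma multZ (c : C) (L : mult) x : (c *: L) x = c *: L x. Proof. by rewrite valE valZ. Qed.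
Lemma mult_ext (L M : mult) : L =1 M -> L = M.
Proof. by move=> LM; apply: val_inj; apply/funext. Qed.

Lemma mult_fD (L : mult) x y : L (x + y) = L x + L y.
Proof.
have [[L' LL'] _] := multP L; apply: smul_inj => z.
by rewrite LL' !starD !smulDl !LL'.
Qed.
Lemma mult_fZ (L : mult) (c : C) x : L (c *: x) = c *: L x.
Proof.
have [[L' LL'] _] := multP L; apply: smul_inj => z.
by rewrite LL' !starZ !smulZl LL'.
Qed.
Lemma mult_fB (L : mult) x y : L (x - y) = L x - L y.
Proof. by rewrite mult_fD -scaleN1r mult_fZ scaleN1r. Qed.
Lemma mult_fM (L : mult) x y : L (x ** y) = L x ** y.
Proof.
have [[L' LL'] _] := multP L; apply: smul_inj => z.
by rewrite LL' !starM -!smulA LL'.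
Qed.

Let unit_im (L : mult) : set R := [set nm (L x) | x in [set x | nm x <= 1]].
Let mn (L : mult) : R := sup (unit_im L).

Let unit_im0 (L : mult) : unit_im L !=set0.
Proof. by exists (nm (L 0)), 0 => //=; rewrite nm0. Qed.

Let mn_ub (L : mult) x : nm (L x) <= mn L * nm x.
Proof.
have [_ [k kL]] := multP L.
have [->|x0] := eqVneq x 0.
  have L0 : L 0 = 0 by rewrite -[X in L X](scale0r (0 : A)) mult_fZ scale0r.
  by rewrite L0 nm0 mulr0.
have nx : 0 < nm x by rewrite lt_neqAle nm_ge0 andbT eq_sym; apply: contra_neq x0 => /nm0_eq0.
rewrite -ler_pdivrMr// mulrC; apply: ub_le_sup.
  exists `|k| => _ [y /= y1 <-]; apply: le_trans (kL y) _.
  have := ler_norm k; have := normr_ge0 k; have := nm_ge0 y; nra.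
exists (((nm x)^-1%:C)%C *: x).
  by rewrite /= nmZ nmR ger0_norm ?invr_ge0 ?nm_ge0// mulVf ?gt_eqF.
by rewrite mult_fZ nmZ nmR ger0_norm ?invr_ge0 ?nm_ge0.
Qed.

Let mn_le (L : mult) (k : R) : 0 <= k -> (forall x, nm (L x) <= k * nm x) -> mn L <= k.
Proof.
move=> k0 kL; apply: ge_sup; first exact: unit_im0.
by move=> _ [x /= x1 <-]; apply: le_trans (kL x) _; rewrite ler_piMr.
Qed.

Let mn_ge0 (L : mult) : 0 <= mn L.
Proof.
have [_ [k kL]] := multP L.
apply: le_trans (nm_ge0 (L 0)) _; apply: ub_le_sup; last by exists 0 => //=; rewrite nm0.
exists `|k| => _ [y /= y1 <-]; apply: le_trans (kL y) _.
have := ler_norm k; have := normr_ge0 k; have := nm_ge0 y; nra.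
Qed.

Let norm (L : mult) : C := ((mn L)%:C)%C.
Let normD (L M : mult) : norm (L + M) <= norm L + norm M.
Proof.
rewrite /norm -rmorphD/= lecR; apply: mn_le => [|x]; first by rewrite addr_ge0.
by rewrite multD mulrDl (le_trans (nmD _ _))// lerD.
Qed.
Let normZ (c : C) (L : mult) : norm (c *: L) = `|c| * norm L.
Proof.
have le (a : C) (M : mult) : mn (a *: M) <= nm a * mn M.
  apply: mn_le => [|x]; first by rewrite mulr_ge0 ?nm_ge0.
  by rewrite multZ nmZ -mulrA ler_wpM2l ?nm_ge0.
rewrite /norm normE -rmorphM/=; congr (_%:C)%C; apply/le_anti; rewrite le/=.
have [->|c0] := eqVneq c 0; first by rewrite nm0 mul0r.
have c1 : 0 < nm c by rewrite lt_neqAle nm_ge0 andbT eq_sym; apply: contra_neq c0 => /nm0_eq0.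
rewrite -ler_pdivlMl// -nmV; apply: le_trans (le _ _).
by rewrite scalerA mulVf// scale1r.
Qed.
Let norm0_eq0 (L : mult) : norm L = 0 -> L = 0.
Proof.
move=> /complexI L0; apply: mult_ext => x; rewrite mult0; apply: nm0_eq0.
by apply/le_anti; rewrite nm_ge0 andbT; have := mn_ub L x; rewrite L0 mul0r.
Qed.
HB.instance Definition _ := @Lmodule_isNormed.Build C mult norm normD normZ norm0_eq0.

Lemma mult_nm_ub (L : mult) x : nm (L x) <= nm L * nm x.
Proof. exact: mn_ub. Qed.
Lemma mult_nm_le (L : mult) (k : R) : 0 <= k -> (forall x, nm (L x) <= k * nm x) -> nm L <= k.
Proof. exact: mn_le. Qed.

Let adj_ex (L : mult) : exists M : mult, adj_fun L M.
Proof.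
have [[M LM] _] := multP L; suff Mp : mult_pred M by exists (Mult Mp).
apply/asboolP; split; first by exists L; exact: adj_fun_sym.
exists (nm L) => y; have [->|My] := eqVneq (M y) 0.
  by rewrite nm0 mulr_ge0 ?nm_ge0.
have nM : 0 < nm (M y) by rewrite lt_neqAle nm_ge0 andbT eq_sym; apply: contra_neq My => /nm0_eq0.
rewrite -(ler_pM2r nM) -expr2 -nm_cstar -LM; apply: le_trans (nm_smul _ _) _.
by rewrite nm_star mulrAC ler_wpM2r ?nm_ge0// mult_nm_ub.
Qed.

Definition mstar (L : mult) : mult := projT1 (cid (adj_ex L)).
Lemma mstarP (L : mult) : adj_fun L (mstar L).
Proof. by rewrite /mstar; case: cid. Qed.

Lemma mstar_uniq (L M : mult) : adj_fun L M -> mstar L = M.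
Proof.
move=> LM; apply: mult_ext => x; apply: smul_inj => y.
by rewrite (adj_fun_sym (@mstarP L)) (adj_fun_sym LM).
Qed.

Lemma mstar_nm (L : mult) : nm (mstar L) <= nm L.
Proof.
apply: mult_nm_le => [|y]; first exact: nm_ge0.
have [->|My] := eqVneq (mstar L y) 0.
  by rewrite nm0 mulr_ge0 ?nm_ge0.
have nM : 0 < nm (mstar L y).
  by rewrite lt_neqAle nm_ge0 andbT eq_sym; apply: contra_neq My => /nm0_eq0.
rewrite -(ler_pM2r nM) -expr2 -nm_cstar -mstarP; apply: le_trans (nm_smul _ _) _.
by rewrite nm_star mulrAC ler_wpM2r ?nm_ge0// mult_nm_ub.
Qed.

(** Strict limits: the adjoint relation is an equation between products, so it passes to pointwise
    limits of L and L'; the eventual bound keeps the limit bounded. *)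
Lemma mult_of_limit (T : Type) (F : set_system T) (FF : ProperFilter F) (L L' : T -> A -> A)
    (l l' : A -> A) (k : R) :
  (forall t, adj_fun (L t) (L' t)) -> (\forall t \near F, forall x, nm (L t x) <= k * nm x) ->
  (forall x, L t x @[t --> F] --> l x) -> (forall x, L' t x @[t --> F] --> l' x) ->
  mult_pred l /\ adj_fun l l'.
Proof.
move=> adj bnd cl cl'.
have ll : adj_fun l l'.
  move=> x y; apply/eqP; rewrite -subr_eq0; apply/eqP/nm_small_eq0 => e e0.
  have s0 : 0 < 2 * (nm x + nm y + 1) by have := nm_ge0 x; have := nm_ge0 y; lra.
  have d0 : 0 < e / (2 * (nm x + nm y + 1)) by rewrite divr_gt0.
  have /nm_cvgP/(_ _ d0) h1 := cl x; have /nm_cvgP/(_ _ d0) h2 := cl' y.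
  have [t [h3 h4]] := filter_ex (filterI h1 h2).
  rewrite ltr_pdivlMr// in h3; rewrite ltr_pdivlMr// in h4.
  have -> : star (l x) ** y - star x ** l' y =
      star (l x - L t x) ** y - star x ** (l' y - L' t y).
    by rewrite starB smulBl smulBr opprB addrA adj subrK.
  apply: le_trans (nmD _ _) _; rewrite nmN.
  have h5 := nm_smul (star (l x - L t x)) y; have h6 := nm_smul (star x) (l' y - L' t y).
  rewrite !nm_star in h5 h6; have x0 := nm_ge0 x; have y0 := nm_ge0 y.
  have := nm_ge0 (l x - L t x); have := nm_ge0 (l' y - L' t y); nra.
split => //; apply/asboolP; split; first by exists l'.
exists k => x; apply/ler_addgt0Pr => e e0.
have /nm_cvgP/(_ _ e0)/(filterI bnd)/filter_ex[t [bt h]] := cl x.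
have := nmD (l x - L t x) (L t x); rewrite subrK; have := bt x; lra.
Qed.

Let complete (F : set_system mult) : ProperFilter F -> cauchy F -> cvg F.
Proof.
apply: seq_complete => u cu.
have lim (v : nat -> mult) x : (forall e : R, 0 < e -> exists N, forall m n, (N <= m)%N -> (N <= n)%N ->
       nm (v m - v n) < e) -> exists l : A, v n x @[n --> \oo] --> l.
  move=> cv; apply: nm_cauchy => e e0; have x1 : 0 < nm x + 1 by rewrite ltr_wpDl ?nm_ge0.
  have [|N hN] := cv (e / (nm x + 1)); first by rewrite divr_gt0.
  exists N => m n Nm Nn; rewrite -multB; apply: le_lt_trans (mult_nm_ub _ _) _.
  have := hN m n Nm Nn; rewrite ltr_pdivlMr//; have := nm_ge0 (u m - u n).
  have := nm_ge0 (v m - v n); have := nm_ge0 x; nra.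
have mstarB (L M : mult) : mstar (L - M) = mstar L - mstar M.
  apply: mstar_uniq => x y; rewrite !multB starB smulBl !(mstarP L) !(mstarP M).
  by rewrite smulBr.
have /choice[l hl] : forall x, exists l : A, u n x @[n --> \oo] --> l by move=> x; exact: lim.
have /choice[l' hl'] : forall x, exists l : A, mstar (u n) x @[n --> \oo] --> l.
  move=> x; apply: (lim (fun n => mstar (u n))) => e e0; have [N hN] := cu e e0.
  by exists N => m n Nm Nn; rewrite -mstarB; apply: le_lt_trans (mstar_nm _) _; exact: hN.
have [N1 hN1] := cu 1 ltr01.
have [|lp ll] := @mult_of_limit nat \oo _ (fun n => u n) (fun n => mstar (u n)) l l'
  (nm (u N1) + 1) (fun n => @mstarP (u n)) _ hl hl'.
  exists N1 => // n /= Nn x; apply: le_trans (mult_nm_ub _ _) _.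
  rewrite ler_wpM2r ?nm_ge0//; have := nmD (u n - u N1) (u N1); rewrite subrK.
  have := hN1 n N1 Nn (leqnn _); lra.
exists (Mult lp); apply/nm_cvgP => e e0; have [|N hN] := cu (e / 2); first by rewrite divr_gt0.
exists N => // n /= Nn; apply: (@le_lt_trans _ _ (e / 2)); last by rewrite ltr_pdivrMr// ltr_pMr// ltr1n.
apply: mult_nm_le => [|x]; first by rewrite divr_ge0// ltW.
rewrite multB; apply/ler_addgt0Pr => d d0.
have /nm_cvgP/(_ _ d0)[M _ hM] := hl x.
have := hM (maxn M N) (leq_maxl _ _); rewrite /= => h1.
have h2 := hN (maxn M N) n (leq_maxr _ _) Nn.
have := nm_tri (l x) (u (maxn M N) x) (u n x); rewrite -multB.
have := mult_nm_ub (u (maxn M N) - u n) x.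
have := ler_wpM2r (nm_ge0 x) (ltW h2); lra.
Qed.

HB.instance Definition _ := Uniform_isComplete.Build mult complete.

Let mul_pred (L M : mult) : mult_pred (fun x => L (M x)).
Proof.
apply/asboolP; split.
  by exists (fun y => mstar M (mstar L y)) => x y; rewrite !mstarP.
exists (nm L * nm M) => x; apply: le_trans (mult_nm_ub _ _) _.
by rewrite -mulrA ler_wpM2l ?nm_ge0// mult_nm_ub.
Qed.

Definition mmul (L M : mult) : mult := Mult (mul_pred L M).

Let mulA : associative mmul. Proof. by move=> L M N; exact: mult_ext. Qed.
Let mulDl : left_distributive mmul +%R.
Proof. by move=> L M N; apply: mult_ext => x; rewrite multD; exact: multD. Qed.
Let mulDr : right_distributive mmul +%R.
Proof. by move=> L M N; apply: mult_ext => x; rewrite multD -[LHS]/(L ((M + N) x)) multD mult_fD. Qed.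
Let mulZl (c : C) (L M : mult) : mmul (c *: L) M = c *: mmul L M.
Proof. by apply: mult_ext => x; rewrite multZ; exact: multZ. Qed.
Let mulZr (c : C) (L M : mult) : mmul L (c *: M) = c *: mmul L M.
Proof. by apply: mult_ext => x; rewrite multZ -[LHS]/(L ((c *: M) x)) multZ mult_fZ. Qed.
Let sD : {morph mstar : L M / L + M}.
Proof.
move=> L M; apply: mstar_uniq => x y.
by rewrite !multD starD smulDl smulDr !mstarP.
Qed.
Let sZ (c : C) (L : mult) : mstar (c *: L) = c^* *: mstar L.
Proof. by apply: mstar_uniq => x y; rewrite !multZ starZ smulZl smulZr mstarP. Qed.
Let sM (L M : mult) : mstar (mmul L M) = mmul (mstar M) (mstar L).
Proof. by apply: mstar_uniq => x y /=; rewrite !mstarP. Qed.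
Let sK : involutive mstar.
Proof. by move=> L; apply: mstar_uniq; apply: adj_fun_sym; exact: mstarP. Qed.

HB.instance Definition _ := @Lmodule_isStarAlgebra.Build R mult
  mmul mstar mulA mulDl mulDr mulZl mulZr sD sZ sM sK.

Let norm_mul (L M : mult) : `|L ** M| <= `|L| * `|M|.
Proof.
rewrite !normE -rmorphM/= lecR; apply: mult_nm_le => [|x]; first by rewrite mulr_ge0 ?nm_ge0.
apply: le_trans (mult_nm_ub L (M x)) _.
by rewrite -mulrA ler_wpM2l ?nm_ge0// mult_nm_ub.
Qed.

Let norm_cs (L : mult) : `|star L ** L| = `|L| ^+ 2.
Proof.
rewrite !normE -rmorphXn/=; congr (_%:C)%C; apply/le_anti/andP; split.
  have := norm_mul (star L) L; rewrite !normE -rmorphM/= lecR => /le_trans; apply.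
  by rewrite expr2 ler_wpM2r ?nm_ge0// mstar_nm.
have : nm L <= Num.sqrt (nm (star L ** L)).
  apply: mult_nm_le => [|x]; first exact: sqrtr_ge0.
  rewrite -(@ler_pXn2r _ 2) ?nnegrE ?mulr_ge0 ?nm_ge0 ?sqrtr_ge0//.
  rewrite exprMn sqr_sqrtr ?nm_ge0// -nm_cstar (mstarP L).
  apply: le_trans (nm_smul _ _) _; rewrite nm_star expr2 mulrA [X in _ <= X]mulrC.
  by rewrite ler_wpM2l ?nm_ge0//; exact: (mult_nm_ub (star L ** L) x).
rewrite -(@ler_pXn2r _ 2) ?nnegrE ?nm_ge0 ?sqrtr_ge0//.
by rewrite sqr_sqrtr ?nm_ge0.
Qed.

HB.instance Definition _ := @StarAlgebra_isCStar.Build R mult norm_mul norm_cs.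

Lemma multM (L M : mult) x : (L ** M) x = L (M x). Proof. by []. Qed.
Lemma mult_starP (L : mult) x y : star (L x) ** y = star x ** (star L) y.
Proof. exact: mstarP. Qed.
Lemma mult_star_uniq (L M : mult) : adj_fun L M -> star L = M.
Proof. exact: mstar_uniq. Qed.

Let lmul_pred (a : A) : mult_pred (smul a).
Proof.
apply/asboolP; split; first by exists (smul (star a)) => x y; rewrite starM smulA.
by exists (nm a) => x; exact: nm_smul.
Qed.

Definition lmul (a : A) : mult := Mult (lmul_pred a).

Lemma lmul_hom : is_star_hom lmul.
Proof.
split.
- by move=> x y; apply: mult_ext => z; rewrite multD /= smulDl.
- by move=> c x; apply: mult_ext => z; rewrite multZ /= smulZl.
- by move=> x y; apply: mult_ext => z; rewrite multM /= smulA.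
- by move=> x; apply/esym/mult_star_uniq => y z /=; rewrite starM smulA.
Qed.

(** Evaluation at star a gives |a a^*| = |a|^2. *)
Lemma lmul_nm (a : A) : nm a <= nm (lmul a).
Proof.
have := mult_nm_ub (lmul a) (star a); rewrite /= nm_cstarr nm_star.
have [->|a0] := eqVneq (nm a) 0; first by rewrite nm_ge0.
have : 0 < nm a by rewrite lt_neqAle eq_sym a0 nm_ge0.
nra.
Qed.

End multipliers.

(** * Rational maps and the transfer operator *)

Section ultrafilters.

Lemma fmap_ultra (T U : Type) (g : T -> U) (F : set_system T) :
  UltraFilter F -> UltraFilter (g @ F).
Proof.
move=> FU; split; first exact: fmap_proper_filter.
move=> G GP FG; apply/seteqP; split => // A GA.
have [//|FnA] := in_ultra_setVsetC (g @^-1` A) FU.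
have GnA : G (~` A) by exact: FG.
by have [x []] := filter_ex (filterI GA GnA).
Qed.

(** If the preimage of a neighbourhood A of l is not in F, an ultrafilter containing F and its
    complement contradicts the assumption. Along ultrafilters, compactness of the sphere supplies
    all limits. *)
Lemma cvg_ultra (T : Type) (V : topologicalType) (F : set_system T) (FF : Filter F)
    (g : T -> V) (l : V) :
  (forall G, UltraFilter G -> F `<=` G -> g @ G --> l) -> g @ F --> l.
Proof.
move=> h A lA; have [//|nA] := pselect ((g @ F) A).
pose W := within (~` (g @^-1` A)) F.
have WP : ProperFilter W.
  apply: Build_ProperFilter_ex => B WB.
  have [//|nB] := pselect (exists x, B x); exfalso; apply: nA.
  have {}WB : F [set x | ~ A (g x) -> B x] by [].
  apply: (@filterS _ F _ _ _ _ WB) => x /= Bx; have [//|nAx] := pselect (A (g x)).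
  by exfalso; apply: nB; exists x; exact: Bx.
have [G [GU WG]] := ultraFilterLemma WP.
have FG : F `<=` G by move=> B FB; apply: WG; apply: filterS FB => x Bx _.
have GA : G (g @^-1` A) := h G GU FG A lA.
have GnA : G (~` (g @^-1` A)) by apply: WG; rewrite /W /within/=; apply: filterE.
by have [x []] := filter_ex (filterI GA GnA).
Qed.

End ultrafilters.

Section complex_plane.
Context {R : realType}.
Local Notation C := (complex R).

Lemma rc_continuous : continuous (fun p : R * R => (p.1 +i* p.2)%C : C).
Proof.
move=> [a b]; apply/nm_cvgP => e e0; have e20 : 0 < e / 2 by rewrite divr_gt0.
have h1 : \forall p \near ((a, b) : R * R), `|a - p.1| < e / 2.
  have : p.1 @[p --> ((a, b) : R * R)] --> a by exact: cvg_fst.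
  by move/cvgrPdist_lt; apply.
have h2 : \forall p \near ((a, b) : R * R), `|b - p.2| < e / 2.
  have : p.2 @[p --> ((a, b) : R * R)] --> b by exact: cvg_snd.
  by move/cvgrPdist_lt; apply.
apply: filterS (filterI h1 h2) => -[u v] /= [au bv].
have -> : (a +i* b)%C - (u +i* v)%C = ((a - u)%:C)%C + 'i%C * ((b - v)%:C)%C :> C by simpc.
apply: le_lt_trans (nmD _ _) _; rewrite nmM !nmR.
by rewrite [nm 'i%C](_ : _ = 1) ?mul1r; [lra|rewrite /nm normc_def/= expr0n/= expr1n add0r sqrtr1].
Qed.

Lemma nm_continuous : continuous (fun z : C => nm z : R).
Proof. exact: Re_norm_continuous. Qed.

Lemma complex_compact_ball (M : R) : compact [set z : C | nm z <= M].
Proof.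
pose B := (fun p : R * R => (p.1 +i* p.2)%C : C) @` (`[- M, M] `*` `[- M, M]).
have cB : compact B.
  apply: continuous_compact; last by apply: compact_setX; exact: segment_compact.
  by apply: continuous_subspaceT => x; exact: rc_continuous.
apply: subclosed_compact cB _.
  apply: nm_closedI => z h; rewrite /=; apply/ler_addgt0Pr => e e0.
  have [w /= wM zw] := h e e0; have := nmD (z - w) w; rewrite subrK; lra.
move=> [a b] /= zM; exists (a, b) => //=; rewrite !in_itv/= -!ler_norml.
have h1 := Re_le_norm (a +i* b)%C; have h2 := Im_le_norm (a +i* b)%C.
by rewrite normE lecR/= in h1; rewrite normE lecR/= in h2; split; [exact: le_trans h1 zM|exact: le_trans h2 zM].
Qed.

Lemma complex_compact_bounded (K : set C) : compact K -> exists M : R, forall z, K z -> nm z <= M.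
Proof.
move=> cK; have : compact ((fun z => nm z) @` K).
  by apply: continuous_compact => //; apply: continuous_subspaceT => x; exact: nm_continuous.
move=> /compact_bounded[M [_ HM]]; exists (`|M| + 1) => z Kz.
apply: (le_trans (ler_norm _)); apply: HM; last by exists z.
by rewrite (le_lt_trans (ler_norm _))// ltrDl.
Qed.

Lemma complex_hausdorff : hausdorff_space C.
Proof. exact: norm_hausdorff. Qed.

Lemma complex_locally_compact : locally_compact [set: C].
Proof.
move=> z _; exists [set w : C | nm w <= nm z + 1].
- apply/nm_nbhsP; exists 1 => // w zw _; rewrite /=.
  have := nmD (w - z) z; rewrite subrK nmB; lra.
- by split => //; [exact: complex_compact_ball|apply: compact_closed; [exact: complex_hausdorff|exact: complex_compact_ball]].
Qed.

Lemma polynomial_continuous (p : {poly C}) : continuous (fun z : C => p.[z]).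
Proof.
elim/poly_ind : p => [|p c ih].
  by rewrite (_ : (fun z => _) = cst 0); [exact: cst_continuous|apply/funext => z; rewrite horner0].
rewrite (_ : (fun z => _) = fun z => p.[z] * z + c); last by apply/funext => z; rewrite hornerMXaddC.
move=> z; have h : p.[w] @[w --> z] --> p.[z] := ih z.
have hid : (w : C) @[w --> z] --> (z : C) by exact: cvg_id.
exact: cvgD (cvgM h hid) (cvg_cst _).
Qed.

Lemma poly_nonroot (p : {poly C}) : p != 0 -> exists z, p.[z] != 0.
Proof.
move=> p0; apply: contrapT => h.
pose s : seq C := [seq i%:R | i <- iota 0 (size p)].
have s1 : all (root p) s.
  by apply/allP => z _; apply/negPn/negP => pz; apply: h; exists z.
have s2 : uniq s.
  by rewrite map_inj_uniq ?iota_uniq// => m n /eqP; rewrite eqr_nat => /eqP.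
by have := max_poly_roots p0 s1 s2; rewrite size_map size_iota ltnn.
Qed.

Lemma poly_eq (p q : {poly C}) : (forall z, p.[z] = q.[z]) -> p = q.
Proof.
move=> h; apply/eqP; rewrite -subr_eq0; apply/negPn/negP => /poly_nonroot[z].
by rewrite hornerD hornerN h subrr eqxx.
Qed.

End complex_plane.

(** * Homogeneous coordinates on the Riemann sphere *)

Section sphere.
Context {R : realType}.
Local Notation C := (complex R).
Local Notation sphere := (riemann_sphere R).

Lemma sphere_compact : compact [set: sphere].
Proof. exact: one_point_compactification_compact. Qed.

Lemma sphere_hausdorff : hausdorff_space sphere.
Proof.
apply: one_point_compactification_hausdorff; first exact: complex_locally_compact.
exact: complex_hausdorff.
Qed.

Lemma sphere_ultra (T : Type) (F : set_system T) (g : T -> sphere) :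
  UltraFilter F -> exists l : sphere, g @ F --> l.
Proof.
move=> FU; have gU := fmap_ultra g FU.
have := sphere_compact; rewrite compact_ultra => /(_ _ gU)[|l [_ /= gl]]; last by exists l.
exact: filterT.
Qed.

Lemma nbhs_SomeE (a : C) (U : set sphere) : nbhs (Some a : sphere) U <-> nbhs a (Some @^-1` U).
Proof. by []. Qed.

Lemma nbhs_NoneP (U : set sphere) : nbhs (None : sphere) U <->
  U None /\ exists M : R, forall z, M < nm z -> U (Some z).
Proof.
split=> [nU|[UN [M UM]]].
  split; first exact: (@nbhs_singleton sphere _ _ nU).
  have [K [cK _] KU] := nU; have [M KM] := complex_compact_bounded cK.
  exists M => z Mz; apply: KU; left; exists z => //= Kz.
  by have := KM _ Kz; rewrite leNgt Mz.
exists [set z : C | nm z <= M].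
  split; first exact: complex_compact_ball.
  by apply: compact_closed; [exact: complex_hausdorff|exact: complex_compact_ball].
move=> [z|] [[w /= /negP wM []]|] //=.
by move=> <-; apply: UM; rewrite ltNge.
Qed.

(** The point with homogeneous coordinates [x : y]; the value at x = y = 0 is arbitrary. *)
Definition pt (x y : C) : sphere := if y == 0 then None else Some (x / y).

Lemma pt_cvg (T : Type) (F : set_system T) {FF : Filter F} (x y : T -> C) (x0 y0 : C) :
  x @ F --> x0 -> y @ F --> y0 -> ~ (x0 = 0 /\ y0 = 0) ->
  pt (x t) (y t) @[t --> F] --> pt x0 y0.
Proof.
move=> hx hy; have [y0E|y00 _] := eqVneq y0 0; last first.
  rewrite /pt (negbTE y00) => U /= nU.
  have xy : x t / y t @[t --> F] --> x0 / y0 by apply: cvgM hx _; exact: cvgV.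
  have h1 : \forall t \near F, y t != 0 by exact: cvgr_neq0 hy y00.
  have h2 := xy _ nU.
  by apply: filterS (filterI h1 h2) => t /= [/negbTE -> ].
rewrite y0E in hy *; rewrite /pt eqxx => /not_andP[x00|//] U /nbhs_NoneP[UN [M UM]].
have x1 : 0 < nm x0.
  by rewrite lt_neqAle nm_ge0 andbT; apply/eqP => x01; apply: x00; exact/nm0_eq0/esym.
have x2 : 0 < nm x0 / 2 by rewrite divr_gt0.
have y2 : 0 < nm x0 / 2 / (`|M| + 1) by rewrite divr_gt0// ltr_wpDl.
move/nm_cvgP : hx => /(_ _ x2) h1; move/nm_cvgP : hy => /(_ _ y2) h2.
apply: filterS (filterI h1 h2) => t /= [].
rewrite sub0r nmN; case: ifPn => [//|yt h3 h4]; apply: UM.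
have yt0 : 0 < nm (y t).
  by rewrite lt_neqAle nm_ge0 andbT; apply: contra_neq yt => /esym/nm0_eq0.
rewrite nmM nmV ltr_pdivlMr//.
move: h4; rewrite ltr_pdivlMr ?ltr_wpDl// => h4.
have := nmD (x0 - x t) (x t); rewrite subrK.
have := ler_norm M; nra.
Qed.

Lemma pt_scale (u x y : C) : u != 0 -> pt (u * x) (u * y) = pt x y.
Proof.
move=> u0; rewrite /pt mulf_eq0 (negbTE u0)/=; case: ifPn => // y0.
by rewrite -mulf_div divff// mul1r.
Qed.

(* Homogeneous coordinates of z that are continuous in z near z0. *)
Definition lx (z0 z : sphere) : C :=
  match z0, z with
  | Some _, Some w => w
  | None, Some w => if w == 0 then 0 else 1
  | _, None => 1
  end.
Definition ly (z0 z : sphere) : C :=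
  match z0, z with
  | Some _, Some _ => 1
  | None, Some w => if w == 0 then 1 else w^-1
  | _, None => 0
  end.

Lemma pt_lift z0 z : pt (lx z0 z) (ly z0 z) = z.
Proof.
rewrite /pt /lx /ly; case: z0 => [a|]; case: z => [w|]; rewrite ?eqxx ?oner_eq0 ?divr1//.
have [->|w0] := eqVneq w 0; first by rewrite oner_eq0 mul0r.
by rewrite invr_eq0 (negbTE w0) invrK mul1r.
Qed.

Lemma lift_neq0 z0 z : ~ (lx z0 z = 0 /\ ly z0 z = 0).
Proof.
rewrite /lx /ly; case: z0 => [a|]; case: z => [w|] [] /eqP; rewrite ?oner_eq0//.
- by move=> _ /eqP; rewrite oner_eq0.
- by have [_ _ /eqP|_] := eqVneq w 0; rewrite oner_eq0.
Qed.

Lemma lift_scale z0 z1 z : exists2 u : C, u != 0 &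
  lx z0 z = u * lx z1 z /\ ly z0 z = u * ly z1 z.
Proof.
rewrite /lx /ly; case: z0 => [a|]; case: z1 => [b|]; case: z => [w|];
  try by exists 1; rewrite ?oner_neq0 ?mul1r.
- have [->|w0] := eqVneq w 0; first by exists 1; rewrite ?oner_neq0 ?mul1r.
  by exists w => //; rewrite mulr1 mulfV.
- have [->|w0] := eqVneq w 0; first by exists 1; rewrite ?oner_neq0 ?mul1r.
  by exists w^-1; rewrite ?invr_neq0// mulr1 mulVf.
Qed.

Lemma lift_cvg z0 : lx z0 z @[z --> z0] --> lx z0 z0 /\ ly z0 z @[z --> z0] --> ly z0 z0.
Proof.
case: z0 => [a|] /=; split.
- by move=> U nU; apply/nbhs_SomeE.
- by move=> U nU; apply/nbhs_SomeE; apply: filterE => w /=; exact: nbhs_singleton.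
- move=> U nU; apply/nbhs_NoneP; split => /=; first exact: nbhs_singleton.
  exists 0 => z z0 /=; case: ifPn => [/eqP zE|_]; last exact: nbhs_singleton.
  by move: z0; rewrite zE nm0 ltxx.
- move=> U /nm_nbhsP[e e0 eU]; apply/nbhs_NoneP; split => /=.
    by apply: eU; rewrite subrr nm0.
  exists e^-1 => z ez /=; have z0 : 0 < nm z by apply: lt_trans ez; rewrite invr_gt0.
  case: ifPn => [/eqP zE|_]; first by move: z0; rewrite zE nm0 ltxx.
  by apply: eU; rewrite sub0r nmN nmV -[e]invrK ltf_pV2 ?posrE ?invr_gt0.
Qed.

End sphere.

Section cvg_tools.
Context {R : realType}.
Local Notation C := (complex R).

Lemma sum_cvg (T I : Type) (F : set_system T) {FF : Filter F} (s : seq I) (u : I -> T -> C)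
    (l : I -> C) : (forall i, u i t @[t --> F] --> l i) ->
  \sum_(i <- s) u i t @[t --> F] --> \sum_(i <- s) l i.
Proof.
move=> h; elim: s => [|i s ih].
  by rewrite big_nil; under eq_fun do rewrite big_nil; exact: cvg_cst.
by rewrite big_cons; under eq_fun do rewrite big_cons; apply: cvgD; [exact: h|exact: ih].
Qed.

Lemma prod_cvg (T I : Type) (F : set_system T) {FF : Filter F} (s : seq I) (u : I -> T -> C)
    (l : I -> C) : (forall i, u i t @[t --> F] --> l i) ->
  \prod_(i <- s) u i t @[t --> F] --> \prod_(i <- s) l i.
Proof.
move=> h; elim: s => [|i s ih].
  by rewrite big_nil; under eq_fun do rewrite big_nil; exact: cvg_cst.
rewrite big_cons; under eq_fun do rewrite big_cons; exact: cvgM (h i) ih.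
Qed.

Lemma exp_cvg (T : Type) (F : set_system T) {FF : Filter F} (u : T -> C) (l : C) n :
  u @ F --> l -> u t ^+ n @[t --> F] --> l ^+ n.
Proof.
move=> h; elim: n => [|n ih].
  by rewrite expr0; under eq_fun do rewrite expr0; exact: cvg_cst.
rewrite exprS; under eq_fun do rewrite exprS; exact: cvgM h ih.
Qed.

Lemma div_cvg (T : Type) (F : set_system T) {FF : Filter F} (a l m : T -> C) (a0 l0 m0 : C) :
  a @ F --> a0 -> l @ F --> l0 -> m @ F --> m0 -> l0 != 0 ->
  a t / l t * m t @[t --> F] --> a0 / l0 * m0.
Proof.
move=> ha hl hm l00; have hV : (l t)^-1 @[t --> F] --> l0^-1 by exact: (cvgV l00 hl).
exact: cvgM (cvgM ha hV) hm.
Qed.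

Lemma cvg_near_eq (T : Type) (V : topologicalType) (F : set_system T) {FF : Filter F}
    (g h : T -> V) (l : V) :
  (\forall t \near F, g t = h t) -> g @ F --> l -> h @ F --> l.
Proof. by move=> gh; apply: cvg_trans; exact: near_eq_cvg. Qed.

Lemma dnbhs_cvg (T V : topologicalType) (g : T -> V) x (l : V) :
  g z @[z --> x] --> l -> g z @[z --> x^'] --> l.
Proof. by apply: cvg_trans; apply: cvg_app; exact: cvg_within. Qed.

Lemma lin_cvg (T : Type) (F : set_system T) {FF : Filter F} (a b : T -> C) (a0 b0 c u v : C) :
  a @ F --> a0 -> b @ F --> b0 -> c * (a t * u - b t * v) @[t --> F] --> c * (a0 * u - b0 * v).
Proof.
move=> ha hb.
exact: (cvgM (cvg_cst c) (cvgB (cvgM ha (cvg_cst u)) (cvgM hb (cvg_cst v)))).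
Qed.

Lemma lin1_cvg (T : Type) (F : set_system T) (FF : Filter F) (a b : T -> C)
    (a0 b0 u v : C) :
  a @ F --> a0 -> b @ F --> b0 -> a t * u - b t * v @[t --> F] --> a0 * u - b0 * v.
Proof. by move=> ha hb; exact: (cvgB (cvgM ha (cvg_cst u)) (cvgM hb (cvg_cst v))). Qed.

Lemma mulexp_cvg (T : Type) (F : set_system T) {FF : Filter F} (a v : T -> C) (a0 v0 : C) k :
  a @ F --> a0 -> v @ F --> v0 -> a t * v t ^+ k @[t --> F] --> a0 * v0 ^+ k.
Proof.
move=> ha hv; have h : v t ^+ k @[t --> F] --> v0 ^+ k by exact: exp_cvg.
exact: (cvgM ha h).
Qed.

Lemma pt_eq (a b c e : C) : ~ (a = 0 /\ b = 0) -> ~ (c = 0 /\ e = 0) ->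
  pt a b = pt c e <-> a * e = b * c.
Proof.
move=> ab ce; rewrite /pt; have [b0|b0] := eqVneq b 0; have [e0|e0] := eqVneq e 0.
- by rewrite b0 e0 mulr0 mul0r.
- rewrite b0 mul0r; split=> // /eqP; rewrite mulf_eq0 (negbTE e0) orbF => /eqP a0.
  by case: ab.
- rewrite e0 mulr0; split=> // /esym/eqP; rewrite mulf_eq0 (negbTE b0)/= => /eqP c0.
  by case: ce.
- split=> [[] h|h].
    by apply/eqP; rewrite [b * c]mulrC -eqr_div// h.
  by congr Some; apply/eqP; rewrite eqr_div// h mulrC.
Qed.

Lemma perm_pmap_id (T : eqType) (s : seq (option T)) (t : seq T) (n : nat) :
  perm_eq (pmap id s) t -> size s = (size t + n)%N ->
  perm_eq s ([seq Some z | z <- t] ++ nseq n None).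
Proof.
move=> st; rewrite -(perm_size st) => sz.
have h : perm_eq s ([seq Some z | z <- pmap id s] ++ nseq n None).
  elim: s n {st} sz => [|[a|] s ih] n /=.
  - by case: n.
  - by rewrite addSn => -[/ih]; rewrite perm_cons.
  - case: n => [|n] /=; last move=> sz.
      have : (size (pmap id s) <= size s)%N by rewrite size_pmap count_size.
      by move=> + sz; rewrite addn0 in sz; rewrite -sz ltnn.
    have /ih h : size s = (size (pmap id s) + n)%N by move: sz; rewrite addnS => -[].
    by rewrite perm_sym -[None :: nseq _ _]cat1s perm_catCA/= perm_cons perm_sym.
by apply: perm_trans h _; rewrite perm_cat2r perm_map.
Qed.

End cvg_tools.

(** * Fibres, branch indices and transfer operator of a rational map *)

Section rational.
Context {R : realType}.
Local Notation C := (complex R).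
Local Notation sphere := (riemann_sphere R).
Variables (P Q : {poly C}).
Local Notation f := (@rational_map R P Q).
Hypotheses (PQ : coprimep P Q) (Q0 : Q != 0) (fN : ~ exists c, forall z, f z = c).

Definition rdeg : nat := (maxn (size P) (size Q)).-1.
Local Notation d := rdeg.

Let d_sizeP : (size P <= d.+1)%N.
Proof. by rewrite /rdeg (leq_trans (leq_maxl _ (size Q)))// leqSpred. Qed.
Let d_sizeQ : (size Q <= d.+1)%N.
Proof. by rewrite /rdeg (leq_trans (leq_maxr (size P) _))// leqSpred. Qed.
Let d_top : ~ (P`_d = 0 /\ Q`_d = 0).
Proof.
case=> Pd Qd; have sQ : (0 < size Q)%N by rewrite size_poly_gt0.
have : (maxn (size P) (size Q) = d.+1)%N.
  by rewrite /rdeg prednK// (leq_trans sQ)// leq_maxr.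
rewrite /maxn; case: ifP => _ sz.
  by move: Q0; rewrite -lead_coef_eq0 /lead_coef sz Qd eqxx.
have P0 : P = 0 by apply/eqP; rewrite -lead_coef_eq0 /lead_coef sz Pd.
by rewrite P0 size_poly0 in sz.
Qed.

(** The homogenization of p in degree d, so that f is [x : y] |-> [hom P : hom Q] at poles and at
    infinity as well. *)
Definition hom (p : {poly C}) (x y : C) : C := \sum_(i < d.+1) p`_i * (x ^+ i * y ^+ (d - i)).

Lemma hom1 (p : {poly C}) x : (size p <= d.+1)%N -> hom p x 1 = p.[x].
Proof.
move=> sp; rewrite (horner_coef_wide _ sp); apply: eq_bigr => i _.
by rewrite expr1n mulr1.
Qed.

Lemma homZ p u x y : hom p (u * x) (u * y) = u ^+ d * hom p x y.
Proof.
rewrite /hom big_distrr/=; apply: eq_bigr => i _; rewrite !exprMn.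
have -> : u ^+ d = u ^+ i * u ^+ (d - i) by rewrite -exprD subnKC// -ltnS.
by ring.
Qed.

Lemma hom0 p x : hom p x 0 = p`_d * x ^+ d.
Proof.
rewrite /hom big_ord_recr/= subnn expr0 mulr1 big1 ?add0r// => i _.
by rewrite expr0n subn_eq0 leqNgt ltn_ord/= !mulr0.
Qed.

Lemma hom_lin p q a b x y : hom (a *: p - b *: q) x y = a * hom p x y - b * hom q x y.
Proof.
rewrite /hom !big_distrr/= -sumrB; apply: eq_bigr => i _.
by rewrite coefB !coefZ mulrBl !mulrA.
Qed.

Lemma hom_cvg (T : Type) (F : set_system T) {FF : Filter F} p (x y : T -> C) (x0 y0 : C) :
  x @ F --> x0 -> y @ F --> y0 -> hom p (x t) (y t) @[t --> F] --> hom p x0 y0.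
Proof.
move=> hx hy; apply: sum_cvg => i; apply: cvgM; first exact: cvg_cst.
by apply: cvgM; exact: exp_cvg.
Qed.

Lemma hom_neq0 x y : ~ (x = 0 /\ y = 0) -> ~ (hom P x y = 0 /\ hom Q x y = 0).
Proof.
have [->|y0 _] := eqVneq y 0.
  rewrite !hom0 => xy; have x0 : x ^+ d != 0.
    by rewrite expf_neq0//; apply/eqP => x0; apply: xy.
  case=> /eqP + /eqP; rewrite !mulf_eq0 !(negbTE x0) !orbF => /eqP Pd /eqP Qd.
  exact: d_top.
have h (p : {poly C}) : (size p <= d.+1)%N -> hom p x y = y ^+ d * p.[x / y].
  by move=> sp; rewrite -hom1// -homZ mulr1 mulrCA mulfV// mulr1.
rewrite !h//; case=> /eqP + /eqP; rewrite !mulf_eq0 expf_eq0 !(negbTE y0) !andbF/=.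
by move=> rP; apply/negP; exact: (coprimep_root PQ).
Qed.

Lemma f_hom x y : ~ (x = 0 /\ y = 0) -> f (pt x y) = pt (hom P x y) (hom Q x y).
Proof.
have [->|y0 _] := eqVneq y 0.
  move=> xy; rewrite {1}/pt eqxx !hom0 /= -/d ![_ * x ^+ d]mulrC pt_scale//.
  by rewrite expf_neq0//; apply/eqP => x0; apply: xy.
have h (p : {poly C}) : (size p <= d.+1)%N -> hom p x y = y ^+ d * p.[x / y].
  by move=> sp; rewrite -hom1// -homZ mulr1 mulrCA mulfV// mulr1.
by rewrite !h// pt_scale ?expf_neq0// {1}/pt (negbTE y0).
Qed.

Lemma f_lift z0 z : f z = pt (hom P (lx z0 z) (ly z0 z)) (hom Q (lx z0 z) (ly z0 z)).
Proof. by rewrite -{1}(pt_lift z0 z) f_hom//; exact: lift_neq0. Qed.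

Lemma f_continuous : continuous f.
Proof.
move=> z; have -> : f = fun t => pt (hom P (lx z t) (ly z t)) (hom Q (lx z t) (ly z t)).
  by apply/funext => t; exact: f_lift.
have [hx hy] := lift_cvg z.
exact: (pt_cvg (@hom_cvg _ _ _ P _ _ _ _ hx hy) (@hom_cvg _ _ _ Q _ _ _ _ hx hy)
  (hom_neq0 (@lift_neq0 _ z z))).
Qed.

Local Notation cx := (lx (Some (0 : C))).
Local Notation cy := (ly (Some (0 : C))).

(* The polynomial whose roots, together with infinity taken d - deg times, are
   the preimages of y. *)
Definition fibpoly (y : sphere) : {poly C} := cy y *: P - cx y *: Q.

Lemma size_fibpoly y : (size (fibpoly y) <= d.+1)%N.
Proof.
rewrite (leq_trans (size_polyD _ _))// size_polyN geq_max.
by rewrite !(leq_trans (size_scale_leq _ _)).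
Qed.

Lemma fiber_hom x1 x2 y : ~ (x1 = 0 /\ x2 = 0) ->
  f (pt x1 x2) = y <-> hom (fibpoly y) x1 x2 = 0.
Proof.
move=> x12; rewrite f_hom// hom_lin -{1}(pt_lift (Some 0) y).
rewrite pt_eq; [|exact: hom_neq0|exact: lift_neq0]; rewrite [cy y * _]mulrC [cx y * _]mulrC.
by split=> [->|/eqP]; rewrite ?subrr// subr_eq0 => /eqP.
Qed.

Lemma fiber_lift z0 x y : f x = y <-> hom (fibpoly y) (lx z0 x) (ly z0 x) = 0.
Proof. by rewrite -fiber_hom ?pt_lift//; exact: lift_neq0. Qed.

Lemma fibpoly_neq0 y : fibpoly y != 0.
Proof.
apply/eqP => F0; apply: fN; exists y => z; rewrite -(pt_lift z z).
apply/fiber_hom; first exact: lift_neq0.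
by rewrite F0 /hom big1// => i _; rewrite coef0 mul0r.
Qed.

Definition proots (p : {poly C}) : seq C := projT1 (closed_field_poly_normal p).
Lemma prootsE p : p = lead_coef p *: \prod_(z <- proots p) ('X - z%:P).
Proof. by rewrite /proots; case: closed_field_poly_normal. Qed.

Lemma size_proots p : p != 0 -> size (proots p) = (size p).-1.
Proof.
move=> p0; rewrite {2}(prootsE p) size_scale ?lead_coef_eq0//.
by rewrite size_prod_XsubC.
Qed.

Definition rts (y : sphere) : seq sphere :=
  [seq (Some z : sphere) | z <- proots (fibpoly y)] ++ nseq (d - (size (fibpoly y)).-1) None.

Lemma size_rts y : size (rts y) = d.
Proof.
rewrite /rts size_cat size_map size_nseq size_proots ?fibpoly_neq0// subnKC//.
by have := size_fibpoly y; case: (size _).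
Qed.

Lemma mem_rts x y : (x \in rts y) = (f x == y).
Proof.
have Sinj : injective (Some : C -> sphere) by move=> ? ? [].
have Fy0 := fibpoly_neq0 y; have sF := size_fibpoly y.
apply/idP/eqP; rewrite mem_cat (fiber_lift (Some 0)); case: x => [a|] /=.
- case/orP => [|/nseqP[//]]; rewrite mem_map// -root_prod_XsubC hom1// => ar.
  by rewrite [fibpoly y]prootsE hornerZ (rootP ar) mulr0.
- case/orP => [/mapP[//]|]; rewrite mem_nseq andbT subn_gt0 => sd.
  by rewrite hom0 nth_default ?mul0r//; move: sd; case: (size _).
- rewrite hom1// => /eqP; rewrite {1}[fibpoly y]prootsE hornerZ mulf_eq0 lead_coef_eq0.
  by rewrite (negbTE Fy0)/= => h; rewrite mem_map// -root_prod_XsubC /root h.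
- rewrite hom0 expr1n mulr1 => h; apply/orP; right; rewrite mem_nseq eqxx andbT subn_gt0.
  have s0 : (0 < size (fibpoly y))%N by rewrite size_poly_gt0.
  rewrite -ltnS prednK// ltn_neqAle sF andbT; apply/eqP => sE.
  by move: Fy0; rewrite -lead_coef_eq0 /lead_coef sE h eqxx.
Qed.

Lemma fibpoly_fact y : exists2 k : C, k != 0 &
  forall w, (fibpoly y).[w] = k * \prod_(r <- rts y) (w * cy r - cx r).
Proof.
(* Each of the n roots at infinity contributes the constant factor w * 0 - 1. *)
set p := fibpoly y; set n := (d - (size p).-1)%N.
exists (lead_coef p * (-1) ^+ n).
  by rewrite mulf_neq0 ?lead_coef_eq0 ?fibpoly_neq0// expf_neq0// oppr_eq0 oner_eq0.
move=> w; rewrite {1}[p]prootsE hornerZ -mulrA; congr (_ * _).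
have E m : \prod_(r <- nseq m (None : sphere)) (w * cy r - cx r) = (-1) ^+ m.
  elim: m => [|m ih]; first by rewrite big_nil.
  by rewrite /= big_cons ih mulr0 sub0r exprS.
have -> : \prod_(r <- rts y) (w * cy r - cx r) = (\prod_(z <- proots p) (w - z)) * (-1) ^+ n.
  rewrite -E /rts big_cat/=; congr (_ * _).
  by rewrite big_map; apply: eq_bigr => z _; rewrite /= mulr1.
rewrite mulrCA -exprMn mulrNN mulr1 expr1n mulr1 horner_prod.
by apply: eq_bigr => z _; rewrite !hornerE.
Qed.

(* Roots depend continuously on y: by compactness the roots converge along any
   ultrafilter, and comparing the factorizations of fibpoly at two points w
   shows that the limits are the roots at the limit point. *)
Lemma rts_ultra (T : Type) (F : set_system T) (FU : UltraFilter F) (y : T -> sphere) y0 :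
  y @ F --> y0 -> exists rho : nat -> sphere,
    (forall i, nth None (rts (y t)) i @[t --> F] --> rho i) /\
    perm_eq (mkseq rho d) (rts y0).
Proof.
move=> yy0; have /choice[rho hrho] : forall i, exists l : sphere, nth None (rts (y t)) i @[t --> F] --> l.
  by move=> i; exact: sphere_ultra.
exists rho; split => //.
(* A is the fibre polynomial and L the product over the roots, both in coordinates continuous near
   the limit points; [AL] says that they are proportional for each t. *)
pose A t w : C := ly y0 (y t) * P.[w] - lx y0 (y t) * Q.[w].
pose A0 w : C := ly y0 y0 * P.[w] - lx y0 y0 * Q.[w].
have [hx hy] := lift_cvg y0.
have AA0 w : A t w @[t --> F] --> A0 w.
  apply: cvgB; (apply: cvgM; last exact: cvg_cst).
    exact: (@cvg_comp _ _ _ y (ly y0) _ _ _ yy0 hy).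
  exact: (@cvg_comp _ _ _ y (lx y0) _ _ _ yy0 hx).
pose L t w : C := \prod_(i <- iota 0 d)
  (w * ly (rho i) (nth None (rts (y t)) i) - lx (rho i) (nth None (rts (y t)) i)).
pose L0 w : C := \prod_(i <- iota 0 d) (w * ly (rho i) (rho i) - lx (rho i) (rho i)).
have LL0 w : L t w @[t --> F] --> L0 w.
  apply: prod_cvg => i; have [kx ky] := lift_cvg (rho i); apply: cvgB.
    apply: cvgM; first exact: cvg_cst.
    exact: (@cvg_comp _ _ _ _ (ly (rho i)) _ _ _ (hrho i) ky).
  exact: (@cvg_comp _ _ _ _ (lx (rho i)) _ _ _ (hrho i) kx).
have AL t : exists2 k : C, k != 0 & forall w, A t w = k * L t w.
  have [u u0 [ux uy]] := lift_scale y0 (Some 0) (y t).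
  have [k k0 hk] := fibpoly_fact (y t).
  have /choice[v hv] : forall i, exists v : C, v != 0 /\
      lx (rho i) (nth None (rts (y t)) i) = v * cx (nth None (rts (y t)) i) /\
      ly (rho i) (nth None (rts (y t)) i) = v * cy (nth None (rts (y t)) i).
    by move=> i; have [v v0 [vx vy]] := lift_scale (rho i) (Some 0) (nth None (rts (y t)) i); exists v.
  have LE w : L t w = (\prod_(i <- iota 0 d) v i) * \prod_(r <- rts (y t)) (w * cy r - cx r).
    rewrite (big_nth None) size_rts /index_iota subn0 -big_split/=; apply: eq_bigr => i _.
    by have [_ [-> ->]] := hv i; rewrite mulrBr mulrCA.
  have v0 : \prod_(i <- iota 0 d) v i != 0.
    by rewrite prodf_seq_neq0; apply/allP => i _; have [] := hv i.
  exists (u * k / \prod_(i <- iota 0 d) v i); first by rewrite !mulf_neq0 ?invr_neq0.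
  move=> w; rewrite LE mulrA mulfVK// -mulrA -hk /fibpoly /A ux uy !hornerE; ring.
have [u u0 [ux uy]] := lift_scale y0 (Some 0) y0.
have A0E w : A0 w = u * (fibpoly y0).[w] by rewrite /A0 /fibpoly ux uy !hornerE; ring.
pose Lp : {poly C} := \prod_(i <- iota 0 d) (ly (rho i) (rho i) *: 'X - (lx (rho i) (rho i))%:P).
have LpE w : L0 w = Lp.[w].
  by rewrite horner_prod; apply: eq_bigr => i _; rewrite !hornerE mulrC.
have Lp0 : Lp != 0.
  rewrite prodf_seq_neq0; apply/allP => i _ /=; apply/eqP => h.
  have h1 := congr1 (fun p : {poly C} => p`_1) h.
  have h0 := congr1 (fun p : {poly C} => p`_0) h.
  rewrite /= coefB coefZ coefX coefC coef0 mulr1 subr0 in h1.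
  rewrite /= coefB coefZ coefX coefC coef0 mulr0 sub0r in h0.
  by apply: (@lift_neq0 _ (rho i) (rho i)); rewrite h1; split => //; rewrite -[LHS]opprK h0 oppr0.
(* At a w0 where neither limit vanishes, the factor A / L converges to k0 != 0, and thus the
   proportionality survives in the limit for every w. *)
have [w0 hw0] := poly_nonroot (mulf_neq0 Lp0 (fibpoly_neq0 y0)).
rewrite hornerM mulf_eq0 negb_or in hw0; case/andP: hw0 => Lw0 Fw0.
have L0w0 : L0 w0 != 0 by rewrite LpE.
have A0w0 : A0 w0 != 0 by rewrite A0E mulf_neq0.
pose k0 := A0 w0 / L0 w0.
have k00 : k0 != 0 by rewrite mulf_neq0 ?invr_neq0.
have A0L0 w : A0 w = k0 * L0 w.
  have h1 : A t w0 / L t w0 * L t w @[t --> F] --> k0 * L0 w.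
    exact: (div_cvg (AA0 w0) (LL0 w0) (LL0 w) L0w0).
  have h2 : A t w @[t --> F] --> k0 * L0 w.
    have ne : \forall t \near F, L t w0 != 0 by exact: cvgr_neq0 (LL0 w0) L0w0.
    apply: cvg_trans h1; apply: near_eq_cvg; apply: filterS ne => t Lt.
    by have [k k_0 kE] := AL t; rewrite !kE mulfK.
  exact: (cvg_unique (@complex_hausdorff R) (AA0 w) h2).
have FLp : fibpoly y0 = (k0 / u) *: Lp.
  apply: poly_eq => w; rewrite hornerZ -LpE -mulrA [u^-1 * _]mulrC mulrA -A0L0 A0E.
  by rewrite mulrC mulKf.
have [c c0 Lpc] : exists2 c : C, c != 0 & Lp = c *: \prod_(z <- pmap id (mkseq rho d)) ('X - z%:P).
  rewrite /Lp /mkseq; elim: (iota 0 d) => [|i s [c c0 ih]].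
    by exists 1; rewrite ?oner_neq0// !big_nil scale1r.
  rewrite big_cons ih /=; case E : (rho i) => [a|] /=.
    by exists c => //; rewrite big_cons scale1r scalerAr.
  exists (- c); first by rewrite oppr_eq0.
  by rewrite scale0r sub0r -scalerAr mulN1r scalerN scaleNr.
have sp : perm_eq (pmap id (mkseq rho d)) (proots (fibpoly y0)).
  apply: prod_XsubC_eq; move: FLp; rewrite {1}[fibpoly y0]prootsE Lpc scalerA.
  set p1 := \prod_(_ <- proots _) _; set p2 := \prod_(_ <- pmap _ _) _ => h.
  have m1 : lead_coef p1 = 1 by apply/monicP/monic_prod_XsubC.
  have m2 : lead_coef p2 = 1 by apply/monicP/monic_prod_XsubC.
  have := congr1 lead_coef h; rewrite !lead_coefZ m1 m2 !mulr1 => hl.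
  have l0 : lead_coef (fibpoly y0) != 0 by rewrite lead_coef_eq0 fibpoly_neq0.
  by move: h; rewrite -hl => /(scalerI l0).
(* The finite limits are the finite roots at y0; the number of infinite ones follows from the total
   d. *)
apply: perm_pmap_id sp _; rewrite size_mkseq size_proots ?fibpoly_neq0// subnKC//.
by have := size_fibpoly y0; case: (size _).
Qed.

Definition transfer (g : sphere -> C) (y : sphere) : C := \sum_(x <- rts y) g x.

Lemma transfer_continuous g : continuous g -> continuous (transfer g).
Proof.
move=> cg y0; apply: (cvg_ultra (nbhs_filter y0)) => F FU yF.
have [rho [hrho rho_rts]] := @rts_ultra _ F FU id y0 yF.
rewrite /transfer -(perm_big _ rho_rts)/= big_map.
under eq_fun do rewrite (big_nth None) size_rts /index_iota subn0.
by apply: sum_cvg => i; exact: (@cvg_comp _ _ _ _ g _ _ _ (hrho i) (cg _)).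
Qed.

Lemma f_surj y : exists x, f x = y.
Proof.
have d0 : (0 < d)%N.
  rewrite lt0n; apply/eqP => d0; apply: fN; exists (f (Some 0)) => z.
  have nil t : rts t = [::] by apply/eqP; rewrite -size_eq0 size_rts d0.
  by have := mem_rts z (f z); rewrite nil eqxx.
have : nth None (rts y) 0 \in rts y by rewrite mem_nth// size_rts.
by rewrite mem_rts => /eqP ?; exists (nth None (rts y) 0).
Qed.

(** Otherwise an ultrafilter of points y tends to f x while avoiding f(U); by [rts_ultra] some root
    over y tends to x, hence lies in U. *)
Lemma f_open x (U : set sphere) : nbhs x U -> nbhs (f x) (f @` U).
Proof.
move=> xU; suff h : (fun y : sphere => y) @ nbhs (f x) --> f x.
  apply: contrapT => nU.
  pose W := within (~` (f @` U)) (nbhs (f x)).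
  have WP : ProperFilter W.
    apply: Build_ProperFilter_ex => B WB; apply: contrapT => nB; apply: nU.
    have {}WB : nbhs (f x) [set y | ~ (f @` U) y -> B y] by [].
    apply: filterS WB => y By; apply: contrapT => nUy; apply: nB; exists y; exact: By.
  have [G [GU WG]] := ultraFilterLemma WP.
  have Gx : (fun y : sphere => y) @ G --> f x.
    by move=> A xA; apply: WG; rewrite /W /within/=; apply: filterS xA.
  have [rho [hrho rho_rts]] := rts_ultra GU Gx.
  have [i id xE] : exists2 i, (i < d)%N & x = rho i.
    have : x \in mkseq rho d by rewrite (perm_mem rho_rts) mem_rts.
    move=> xin; have := index_mem x (mkseq rho d); rewrite xin size_mkseq => id.
    by exists (index x (mkseq rho d)) => //; have := nth_index None xin; rewrite nth_mkseq.
  have GA : G (~` (f @` U)) by apply: WG; rewrite /W /within/=; apply: filterE.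
  have GB : G [set y | U (nth None (rts y) i)] by apply: hrho; rewrite -xE.
  have [y [yA yB]] := filter_ex (filterI GA GB).
  apply: yA; exists (nth None (rts y) i) => //.
  by apply/eqP; rewrite -mem_rts mem_nth// size_rts.
exact: cvg_id.
Qed.

Lemma rdeg_gt0 : (0 < d)%N.
Proof.
rewrite lt0n; apply/eqP => d0; apply: fN; exists (f (Some 0)) => z.
have nil t : rts t = [::] by apply/eqP; rewrite -size_eq0 size_rts d0.
by have := mem_rts z (f z); rewrite nil eqxx.
Qed.

Definition den (x z : sphere) : C := chart x z - chart x x.

(** In homogeneous coordinates the chart difference is, up to the sign of the chart at infinity, the
    determinant of z and x, which is the factor of the fibre form belonging to the root x. *)
Lemma den_lift x : \forall z \near x, z <> x ->
  den x z = (if x is Some _ then 1 else - 1) * (lx x z * cy x - ly x z * cx x) /\ ly x z != 0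
    /\ den x z != 0.
Proof.
case: x => [a|].
  apply/nbhs_SomeE; apply: filterE => w wa.
  rewrite /den /=; have wa' : w - a != 0 by rewrite subr_eq0; apply/eqP => h; apply: wa; rewrite h.
  by rewrite !mul1r mulr1 oner_neq0.
apply/nbhs_NoneP; split => //; exists 0 => w w0 _; rewrite /den /=.
have {}w0 : w != 0 by apply: contraTneq w0 => ->; rewrite nm0 ltxx.
by rewrite (negbTE w0) mulr0 sub0r mulr1 mulN1r opprK subr0 invr_neq0.
Qed.

Lemma den_cvg x : den x z @[z --> x] --> 0.
Proof.
have [hx hy] := lift_cvg x; have Fx : Filter (nbhs x) by exact: nbhs_filter.
have h := @lin_cvg _ _ _ Fx _ _ _ _ (if x is Some _ then 1 else - 1) (cy x) (cx x) hx hy.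
have E : (if x is Some _ then 1 else - 1) * (lx x x * cy x - ly x x * cx x) = 0 :> C.
  by case: (x) => [a|] /=; rewrite ?mulr1 ?mul1r ?mulr0 ?mul0r ?subrr ?mulr0.
rewrite E in h; apply: (cvg_near_eq _ h).
apply: (filterS _ (den_lift x)) => z hz.
have [->|zx] := pselect (z = x); first by rewrite E /den subrr.
by have [-> _] := hz zx.
Qed.

Lemma sphere_dnbhs_proper (x : sphere) : ProperFilter (dnbhs x).
Proof.
apply: Build_ProperFilter_ex => U; rewrite /dnbhs/=; case: x => [a|].
  move=> /nbhs_SomeE/nm_nbhsP[e e0 eU]; exists (Some (a + ((e / 2)%:C)%C)).
  have e20 : 0 < e / 2 by rewrite divr_gt0.
  apply: eU; first by rewrite opprD addrA subrr sub0r nmN nmR gtr0_norm//; lra.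
  rewrite /=; apply/eqP => -[] /eqP; rewrite -subr_eq0 addrAC subrr add0r => /eqP/complexI h.
  by move: e20; rewrite h ltxx.
move=> /nbhs_NoneP[_ [M hM]]; exists (Some ((`|M| + 1)%:C)%C); apply: hM => //.
rewrite nmR ger0_norm ?addr_ge0//; have := ler_norm M; lra.
Qed.

(** If n < m, the quotient for n is the quotient for m times a positive power of z - x, so it tends
    to 0, not to a nonzero c. *)
Lemma branch_uniq x n m : is_branch_index f x n -> is_branch_index f x m -> n = m.
Proof.
have PF := sphere_dnbhs_proper x.
wlog nm : n m / (n < m)%N.
  move=> h bn bm; have [nm|mn|//] := ltngtP n m; first exact: (h n m).
  by apply/esym; exact: (h m n).
move=> [_ [c [c0 cn]]] [_ [c' [c'0 cm]]]; exfalso.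
have d0 : den x z @[z --> x^'] --> 0 by apply: dnbhs_cvg; exact: den_cvg.
have h1 := @mulexp_cvg _ _ _ (@filter_filter _ _ PF) _ _ _ _ (m - n)%N cm d0.
have h2 : (chart (f x) (f z) - chart (f x) (f x)) / den x z ^+ n @[z --> x^'] --> c' * 0 ^+ (m - n).
  apply: (cvg_near_eq _ h1); apply: (filterS _ (den_lift x)) => z hz /= zx.
  have [_ [_ dz]] := hz (elimN eqP zx).
  rewrite -/(den x z) -{1}(subnKC (ltnW nm)) exprD invfM mulrA -[RHS]mulr1 -[LHS]mulrA.
  by rewrite mulVf// expf_neq0.
have := cvg_unique (@complex_hausdorff R) cn h2.
by rewrite expr0n subn_eq0 leqNgt nm mulr0 => cE; rewrite cE eqxx in c0.
Qed.

Lemma hom_fibpoly y : exists2 k : C, k != 0 & forall x1 x2, x2 != 0 ->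
  hom (fibpoly y) x1 x2 = k * \prod_(r <- rts y) (x1 * cy r - x2 * cx r).
Proof.
have [k k0 hk] := fibpoly_fact y; exists k => // x1 x2 x20.
have := homZ (fibpoly y) x2 (x1 / x2) 1.
rewrite mulr1 mulrCA mulfV// mulr1 hom1 ?size_fibpoly// => ->.
rewrite hk mulrCA; congr (_ * _); rewrite -[in x2 ^+ d](size_rts y).
elim: (rts y) => [|r s ih]; first by rewrite !big_nil mulr1.
rewrite !big_cons -ih /= exprS; field; exact: x20.
Qed.

(** In the chart at f x, the difference f z - f x is the fibre form over f x, evaluated at z,
    divided by a nonvanishing form: Q if f x is finite, and P with the sign -1 if f x is infinite,
    where the chart is Q / P. The factors of the fibre form at the root x give (z - x)^n, the others
    have a nonzero limit. *)
Lemma branch_indexP x : is_branch_index f x (count_mem x (rts (f x))).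
Proof.
set n := count_mem _ _; split; first by rewrite -has_count has_pred1 mem_rts.
set y := f x; have [k k0 hk] := hom_fibpoly y.
have [hx hy] := lift_cvg x.
pose G := if y is Some _ then Q else P.
pose e : C := if y is Some _ then 1 else - 1.
pose s : C := if x is Some _ then 1 else - 1.
pose rest X Y : C := \prod_(r <- rts y | r != x) (X * cy r - Y * cx r).
have ss : s * s = 1 by rewrite /s; case: (x) => [_|]; rewrite ?mulrNN mulr1.
have fx : y = pt (hom P (lx x x) (ly x x)) (hom Q (lx x x) (ly x x)) := f_lift x x.
have PQx := hom_neq0 (@lift_neq0 _ x x).
have G0 : hom G (lx x x) (ly x x) != 0.
  apply/eqP; rewrite /G; move: fx; case: (y) => [b|].
    by rewrite /pt; case: eqP => // ? _.
  by rewrite /pt; case: eqP => // h _ h'; apply: PQx.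
have Gcvg : hom G (lx x z) (ly x z) @[z --> x] --> hom G (lx x x) (ly x x).
  exact: (@hom_cvg _ _ _ G _ _ _ _ hx hy).
have Gnear : \forall z \near x, hom G (lx x z) (ly x z) != 0 by exact: cvgr_neq0 Gcvg G0.
have num z : hom G (lx x z) (ly x z) != 0 -> chart y (f z) - chart y y =
    e * hom (fibpoly y) (lx x z) (ly x z) / hom G (lx x z) (ly x z).
  rewrite (f_lift x z) /fibpoly hom_lin /G /e /pt; case: (y) => [b|] /= g0.
    by rewrite (negbTE g0) !mul1r mulrBl mulfK.
  rewrite mul0r mul1r sub0r mulrNN mul1r subr0; case: ifPn => [/eqP ->|q0] /=.
    by rewrite mul0r.
  by rewrite invf_div.
have rest0 : rest (lx x x) (ly x x) != 0.
  rewrite /rest prodf_seq_neq0; apply/allP => r _; apply/implyP => rx.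
  rewrite subr_eq0; apply/eqP => h; move/eqP: rx; apply; apply/esym.
  rewrite -[LHS](pt_lift x) -[RHS](pt_lift (Some 0)).
  by apply/pt_eq; [exact: lift_neq0|exact: lift_neq0|].
exists (e * k * s ^+ n * rest (lx x x) (ly x x) / hom G (lx x x) (ly x x)); split.
  rewrite !mulf_neq0 ?invr_neq0//; first by rewrite /e; case: (y) => [_|]; rewrite ?oppr_eq0 oner_neq0.
  by rewrite expf_neq0// /s; case: (x) => [_|]; rewrite ?oppr_eq0 oner_neq0.
have Fx : Filter (nbhs x) by exact: nbhs_filter.
have hr : rest (lx x z) (ly x z) @[z --> x] --> rest (lx x x) (ly x x).
  rewrite /rest; under eq_fun do rewrite -big_filter; rewrite -big_filter.
  exact: (@prod_cvg _ _ _ _ Fx _ (fun r z => lx x z * cy r - ly x z * cx r)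
    (fun r => lx x x * cy r - ly x x * cx r)
    (fun r => @lin1_cvg _ _ _ Fx _ _ _ _ (cy r) (cx r) hx hy)).
have hc : (fun=> e * k * s ^+ n) z @[z --> x] --> e * k * s ^+ n by exact: cvg_cst.
have h1 := dnbhs_cvg (@div_cvg _ _ _ Fx _ _ _ _ _ _ hc Gcvg hr G0); rewrite mulrAC.
apply: (cvg_near_eq _ h1).
apply: (filterS _ (filterI (den_lift x) Gnear)) => z [hz g0] /= zx.
have [dz [ly0 dz0]] := hz (elimN eqP zx).
rewrite num// -/(den x z) hk// (bigID (pred1 x))/= -/(rest _ _).
have -> : \prod_(r <- rts y | r == x) (lx x z * cy r - ly x z * cx r) = s ^+ n * den x z ^+ n.
  rewrite -exprMn dz -/s mulrA ss mul1r (eq_bigr (fun=> lx x z * cy x - ly x z * cx x)).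
    by rewrite big_const_seq iter_mulr_1.
  by move=> r /eqP ->.
move: (hom G _ _) g0 (den x z ^+ n) (expf_neq0 n dz0) (s ^+ n) (rest _ _) => g g0 D D0 S r.
by clear -g0 D0; field; apply/andP.
Qed.

Lemma branch_indexE x : branch_index f x = count_mem x (rts (f x)).
Proof.
have h := branch_indexP x; rewrite /branch_index; case: xgetP => [m _ hm|/(_ _ h)//].
exact: branch_uniq hm h.
Qed.

Lemma fiberE y : f @^-1` [set y] = [set` undup (rts y)].
Proof. by apply/seteqP; split => x; rewrite /= mem_undup mem_rts => /eqP. Qed.

Lemma transferE g y :
  \sum_(x \in f @^-1` [set y]) (branch_index f x)%:R * g x = transfer g y.
Proof.
rewrite fiberE -fsbig_seq ?undup_uniq// /transfer -[RHS]big_undup_iterop_count/=.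
apply: eq_big_seq => x; rewrite mem_undup mem_rts => /eqP fx.
by rewrite branch_indexE fx mulr_natl; elim: (count_mem _ _) => [|[|n] ih].
Qed.

(** A finite branch point is a multiple root of its fibre polynomial, hence a root of the Wronskian
    W = P'Q - PQ'. If W were 0, coprimality would give Q | Q', so Q' = 0 and P' = 0, and f would be
    constant. *)
Lemma branch_finite : finite_set [set x | branch_index f x != 1%N].
Proof.
pose W := P^`() * Q - P * Q^`().
have size_der (p : {poly C}) : p^`() = 0 -> (size p <= 1)%N.
  move=> p'; apply/leq_sizeP => -[//|j] _; have := congr1 (fun q : {poly C} => q`_j) p'.
  by rewrite coef_deriv coef0 => /eqP; rewrite mulrn_eq0/= => /eqP.
have W0 : W != 0.
  apply/eqP => /eqP; rewrite subr_eq0 => /eqP WE.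
  have QQ' : Q %| Q^`().
    have QP : coprimep Q P by rewrite coprimep_sym.
    by rewrite -(Gauss_dvdpr _ QP) -WE dvdp_mull.
  have Q'0 : Q^`() = 0.
    apply/eqP/negPn/negP => Q'n; have := dvdp_leq Q'n QQ'.
    by rewrite leqNgt lt_size_deriv.
  have P'0 : P^`() = 0.
    by apply/eqP; move/eqP: WE; rewrite Q'0 mulr0 mulf_eq0 (negbTE Q0) orbF.
  have := rdeg_gt0; rewrite /rdeg -ltnS prednK ?ltnS.
    by rewrite ltnNge geq_max !size_der.
  by rewrite (leq_trans _ (leq_maxr _ _))// size_poly_gt0.
apply: (@sub_finite_set _ _ [set` (None : sphere) :: [seq (Some z : sphere) | z <- proots W]]);
  last exact: finite_seq.
move=> [a|] /=; rewrite inE//= => ba.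
rewrite mem_map; last by move=> ? ? [].
rewrite -root_prod_XsubC; have : root W a; last first.
  by rewrite {1}[W]prootsE rootZ// lead_coef_eq0.
set y := f (Some a) in ba *.
have c2 : (2 <= count_mem a (proots (fibpoly y)))%N.
  have cE : count_mem (Some a : sphere) (rts y) = count_mem a (proots (fibpoly y)).
    rewrite count_cat count_map [X in (_ + X)%N](_ : _ = 0%N) ?addn0; first exact: eq_count.
    by apply/count_memPn/negP => /nseqP[].
  have : (0 < count_mem (Some a : sphere) (rts y))%N by rewrite -has_count has_pred1 mem_rts.
  by move: ba; rewrite branch_indexE -/y cE; case: (count_mem _ _) => [|[|]].
have [t st] : exists t, perm_eq (proots (fibpoly y)) [:: a, a & t].
  have a1 : a \in proots (fibpoly y) by rewrite -has_pred1 has_count; exact: ltnW c2.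
  have p1 := perm_to_rem a1; have a2 : a \in rem a (proots (fibpoly y)).
    rewrite -has_pred1 has_count; move/permP: p1 => /(_ (pred1 a)) /=; rewrite eqxx.
    by move: c2; case: (count_mem a (rem _ _)) => // + h; rewrite h.
  exists (rem a (rem a (proots (fibpoly y)))); apply: perm_trans p1 _.
  by rewrite perm_cons perm_to_rem.
have FE : fibpoly y = ('X - a%:P) * (('X - a%:P) * (lead_coef (fibpoly y) *: \prod_(z <- t) ('X - z%:P))).
  rewrite {1}[fibpoly y]prootsE (perm_big _ st)/= !big_cons.
  by rewrite -!scalerAr.
move: (lead_coef (fibpoly y)) FE => l FE.
have F1 : (fibpoly y).[a] = 0 by rewrite FE hornerM hornerXsubC subrr mul0r.
have F2 : (fibpoly y)^`().[a] = 0.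
  rewrite FE derivM derivXsubC mul1r hornerD !hornerM hornerXsubC subrr !mul0r.
  by rewrite addr0.
rewrite /fibpoly !hornerE in F1; rewrite /fibpoly derivB !derivZ !hornerE in F2.
rewrite /root /W !hornerE; move/eqP: F1; move/eqP: F2; rewrite !subr_eq0 => /eqP F2 /eqP F1.
have [cy0|cy0] := eqVneq (cy y) 0.
  have cx0 : cx y != 0 by apply/eqP => cx0; apply: (@lift_neq0 _ (Some 0) y).
  have Qa : Q.[a] = 0 by apply: (mulfI cx0); rewrite -F1 cy0 mul0r mulr0.
  have Q'a : Q^`().[a] = 0 by apply: (mulfI cx0); rewrite -F2 cy0 mul0r mulr0.
  by rewrite Qa Q'a !mulr0.
by rewrite -(inj_eq (mulfI cy0)) !mulrA F2 F1 -!mulrA [Q.[a] * _]mulrC.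
Qed.

End rational.

(** * Bounded families of rational functions *)

Section rational_on_discs.
Context {R : realType}.
Local Notation C := (complex R).
Implicit Types (A B : {poly C}) (a u : C) (r M : R).

Definition disc a r : set C := [set u | nm (u - a) <= r].

Lemma disc_compact a r : compact (disc a r).
Proof.
have -> : disc a r = (fun u => u + a) @` [set u | nm u <= r].
  apply/seteqP; split => u /=; first by move=> h; exists (u - a) => //; rewrite subrK.
  by move=> [v vr <-]; rewrite /disc/= addrK.
apply: continuous_compact; last exact: complex_compact_ball.
by apply: continuous_subspaceT => u; exact: (cvgD cvg_id (cvg_cst a)).
Qed.

Lemma compact_argmax (T : topologicalType) (K : set T) (g : T -> R) :
  compact K -> K !=set0 -> {within K, continuous g} ->
  exists2 x, K x & forall y, K y -> g y <= g x.
Proof.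
move=> cK [x0 Kx0] cg; have cI : compact (g @` K) by exact: continuous_compact.
have ne : g @` K !=set0 by exists (g x0), x0.
have ub : has_ubound (g @` K).
  have [M [_ HM]] := compact_bounded cI; exists (`|M| + 1) => z Kz.
  apply: (le_trans (ler_norm _)); apply: HM => //.
  by rewrite (le_lt_trans (ler_norm _))// ltrDl.
have cl : closed (g @` K) by apply: compact_closed => //; exact: Rhausdorff.
have [x Kx xE] : (g @` K) (sup (g @` K)) by apply: cl; exact: closure_sup.
by exists x => // y Ky; rewrite xE; apply: ub_le_sup => //; exists y.
Qed.

Definition rf A B u : C := A.[u] / B.[u].

Lemma rf_cvg A B u : B.[u] != 0 -> rf A B v @[v --> u] --> rf A B u.
Proof.
move=> Bu; have hA := @polynomial_continuous _ A u; have hB := @polynomial_continuous _ B u.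
exact: (cvgM hA (cvgV Bu hB)).
Qed.

Lemma nm_cvg (T : Type) (F : set_system T) (FF : Filter F) (g : T -> C) (l : C) :
  g @ F --> l -> nm (g t) @[t --> F] --> nm l.
Proof. by move=> h; exact: (cvg_comp _ _ h (@nm_continuous _ l)). Qed.

(** At a maximum u0 inside the disc with value v != 0, write A/B = v + D/B with D vanishing to exact
    order k at u0. A small step in a suitable direction then increases the modulus. *)
Lemma max_principle A B a r M : 0 < r -> (forall u, disc a r u -> B.[u] != 0) ->
  (forall u, nm (u - a) = r -> nm (rf A B u) <= M) ->
  forall u, disc a r u -> nm (rf A B u) <= M.
Proof.
move=> r0 Bn bd u du.
have [||u0 du0 hmax] := @compact_argmax _ (disc a r) (fun v => nm (rf A B v)) (@disc_compact a r).
- by exists u.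
- apply: continuous_in_subspaceT => v; rewrite inE => dv.
  by apply: (nm_cvg (nbhs_filter v)); exact: rf_cvg (Bn v dv).
apply: le_trans (hmax u du) _.
have bpt : nm (a + (r%:C)%C - a) = r by rewrite addrAC subrr add0r nmR gtr0_norm.
have M0 : 0 <= M by apply: le_trans (nm_ge0 _) (bd _ bpt).
have [->|v0] := eqVneq (rf A B u0) 0; first by rewrite nm0.
have [uE|ur] := eqVneq (nm (u0 - a)) r; first exact: bd.
have {ur}ur : nm (u0 - a) < r by rewrite lt_neqAle ur.
set v := rf A B u0 in v0 *; have Bu0 := Bn u0 du0.
pose D := A - v *: B.
have Du0 : root D u0 by rewrite /root /D hornerD hornerN hornerZ /v /rf divfK// subrr.
have AE w : B.[w] != 0 -> rf A B w = v + D.[w] / B.[w].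
  by move=> Bw; rewrite /D hornerD hornerN hornerZ mulrBl mulfK// addrC subrK.
have [D0|D0] := eqVneq D 0.
  have := bd _ bpt; rewrite AE; last by apply: Bn; rewrite /disc/= bpt.
  by rewrite D0 horner0 mul0r addr0.
have [k [E]] := multiplicity_XsubC D u0; rewrite D0 /= => E0 DE.
have k0 : (0 < k)%N.
  by case: k DE => // DE; move: Du0; rewrite DE expr0 mulr1 (negbTE E0).
exfalso; set c := E.[u0] / B.[u0].
have c0 : c != 0 by rewrite mulf_neq0 ?invr_neq0.
(* With w^k = v / c the leading term c (t w)^k of D/B is t^k v, aligned with v. *)
pose w := k.-root (v / c); have wk : w ^+ k = v / c by exact: rootCK.
have w0 : w != 0.
  apply/eqP => w0; move: wk; rewrite w0 expr0n gtn_eqF//= => /esym/eqP.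
  by rewrite mulf_eq0 invr_eq0 (negbTE v0) (negbTE c0).
have nw : 0 < nm w by rewrite lt_neqAle nm_ge0 andbT eq_sym; apply: contra_neq w0 => /nm0_eq0.
have h1 : \forall z \near u0, nm (c - rf E B z) < nm c by
  have /nm_cvgP := rf_cvg (A := E) Bu0; apply; rewrite lt_neqAle nm_ge0 andbT eq_sym; apply: contra_neq c0 => /nm0_eq0.
have [e e0 he] : exists2 e : R, 0 < e & forall z, nm (u0 - z) < e -> nm (c - rf E B z) < nm c.
  by move/nm_nbhsP : h1.
pose t := Num.min (e / 2 / nm w) ((r - nm (u0 - a)) / nm w).
have t0 : 0 < t by rewrite lt_min !divr_gt0// subr_gt0.
have t1 : t * nm w < e.
  rewrite -ltr_pdivlMr// gt_min; apply/orP; left.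
  by rewrite ltr_pM2r ?invr_gt0//; lra.
have t2 : t * nm w <= r - nm (u0 - a) by rewrite -ler_pdivlMr// ge_min lexx orbT.
pose z := u0 + (t%:C)%C * w.
have tw : nm ((t%:C)%C * w) = t * nm w by rewrite nmM nmR gtr0_norm.
have dz : disc a r z.
  by rewrite /disc/= /z addrAC; apply: le_trans (nmD _ _) _; rewrite tw; lra.
have hz : nm (c - rf E B z) < nm c by apply: he; rewrite /z opprD addrA subrr sub0r nmN tw.
have := hmax z dz; rewrite AE ?Bn// -/v DE hornerM horner_exp hornerXsubC.
set T := t ^+ k; have T0 : 0 < T by rewrite exprn_gt0.
have nv : 0 < nm v by rewrite lt_neqAle nm_ge0 andbT eq_sym; apply: contra_neq v0 => /nm0_eq0.
pose q := rf E B z / c.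
have -> : v + E.[z] * (z - u0) ^+ k / B.[z] = v * (1 + (T%:C)%C * q).
  rewrite /z addrAC subrr add0r exprMn wk -rmorphXn/= -/T /q /rf.
  by field; rewrite c0 Bn.
have q1 : nm (1 - q) < 1.
  have -> : 1 - q = (c - rf E B z) / c by rewrite mulrBl mulfV.
  by rewrite nmM nmV ltr_pdivrMr ?mul1r// lt_neqAle nm_ge0 andbT eq_sym; apply: contra_neq c0 => /nm0_eq0.
rewrite nmM => h; have {}h : nm (1 + (T%:C)%C * q) <= 1.
  by move: h; rewrite -[X in _ <= X]mulr1 ler_pM2l.
have h1' : nm ((T%:C)%C * (1 - q)) = T * nm (1 - q) by rewrite nmM nmR gtr0_norm.
have h2' : nm (((1 + T)%:C)%C : C) = 1 + T by rewrite nmR ger0_norm// addr_ge0// ltW.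
(* From 1 + T = (1 + T q) + T(1 - q), maximality gives 1 + T <= 1 + T |1 - q|, against |1 - q| <
   1. *)
have : nm (((1 + T)%:C)%C : C) <= nm (1 + (T%:C)%C * q) + nm ((T%:C)%C * (1 - q)).
  apply: le_trans (nmD _ _); apply: le_of_eq; congr nm.
  by rewrite rmorphD/= rmorph1; ring.
rewrite h1' h2' => h'.
nra.
Qed.

(** The difference quotient at a is again a polynomial over B. On the circle it is at most 2M / r,
    hence on the disc by the maximum principle. *)
Lemma schwarz A B a r M : 0 < r -> (forall u, disc a r u -> B.[u] != 0) ->
  (forall u, disc a r u -> nm (rf A B u) <= M) ->
  exists E : {poly C}, (forall u, disc a r u -> nm (rf E B u) <= 2 * M / r) /\
    forall u, disc a r u -> rf A B u = rf A B a + (u - a) * rf E B u.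
Proof.
move=> r0 Bn bd; have da : disc a r a by rewrite /disc/= subrr nm0 ltW.
have Ba := Bn a da; pose D := A - rf A B a *: B.
have /factor_theorem[E DE] : root D a.
  by rewrite /root /D hornerD hornerN hornerZ /rf divfK// subrr.
have AE u : disc a r u -> rf A B u = rf A B a + (u - a) * rf E B u.
  move=> du; have Bu := Bn u du.
  have := congr1 (fun p : {poly C} => p.[u]) DE.
  rewrite /D hornerD hornerN hornerZ hornerM hornerXsubC => h.
  rewrite {1}/rf -[A.[u]](subrK (rf A B a * B.[u])) h mulrDl mulfK// addrC; congr (_ + _).
  by rewrite /rf mulrAC [_ * (u - a)]mulrC mulrA.
exists E; split => //; apply: max_principle => // u ur.
have du : disc a r u by rewrite /disc/= ur.
have h : (u - a) * rf E B u = rf A B u - rf A B a by rewrite (AE u du) addrAC subrr add0r.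
rewrite ler_pdivlMr// mulrC -{1}ur -nmM h.
apply: le_trans (nmD _ _) _; rewrite nmN; have := bd u du; have := bd a da; lra.
Qed.

Section hurwitz.
Context {I : Type} {U : set_system I} {UU : UltraFilter U}.
Variables (A B : I -> {poly C}) (a : C) (r M : R).
Hypotheses (r0 : 0 < r) (M0 : 0 <= M).
Hypothesis nz : \forall i \near U, forall u, disc a r u ->
  [/\ (A i).[u] != 0, (B i).[u] != 0 & nm (rf (A i) (B i) u) <= M].
Hypothesis lim0 : rf (A i) (B i) a @[i --> U] --> 0.

(* Iterating schwarz expands each rational function in powers of u - a, with
   bounds uniform in i. *)
Let expansion : exists E : nat -> I -> {poly C}, forall k, \forall i \near U,
  forall u, disc a r u -> nm (rf (E k i) (B i) u) <= M * (2 / r) ^+ k /\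
    rf (A i) (B i) u = \sum_(j < k) rf (E j i) (B i) a * (u - a) ^+ j +
      (u - a) ^+ k * rf (E k i) (B i) u.
Proof.
have step (p : I * nat * {poly C}) : exists E : {poly C},
    (forall u, disc a r u -> (B p.1.1).[u] != 0) ->
    (forall u, disc a r u -> nm (rf p.2 (B p.1.1) u) <= M * (2 / r) ^+ p.1.2) ->
    (forall u, disc a r u -> nm (rf E (B p.1.1) u) <= M * (2 / r) ^+ p.1.2.+1) /\
    forall u, disc a r u -> rf p.2 (B p.1.1) u = rf p.2 (B p.1.1) a + (u - a) * rf E (B p.1.1) u.
  case: p => -[i k] p /=.
  have [h1|h1] := pselect (forall u, disc a r u -> (B i).[u] != 0); last by exists 0.
  have [h2|h2] := pselect (forall u, disc a r u -> nm (rf p (B i) u) <= M * (2 / r) ^+ k); last by exists 0.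
  have [E [E1 E2]] := schwarz r0 h1 h2; exists E => _ _; split => // u /E1.
  by move=> /le_trans; apply; rewrite exprSr; apply: le_of_eq; ring.
have /choice[T hT] := step.
exists (fun k i => (fix E k := if k is m.+1 then T (i, m, E m) else A i) k) => k.
apply: filterS nz => i hi; elim: k => [|k ih] u du.
  by rewrite expr0 mulr1 big_ord0 add0r mul1r; have [] := hi u du.
set E := fun k => (fix E k := if k is m.+1 then T (i, m, E m) else A i) k.
have [||b1 b2] := hT (i, k, E k).
- by move=> v dv; have [] := hi v dv.
- by move=> v dv; have [] := ih v dv.
split; first exact: b1.
have [_ ->] := ih u du; rewrite big_ord_recr/= -addrA; congr (_ + _).
by rewrite -/(E k) (b2 u du)/= -/(E k.+1) mulrDr mulrC exprSr mulrA.
Qed.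

Let near_forall_lt (p : nat -> I -> Prop) k :
  (forall j, (j < k)%N -> \forall i \near U, p j i) ->
  \forall i \near U, forall j, (j < k)%N -> p j i.
Proof.
elim: k => [|k ih] h; first by apply: filterE.
apply: filterS (filterI (h k (ltnSn k)) (ih (fun j jk => h j (ltnW jk)))) => i [hk hj] j.
by rewrite ltnS leq_eqVlt => /orP[/eqP ->|/hj].
Qed.

Let small_sum (e : nat -> I -> C) k (rho eta : R) : 0 <= rho -> 0 < eta ->
  (forall j, (j < k)%N -> e j i @[i --> U] --> 0) ->
  \forall i \near U, forall w : C, nm w = rho -> nm (\sum_(j < k) e j i * w ^+ j) < eta.
Proof.
move=> rho0 eta0 he; pose L : R := \sum_(j < k) rho ^+ j + 1.
have L0 : 0 < L by rewrite ltr_wpDl// sumr_ge0// => j _; rewrite exprn_ge0.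
have /near_forall_lt : forall j, (j < k)%N -> \forall i \near U, nm (e j i) < eta / L.
  move=> j jk; have d0 : 0 < eta / L by rewrite divr_gt0.
  by have /nm_cvgP/(_ _ d0) := he j jk; apply: filterS => i; rewrite sub0r nmN.
apply: filterS => i hi w wr; apply: le_lt_trans (nm_sum _ _ _) _.
have : \sum_(j < k) nm (e j i * w ^+ j) <= \sum_(j < k) (eta / L) * rho ^+ j.
  apply: ler_sum => j _; rewrite nmM nmX wr ler_wpM2r ?exprn_ge0// ltW//; exact: hi.
move=> /le_lt_trans; apply; rewrite -big_distrr/= mulrAC ltr_pdivrMr//.
by rewrite ltr_pM2l// /L ltrDl.
Qed.

(** All Taylor coefficients at a tend to 0, by strong induction: if the first k do and the next one
    stays at least delta in modulus, A/B is bounded below on a small circle by a bound exceeding its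
    value at a, and B/A violates the maximum principle. The uniform remainder then gives the limit
    at u. *)
Lemma hurwitz u : nm (u - a) < r / 2 -> rf (A i) (B i) u @[i --> U] --> 0.
Proof.
move=> ur; have [E hE] := expansion.
have da : disc a r a by rewrite /disc/= subrr nm0 ltW.
have coef k : rf (E k i) (B i) a @[i --> U] --> 0.
  elim/ltn_ind : k => k ih.
  have [k0|k0] := posnP k.
    subst k; apply: (cvg_near_eq _ lim0); apply: filterS (hE 0%N) => i /(_ a da)[_ ->].
    by rewrite big_ord0 add0r expr0 mul1r.
  apply/nm_cvgP => delta delta0; set S := [set i | nm (0 - rf (E k i) (B i) a) < delta].
  have [//|nS] := in_ultra_setVsetC S UU.
  exfalso; pose M' := M * (2 / r) ^+ k.+1.
  have M'0 : 0 <= M' by rewrite mulr_ge0// exprn_ge0// divr_ge0// ltW.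
  (* On the circle of radius s the k-th term has modulus at least s^k delta; s makes the remainder
     at most half of that, and the lower terms stay below a quarter, so s^k delta / 4 remains. *)
  pose s := Num.min r (delta / (2 * (M' + 1))).
  have M'1 : 0 < 2 * (M' + 1) by rewrite mulr_gt0// ltr_wpDl.
  have s0 : 0 < s by rewrite lt_min r0 divr_gt0.
  have sr : s <= r by rewrite ge_min lexx.
  have sd : s * (2 * (M' + 1)) <= delta by rewrite -ler_pdivlMr// ge_min lexx orbT.
  have sk : 0 < s ^+ k by rewrite exprn_gt0.
  have eta0 : 0 < s ^+ k * delta / 4 by rewrite divr_gt0// mulr_gt0.
  have h1 := small_sum (ltW s0) eta0 ih.
  have h2 := hE k.+1.
  have /nm_cvgP/(_ _ eta0) h3 := lim0.
  have [i [[[[nSi h1i] h2i] h3i] nzi]] := filter_ex (filterI (filterI (filterI (filterI nS h1) h2) h3) nz).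
  move: nSi; rewrite /S /= sub0r nmN => /negP; rewrite -leNgt => dk.
  rewrite sub0r nmN in h3i.
  have low v : nm (v - a) = s -> s ^+ k * delta / 4 <= nm (rf (A i) (B i) v).
    move=> vs; have dv : disc a r v by rewrite /disc/= vs.
    have [b1] := h2i v dv; rewrite big_ord_recr/= -/M' => ->.
    have := h1i (v - a) vs; set X := \sum_(_ < _) _ => hX.
    set Y := rf (E k i) _ _ * _; set Z' := _ ^+ k.+1 * _.
    have nY : s ^+ k * delta <= nm Y by rewrite /Y nmM nmX vs mulrC ler_wpM2r// ltW.
    have nZ : nm Z' <= s ^+ k * (delta / 2).
      rewrite /Z' nmM nmX vs exprSr -mulrA ler_pM2l//.
      apply: le_trans (ler_wpM2l (ltW s0) b1) _; rewrite -/M'; have := s0; nra.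
    have := nmD (X + Y + Z') (- (X + Z')); rewrite nmN.
    have -> : X + Y + Z' - (X + Z') = Y by rewrite opprD addrACA subrr addr0 addrAC subrr add0r.
    have := nmD X Z'; lra.
  have Bsmall v : disc a s v -> (A i).[v] != 0.
    by move=> dv; have [] := nzi v (le_trans dv sr).
  have inv v : nm (rf (B i) (A i) v) = (nm (rf (A i) (B i) v))^-1 by rewrite -nmV /rf invf_div.
  have bnd v : nm (v - a) = s -> nm (rf (B i) (A i) v) <= (s ^+ k * delta / 4)^-1.
    move=> vs; rewrite inv lef_pV2 ?posrE//; [exact: low|exact: lt_le_trans eta0 (low v vs)].
  have da' : disc a s a by rewrite /disc/= subrr nm0 ltW.
  have := max_principle s0 Bsmall bnd da'; rewrite inv.
  have Aa : 0 < nm (rf (A i) (B i) a).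
    rewrite lt_neqAle nm_ge0 andbT eq_sym; have [Aa0 Ba0 _] := nzi a da.
    have : rf (A i) (B i) a != 0 by rewrite mulf_neq0 ?invr_neq0.
    by apply: contra_neq => /nm0_eq0.
  by rewrite lef_pV2 ?posrE// leNgt h3i.
apply/nm_cvgP => e e0; have e20 : 0 < e / 2 by rewrite divr_gt0.
have n0 := nm_ge0 (u - a).
(* The remainder is at most M (2|u - a| / r)^k, which is why |u - a| < r / 2 is assumed. *)
have [||k hk] := @geometric_small _ (nm (u - a) * (2 / r)) M (e / 2) _ _ e20.
- by rewrite mulr_ge0// divr_ge0// ltW.
- by rewrite mulrA ltr_pdivrMr// mul1r -ltr_pdivlMr.
have h1 := @small_sum (fun j i => rf (E j i) (B i) a) k _ _ n0 e20 (fun j _ => coef j).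
apply: filterS (filterI h1 (hE k)) => i [h1i h2i].
have du : disc a r u by rewrite /disc/=; lra.
have [b1 ->] := h2i u du; rewrite sub0r nmN.
have := h1i (u - a) erefl; have := hk k (leqnn _); rewrite exprMn => h3 h4.
apply: le_lt_trans (nmD _ _) _; rewrite nmM nmX.
have := ler_wpM2l (exprn_ge0 k n0) b1; rewrite [M * _]mulrC mulrA => h5.
lra.
Qed.

End hurwitz.

End rational_on_discs.

(** * Invariance of the Julia set and its branch points *)

Section chordal_metric.
Context {R : realType}.
Local Notation C := (complex R).
Local Notation sphere := (riemann_sphere R).
Local Notation cx := (lx (Some (0 : C))).
Local Notation cy := (ly (Some (0 : C))).

(* The square of the chordal distance of [x : y] and [x' : y'] *)
Definition chordq (x y x' y' : C) : R :=
  4 * nm (x * y' - y * x') ^+ 2 / ((nm x ^+ 2 + nm y ^+ 2) * (nm x' ^+ 2 + nm y' ^+ 2)).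

Definition chord (z w : sphere) : R := chordq (cx z) (cy z) (cx w) (cy w).

Lemma nm2_gt0 (x y : C) : ~ (x = 0 /\ y = 0) -> 0 < nm x ^+ 2 + nm y ^+ 2.
Proof.
move=> xy; rewrite lt_neqAle addr_ge0 ?exprn_ge0 ?nm_ge0// andbT eq_sym.
apply/eqP => h; apply: xy; have hx := sqr_ge0 (nm x); have hy := sqr_ge0 (nm y).
split; apply: nm0_eq0; apply/eqP; rewrite -sqrf_eq0; apply/eqP; lra.
Qed.

Lemma chordq_scale u v x y x' y' : u != 0 -> v != 0 ->
  chordq (u * x) (u * y) (v * x') (v * y') = chordq x y x' y'.
Proof.
move=> u0 v0; rewrite /chordq.
have -> : u * x * (v * y') - u * y * (v * x') = u * v * (x * y' - y * x') by ring.
rewrite !nmM !exprMn -!mulrDr.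
have nu : nm u != 0 by apply: contra_neq u0 => /nm0_eq0.
have nv : nm v != 0 by apply: contra_neq v0 => /nm0_eq0.
set a := nm u ^+ 2; set b := nm v ^+ 2; set N := nm _ ^+ 2.
set D := nm x ^+ 2 + _; set E := nm x' ^+ 2 + _.
have ab0 : a * b != 0 by rewrite mulf_neq0 ?expf_neq0.
have -> : 4 * (a * b * N) = a * b * (4 * N) by ring.
have -> : a * D * (b * E) = a * b * (D * E) by ring.
by rewrite -mulf_div divff// mul1r.
Qed.

Lemma chordE z0 w0 z w : chord z w = chordq (lx z0 z) (ly z0 z) (lx w0 w) (ly w0 w).
Proof.
have [u u0 [ex ey]] := lift_scale (Some 0) z0 z; have [v v0 [fx fy]] := lift_scale (Some 0) w0 w.
by rewrite /chord ex ey fx fy chordq_scale.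
Qed.

Lemma chord_ge0 z w : 0 <= chord z w.
Proof. by rewrite /chord /chordq divr_ge0 ?mulr_ge0 ?addr_ge0 ?exprn_ge0 ?nm_ge0. Qed.

Lemma chord_eq0 z w : chord z w = 0 <-> z = w.
Proof.
have nz := @lift_neq0 _ (Some (0 : C)) z; have nw := @lift_neq0 _ (Some (0 : C)) w.
rewrite -{2}(pt_lift (Some 0) z) -{2}(pt_lift (Some 0) w) (pt_eq nz nw) /chord /chordq.
split=> [/eqP|->]; last by rewrite subrr nm0 expr0n/= mulr0 mul0r.
rewrite mulf_eq0 invr_eq0.
have n1 := nm2_gt0 nz; have n2 := nm2_gt0 nw; set N := (X in _ || (X == 0)).
have -> : (N == 0) = false by rewrite gt_eqF// mulr_gt0.
by rewrite orbF mulf_eq0 pnatr_eq0/= sqrf_eq0 => /eqP/nm0_eq0/eqP; rewrite subr_eq0 => /eqP.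
Qed.

Lemma chord_cvg (T : Type) (F : set_system T) (FF : Filter F) (u v : T -> sphere) p q :
  u @ F --> p -> v @ F --> q -> chord (u t) (v t) @[t --> F] --> chord p q.
Proof.
move=> up vq.
have [lxp lyp] := lift_cvg p; have [lxq lyq] := lift_cvg q.
have h1 := cvg_comp _ _ up lxp; have h2 := cvg_comp _ _ up lyp.
have h3 := cvg_comp _ _ vq lxq; have h4 := cvg_comp _ _ vq lyq.
rewrite (_ : (fun t => _) = fun t => chordq (lx p (u t)) (ly p (u t)) (lx q (v t)) (ly q (v t)));
  last by apply/funext => t; exact: chordE.
rewrite (chordE p q).
have num : nm (lx p (u t) * ly q (v t) - ly p (u t) * lx q (v t)) @[t --> F] -->
    nm (lx p p * ly q q - ly p p * lx q q).
  by apply: (nm_cvg FF); exact: (cvgB (cvgM h1 h4) (cvgM h2 h3)).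
have n1 := nm_cvg FF h1; have n2 := nm_cvg FF h2; have n3 := nm_cvg FF h3; have n4 := nm_cvg FF h4.
have sq (g : T -> R) (l : R) : g @ F --> l -> g t ^+ 2 @[t --> F] --> l ^+ 2.
  by move=> h; rewrite expr2; under eq_fun do rewrite expr2; exact: (cvgM h h).
have den := cvgM (cvgD (sq _ _ n1) (sq _ _ n2)) (cvgD (sq _ _ n3) (sq _ _ n4)).
have d0 : (nm (lx p p) ^+ 2 + nm (ly p p) ^+ 2) * (nm (lx q q) ^+ 2 + nm (ly q q) ^+ 2) != 0.
  by rewrite gt_eqF// mulr_gt0// nm2_gt0//; exact: lift_neq0.
exact: (cvgM (cvgM (cvg_cst (4 : R)) (sq _ _ num)) (cvgV d0 (den _ _ _))).
Qed.

Lemma chordal_ge0 (z w : sphere) : 0 <= chordal_dist z w.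
Proof.
by case: z => [a|]; case: w => [b|] //=; rewrite divr_ge0 ?mulr_ge0 ?sqrtC_ge0 ?addr_ge0 ?exprn_ge0.
Qed.

Lemma chordal_sqr (z w : sphere) : chordal_dist z w ^+ 2 = ((chord z w)%:C)%C.
Proof.
have n1 (a : C) : sqrtC (1 + `|a| ^+ 2) ^+ 2 = ((nm a ^+ 2 + 1)%:C)%C.
  by rewrite sqrtCK normE rmorphD/= rmorph1 rmorphXn/= addrC.
have four : (4%:R : C) = ((4%:R : R)%:C)%C by rewrite rmorph_nat.
case: z => [a|]; case: w => [b|] /=.
- rewrite /chord /chordq/= nm1 expr1n mulr1 mul1r fmorph_div/= expr_div_n !exprMn !n1 normE.
  by rewrite -natrX four -rmorphXn/= -!rmorphM.
- rewrite /chord /chordq/= nm1 nm0 expr1n expr0n/= mulr0 sub0r nmN mulr1 nm1 expr1n addr0 !mulr1.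
  by rewrite expr_div_n n1 -natrX four fmorph_div.
- rewrite /chord /chordq/= nm1 nm0 expr1n expr0n/= mul0r subr0 mulr1 nm1 expr1n addr0 mulr1 mul1r.
  by rewrite expr_div_n n1 -natrX four fmorph_div.
- by rewrite /chord /chordq/= !(mulr0, mul0r) subrr nm0 !(expr0n, mulr0, mul0r).
Qed.

Lemma chordal_ltP (z w : sphere) (e : R) : 0 < e ->
  chordal_dist z w < (e%:C)%C <-> chord z w < e ^+ 2.
Proof.
move=> e0; rewrite -ltcR -chordal_sqr rmorphXn/= ltr_pXn2r ?nnegrE ?chordal_ge0//.
by rewrite lecR ltW.
Qed.

Lemma equiP (f : sphere -> sphere) x : equicontinuous_iterates f x <->
  forall e : R, 0 < e -> \forall y \near x, forall n, chord (iter n f y) (iter n f x) < e.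
Proof.
split=> h e e0.
  pose s := Num.sqrt e; have s0 : 0 < s by rewrite sqrtr_gt0.
  have s0' : 0 < (s%:C)%C :> C by rewrite ltcR.
  have := h _ s0'; apply: filterS => y hy n.
  by rewrite -[e]sqr_sqrtr ?(ltW e0)//; apply/chordal_ltP.
have eE : e = ((complex.Re e)%:C)%C by rewrite RRe_real// gtr0_real.
have e1 : 0 < complex.Re e by rewrite -ltcR -eE.
have e2 : 0 < complex.Re e ^+ 2 by rewrite exprn_gt0.
by have := h _ e2; apply: filterS => y hy n; rewrite eE; apply/chordal_ltP.
Qed.

(** A uniform separation in place of a triangle inequality, as [chord] is a squared distance. By
    compactness the points outside N have chord to m bounded away from 0, and the bound persists for
    w near m. *)
Lemma chord_sep (m : sphere) (N : set sphere) : nbhs m N ->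
  exists2 e : R, 0 < e & \forall w \near m, forall w', chord w' w < e -> N w'.
Proof.
move=> mN; pose K := ~` N^°.
have cK : compact K.
  apply: (subclosed_compact _ sphere_compact) => //.
  by apply: open_closedC; exact: open_interior.
move/compact_near_coveringP : cK => cK.
have FF : Filter (filter_prod (nbhs m) (0 : R)^'+) by exact: filter_prod_filter.
have := cK (sphere * R)%type _ (fun i w' => i.2 <= chord w' i.1) FF.
case=> [w' Kw'|].
- have c0 : 0 < chord w' m.
    rewrite lt_neqAle chord_ge0 andbT eq_sym; apply/eqP => /chord_eq0 w'm.
    by apply: Kw'; rewrite w'm; exact: mN.
  have c1 : chord p.1 p.2.1 @[p --> filter_prod (nbhs w') (filter_prod (nbhs m) (0 : R)^'+)] --> chord w' m.
    apply: chord_cvg; first exact: cvg_fst.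
    by apply: cvg_comp cvg_snd _; exact: cvg_fst.
  have c2 : \forall p \near filter_prod (nbhs w') (filter_prod (nbhs m) (0 : R)^'+), chord w' m / 2 < chord p.1 p.2.1.
    have h : chord w' m / 2 < chord w' m by rewrite ltr_pdivrMr//; lra.
    exact: cvgr_gt _ c1 _ h.
  have c3 : \forall p \near filter_prod (nbhs w') (filter_prod (nbhs m) (0 : R)^'+), p.2.2 < chord w' m / 2.
    have h : \forall e \near (0 : R)^'+, e < chord w' m / 2.
      by apply: nbhs_right_lt; rewrite divr_gt0.
    have hh := cvg_comp _ _ (@cvg_snd _ _ (nbhs w') (filter_prod (nbhs m) (0 : R)^'+) _) (@cvg_snd _ _ (nbhs m) (0 : R)^'+ _).
    exact: hh _ h.
  by apply: filterS (filterI c2 c3) => p [h1 h2] /=; apply: ltW; exact: lt_trans h2 h1.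
move=> -[A B] /= [mA B0] AB.
have [e [e0 Be]] := filter_ex (filterI (nbhs_right_gt (0 : R)) B0).
exists e => //; apply: filterS mA => w Aw w' w'w.
apply: contrapT => Nw'; have Kw' : K w' by move=> /interior_subset.
by have := AB (w, e) (conj Aw Be) w' Kw'; rewrite /= leNgt w'w.
Qed.

Lemma chord_lim (T : Type) (F : set_system T) (FF : ProperFilter F) (u v : T -> sphere) (p q : sphere) :
  u @ F --> p -> v @ F --> q ->
  (forall e : R, 0 < e -> \forall t \near F, chord (u t) (v t) < e) -> p = q.
Proof.
move=> up vq h; apply/chord_eq0/le_anti; rewrite chord_ge0 andbT.
apply/ler_addgt0Pr => e e0; rewrite add0r.
have F' : Filter F by exact _.
have c := chord_cvg F' up vq; rewrite leNgt; apply/negP => ec.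
have c1 : \forall t \near F, e < chord (u t) (v t) by exact: cvgr_gt _ c _ ec.
by have [t [h1 h2]] := filter_ex (filterI c1 (h e e0)); move: (lt_trans h1 h2); rewrite ltxx.
Qed.

Lemma chord_near (T : Type) (F : set_system T) (FF : Filter F) (u : T -> sphere) (p : sphere) (e : R) :
  0 < e -> u @ F --> p -> \forall t \near F, chord (u t) p < e.
Proof.
move=> e0 up; have cp : (fun _ : T => p) @ F --> p by exact: cvg_cst.
have c := chord_cvg FF up cp; rewrite (_ : chord p p = 0) in c; last exact/chord_eq0.
exact: cvgr_lt _ c _ e0.
Qed.

End chordal_metric.

Section dynamics.
Context {R : realType}.
Local Notation C := (complex R).
Local Notation sphere := (riemann_sphere R).
Local Notation cx := (lx (Some (0 : C))).
Local Notation cy := (ly (Some (0 : C))).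
Variables (P Q : {poly C}).
Local Notation f := (@rational_map R P Q).
Hypotheses (PQ : coprimep P Q) (Q0 : Q != 0) (fN : ~ exists c, forall z, f z = c).

Lemma fatou_open : open (fatou f).
Proof. by apply: bigcup_open => U []. Qed.

Lemma fatou_equi x : fatou f x -> equicontinuous_iterates f x.
Proof. by case=> U [oU hU] /hU. Qed.

Lemma iter_continuous n : continuous (iter n f).
Proof.
elim: n => [|n ih] x; first exact: cvg_id.
exact: (cvg_comp _ _ (ih x) (@f_continuous R P Q PQ Q0 (iter n f x))).
Qed.

Lemma fatou_forward x : fatou f x -> fatou f (f x).
Proof.
case=> U [oU hU] Ux; exists (f @` U); last by exists x.
split.
  rewrite openE => _ [y Uy <-]; apply: f_open => //.
  by rewrite nbhsE; exists U.
move=> _ [y Uy <-]; apply/equiP => e e0.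
have /equiP/(_ e e0)/(f_open PQ Q0 fN) := hU _ Uy.
by apply: filterS => _ [z hz <-] n; rewrite -!iterSr; exact: (hz n.+1).
Qed.

Lemma fatou_backward x : fatou f (f x) -> fatou f x.
Proof.
case=> U [oU hU] Ux; exists (f @^-1` U) => //; split.
  by apply: open_comp oU => z _; exact: f_continuous.
move=> y Uy; apply/equiP => e e0.
have /equiP/(_ e e0) h := hU _ Uy.
have h1 : \forall z \near y, chord z y < e.
  exact: (@chord_near _ _ _ (nbhs_filter y) id y e e0 cvg_id).
have h2 : \forall z \near y, forall n, chord (iter n f (f z)) (iter n f (f y)) < e.
  exact: (@f_continuous R P Q PQ Q0 y _ h).
by apply: filterS (filterI h1 h2) => z [z1 z2] [//|n]; rewrite !iterSr.
Qed.

Lemma fatouE x : fatou f (f x) <-> fatou f x.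
Proof. by split; [exact: fatou_backward|exact: fatou_forward]. Qed.

Lemma juliaE x : julia f (f x) <-> julia f x.
Proof. by rewrite /julia/=; split=> h; apply: contra_not h => /fatouE. Qed.

Lemma fatou_iter n x : fatou f (iter n f x) <-> fatou f x.
Proof. by elim: n => [//|n ih]; rewrite /= fatouE. Qed.

(* The points at which chart is the chart around x, not its junk value. *)
Definition in_chart (x z : sphere) : Prop :=
  match x with Some _ => z <> None | None => z <> Some 0 end.

Lemma chart_near x : \forall z \near x, in_chart x z.
Proof.
case: x => [a|] /=; first by apply/nbhs_SomeE; apply: filterE.
apply/nbhs_NoneP; split => //; exists 0 => z z0 [zE].
by move: z0; rewrite zE nm0 ltxx.
Qed.

Lemma chart_basis x (U : set sphere) : nbhs x U -> exists2 e : R, 0 < e &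
  forall z, in_chart x z -> nm (den x z) < e -> U z.
Proof.
case: x => [a|]; rewrite /den /chart.
  move=> /nbhs_SomeE/nm_nbhsP[e e0 eU]; exists e => // -[w|] //= _ we.
  by apply: eU; rewrite nmB.
move=> /nbhs_NoneP[UN [M UM]]; exists (`|M| + 1)^-1; first by rewrite invr_gt0 ltr_wpDl.
move=> [w|] //= w0; rewrite subr0 nmV => we; apply: UM.
have w0' : 0 < nm w.
  rewrite lt_neqAle nm_ge0 andbT eq_sym; apply/eqP => /nm0_eq0 wE; by apply: w0; rewrite wE.
move: we; rewrite ltf_pV2 ?posrE ?ltr_wpDl// => h.
by have := ler_norm M; lra.
Qed.

Lemma chart_nbhs x (e : R) : 0 < e -> \forall z \near x, in_chart x z /\ nm (den x z) < e.
Proof.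
move=> e0; have Fx : Filter (nbhs x) by exact: nbhs_filter.
have /nm_cvgP/(_ _ e0) h := @den_cvg R x.
by apply: filterS (filterI (chart_near x) h) => z [h1]; rewrite sub0r nmN.
Qed.

Lemma den_bound x : exists2 L : R, 0 < L & \forall z \near x,
  nm (den (f x) (f z)) <= L * nm (den x z) ^+ branch_index f x.
Proof.
have [n0 [c [c0]]] := branch_indexP PQ Q0 fN x.
rewrite -(branch_indexE PQ Q0 fN) in n0 *; move: (branch_index f x) n0 => n n0 hc.
have Fx : Filter (nbhs x) by exact: nbhs_filter.
have Fx' : Filter (dnbhs x) by exact: dnbhs_filter.
have /nm_cvgP/(_ _ ltr01) : (den (f x) (f z) / den x z ^+ n) @[z --> x^'] --> c by [].
rewrite /dnbhs /within/= => h.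
have {}h : \forall z \near x, z != x -> nm (c - den (f x) (f z) / den x z ^+ n) < 1 := h.
exists (nm c + 1); first by rewrite ltr_wpDl// nm_ge0.
apply: (filterS _ (filterI h (den_lift x))) => z [h1 h2].
have [->|zx] := eqVneq z x.
  by rewrite /den !subrr !nm0 expr0n gtn_eqF//= mulr0.
have [_ [_ dz]] := h2 (elimN eqP zx).
have d0 : 0 < nm (den x z) by rewrite lt_neqAle nm_ge0 andbT eq_sym; apply: contra_neq dz => /nm0_eq0.
have {}h1 := h1 zx; rewrite -nmX -ler_pdivrMr; last by rewrite nmX exprn_gt0.
rewrite -nmV -nmM; set w := _ / _ in h1 *.
by have := nmD (w - c) c; rewrite subrK nmB; lra.
Qed.

Lemma den_lipschitz x : exists2 L : R, 0 < L & \forall z \near x,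
  nm (den (f x) (f z)) <= L * nm (den x z).
Proof.
have [L L0 hL] := den_bound x; exists L => //.
have Fx : Filter (nbhs x) by exact: nbhs_filter.
apply: (filterS _ (filterI hL (chart_nbhs x ltr01))) => z [h1 [_ h2]].
apply: le_trans h1 _; rewrite ler_pM2l//.
have [n0 _] := branch_indexP PQ Q0 fN x; rewrite -(branch_indexE PQ Q0 fN) in n0.
by rewrite -[leRHS]expr1 ler_wiXn2l ?nm_ge0 ?ltW.
Qed.

Lemma den_small x (eta : R) : branch_index f x <> 1%N -> 0 < eta ->
  \forall z \near x, nm (den (f x) (f z)) <= eta * nm (den x z).
Proof.
move=> b1 eta0; have [L L0 hL] := den_bound x.
have Fx : Filter (nbhs x) by exact: nbhs_filter.
have m0 : 0 < Num.min 1 (eta / L) by rewrite lt_min ltr01 divr_gt0.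
apply: (filterS _ (filterI hL (chart_nbhs x m0))) => z [h1 [_ h2]].
apply: le_trans h1 _.
have [n0 _] := branch_indexP PQ Q0 fN x; rewrite -(branch_indexE PQ Q0 fN) in n0.
have n2 : (1 < branch_index f x)%N by rewrite ltn_neqAle n0 andbT; apply/eqP => /esym.
have d1 : nm (den x z) <= 1 by apply: ltW; apply: lt_le_trans h2 _; rewrite ge_min lexx.
have d2 : nm (den x z) <= eta / L by apply: ltW; apply: lt_le_trans h2 _; rewrite ge_min lexx orbT.
have d0 := nm_ge0 (den x z).
apply: (@le_trans _ _ (L * nm (den x z) ^+ 2)).
  by rewrite ler_pM2l// ler_wiXn2l.
rewrite expr2 mulrA ler_wpM2r//; by rewrite mulrC -ler_pdivlMr.
Qed.

(** Among p steps from c the first one shrinks distances by an arbitrarily small factor and the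
    others are Lipschitz, so the p-th iterate halves small distances to c. Small discs are then
    invariant under it, and n = qp + j with j < p reduces all iterates to finitely many. *)
Lemma superattracting c p : (0 < p)%N -> iter p f c = c -> branch_index f c <> 1%N ->
  equicontinuous_iterates f c.
Proof.
move=> p0 pc bc.
have Fc (x : sphere) : Filter (nbhs x) by exact: nbhs_filter.
have small j (eta : R) : 0 < eta -> \forall z \near c,
    nm (den (iter j.+1 f c) (iter j.+1 f z)) <= eta * nm (den c z).
  elim: j eta => [|j ih] eta eta0; first exact: den_small.
  have [L L0 hL] := den_lipschitz (iter j.+1 f c).
  have h1 := ih (eta / L) (divr_gt0 eta0 L0).
  have h2 := @iter_continuous j.+1 c _ hL.
  apply: filterS (filterI h1 h2) => z [z1 z2]; apply: le_trans z2 _.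
  by apply: le_trans (ler_wpM2l (ltW L0) z1) _; rewrite mulrA mulrCA divff ?mulr1// gt_eqF.
have half0 : (0 : R) < 2^-1 by rewrite invr_gt0.
have h1 : \forall z \near c, nm (den c (iter p f z)) <= 2^-1 * nm (den c z).
  by have := small p.-1 _ half0; rewrite prednK// pc.
have h2 : \forall z \near c, in_chart c (iter p f z).
  by apply: (@iter_continuous p c); rewrite pc; exact: chart_near.
have [d0 d00 hd0] := chart_basis (filterI h1 h2).
have step z : in_chart c z -> nm (den c z) < d0 ->
    in_chart c (iter p f z) /\ nm (den c (iter p f z)) <= nm (den c z).
  move=> z1 z2; have [h3 h4] := hd0 z z1 z2; split => //.
  by apply: le_trans h3 _; have := nm_ge0 (den c z); lra.
apply/equiP => e e0.
have [V [cV hV]] : exists V, nbhs c V /\ forall z, V z -> forall j, (j < p)%N ->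
    chord (iter j f z) (iter j f c) < e.
  elim: p {p0 pc h1 h2 hd0 step} => [|p [V [cV hV]]].
    by exists setT; split => //; exact: filterT.
  exists (V `&` [set z | chord (iter p f z) (iter p f c) < e]); split.
    apply: filterI => //.
    exact: (chord_near (Fc c) e0 (@iter_continuous p c)).
  move=> z [Vz zp] j; rewrite ltnS leq_eqVlt => /orP[/eqP -> //|]; exact: hV.
have [d1 d10 hd1] := chart_basis cV.
have m0 : 0 < Num.min d0 d1 by rewrite lt_min d00.
apply: filterS (chart_nbhs c m0) => z [z1 z2] n.
have it k : in_chart c (iter (k * p) f z) /\ nm (den c (iter (k * p) f z)) < Num.min d0 d1.
  elim: k => [//|k [i1 i2]]; rewrite mulSn iterD.
  have [|j1 j2] := step _ i1; first by apply: lt_le_trans i2 _; rewrite ge_min lexx.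
  by split => //; exact: le_lt_trans j2 i2.
have itc k : iter (k * p) f c = c by elim: k => [//|k ih]; rewrite mulSn iterD ih.
have [i1 i2] := it (n %/ p)%N.
rewrite (divn_eq n p) addnC !iterD itc; apply: hV; last by rewrite ltn_mod.
by apply: hd1 => //; apply: lt_le_trans i2 _; rewrite ge_min lexx orbT.
Qed.

(* Coordinates of the points near c: kappa c maps a disc around 0 to a neighbourhood of c. *)
Definition kx (c : sphere) : {poly C} := if c is Some a then a%:P + 'X else 1.
Definition ky (c : sphere) : {poly C} := if c is Some a then 1 else 'X.
Definition kappa (c : sphere) (u : C) : sphere := pt (kx c).[u] (ky c).[u].

Lemma kappa_neq0 c u : ~ ((kx c).[u] = 0 /\ (ky c).[u] = 0).
Proof. by case: c => [a|] /= [] /eqP; rewrite !hornerE ?oner_eq0// => _ /eqP; rewrite oner_eq0. Qed.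

Lemma kappa0 c : kappa c 0 = c.
Proof. by case: c => [a|]; rewrite /kappa /pt /= !hornerE ?eqxx// oner_eq0 divr1. Qed.

Lemma kappa_inj0 c u : kappa c u = c -> u = 0.
Proof.
case: c => [a|]; rewrite /kappa /pt /= !hornerE.
  by rewrite oner_eq0 divr1 => -[] /eqP; rewrite -subr_eq0 addrAC subrr add0r => /eqP.
by case: ifP => // /eqP.
Qed.

Lemma kappa_continuous c : continuous (kappa c).
Proof.
move=> u; have Fu : Filter (nbhs u) by exact: nbhs_filter.
exact: (pt_cvg (@polynomial_continuous _ _ u) (@polynomial_continuous _ _ u) (@kappa_neq0 c u)).
Qed.

Lemma kappa_den c z : in_chart c z -> kappa c (den c z) = z.
Proof.
case: c => [a|]; case: z => [w|] //=; rewrite /kappa /den /pt /= ?(hornerD, hornerC, hornerX).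
- by move=> _; rewrite oner_eq0 divr1 /= addrC subrK.
- move=> w0; rewrite subr0 invr_eq0 ifN ?invrK ?mul1r//.
  by apply/eqP => wE; apply: w0; rewrite wE.
- by move=> _; rewrite subr0 eqxx.
Qed.

(** Polynomials in u that are homogeneous coordinates of the n-th iterate at [kappa c u]; they turn
    the iterates near c into quotients of polynomials on a disc. *)
Fixpoint iterp (c : sphere) n : {poly C} * {poly C} :=
  if n is m.+1 then
    let: (p, q) := iterp c m in
    (\sum_(i < (rdeg P Q).+1) P`_i *: (p ^+ i * q ^+ (rdeg P Q - i)),
     \sum_(i < (rdeg P Q).+1) Q`_i *: (p ^+ i * q ^+ (rdeg P Q - i)))
  else (kx c, ky c).

Lemma iterpE c n u : ~ ((iterp c n).1.[u] = 0 /\ (iterp c n).2.[u] = 0) /\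
  iter n f (kappa c u) = pt (iterp c n).1.[u] (iterp c n).2.[u].
Proof.
elim: n => [|n [ih1 ih2]]; first by split => //; exact: kappa_neq0.
have homE (S p q : {poly C}) : (\sum_(i < (rdeg P Q).+1) S`_i *: (p ^+ i * q ^+ (rdeg P Q - i))).[u] =
    hom P Q S p.[u] q.[u].
  by rewrite horner_sum; apply: eq_bigr => i _; rewrite hornerZ hornerM !horner_exp.
rewrite iterS ih2 f_hom//=; case: (iterp c n) ih1 ih2 => p q /= ih1 ih2; rewrite !homE.
by split => //; exact: hom_neq0.
Qed.

Definition cross (m z0 z : sphere) : C := cy m * lx z0 z - cx m * ly z0 z.

Lemma cross_eq0 m z0 z : cross m z0 z = 0 <-> z = m.
Proof.
have h := @pt_eq R (lx z0 z) (ly z0 z) (cx m) (cy m) (@lift_neq0 _ _ _) (@lift_neq0 _ _ _).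
rewrite !pt_lift in h; rewrite h /cross; split=> [/eqP|e].
  by rewrite subr_eq0 => /eqP e; rewrite mulrC e mulrC.
by rewrite mulrC e mulrC subrr.
Qed.

Lemma cross_cvg (T : Type) (F : set_system T) (FF : Filter F) (w : T -> sphere) m z0 :
  w @ F --> z0 -> cross m z0 (w t) @[t --> F] --> cross m z0 z0.
Proof.
move=> wz; have [hx hy] := lift_cvg z0.
have h1 := cvg_comp _ _ wz hx; have h2 := cvg_comp _ _ wz hy.
exact: (cvgB (cvgM (cvg_cst (cy m)) h1) (cvgM (cvg_cst (cx m)) h2)).
Qed.

(* A Moebius map sending m1 to 0 and m2 to infinity. *)
Definition mob (m1 m2 z : sphere) : C := cross m1 (Some 0) z / cross m2 (Some 0) z.

Lemma mobE m1 m2 z0 z : mob m1 m2 z = cross m1 z0 z / cross m2 z0 z.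
Proof.
have [u u0 [ex ey]] := @lift_scale R (Some 0) z0 z.
rewrite /mob /cross ex ey; have fac (a b x y : C) : a * (u * x) - b * (u * y) = u * (a * x - b * y) by ring.
by rewrite !fac -mulf_div divff// mul1r.
Qed.

Lemma mob_cvg (T : Type) (F : set_system T) (FF : Filter F) (w : T -> sphere) m1 m2 z0 :
  z0 <> m2 -> w @ F --> z0 -> mob m1 m2 (w t) @[t --> F] --> mob m1 m2 z0.
Proof.
move=> zm wz; rewrite (_ : (fun t => _) = fun t => cross m1 z0 (w t) / cross m2 z0 (w t)); last first.
  by apply/funext => t; exact: mobE.
rewrite (mobE _ _ z0); have c2 : cross m2 z0 z0 != 0 by apply/eqP => /cross_eq0.
have h1 : cross m1 z0 (w t) @[t --> F] --> cross m1 z0 z0 := cross_cvg FF (m := m1) wz.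
have h2 : cross m2 z0 (w t) @[t --> F] --> cross m2 z0 z0 := cross_cvg FF (m := m2) wz.
exact: (cvgM h1 (cvgV c2 h2)).
Qed.

Lemma mob_inj m1 m2 z w : m1 <> m2 -> z <> m2 -> w <> m2 -> mob m1 m2 z = mob m1 m2 w -> z = w.
Proof.
move=> m12 zm wm; rewrite /mob => /eqP; rewrite eqr_div; last 2 first.
- by apply/eqP => /cross_eq0.
- by apply/eqP => /cross_eq0.
move=> /eqP h; rewrite -(pt_lift (Some 0) z) -(pt_lift (Some 0) w).
apply/pt_eq; [exact: lift_neq0|exact: lift_neq0|].
have d : cx m1 * cy m2 - cy m1 * cx m2 != 0.
  rewrite subr_eq0; apply/eqP => e; apply: m12.
  by rewrite -(pt_lift (Some 0) m1) -(pt_lift (Some 0) m2); apply/pt_eq; [exact: lift_neq0|exact: lift_neq0|].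
apply: (mulfI d); move: h; rewrite /cross => h; apply/eqP; rewrite -subr_eq0.
move/eqP: h; rewrite -subr_eq0 => /eqP h; apply/eqP.
by rewrite -h; ring.
Qed.

Lemma mob_eq0 m1 m2 z : m1 <> m2 -> z <> m2 -> mob m1 m2 z = 0 -> z = m1.
Proof.
move=> m12 zm /eqP; rewrite mulf_eq0 invr_eq0 => /orP[/eqP/cross_eq0//|/eqP/cross_eq0//].
Qed.

Lemma mobV m1 m2 z : (mob m1 m2 z)^-1 = mob m2 m1 z.
Proof. by rewrite /mob invf_div. Qed.

Definition fnum c m n : {poly C} := cy m *: (iterp c n).1 - cx m *: (iterp c n).2.

Lemma fnum_eq0 c m n u : (fnum c m n).[u] = 0 <-> iter n f (kappa c u) = m.
Proof.
have [nz ->] := iterpE c n u.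
rewrite -{2}(pt_lift (Some 0) m) (pt_eq nz (@lift_neq0 _ _ _)) /fnum hornerD hornerN !hornerZ.
split=> [/eqP|e]; first by rewrite subr_eq0 => /eqP e; rewrite mulrC e mulrC.
by rewrite mulrC e mulrC subrr.
Qed.

Lemma rf_fnum c m m' n u : rf (fnum c m n) (fnum c m' n) u = mob m m' (iter n f (kappa c u)).
Proof.
have [nz E] := iterpE c n u.
rewrite E /rf /fnum !hornerD !hornerN !hornerZ; set x := _.[u] in nz *; set y := _.[u] in nz *.
have [v v0 [ex ey]] : exists2 v : C, v != 0 & cx (pt x y) = v * x /\ cy (pt x y) = v * y.
  rewrite /pt; have [y0|y0] := eqVneq y 0.
    have x0 : x != 0 by apply/eqP => x0; apply: nz.
    by exists x^-1; rewrite ?invr_neq0//= y0 mulr0 mulVf.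
  by exists y^-1; rewrite ?invr_neq0//= mulVf// mulrC.
rewrite /mob /cross ex ey; have fac (a b : C) : a * (v * x) - b * (v * y) = v * (a * x - b * y) by ring.
by rewrite !fac -mulf_div divff// mul1r.
Qed.

(** At a limit m' the reciprocal Moebius map would tend to 0, although M bounds it away from 0. *)
Lemma mob_bounded_lim (T : Type) (F : set_system T) (FF : ProperFilter F) (w : T -> sphere)
    m m' (M : R) (p : sphere) : m <> m' -> w @ F --> p ->
  (\forall t \near F, [/\ w t <> m, w t <> m' & nm (mob m m' (w t)) <= M]) -> p <> m'.
Proof.
move=> mm wp h pm'; have F' : Filter F by exact _.
have pm : p <> m by rewrite pm' => /esym.
have c := mob_cvg F' (m1 := m') pm wp.
have c0 : mob m' m p = 0.
  by rewrite pm' /mob (_ : cross m' _ _ = 0) ?mul0r//; exact/cross_eq0.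
rewrite c0 in c; have d0 : 0 < (`|M| + 1)^-1 by rewrite invr_gt0 ltr_wpDl.
have /nm_cvgP/(_ _ d0) h1 := c.
have [t [[t1 t2 t3]]] := filter_ex (filterI h h1).
rewrite sub0r nmN -mobV nmV ltf_pV2 ?posrE ?ltr_wpDl//.
  by have := ler_norm M; lra.
rewrite lt_neqAle nm_ge0 andbT eq_sym; apply/eqP => /nm0_eq0 e; exact: (t1 (mob_eq0 mm t2 e)).
Qed.

(** * Iterates near a point that omit two values *)

Section omitted_values.
Variables (c : sphere) (rho : R).
Hypothesis rho0 : 0 < rho.
Hypothesis equi : forall u : C, nm u <= rho -> u != 0 -> equicontinuous_iterates f (kappa c u).
Context {G : set_system (sphere * nat)} {GU : UltraFilter G}.

Let omits m := forall (u : C) n, nm u <= 2 * rho -> iter n f (kappa c u) <> m.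

Let lim_ex (w : sphere * nat -> sphere) : exists l : sphere, w @ G --> l.
Proof. exact: sphere_ultra. Qed.

(** The limit of the iterates along the second component of G. Compactness makes it exist
    everywhere; no uniformity is known at 0, the one point of the disc where equicontinuity is in
    question. *)
Let g (u : C) : sphere := xget (None : sphere) [set l : sphere | iter t.2 f (kappa c u) @[t --> G] --> l].

Let gP u : iter t.2 f (kappa c u) @[t --> G] --> g u.
Proof.
rewrite /g; case: xgetP => [l _ //|h].
by have [l hl] := lim_ex (fun t => iter t.2 f (kappa c u)); case: (h l).
Qed.

Let gP2 (v : sphere * nat -> C) u : nm u <= rho -> u != 0 -> v @ G --> u ->
  iter t.2 f (kappa c (v t)) @[t --> G] --> g u.
Proof.
move=> ur u0 vu; have [l hl] := lim_ex (fun t => iter t.2 f (kappa c (v t))).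
suff <- : l = g u by [].
apply: (chord_lim _ hl (@gP u)) => e e0.
have /equiP/(_ e e0) h := equi ur u0.
have := cvg_comp _ _ vu (@kappa_continuous c u) _ h.
by rewrite /=; apply: filterS => t; exact.
Qed.

(** Let v n be a point of the circle where the Moebius image of the n-th iterate is largest. Along G
    these points tend to some u, and by equicontinuity the iterates at v n tend to g u, away from
    the pole m'. *)
Let circle_bound m m' : (forall u : C, nm u = rho -> g u <> m') -> omits m' ->
  exists M : R, \forall t \near G, forall u : C, nm u = rho ->
    nm (rf (fnum c m t.2) (fnum c m' t.2) u) <= M.
Proof.
move=> gm om; pose K : set C := [set u | nm u = rho].
have cK : compact K.
  apply: (subclosed_compact _ (@complex_compact_ball R rho)); last by move=> u; rewrite /K/= => ->.
  have -> : K = (fun z : C => nm z) @^-1` [set rho] by [].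
  apply: closed_comp; first by move=> z _; exact: nm_continuous.
  by apply: compact_closed; [exact: Rhausdorff|exact: compact_set1].
have K0 : K !=set0 by exists ((rho%:C)%C); rewrite /K/= nmR gtr0_norm.
have /choice[v hv] : forall n : nat, exists v : C, K v /\ forall u : C, K u ->
    nm (rf (fnum c m n) (fnum c m' n) u) <= nm (rf (fnum c m n) (fnum c m' n) v).
  move=> n; have [|v Kv hv] := compact_argmax cK K0 (g := fun u => nm (rf (fnum c m n) (fnum c m' n) u)).
    apply: continuous_in_subspaceT => u; rewrite inE => Ku.
    apply: (nm_cvg (nbhs_filter u)); apply: rf_cvg; apply/eqP => /fnum_eq0.
    by apply: om; rewrite Ku; have := rho0; lra.
  by exists v.
have vU := fmap_ultra (fun t : sphere * nat => v t.2) GU.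
have [u [Ku vu]] : exists u, K u /\ v t.2 @[t --> G] --> u.
  move: cK; rewrite compact_ultra => /(_ _ vU)[|u [Ku vu]]; last by exists u.
  exact: (@filterE _ G _ [set t | K (v t.2)] (fun t => proj1 (hv t.2))).
have u0 : u != 0.
  by apply/eqP => u0; move: Ku rho0; rewrite u0 /K/= nm0 => ->; rewrite ltxx.
have GF : Filter G by exact _.
have h1 := gP2 (le_of_eq Ku) u0 vu.
have /nm_cvgP/(_ _ ltr01) h2 := mob_cvg GF (m1 := m) (gm _ Ku) h1.
exists (nm (mob m m' (g u)) + 1); apply: filterS h2 => t ht w Kw.
apply: le_trans (proj2 (hv t.2) w Kw) _; rewrite rf_fnum.
set x := mob m m' (g u) in ht *; set y := mob m m' _ in ht *.
have := nmD x (- (x - y)); rewrite nmN opprB addrC subrK; lra.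
Qed.

(** As m' is omitted there are no poles, so the bound on the circle holds on the disc by the maximum
    principle. The estimate of [schwarz] at 0 then makes the iterates at y and at c merge. *)
Let circle_case m m' (p q : sphere) : m <> m' -> omits m -> omits m' ->
  (forall u : C, nm u = rho -> g u <> m') ->
  fst @ G --> c -> iter t.2 f t.1 @[t --> G] --> p -> iter t.2 f c @[t --> G] --> q -> p = q.
Proof.
move=> mm om om' gm yc yp cq; have GF : Filter G by exact _.
have [M hM] := circle_bound m gm om'.
have nz (n : nat) (u : C) : disc 0 rho u -> (fnum c m' n).[u] != 0.
  rewrite /disc/= subr0 => ur; apply/eqP => /fnum_eq0; apply: om'.
  by have := rho0; lra.
have {}hM : \forall t \near G, forall u, disc 0 rho u ->
    nm (rf (fnum c m t.2) (fnum c m' t.2) u) <= M.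
  apply: filterS hM => t ht; apply: (max_principle rho0 (nz t.2)) => u ur.
  by apply: ht; rewrite -ur subr0.
have d0 : disc 0 rho (0 : C) by rewrite /disc/= subrr nm0 ltW.
have M0 : 0 <= M.
  by have [t ht] := filter_ex hM; apply: le_trans (nm_ge0 _) (ht 0 d0).
pose v (t : sphere * nat) : C := den c t.1.
have v0 : v @ G --> (0 : C) by exact: (cvg_comp _ _ yc (@den_cvg R c)).
have vd : \forall t \near G, disc 0 rho (v t).
  have /nm_cvgP/(_ _ rho0) := v0; apply: filterS => t; rewrite /disc/= sub0r nmN subr0.
  exact: ltW.
have vk : \forall t \near G, kappa c (v t) = t.1.
  have h : \forall t \near G, in_chart c t.1 := yc _ (@chart_near c).
  by apply: filterS h => t; exact: kappa_den.
have pm : p <> m'.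
  apply: (mob_bounded_lim _ mm yp (M := M)).
  apply: filterS (filterI hM (filterI vd vk)) => t [h1 [h2 h3]].
  have v2 : nm (v t) <= 2 * rho by move: h2; rewrite /disc/= subr0; have := rho0; lra.
  rewrite -h3; split; [exact: om|exact: om'|].
  by rewrite -rf_fnum; exact: h1.
have qm : q <> m'.
  apply: (mob_bounded_lim _ mm cq (M := M)).
  apply: filterS hM => t h1; have n0 : nm (0 : C) <= 2 * rho by rewrite nm0 mulr_ge0// ltW.
  rewrite -(kappa0 c); split; [exact: om|exact: om'|].
  by rewrite -rf_fnum; exact: h1.
apply: (mob_inj mm pm qm).
have c1 := mob_cvg GF (m1 := m) pm yp; have c2 := mob_cvg GF (m1 := m) qm cq.
have c3 : mob m m' (iter t.2 f t.1) - mob m m' (iter t.2 f c) @[t --> G] --> mob m m' p - mob m m' q.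
  exact: (cvgB c1 c2).
suff c4 : mob m m' (iter t.2 f t.1) - mob m m' (iter t.2 f c) @[t --> G] --> (0 : C).
  by apply/eqP; rewrite -subr_eq0; apply/eqP; exact: (cvg_unique (@complex_hausdorff R) c3 c4).
apply/nm_cvgP => e e0; pose L := 2 * M / rho + 1.
have L0 : 0 < L by rewrite ltr_wpDl// divr_ge0 ?mulr_ge0// ltW.
have /nm_cvgP/(_ _ (divr_gt0 e0 L0)) h := v0.
apply: filterS (filterI (filterI h hM) (filterI vd vk)) => t [[h1 h2] [h3 h4]].
have [E [E1 E2]] := schwarz rho0 (nz t.2) h2.
have := E2 _ h3; rewrite !rf_fnum h4 kappa0 => ->.
rewrite sub0r nmN addrAC subrr add0r nmM subr0.
rewrite sub0r nmN ltr_pdivlMr// in h1; apply: le_lt_trans h1.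
rewrite ler_wpM2l ?nm_ge0//; apply: le_trans (E1 _ h3) _; rewrite /L; lra.
Qed.

(** Equicontinuity keeps the iterates near the limit m' on a small disc around u, where the Moebius
    map sending m' to 0 is bounded and never 0. By [hurwitz] its limit vanishes on half of that
    disc. *)
Let near_eq m m' (u : C) : m <> m' -> omits m -> omits m' -> nm u <= rho -> u != 0 ->
  g u = m' -> \forall v \near u, g v = m'.
Proof.
move=> mm om om' ur u0 gu; have GF : Filter G by exact _.
have mm' : m' <> m by move=> /esym.
have mob0 : mob m' m m' = 0 by rewrite /mob (_ : cross m' _ _ = 0) ?mul0r//; exact/cross_eq0.
have N1 : nbhs m' [set w | nm (mob m' m w) <= 1].
  have Fm : Filter (nbhs m') by exact: nbhs_filter.
  have c1 : mob m' m w @[w --> m'] --> mob m' m m' := mob_cvg Fm (w := id) mm' cvg_id.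
  rewrite mob0 in c1.
  have /nm_cvgP/(_ _ ltr01) := c1; apply: filterS => w; rewrite sub0r nmN; exact: ltW.
have [e e0 he] := chord_sep N1.
have /equiP/(_ e e0) h := equi ur u0.
have /nm_nbhsP[r0 r00 hr0] : \forall v \near u, forall n, chord (iter n f (kappa c v)) (iter n f (kappa c u)) < e.
  exact: (@kappa_continuous c u _ h).
pose r := Num.min (r0 / 2) rho; have r_gt0 : 0 < r by rewrite lt_min rho0 divr_gt0.
have r1 : r < r0 by rewrite /r gt_min; apply/orP; left; lra.
have r2 : r <= rho by rewrite /r ge_min lexx orbT.
have gu' := @gP u; rewrite gu in gu'.
have nz : \forall t \near G, forall v, disc u r v ->
    [/\ (fnum c m' t.2).[v] != 0, (fnum c m t.2).[v] != 0 & nm (rf (fnum c m' t.2) (fnum c m t.2) v) <= 1].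
  have h1 : \forall t \near G, forall w', chord w' (iter t.2 f (kappa c u)) < e -> nm (mob m' m w') <= 1 := gu' _ he.
  apply: filterS h1 => t ht v; rewrite /disc/= => vr.
  have v2 : nm v <= 2 * rho by have := nmD (v - u) u; rewrite subrK; lra.
  split; first by apply/eqP => /fnum_eq0; exact: om'.
    by apply/eqP => /fnum_eq0; exact: om.
  by rewrite rf_fnum; apply: ht; apply: hr0; rewrite nmB; exact: le_lt_trans r1.
have lim0 : rf (fnum c m' t.2) (fnum c m t.2) u @[t --> G] --> (0 : C).
  have c2 := mob_cvg GF (m1 := m') mm' gu'; rewrite mob0 in c2.
  by rewrite (_ : (fun t => _) = fun t => mob m' m (iter t.2 f (kappa c u)))//; apply/funext => t; exact: rf_fnum.
apply/nm_nbhsP; exists (r / 2); first by rewrite divr_gt0.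
move=> v vr; rewrite nmB in vr.
have c3 := @hurwitz R _ G GU _ _ _ _ _ r_gt0 ler01 nz lim0 v vr.
have {}c3 : mob m' m (iter t.2 f (kappa c v)) @[t --> G] --> (0 : C).
  by rewrite (_ : (fun t => _) = fun t => rf (fnum c m' t.2) (fnum c m t.2) v)//; apply/funext => t; rewrite rf_fnum.
have gvm : g v <> m.
  apply: (mob_bounded_lim _ mm' (@gP v) (M := 1)); apply: filterS nz => t /(_ v)[].
    by rewrite /disc/=; lra.
  move=> h1 h2; rewrite rf_fnum => h3; split => //.
    by move=> e1; case/negP: h1; apply/eqP/fnum_eq0.
  by move=> e1; case/negP: h2; apply/eqP/fnum_eq0.
apply: (mob_eq0 mm' gvm).
exact: (cvg_unique (@complex_hausdorff R) (mob_cvg GF (m1 := m') gvm (@gP v)) c3).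
Qed.

Let near_neq m (u : C) : nm u <= rho -> u != 0 -> g u <> m -> \forall v \near u, g v <> m.
Proof.
move=> ur u0 gum; have GF : Filter G by exact _.
have N1 : nbhs (g u) [set w : sphere | w <> m].
  apply: open_nbhs_nbhs; split => //.
  have -> : [set w : sphere | w <> m] = ~` [set m] by [].
  rewrite openC; apply: compact_closed; first exact: sphere_hausdorff.
  exact: compact_set1.
have [e e0 he] := chord_sep N1; have {}he := nbhs_singleton he.
have e20 : 0 < e / 2 by rewrite divr_gt0.
have /equiP/(_ _ e20) h := equi ur u0.
have h1 : \forall v \near u, forall n, chord (iter n f (kappa c v)) (iter n f (kappa c u)) < e / 2.
  exact: (@kappa_continuous c u _ h).
apply: filterS h1 => v hv.
apply: he; rewrite ltNge; apply/negP => ev.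
have c1 := chord_cvg GF (@gP v) (@gP u).
have ev' : e / 2 < chord (g v) (g u) by lra.
have h1 : \forall t \near G, e / 2 < chord (iter t.2 f (kappa c v)) (iter t.2 f (kappa c u)).
  exact: cvgr_gt _ c1 _ ev'.
have [t] := filter_ex h1; have := hv t.2; rewrite /=; lra.
Qed.

(** Where the segment avoids 0, the set of points with g = m' is open by [near_eq] and closed by
    [near_neq]. *)
Let segment_eq m m' (u v : C) : m <> m' -> omits m -> omits m' -> nm u <= rho -> nm v <= rho ->
  (forall t : R, 0 <= t <= 1 -> u + (t%:C)%C * (v - u) != 0) -> g u = m' -> g v = m'.
Proof.
move=> mm om om' ur vr nz gu.
pose ga (t : R) : C := u + (t%:C)%C * (v - u).
have gac : continuous ga.
  move=> t; apply/nm_cvgP => e e0; have L0 : 0 < nm (v - u) + 1 by rewrite ltr_wpDl// nm_ge0.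
  have : (s : R) @[s --> t] --> t by exact: cvg_id.
  move/cvgrPdist_lt/(_ _ (divr_gt0 e0 L0)); apply: filterS => s hs.
  rewrite /ga opprD addrACA subrr add0r -mulrBl -rmorphB/= nmM nmR.
  rewrite ltr_pdivlMr// in hs; apply: le_lt_trans hs.
  by rewrite ler_wpM2l//; lra.
have gar t : 0 <= t <= 1 -> nm (ga t) <= rho.
  move=> /andP[t0 t1]; have -> : ga t = ((1 - t)%:C)%C * u + (t%:C)%C * v.
    by rewrite /ga rmorphB/= rmorph1; ring.
  apply: le_trans (nmD _ _) _; rewrite !nmM !nmR !ger0_norm ?subr_ge0//; nra.
pose S := [set t : R | 0 <= t <= 1 /\ g (ga t) = m'].
have oS t : 0 <= t <= 1 -> g (ga t) = m' -> \forall s \near t, g (ga s) = m'.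
  by move=> ht e; exact: (gac t _ (near_eq mm om om' (gar t ht) (nz t ht) e)).
have oN t : 0 <= t <= 1 -> g (ga t) <> m' -> \forall s \near t, g (ga s) <> m'.
  by move=> ht e; exact: (gac t _ (near_neq (gar t ht) (nz t ht) e)).
have : S = `[0, 1]%classic.
  apply: (@segment_connected R 0 1).
  - by exists 0; rewrite /S/= lexx ler01 /ga mul0r addr0.
  - exists ([set t : R | g (ga t) = m']^°); first exact: open_interior.
    apply/seteqP; split => t /=; rewrite in_itv/=.
      by move=> [ht e]; split => //; exact: oS.
    by move=> [ht /interior_subset].
  - exists (~` [set t : R | g (ga t) <> m']^°); first by apply: open_closedC; exact: open_interior.
    apply/seteqP; split => t /=; rewrite in_itv/=.
      by move=> [ht e]; split => // /interior_subset.
    by move=> [ht h]; split => //; apply: contrapT => /(oN t ht).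
move/seteqP => [_ /(_ 1)]; rewrite /= in_itv/= ler01 lexx => /(_ isT)[_].
by rewrite /ga mul1r addrC subrK.
Qed.

(** If g misses m1 or m2 on the circle, [circle_case] applies. It cannot take both values there:
    connectedness of the punctured disc would force them to coincide. *)
Lemma omitted_lim m1 m2 (p q : sphere) : m1 <> m2 -> omits m1 -> omits m2 ->
  fst @ G --> c -> iter t.2 f t.1 @[t --> G] --> p -> iter t.2 f c @[t --> G] --> q -> p = q.
Proof.
move=> m12 om1 om2 yc yp cq; have m21 : m2 <> m1 by move=> /esym.
have [[u1 [u1r gu1]]|h] := pselect (exists u, nm u = rho /\ g u = m2); last first.
  by apply: (circle_case m12 om1 om2 _ yc yp cq) => u ur gu; apply: h; exists u.
have [[u2 [u2r gu2]]|h] := pselect (exists u, nm u = rho /\ g u = m1); last first.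
  by apply: (circle_case m21 om2 om1 _ yc yp cq) => u ur gu; apply: h; exists u.
exfalso; apply: (m12); rewrite -gu2.
(* Two points of the circle that are not antipodal are joined by a segment that avoids 0. *)
have seg (u v : C) : nm u = rho -> nm v = rho -> u + v != 0 -> g u = m2 -> g v = m2.
  move=> ur vr uv; apply: (segment_eq m12 om1 om2); rewrite ?ur ?vr//.
  move=> t /andP[t0 t1]; apply/eqP => e.
  have {}e : ((1 - t)%:C)%C * u = - ((t%:C)%C * v).
    by apply/eqP; rewrite -subr_eq0 opprK -[X in _ == X]e rmorphB/= rmorph1; apply/eqP; ring.
  have := congr1 (@nm R C) e; rewrite nmN !nmM !nmR ur vr !ger0_norm ?subr_ge0// => e'.
  have {}e' : 1 - t = t by apply: (mulIf _ e'); rewrite gt_eqF.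
  have t2 : t = 2^-1 by lra.
  move: e; rewrite e' -mulrN => /mulfI h; move: uv; rewrite h ?addNr ?eqxx//.
  by rewrite (_ : 0 = (0%:C)%C)// t2; apply/eqP => /complexI/eqP; rewrite invr_eq0 pnatr_eq0.
have [e|] := eqVneq (u1 + u2) 0; last by move=> h; exact: (seg u1).
have u2E : u2 = - u1 by apply/eqP; rewrite -addr_eq0 addrC e.
have ni : nm ('i%C : C) = 1 by rewrite /nm normc_def/= expr0n/= expr1n add0r sqrtr1.
have iu : nm ('i%C * u1) = rho by rewrite nmM ni mul1r.
have u10 : u1 != 0 by apply/eqP => u0; move: u1r rho0; rewrite u0 nm0 => <-; rewrite ltxx.
have i1 : (1 + 'i%C : C) != 0 by rewrite eq_complex/= !add0r !addr0 oner_eq0.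
have i2 : ('i%C - 1 : C) != 0 by rewrite eq_complex/= oppr0 !add0r !addr0 oner_eq0 andbF.
(* Antipodal points are joined through i u1. *)
apply: (seg ('i%C * u1) u2) => //.
  by rewrite u2E -[X in _ - X]mul1r -mulrBl mulf_neq0.
by apply: (seg u1) => //; rewrite -[X in X + _]mul1r -mulrDl mulf_neq0.
Qed.

End omitted_values.

(** Suppose N meets J in c only. Then f is not equicontinuous at c, since otherwise the interior of
    N would be in the Fatou set; in particular c is not periodic. But iterates near c omit two
    points of J, which forces equicontinuity at c. *)
Theorem branch_julia_not_isolated c (N : set sphere) : julia f c -> branch_index f c <> 1%N ->
  nbhs c N -> exists x, [/\ N x, x <> c & julia f x].
Proof.
move=> Jc bc cN; apply: contrapT => h.
have {}h x : N x -> x <> c -> fatou f x.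
  by move=> Nx xc; apply: contrapT => Jx; apply: h; exists x.
have nequi : ~ equicontinuous_iterates f c.
  move=> ec; apply: Jc; exists N^°; last exact: cN.
  split; first exact: open_interior.
  move=> x /interior_subset Nx; have [->//|/eqP xc] := eqVneq x c.
  exact: fatou_equi (h x Nx xc).
have np p : iter p.+1 f c <> c by move=> pc; apply: nequi; exact: superattracting pc bc.
(* c not being periodic, m1 and m2 are distinct and off the forward orbit of c. The iterates of the
   other points near c stay in the Fatou set, so no point near c ever reaches m1 or m2. *)
have [m1 fm1] := f_surj PQ Q0 fN c; have [m2 fm2] := f_surj PQ Q0 fN m1.
have Jm1 : julia f m1 by apply/juliaE; rewrite fm1.
have Jm2 : julia f m2 by apply/juliaE; rewrite fm2.
have m12 : m1 <> m2.
  by move=> e; apply: (np 0%N); rewrite /= -{1}fm1 {1}e fm2 fm1.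
have : \forall u \near (0 : C), N (kappa c u).
  by apply: (@kappa_continuous c 0); rewrite kappa0.
move/nm_nbhsP => [r r0 rN].
(* The values must be omitted on radius 2 rho, and with rho = r / 4 this is r / 2 < r. *)
have rho0 : 0 < r / 4 by rewrite divr_gt0.
have inN (u : C) : nm u <= 2 * (r / 4) -> N (kappa c u).
  by move=> ur; apply: rN; rewrite sub0r nmN; have := r0; lra.
have om m (u : C) n : julia f m -> (forall k, iter k f c <> m) -> nm u <= 2 * (r / 4) ->
    iter n f (kappa c u) <> m.
  move=> Jm nm' ur e; have [uc|/eqP uc] := eqVneq (kappa c u) c.
    by apply: (nm' n); rewrite -e uc.
  by apply: Jm; rewrite -e; apply/fatou_iter; apply: h => //; exact: inN.
have equi (u : C) : nm u <= r / 4 -> u != 0 -> equicontinuous_iterates f (kappa c u).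
  move=> ur /eqP u0; apply/fatou_equi/h; last by move/kappa_inj0.
  by apply: inN; have := r0; lra.
apply: nequi; apply/equiP => e e0; apply: contrapT => bad.
pose D : set (sphere * nat) := [set t | ~ chord (iter t.2 f t.1) (iter t.2 f c) < e].
have FF : Filter (filter_prod (nbhs c) (globally [set: nat])) by exact: filter_prod_filter.
(* A failure of equicontinuity at c yields pairs (y, n) in D with y arbitrarily close to c; an
   ultrafilter finer than W is the one to which [omitted_lim] is applied. *)
pose W := within D (filter_prod (nbhs c) (globally [set: nat])).
have WP : ProperFilter W.
  apply: Build_ProperFilter_ex => B [[A1 A2] /= [cA1 A2T] AB].
  apply: contrapT => nB; apply: bad; apply: filterS cA1 => y A1y n.
  apply: contrapT => yn; apply: nB; exists (y, n); apply: AB => //=; split => //; exact: A2T.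
have [G [GU WG]] := ultraFilterLemma WP.
have yc : fst @ G --> c.
  move=> A cA; apply: WG; rewrite /W /within/=; exists (A, setT) => /=; first by split.
  by move=> [y n] /= [].
have [p yp] := sphere_ultra (fun t : sphere * nat => iter t.2 f t.1) GU.
have [q cq] := sphere_ultra (fun t : sphere * nat => iter t.2 f c) GU.
have pq : p = q.
  apply: (omitted_lim rho0 equi m12 _ _ yc yp cq) => u n.
    apply: om => // k e'; apply: (np k); by rewrite iterS e'.
  apply: om => // k e'; apply: (np k.+1); by rewrite 2!iterS e' fm2.
have GF : Filter G by exact _.
have c1 := chord_cvg GF yp cq; rewrite pq (_ : chord q q = 0) in c1; last exact/chord_eq0.
have h1 : \forall t \near G, chord (iter t.2 f t.1) (iter t.2 f c) < e by exact: cvgr_lt _ c1 _ e0.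
have h2 : G D by apply: WG; rewrite /W /within/=; apply: filterE.
by have [t []] := filter_ex (filterI h1 h2).
Qed.

End dynamics.

(** * Functions on the graph of a rational map *)

Section functions_on_sphere.
Context {R : realType}.
Local Notation C := (complex R).
Local Notation sphere := (riemann_sphere R).
Implicit Types (E L U : set sphere) (g h : sphere -> C).

Lemma RC_cvg (T : Type) (F : set_system T) (FF : Filter F) (u : T -> R) (l : R) :
  u @ F --> l -> (((u t)%:C)%C : C) @[t --> F] --> ((l%:C)%C : C).
Proof.
move=> /cvgrPdist_lt h; apply/nm_cvgP => e e0; apply: filterS (h e e0) => t.
by rewrite -rmorphB nmR.
Qed.

Lemma sphere_closed1 (x : sphere) : closed [set x].
Proof. by apply: compact_closed; [exact: sphere_hausdorff|exact: compact_set1]. Qed.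

Lemma sphere_closed_finite (A : set sphere) : finite_set A -> closed A.
Proof.
move=> /finite_setP[n]; elim: n A => [|n ih] A.
  by rewrite II0 card_eq0 => /eqP ->; exact: closed0.
move=> /eq_cardSP[x Ax /ih cA]; rewrite -(setD1K Ax).
by apply: closedU => //; exact: sphere_closed1.
Qed.

Lemma urysohn_sphere (A B : set sphere) : closed A -> closed B -> A `&` B = set0 ->
  exists g : sphere -> R, [/\ continuous g, forall x, 0 <= g x <= 1,
    forall x, A x -> g x = 0 & forall x, B x -> g x = 1].
Proof.
move=> cA cB AB; have nS : normal_space sphere.
  exact: compact_normal (@sphere_hausdorff R) (@sphere_compact R).
have /(@uniform_separatorP _ R)[g [cg g01 g0 g1]] := normal_uniform_separator nS cA cB AB.
exists g; split => //.
- by move=> x; have := g01 (g x); rewrite /= in_itv/=; apply; exists x.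
- by move=> x Ax; apply: g0; exists x.
- by move=> x Bx; apply: g1; exists x.
Qed.

Lemma bump_exists (x : sphere) (N : set sphere) : nbhs x N ->
  exists g : sphere -> R, [/\ continuous g, forall y, 0 <= g y <= 1,
    g x = 1 & forall y, ~ N y -> g y = 0].
Proof.
move=> xN; have [|||g [cg g01 g0 g1]] := @urysohn_sphere (~` N^°) [set x].
- by apply: open_closedC; exact: open_interior.
- exact: sphere_closed1.
- by apply/seteqP; split => // y [/= yN yx]; apply: yN; rewrite yx.
exists g; split => //; first exact: g1.
by move=> y Ny; apply: g0 => /interior_subset.
Qed.

Lemma is_C0_closed_ext L g : closed L -> is_C0 L g ->
  exists2 G, continuous G & forall x, L x -> G x = g x.
Proof.
move=> cL gC0; have [g0 gc gv] := gC0.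
have [M [M0 gM]] := is_C0_bounded gC0.
have nS : normal_space sphere.
  exact: compact_normal (@sphere_hausdorff R) (@sphere_compact R).
have ME : M = ((complex.Re M)%:C)%C by rewrite RRe_real// gtr0_real.
have M1 : 0 < complex.Re M by rewrite -ltcR -ME.
have part (p : C -> R) : (forall z w, `|p z - p w| <= nm (z - w)) -> p 0 = 0 ->
    exists G : sphere -> R, continuous G /\ forall x, L x -> G x = p (g x).
  move=> lip p0.
  have pc : {within L, continuous (fun x => p (g x) : R^o)}.
    apply/subspace_continuousP => x Lx; move/subspace_continuousP : gc => /(_ x Lx) gx.
    have Fx : Filter (within L (nbhs x)) by exact: within_filter.
    apply/cvgrPdist_lt => e e0; have /nm_cvgP/(_ _ e0) := gx.
    by apply: filterS => y; apply: le_lt_trans; exact: lip.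
  have pM x : L x -> `|p (g x) : R^o| <= complex.Re M.
    move=> _; have := lip (g x) 0; rewrite p0 !subr0 => /le_trans; apply.
    by rewrite -lecR -normE -ME.
  have [G [Gg cG _]] := continuous_bounded_extension nS cL M1 pc pM.
  by exists G; split => // x Lx; rewrite -Gg// inE.
have [||G1 [cG1 hG1]] := part (@complex.Re R).
- move=> z w; rewrite -lecR -normE; apply: le_trans (Re_le_norm _).
  by case: z w => [? ?] [? ?].
- by [].
have [||G2 [cG2 hG2]] := part (@complex.Im R).
- move=> z w; rewrite -lecR -normE; apply: le_trans (Im_le_norm _).
  by case: z w => [? ?] [? ?].
- by [].
exists (fun x => (G1 x +i* G2 x)%C).
  move=> x; have Fx : Filter (nbhs x) by exact: nbhs_filter.
  have -> : (fun y => (G1 y +i* G2 y)%C) = fun y => ((G1 y)%:C)%C + 'i%C * ((G2 y)%:C)%C.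
    by apply/funext => y; simpc.
  have h1 := RC_cvg Fx (cG1 x); have h2 := RC_cvg Fx (cG2 x).
  exact: (cvgD h1 (cvgM (cvg_cst 'i%C) h2)).
by move=> x Lx; rewrite hG1// hG2//; case: (g x).
Qed.

Section tame.
Variables (E L U : set sphere).
Hypotheses (EE : E = L `&` U) (cL : closed L) (oU : open U) (LU : U = setT \/ L = setT).

(** Every case is reduced to continuous functions on the whole sphere: for E = L closed this is the
    Tietze extension, and for E = U open extension by 0 is already continuous because of the decay
    at the boundary. *)
Lemma is_C0P g : is_C0 E g <-> exists G : sphere -> C, [/\ continuous G,
  forall x, ~ U x -> G x = 0, forall x, E x -> g x = G x & forall x, ~ E x -> g x = 0].
Proof.
rewrite EE; split=> [gC0|[G [cG G0 gG g0]]]; last first.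
  split; first exact: g0.
    apply: (@subspace_eq_continuous _ _ _ G); first by move=> x; rewrite inE => /gG.
    exact: continuous_subspaceT.
  move=> e e0; have eE : e = ((complex.Re e)%:C)%C by rewrite RRe_real// gtr0_real.
  have e1 : 0 < complex.Re e by rewrite -ltcR -eE.
  exists (L `&` [set x | complex.Re e <= nm (G x)]); split.
  - apply: (subclosed_compact _ (@sphere_compact R)) => //; apply: closedI => //.
    have -> : [set x | complex.Re e <= nm (G x)] = (fun x => nm (G x)) @^-1` [set r : R | complex.Re e <= r] by [].
    apply: closed_comp; last exact: closed_ge.
    by move=> x _; exact: (nm_cvg (nbhs_filter x) (cG x)).
  - move=> x [Lx /= xe]; split => //; apply: contrapT => /G0 Gx.
    by move: xe; rewrite Gx nm0 leNgt e1.
  - move=> x [Lx Ux] nK; rewrite gG// eE normE ltcR ltNge; apply/negP => h.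
    by apply: nK.
case: LU => [UT|LT].
  have EL : L `&` U = L by rewrite UT setIT.
  move: gC0; rewrite EL => gC0; have [G cG hG] := is_C0_closed_ext cL gC0.
  exists G; split => //; [by move=> x []; rewrite UT|by move=> x /hG|by case: gC0].
have EU : L `&` U = U by rewrite LT setTI.
move: gC0; rewrite EU => -[g0 gc gv]; exists g; split => // x.
have Fx : Filter (nbhs x) by exact: nbhs_filter.
have [Ux|Ux] := pselect (U x).
  have := oU; rewrite openE => /(_ x Ux) nU.
  move/subspace_continuousP : gc => /(_ x Ux) gx A /gx h.
  have {}h : \forall y \near x, U y -> A (g y) := h.
  by apply: (filterS _ (filterI nU h)) => y [Uy]; exact.
apply/cvgrPdist_lt => e e0; have [K [cK KU Kg]] := gv e e0.
have oK : open (~` K) by rewrite openC; apply: compact_closed => //; exact: sphere_hausdorff.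
have : nbhs x (~` K) by apply: open_nbhs_nbhs; split => // /KU.
apply: filterS => y nK; rewrite g0// sub0r normrN.
have [Uy|Uy] := pselect (U y); first exact: Kg.
by rewrite g0// normr0.
Qed.

End tame.

End functions_on_sphere.

(** Lets the sphere, the Fatou set (the open part U) and the Julia set (the closed part L) be
    treated at once; invariance of both parts puts whole fibres inside or outside E. *)
Record tame (R : realType) (f : riemann_sphere R -> riemann_sphere R)
    (E L U : set (riemann_sphere R)) : Prop := Tame {
  tame_eq : E = L `&` U;
  tame_closed : closed L;
  tame_open : open U;
  tame_or : U = setT \/ L = setT;
  tame_invL : forall x, L (f x) <-> L x;
  tame_invU : forall x, U (f x) <-> U x
}.

Section graph_modules.
Context {R : realType}.
Local Notation C := (complex R).
Local Notation sphere := (riemann_sphere R).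
Variables (P Q : {poly C}).
Local Notation f := (@rational_map R P Q).
Hypotheses (PQ : coprimep P Q) (Q0 : Q != 0) (fN : ~ exists c, forall z, f z = c).
Variables (E L U : set sphere).
Hypothesis HE : tame f E L U.
Let EE := tame_eq HE.
Let cL := tame_closed HE.
Let oU := tame_open HE.
Let LU := tame_or HE.
Let invL := tame_invL HE.
Let invU := tame_invU HE.
Local Notation D := (C0 R E).
Local Notation Z := (C0 R (graph_on f E)).
Local Notation tr := (transfer P Q).

Lemma invE x : E (f x) <-> E x.
Proof. by rewrite EE /setI/= (propext (invL x)) (propext (invU x)). Qed.

Lemma C0_nm_ub (g : D) x : nm (g x) <= nm g.
Proof. by rewrite -lecR -!normE; exact: C0_norm_ub. Qed.

Lemma C0_nm_le (g : D) (M : R) : 0 <= M -> (forall x, nm (g x) <= M) -> nm g <= M.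
Proof.
move=> M0 h; rewrite -lecR -normE; apply: C0_norm_le; first by rewrite lecR.
by move=> x; rewrite normE lecR.
Qed.

(* Z_E is identified with C_0(E) through x |-> (x, f x). *)
Definition tf (xi : Z) (x : sphere) : C := xi (x, f x).

Lemma graphP x : graph_on f E (x, f x) <-> E x.
Proof. by split=> [[]//|Ex]; split => //=; exact/invE. Qed.

Let pairc x : (y, f y) @[y --> x] --> (x, f x).
Proof.
have h : (y : sphere) @[y --> x] --> x by exact: cvg_id.
exact: (cvg_pair h (f_continuous PQ Q0 (x := x))).
Qed.

Lemma tf_C0 xi : is_C0 E (tf xi).
Proof.
have [xi0 xic xiv] := C0P xi; split.
- by move=> x Ex; apply: xi0 => /graphP.
- apply/subspace_continuousP => x Ex.
  move/subspace_continuousP : xic => /(_ (x, f x) ((graphP x).2 Ex)) h.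
  move=> A /h; rewrite /nbhs/= /within/= => hA.
  have hp : \forall y \near x, graph_on f E (y, f y) -> A (tf xi y) := pairc hA.
  change (\forall y \near x, E y -> A (tf xi y)).
  by apply: filterS hp => y hy Ey; apply: hy; exact/graphP.
- move=> e e0; have [K [cK KG Kxi]] := xiv e e0; exists (fst @` K); split.
  + apply: continuous_compact => //; apply: continuous_subspaceT => p; exact: cvg_fst.
  + by move=> _ [p /KG[]] Ep _ _ <-.
  + move=> x Ex Kx; apply: Kxi; first exact/graphP.
    by move=> Kp; apply: Kx; exists (x, f x).
Qed.

Definition mkZ (g : sphere -> C) : Z :=
  mkC0 (graph_on f E) (fun p => if `[< graph_on f E p >] then g p.1 else 0).

Lemma mkZ_fun (g : sphere -> C) : is_C0 E g -> is_C0 (graph_on f E) (fun p : sphere * sphere => if `[< graph_on f E p >] then g p.1 else 0).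
Proof.
move=> [g0 gc gv]; split.
- by move=> p Gp; case: asboolP.
- apply/subspace_continuousP => p Gp; have Ep : E p.1 by case: Gp.
  move/subspace_continuousP : gc => /(_ p.1 Ep) h.
  move=> A; rewrite /from_subspace (asboolT Gp) => /h hA; have {}hA : \forall x \near p.1, E x -> A (g x) := hA.
  have c1 : q.1 @[q --> p] --> p.1 by exact: cvg_fst.
  have hq : \forall q \near p, E q.1 -> A (g q.1) := c1 _ hA.
  change (\forall q \near p, graph_on f E q -> A (if `[< graph_on f E q >] then g q.1 else 0)).
  by apply: filterS hq => q hq Gq; rewrite (asboolT Gq); apply: hq; case: Gq.
- move=> e e0; have [K [cK KE Kg]] := gv e e0; exists ((fun x => (x, f x)) @` K); split.
  + by apply: continuous_compact => //; apply: continuous_subspaceT => x; exact: pairc.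
  + by move=> _ [x /KE Ex <-]; exact/graphP.
  + move=> p Gp Kp; rewrite (asboolT Gp); have [Ep _ pE] := Gp; apply: Kg => // Kp1.
    by apply: Kp; exists p.1 => //; rewrite -pE; case: (p).
Qed.

Lemma tf_mkZ g : is_C0 E g -> tf (mkZ g) = g.
Proof.
move=> gC0; apply/funext => x; rewrite /tf /mkZ mkC0E; last exact: mkZ_fun.
by case: asboolP => //= Gx; have [-> //] := gC0 => Ex; apply: Gx; exact/graphP.
Qed.

Lemma Z_ext (xi eta : Z) : tf xi =1 tf eta -> xi = eta.
Proof.
move=> h; apply: C0_ext => -[x y].
have [xi0 _ _] := C0P xi; have [eta0 _ _] := C0P eta.
have [Gp|Gp] := pselect (graph_on f E (x, y)); last by rewrite xi0// eta0.
by have [_ _ /= ->] := Gp; exact: h.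
Qed.

Lemma transfer_invE g y : ~ E y -> (forall x, ~ E x -> g x = 0) -> tr g y = 0.
Proof.
move=> Ey g0; rewrite /transfer big1_seq// => x /andP[_]; rewrite mem_rts// => /eqP fx.
by apply: g0 => /invE; rewrite fx.
Qed.

Lemma eq_transfer g h y : (forall x, f x = y -> g x = h x) -> tr g y = tr h y.
Proof. by move=> gh; apply: eq_big_seq => x; rewrite mem_rts// => /eqP; exact: gh. Qed.

(** It is through this that [mkC0] in [graph_ip] returns the intended sum. The extension G is
    transferred on the sphere, and fibres over E lie in E. *)
Lemma transfer_C0 g : is_C0 E g -> is_C0 E (tr g).
Proof.
move=> /(is_C0P EE cL oU LU)[G [cG G0 gG g0]]; apply/(is_C0P EE cL oU LU).
exists (tr G); split.
- exact: transfer_continuous.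
- move=> y Uy; rewrite /transfer big1_seq// => x /andP[_]; rewrite mem_rts// => /eqP fx.
  by apply: G0 => /invU; rewrite fx.
- by move=> y Ey; apply: eq_transfer => x fx; apply: gG; apply/invE; rewrite fx.
- by move=> y Ey; exact: transfer_invE.
Qed.

Lemma C0_conjM (g h : sphere -> C) : is_C0 E g -> is_C0 E h -> is_C0 E (fun x => (g x)^* * h x).
Proof.
move=> /is_C0_star g' h'; pose a : D := MkC0 (asboolT g'); pose b : D := MkC0 (asboolT h').
exact: (@is_C0_mul R sphere E a b).
Qed.

Lemma C0_mulfun (g h : sphere -> C) : is_C0 E g -> is_C0 E h -> is_C0 E (fun x => g x * h x).
Proof.
move=> g' h'; pose a : D := MkC0 (asboolT g'); pose b : D := MkC0 (asboolT h').
exact: (@is_C0_mul R sphere E a b).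
Qed.

Local Notation ip := (@graph_ip R f E).

Lemma graph_ipE xi eta y : ip xi eta y = tr (fun x => (tf xi x)^* * tf eta x) y.
Proof.
have h z : \sum_(x \in f @^-1` [set z]) (branch_index f x)%:R * (xi (x, z))^* * eta (x, z) =
    tr (fun x => (tf xi x)^* * tf eta x) z.
  rewrite -transferE//; apply: eq_fsbigr => x; rewrite inE /= => <-.
  by rewrite mulrA.
rewrite /graph_ip mkC0E ?h//; rewrite (funext h).
by apply: transfer_C0; apply: C0_conjM; exact: tf_C0.
Qed.

Lemma transferD g h y : tr (fun x => g x + h x) y = tr g y + tr h y.
Proof. by rewrite /transfer big_split. Qed.

Lemma transferZ (c : C) g y : tr (fun x => c * g x) y = c * tr g y.
Proof. by rewrite /transfer big_distrr. Qed.

Lemma nm_transfer g y : nm (tr g y) <= \sum_(x <- rts P Q y) nm (g x).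
Proof. exact: nm_sum. Qed.

Lemma tfD xi eta x : tf (xi + eta) x = tf xi x + tf eta x.
Proof. exact: C0_funD. Qed.
Lemma tfZ (c : C) xi x : tf (c *: xi) x = c * tf xi x.
Proof. exact: C0_funZ. Qed.
Lemma tfN xi x : tf (- xi) x = - tf xi x.
Proof. exact: C0_funN. Qed.
Lemma tf_lact a xi x : tf (graph_lact a xi) x = a x * tf xi x.
Proof. by []. Qed.
Lemma tf_ract xi b x : tf (graph_ract xi b) x = b (f x) * tf xi x.
Proof. by []. Qed.

(** The identity behind it is sum (A v - N u)^2 = A (AB - N^2); when A = 0 all u x vanish. *)
Lemma sum_CS (s : seq sphere) (u v : sphere -> R) :
  (\sum_(x <- s) u x * v x) ^+ 2 <= (\sum_(x <- s) u x ^+ 2) * (\sum_(x <- s) v x ^+ 2).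
Proof.
set A := \sum_(x <- s) u x ^+ 2; set B := \sum_(x <- s) v x ^+ 2; set N := \sum_(x <- s) _.
have A0 : 0 <= A by apply: sumr_ge0 => x _; exact: sqr_ge0.
have h : \sum_(x <- s) (A * v x - N * u x) ^+ 2 = A * (A * B - N ^+ 2).
  have -> : A * (A * B - N ^+ 2) = A ^+ 2 * B - 2 * A * N * N + N ^+ 2 * A by ring.
  have -> : A ^+ 2 * B = \sum_(x <- s) A ^+ 2 * v x ^+ 2 by rewrite big_distrr.
  have -> : 2 * A * N * N = \sum_(x <- s) 2 * A * N * (u x * v x) by rewrite big_distrr.
  have -> : N ^+ 2 * A = \sum_(x <- s) N ^+ 2 * u x ^+ 2 by rewrite big_distrr.
  by rewrite -sumrB -big_split/=; apply: eq_bigr => x _; ring.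
have h0 : 0 <= A * (A * B - N ^+ 2) by rewrite -h; apply: sumr_ge0 => x _; exact: sqr_ge0.
have [A1|] := ltrP 0 A; first by move: h0; rewrite pmulr_rge0// subr_ge0.
move=> A2; have {A2}AE : A = 0 by apply/le_anti; rewrite A2 A0.
have N0 : N = 0.
  rewrite /N big1_seq// => x /andP[_ xs].
  have : u x ^+ 2 <= A.
    rewrite /A (big_rem x)//= lerDl; apply: sumr_ge0 => z _; exact: sqr_ge0.
  rewrite AE => ux; have /eqP : u x ^+ 2 = 0 by apply/le_anti; rewrite ux sqr_ge0.
  by rewrite sqrf_eq0 => /eqP ->; rewrite mul0r.
by rewrite N0 AE mul0r expr0n.
Qed.

Lemma ip_diag xi y : nm (ip xi xi y) = \sum_(x <- rts P Q y) nm (tf xi x) ^+ 2.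
Proof.
rewrite graph_ipE /transfer -[RHS]ger0_norm; last by apply: sumr_ge0 => x _; exact: sqr_ge0.
rewrite -nmR rmorph_sum/=; congr nm; apply: eq_bigr => x _.
by rewrite mulrC -normCK normE rmorphXn.
Qed.

Lemma graph_pre_hilbert : pre_hilbert (graph_bimodule f E).
Proof.
split=> /=.
- move=> x y z; apply: C0_ext => t; rewrite C0_funD !graph_ipE -transferD.
  by apply: eq_transfer => w _; rewrite tfD mulrDr.
- move=> c x y; apply: C0_ext => t; rewrite C0_funZ !graph_ipE -transferZ.
  by apply: eq_transfer => w _; rewrite tfZ mulrCA.
- move=> x y b; apply: C0_ext => t; rewrite C0_mulE !graph_ipE mulrC -transferZ.
  by apply: eq_transfer => w <-; rewrite tf_ract mulrCA.
- move=> x y; apply: C0_ext => t; rewrite C0_starE !graph_ipE /transfer rmorph_sum/=.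
  by apply: eq_bigr => w _; rewrite rmorphM/= conjCK mulrC.
- move=> x y; rewrite -[leRHS]sqr_sqrtr ?mulr_ge0 ?nm_ge0//.
  rewrite ler_pXn2r ?nnegrE ?nm_ge0 ?sqrtr_ge0//.
  apply: C0_nm_le; first exact: sqrtr_ge0.
  move=> t; rewrite -(@ler_pXn2r _ 2) ?nnegrE ?nm_ge0 ?sqrtr_ge0//.
  rewrite sqr_sqrtr ?mulr_ge0 ?nm_ge0//.
  apply: (@le_trans _ _ (nm (ip x x t) * nm (ip y y t))); last first.
    by apply: ler_pM; rewrite ?nm_ge0 ?C0_nm_ub.
  rewrite (ip_diag x) (ip_diag y) (graph_ipE x y).
  apply: le_trans (sum_CS (rts P Q t) (fun w => nm (tf x w)) (fun w => nm (tf y w))).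
  rewrite ler_pXn2r ?nnegrE ?nm_ge0//; last by apply: sumr_ge0 => w _; rewrite mulr_ge0 ?nm_ge0.
  apply: le_trans (nm_transfer _ _) _; apply: ler_sum => w _.
  by rewrite nmM nmJ.
- move=> x b; apply: Z_ext => t; rewrite tf_ract.
  by rewrite (tfN x) (tfN (graph_ract x b)) tf_ract mulrN.
Qed.

(** A fibre has d points with multiplicity. Together with [tf_le_ip] this makes the module norm
    equivalent to the supremum norm. *)
Lemma ip_bound xi (M : R) : (forall x, nm (tf xi x) <= M) ->
  nm (ip xi xi) <= (rdeg P Q)%:R * M ^+ 2.
Proof.
move=> h; apply: C0_nm_le; first by rewrite mulr_ge0// sqr_ge0.
move=> y; rewrite ip_diag -(size_rts PQ Q0 fN y) -sum1_size natr_sum big_distrl/=.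
apply: ler_sum => x _; rewrite mul1r ler_pXn2r ?nnegrE ?nm_ge0//.
exact: le_trans (nm_ge0 _) (h x).
Qed.

Lemma tf_le_ip xi x : nm (tf xi x) ^+ 2 <= nm (ip xi xi).
Proof.
apply: le_trans (C0_nm_ub _ (f x)); rewrite ip_diag (big_rem x)/= ?mem_rts// lerDl.
by apply: sumr_ge0 => z _; exact: sqr_ge0.
Qed.

End graph_modules.

Lemma lerMn_nat (R : realType) (x : R) m n : 0 <= x -> (m <= n)%N -> x *+ m <= x *+ n.
Proof. by move=> x0 mn; rewrite -(mulr_natl x m) -(mulr_natl x n) ler_wpM2r// ler_nat. Qed.

Lemma divMl_mul (R : realType) (e k d : R) : 0 < d -> e / (k * d) * d = e / k.
Proof. by move=> d0; rewrite invfM mulrA mulfVK// gt_eqF. Qed.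

Lemma real_sum_cvg (R : realType) (I : eqType) (T : Type) (F : set_system T) (FF : Filter F)
    (s : seq I) (u : I -> T -> R) (l : I -> R) :
  (forall i, i \in s -> u i t @[t --> F] --> l i) ->
  \sum_(i <- s) u i t @[t --> F] --> \sum_(i <- s) l i.
Proof.
elim: s => [|i s ih] h.
  by rewrite big_nil; under eq_fun do rewrite big_nil; exact: cvg_cst.
rewrite big_cons; under eq_fun do rewrite big_cons.
have h1 : u i t @[t --> F] --> l i by apply: h; rewrite inE eqxx.
have h2 : \sum_(j <- s) u j t @[t --> F] --> \sum_(j <- s) l j.
  by apply: ih => j js; apply: h; rewrite inE js orbT.
exact: (cvgD h1 h2).
Qed.

(** * Functions whose left action is compact *)

Section compact_left_action.
Context {R : realType}.
Local Notation C := (complex R).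
Local Notation sphere := (riemann_sphere R).
Variables (P Q : {poly C}).
Local Notation f := (@rational_map R P Q).
Hypotheses (PQ : coprimep P Q) (Q0 : Q != 0) (fN : ~ exists c, forall z, f z = c).
Local Notation tr := (transfer P Q).
Local Notation rts := (rts P Q).

Lemma bump_sum_continuous (g : sphere -> R) : continuous g -> (forall x, 0 <= g x) ->
  continuous (fun y => \sum_(x <- rts y) g x).
Proof.
move=> cg g0 y; have Fy : Filter (nbhs y) by exact: nbhs_filter.
have cG : continuous (fun x => ((g x)%:C)%C : C).
  by move=> x; exact: (RC_cvg (nbhs_filter x) (cg x)).
have h := nm_cvg Fy (transfer_continuous PQ Q0 fN cG (x := y)).
have E z : \sum_(x <- rts z) g x = nm (tr (fun x => ((g x)%:C)%C) z).
  by rewrite /transfer -rmorph_sum/= nmR ger0_norm// sumr_ge0.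
move=> A; rewrite /= E => /h hA.
have {}hA : \forall z \near y, A (nm (tr (fun x => ((g x)%:C)%C) z)) := hA.
change (\forall z \near y, A (\sum_(x <- rts z) g x)).
by apply: filterS hA => z; rewrite -E.
Qed.

Lemma sum_ge_pair (g : sphere -> R) (s : seq sphere) p q : (forall x, 0 <= g x) ->
  p \in s -> q \in s -> p <> q -> g p + g q <= \sum_(x <- s) g x.
Proof.
move=> g0 ps qs pq; rewrite (big_rem p)//= lerD2l (big_rem q)//=.
  by rewrite lerDl sumr_ge0.
move: qs; rewrite (perm_mem (perm_to_rem ps)) inE => /orP[/eqP qp|//].
by case: pq.
Qed.

Lemma sum_count (V : zmodType) (g : sphere -> V) (s : seq sphere) p :
  (forall x, x \in s -> x <> p -> g x = 0) -> \sum_(x <- s) g x = g p *+ count_mem p s.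
Proof.
elim: s => [|x s ih] h; first by rewrite big_nil.
rewrite big_cons ih; last by move=> y ys; apply: h; rewrite inE ys orbT.
rewrite /= mulrnDr; congr (_ + _); have [->//|/eqP xp] := eqVneq x p.
by rewrite h// inE eqxx.
Qed.

Lemma sum_ge_count (g : sphere -> R) (s : seq sphere) p : (forall x, 0 <= g x) ->
  g p *+ count_mem p s <= \sum_(x <- s) g x.
Proof.
move=> g0; elim: s => [|x s ih]; first by rewrite big_nil.
rewrite big_cons /= mulrnDr lerD//; have [->//|_] := eqVneq x p.
by rewrite mulr0n.
Qed.

Lemma count_rts x : count_mem x (rts (f x)) = branch_index f x.
Proof. by rewrite branch_indexE. Qed.

Lemma branch_gt0 x : (0 < branch_index f x)%N.
Proof. by have [] := branch_indexP PQ Q0 fN x; rewrite count_rts. Qed.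

Lemma fiber_nbhs x : nbhs x (~` [set y | f y = f x /\ y <> x]).
Proof.
apply: open_nbhs_nbhs; split; last by case.
rewrite openC; apply: sphere_closed_finite.
apply: (@sub_finite_set _ _ (f @^-1` [set f x])); first by move=> y [].
by rewrite (fiberE PQ Q0 fN); exact: finite_seq.
Qed.

Lemma branch_near c : \forall x \near c, x <> c -> branch_index f x = 1%N.
Proof.
have fin : finite_set [set x | branch_index f x != 1%N /\ x <> c].
  by apply: sub_finite_set (branch_finite PQ Q0 fN) => x [].
have : nbhs c (~` [set x | branch_index f x != 1%N /\ x <> c]).
  by apply: open_nbhs_nbhs; split; [rewrite openC; exact: sphere_closed_finite|case].
by apply: filterS => x h xc; apply/eqP; apply: contrapT => /negP b; apply: h.
Qed.

(** Let g be a bump at x that vanishes at the other preimages of f x. Its sum over the fibre is 1 at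
    f x, hence below 3/2 nearby; two points of a fibre with g > 3/4, or a double one, would exceed
    that. *)
Lemma local_injective x : branch_index f x = 1%N -> exists V : set sphere,
  [/\ nbhs x V, forall p, V p -> branch_index f p = 1%N &
      forall p q, V p -> V q -> f p = f q -> p = q].
Proof.
move=> x1; have [g [cg g01 gx g0]] := bump_exists (fiber_nbhs x).
have gp y : 0 <= g y by case/andP: (g01 y).
pose s y := \sum_(z <- rts y) g z.
have sx : s (f x) = 1.
  rewrite /s (@sum_count R g (rts (f x)) x) ?count_rts ?x1 ?gx// => y.
  by rewrite mem_rts// => /eqP fy yx; apply: g0 => h; exact: h.
exists [set p | 3 / 4 < g p /\ s (f p) < 3 / 2]; split.
- have Fx : Filter (nbhs x) by exact: nbhs_filter.
  have h1 : \forall p \near x, 3 / 4 < g p.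
    have cx : g p @[p --> x] --> (1 : R) by rewrite -gx; exact: cg.
    apply: (cvgr_gt _ cx); lra.
  have h2 : \forall p \near x, s (f p) < 3 / 2.
    have cs : s y @[y --> f x] --> s (f x) .
      exact: bump_sum_continuous cg gp _.
    have := cvg_comp _ _ (f_continuous PQ Q0 (x := x)) cs; rewrite sx => c1.
    apply: (cvgr_lt _ c1); lra.
  by apply: filterS (filterI h1 h2) => p [].
- move=> p [p1 p2]; have h := sum_ge_count (rts (f p)) p gp; have b0 := branch_gt0 p.
  rewrite count_rts -/(s _) in h; move: (branch_index f p) h b0 => b h b0.
  case: b h b0 => [//|[//|b]] h _; exfalso.
  have := lerMn_nat (gp p) (isT : (2 <= b.+2)%N); rewrite mulr2n; lra.
- move=> p q [p1 p2] [q1 q2] fpq; apply: contrapT => pq.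
  have := @sum_ge_pair g (rts (f p)) p q gp; rewrite !mem_rts// -fpq eqxx -/(s _) => /(_ isT isT pq).
  lra.
Qed.

(** The sum over the fibre of a bump at c supported in N is at least 2 at f c, hence above 3/2
    nearby, whereas an unbranched x contributes at most 1. *)
Lemma branch_twin c (N : set sphere) : branch_index f c <> 1%N -> nbhs c N ->
  \forall x \near c, x <> c -> exists x', [/\ N x', x' <> x & f x' = f x].
Proof.
move=> c1 cN; have [g [cg g01 gc g0]] := bump_exists cN.
have gp y : 0 <= g y by case/andP: (g01 y).
pose s y := \sum_(z <- rts y) g z.
have sc : 2 <= s (f c).
  have b2 : (1 < branch_index f c)%N by rewrite ltn_neqAle branch_gt0 andbT eq_sym; apply/eqP.
  have := sum_ge_count (rts (f c)) c gp; rewrite count_rts -/(s _) gc.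
  by apply: le_trans; rewrite ler_nat.
have Fc : Filter (nbhs c) by exact: nbhs_filter.
have h2 : \forall p \near c, 3 / 2 < s (f p).
  have cs : s y @[y --> f c] --> s (f c) .
    exact: bump_sum_continuous cg gp _.
  have c2 := cvg_comp _ _ (f_continuous PQ Q0 (x := c)) cs.
  apply: (cvgr_gt _ c2); lra.
apply: filterS (filterI h2 (branch_near c)) => x [sx bx] xc.
apply: contrapT => nx; move: sx; rewrite /s (@sum_count R g (rts (f x)) x).
  by rewrite count_rts bx//; have /andP[_] := g01 x; lra.
move=> y; rewrite mem_rts// => /eqP fy yx; apply: g0 => Ny; apply: nx.
by exists y.
Qed.

Section module.
Variables (E L U : set sphere).
Hypothesis HE : tame f E L U.
Let EE := tame_eq HE.
Let cL := tame_closed HE.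
Let oU := tame_open HE.
Let LU := tame_or HE.
Let invL := tame_invL HE.
Let invU := tame_invU HE.
Let EL x : E x -> L x. Proof. by rewrite EE => -[]. Qed.
Let EU x : E x -> U x. Proof. by rewrite EE => -[]. Qed.
Let LUE x : L x -> U x -> E x. Proof. by rewrite EE. Qed.
Local Notation D := (C0 R E).
Local Notation Z := (C0 R (graph_on f E)).
Local Notation ip := (@graph_ip R f E).

Let ipE := graph_ipE PQ Q0 fN HE.

Lemma tf_sum (I : Type) (s : seq I) (F : I -> Z) x :
  tf (\sum_(i <- s) F i) x = \sum_(i <- s) tf (F i) x.
Proof.
elim: s => [|i s ih]; first by rewrite !big_nil; exact: C0_fun0.
by rewrite !big_cons tfD ih.
Qed.

Lemma cut_C0 (G : sphere -> C) : continuous G -> (forall x, ~ U x -> G x = 0) ->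
  is_C0 E (fun x => if `[< E x >] then G x else 0).
Proof.
move=> cG G0; apply/(is_C0P EE cL oU LU); exists G; split => //.
- by move=> x Ex; rewrite (asboolT Ex).
- by move=> x Ex; rewrite (asboolF Ex).
Qed.

Lemma C0_within_cvg (g : sphere -> C) c : is_C0 E g -> E c ->
  g x @[x --> within E (nbhs c)] --> g c.
Proof. by move=> [_ /subspace_continuousP h _] Ec; exact: h. Qed.

Lemma rank_one_tf (xi eta : Z) (zeta : graph_bimodule f E) x :
  tf (@rank_one R D (graph_bimodule f E) xi eta zeta) x =
  tr (fun z => (tf eta z)^* * tf zeta z) (f x) * tf xi x.
Proof. by change (tf (graph_ract xi (ip eta zeta)) x = tr (fun z => (tf eta z)^* * tf zeta z) (f x) * tf xi x); rewrite tf_ract ipE. Qed.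

(** Approximate the action of a by a finite-rank operator and test at a bump that is 1 at x and 0 on
    the rest of its fibre, which contains a twin x'. With the kernel h of the operator, the values
    at x and x' give a(x) close to h(x, x) and h(x, x') close to 0. Both arguments of h tend to (c,
    c), so a(c) is small. *)
Lemma lact_compact_branch (a : D) c : is_compact_op (@bimod_lact _ _ (graph_bimodule f E) a) ->
  E c -> branch_index f c <> 1%N ->
  (forall N, nbhs c N -> exists x, [/\ N x, x <> c & E x]) -> a c = 0.
Proof.
move=> [_ comp] Ec bc iso; apply: nm_small_eq0 => e e0.
set d : R := (rdeg P Q)%:R; have d0 : 0 <= d by rewrite ler0n.
(* The bump has module norm at most d + 1, so the error becomes e / 4. *)
pose e' : R := e / (4 * (d + 1)).
have e'0 : 0 < e' by rewrite divr_gt0// mulr_gt0// ltr_wpDl.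
have [|s hs] := comp ((e'%:C)%C); first by rewrite ltcR.
pose h (t : sphere * sphere) : C := \sum_(p <- s) (tf p.2 t.1)^* * tf p.1 t.2.
pose W := within E (nbhs c).
have FW : Filter W by exact: within_filter.
have FWW : Filter (filter_prod W W) by exact: filter_prod_filter.
have tfc (xi : Z) : tf xi x @[x --> W] --> tf xi c.
  exact: (C0_within_cvg (tf_C0 PQ Q0 HE xi) Ec).
have hc : h t @[t --> filter_prod W W] --> h (c, c).
  apply: sum_cvg => p; apply: cvgM.
    have c1 : t.1 @[t --> filter_prod W W] --> W by exact: cvg_fst.
    have c2 := cvg_comp _ _ c1 (tfc p.2).
    apply/nm_cvgP => k k0; have /nm_cvgP/(_ _ k0) := c2; apply: filterS => t.
    by rewrite -rmorphB/= nmJ.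
  have c1 : t.2 @[t --> filter_prod W W] --> W by exact: cvg_snd.
  exact: cvg_comp _ _ c1 (tfc p.1).
have e80 : 0 < e / 8 by rewrite divr_gt0.
have /nm_cvgP/(_ _ e80)[[A1 A2] /= [WA1 WA2] hA] := hc.
have ac : a x @[x --> W] --> a c := C0_within_cvg (C0P a) Ec.
have /nm_cvgP/(_ _ e80) WA3 := ac.
have Fc : Filter (nbhs c) by exact: nbhs_filter.
have [N [cN hN1 hN2 hN3]] : exists N, [/\ nbhs c N, forall x, N x -> E x -> A1 x,
    forall x, N x -> E x -> A2 x & forall x, N x -> E x -> nm (a c - a x) < e / 8].
  exists [set x | (E x -> A1 x) /\ (E x -> A2 x) /\ (E x -> nm (a c - a x) < e / 8)].
  split; [|by move=> x []|by move=> x [_ []]|by move=> x [_ []]].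
  have WA1' : \forall x \near c, E x -> A1 x := WA1.
  have WA2' : \forall x \near c, E x -> A2 x := WA2.
  have WA3' : \forall x \near c, E x -> nm (a c - a x) < e / 8 := WA3.
  exact: (filterS (fun x h => h) (filterI WA1' (filterI WA2' WA3'))).
have [x [[[Nx tw] bx] xc Ex]] := iso _ (filterI (filterI cN (branch_twin bc cN)) (branch_near c)).
have [x' [Nx' x'x fx']] := tw xc; have {}bx := bx xc.
have Ex' : E x' by apply/(invE HE); rewrite fx'; exact/(invE HE).
have xUN : nbhs x (U `&` ~` [set y | f y = f x /\ y <> x]).
  apply: filterI; last exact: fiber_nbhs.
  by apply: open_nbhs_nbhs; split; [exact: oU|exact: (EU Ex)].
have [g [cg g01 gx g0]] := bump_exists xUN.
pose G y : C := if `[< E y >] then ((g y)%:C)%C else 0.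
have GC0 : is_C0 E G.
  apply: (@cut_C0 (fun y => ((g y)%:C)%C)).
    by move=> y; exact: (RC_cvg (nbhs_filter y) (cg y)).
  move=> y Uy; have -> : g y = 0 by apply: g0 => -[].
  exact: rmorph0.
have Gx : G x = 1 by rewrite /G (asboolT Ex) gx.
have Gf y : f y = f x -> y <> x -> G y = 0.
  move=> fy yx; rewrite /G; case: asboolP => [_|_]; last exact: erefl.
  have -> : g y = 0 by apply: g0 => -[_]; apply; split.
  exact: rmorph0.
pose zeta : Z := mkZ P Q E G.
have tz : tf zeta = G := tf_mkZ PQ Q0 HE GC0.
have trE (eta : Z) : tr (fun z => (tf eta z)^* * tf zeta z) (f x) = (tf eta x)^*.
  rewrite /transfer (@sum_count C _ (rts (f x)) x); last first.
    by move=> y; rewrite (mem_rts PQ Q0 fN) => /eqP fy yx; rewrite tz (Gf y fy yx) mulr0.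
  by rewrite count_rts bx tz Gx mulr1.
pose T : Z := graph_lact a zeta - \sum_(p <- s) @rank_one R D (graph_bimodule f E) p.1 p.2 zeta.
have TE y : f y = f x -> tf T y = a y * G y - h (x, y).
  move=> fy; rewrite /T tfD tfN tf_lact tz tf_sum; congr (_ - _).
  by apply: eq_bigr => p _; rewrite rank_one_tf fy trE.
have Tn : @hn R D (graph_bimodule f E) T <= e / 4.
  have := hs zeta; rewrite !ip_normE -rmorphM/= lecR => /le_trans; apply.
  have hz : @hn R D (graph_bimodule f E) zeta <= d + 1.
    rewrite -(@ler_pXn2r _ 2) ?nnegrE; [|by []|exact: hn_ge0|exact: addr_ge0].
    rewrite hn_sqr.
    have gb y : nm (tf zeta y) <= 1.
      rewrite tz /G; case: asboolP => _; last by rewrite nm0.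
      by have /andP[h0 h1] := g01 y; rewrite nmR ger0_norm.
    apply: le_trans (ip_bound PQ Q0 fN HE gb) _; rewrite -/d; nra.
  apply: le_trans (ler_wpM2l (ltW e'0) hz) _.
  by apply: le_of_eq; apply: divMl_mul; exact: ltr_wpDl d0 ltr01.
have Tb y : nm (tf T y) <= e / 4.
  apply: le_trans _ Tn; rewrite -(@ler_pXn2r _ 2) ?nnegrE; [|by []|exact: nm_ge0|exact: hn_ge0].
  rewrite hn_sqr.
  exact: (tf_le_ip PQ Q0 fN HE).
have T1 := Tb x; rewrite (TE x erefl) Gx mulr1 in T1.
have T2 := Tb x'; rewrite (TE x' fx') (Gf _ fx' x'x) mulr0 sub0r nmN in T2.
have H1 := hA (x, x) (conj (hN1 _ Nx Ex) (hN2 _ Nx Ex)).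
have H2 := hA (x, x') (conj (hN1 _ Nx Ex) (hN2 _ Nx' Ex')).
have H3 := hN3 _ Nx Ex; rewrite /= in H1 H2.
have I1 := nm_tri (h (x, x)) (h (c, c)) (h (x, x')); rewrite [nm (h (x, x) - h (c, c))]nmB in I1.
have I2 := nm_tri (a c) (a x) 0; have I3 := nm_tri (a x) (h (x, x)) 0.
have I4 := nm_tri (h (x, x)) (h (x, x')) 0.
(* |a(c)| is at most e/8 for a(c) - a(x), e/4 for a(x) - h(x, x), e/8 + e/8 for passing through h(c,
   c), and e/4 for h(x, x'): 7e/8 in all. *)
by move: I2 I3 I4; rewrite !subr0; lra.
Qed.

(* The sum over i of (a beta_i / M) theta beta_i, with bumps beta_i on sets where f
   is injective and M = max (sum beta_i^2) (1/4). *)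
Lemma lact_finite_rank (a : D) (e : R) : 0 < e ->
  (forall c, E c -> branch_index f c <> 1%N -> a c = 0) ->
  exists (a' : D) (s : seq ((sphere -> C) * (sphere -> C))),
    [/\ forall p, p \in s -> is_C0 E p.1 /\ is_C0 E p.2, nm (a - a') <= e &
        forall (zeta : sphere -> C) x, a' x * zeta x =
          \sum_(p <- s) tr (fun z => (p.2 z)^* * zeta z) (f x) * p.1 x].
Proof.
move=> e0 ab; have [G [cG G0 aG a0]] := (is_C0P EE cL oU LU a).1 (C0P a).
pose K := L `&` [set x | e <= nm (G x)].
have cK : compact K.
  apply: (subclosed_compact _ (@sphere_compact R)) => //; apply: closedI => //.
  have -> : [set x | e <= nm (G x)] = (fun x => nm (G x)) @^-1` [set r : R | e <= r] by [].
  apply: closed_comp; last exact: closed_ge.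
  by move=> x _; exact: (nm_cvg (nbhs_filter x) (cG x)).
have KE x : K x -> E x.
  move=> [Lx /= xe]; apply: (LUE Lx); apply: contrapT => /G0 Gx.
  by move: xe; rewrite Gx nm0 leNgt e0.
(* Each bump lives where f is injective and unbranched, so that its transfer at f y picks out the
   single point y of the fibre. *)
have bx x : exists g : sphere -> R, K x -> [/\ continuous g, forall y, 0 <= g y <= 1, g x = 1,
    forall y, ~ U y -> g y = 0 & forall y, g y != 0 -> branch_index f y = 1%N /\
      forall z, f z = f y -> z <> y -> g z = 0].
  have [Kx|Kx] := pselect (K x); last by exists (fun=> 0).
  have b1 : branch_index f x = 1%N.
    apply: contrapT => b1; have := ab x (KE x Kx) b1; rewrite aG; last exact: KE.
    by move=> Gx; case: Kx => _ /=; rewrite Gx nm0 leNgt e0.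
  have [V [xV V1 V2]] := local_injective b1.
  have xU : nbhs x U by apply: open_nbhs_nbhs; split; [exact: oU|exact: (EU (KE x Kx))].
  have [g [cg g01 gx g0]] := bump_exists (filterI xV xU).
  exists g => _; split => //.
    by move=> y Uy; apply: g0 => -[].
  move=> y gy; have Vy : V y by apply: contrapT => Vy; move/eqP: gy; apply; apply: g0 => -[].
  split; first exact: V1.
  by move=> z fz zy; apply: g0 => -[Vz _]; apply: zy; exact: V2.
have [be hbe] := choice bx.
have := cK; rewrite compact_cover => /(_ sphere K (fun x => [set y | 2^-1 < be x y]))[].
- move=> x Kx; have [cb _ _ _ _] := hbe x Kx.
  rewrite openE => y /= yb; have hy : be x z @[z --> y] --> be x y := cb y.
  exact: (cvgr_gt _ hy).
- move=> x Kx; exists x => //=; have [_ _ -> _ _] := hbe x Kx; lra.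
move=> F FK Kcov; pose pts : seq sphere := finmap.enum_fset F.
have ptsK x : x \in pts -> K x by move=> xF; have := FK x xF; rewrite inE.
pose S y : R := \sum_(x <- pts) be x y ^+ 2.
(* On K some bump exceeds 1/2, so S >= 1/4, M = S, and the finite-rank function is a itself; off K
   it is a times a factor in [0, 1], and |a| <= e. *)
pose M y : R := Num.max (S y) 4^-1.
have S0 y : 0 <= S y by apply: sumr_ge0 => x _; exact: sqr_ge0.
have M0 y : 0 < M y by rewrite /M lt_max invr_gt0 orbC ltr0n.
have cM : continuous M.
  move=> y; have cS : S z @[z --> y] --> S y.
    apply: (real_sum_cvg (nbhs_filter y)) => x xp; have [cb _ _ _ _] := hbe x (ptsK x xp).
    have hy : be x z @[z --> y] --> be x y := cb y.
    by rewrite expr2; under eq_fun do rewrite expr2; exact: (cvgM hy hy).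
  have h1 : (cst (4^-1 : R)) z @[z --> y] --> (4^-1 : R) := @cvg_cst _ (4^-1 : R) _ (nbhs y) (nbhs_filter y).
  exact: (continuous_max cS h1).
pose w x y : C := ((be x y / M y)%:C)%C.
have wC0 x : K x -> is_C0 E (fun y => a y * w x y).
  move=> Kx; have [cb _ _ bU _] := hbe x Kx; apply/(is_C0P EE cL oU LU).
  exists (fun y => G y * w x y); split.
  - move=> y; have hb : be x z @[z --> y] --> be x y := cb y.
    have hM : M z @[z --> y] --> M y := cM y.
    have M0' : M y != 0 by rewrite gt_eqF.
    have h3 : be x z / M z @[z --> y] --> be x y / M y by exact: (cvgM hb (cvgV M0' hM)).
    have h1 : w x z @[z --> y] --> w x y := RC_cvg (nbhs_filter y) h3.
    have h2 : G z @[z --> y] --> G y := cG y.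
    exact: (cvgM h2 h1).
  - by move=> y /G0 ->; rewrite mul0r.
  - by move=> y Ey; rewrite aG.
  - by move=> y Ey; rewrite a0// mul0r.
pose b x y : C := if `[< E y >] then ((be x y)%:C)%C else 0.
have bC0 x : K x -> is_C0 E (b x).
  move=> Kx; have [cb _ _ bU _] := hbe x Kx; apply: (@cut_C0 (fun y => ((be x y)%:C)%C)).
    by move=> y; exact: (RC_cvg (nbhs_filter y) (cb y)).
  move=> y Uy; have -> : be x y = 0 by exact: bU.
  exact: rmorph0.
pose t y : R := S y / M y.
have t01 y : 0 <= t y <= 1.
  rewrite /t; apply/andP; split; first exact: divr_ge0 (S0 y) (ltW (M0 y)).
  by rewrite (ler_pdivrMr _ _ (M0 y)) mul1r /M le_max lexx.
have a'E y : \sum_(x <- pts) a y * w x y * b x y = a y * ((t y)%:C)%C.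
  have [Ey|Ey] := pselect (E y); last first.
    by rewrite a0// mul0r big1// => x _; rewrite !mul0r.
  rewrite /t /S mulr_suml rmorph_sum/= mulr_sumr; apply: eq_bigr => x _.
  rewrite /b (asboolT Ey) -mulrA; congr (_ * _); rewrite /w -rmorphM/=; congr (_%:C)%C.
  by rewrite expr2 mulrAC.
have a'C0 : is_C0 E (fun y => a y * ((t y)%:C)%C).
  rewrite (_ : (fun y => _) = \sum_(x <- pts) (fun y => a y * w x y * b x y)); last first.
    by apply/funext => y; rewrite fct_sumE a'E.
  rewrite big_seq; elim/big_ind : _ => [|u v hu hv|x xp].
  - exact: is_C0_0.
  - exact: is_C0D.
  - by apply: C0_mulfun; [apply: wC0|apply: bC0]; exact: ptsK.
exists (MkC0 (asboolT a'C0)), [seq ((fun y => a y * w x y), b x) | x <- pts]; split.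
- by move=> p /mapP[x xp ->]; split; [apply: wC0|apply: bC0]; exact: ptsK.
- apply: C0_nm_le; first exact: ltW.
  move=> y; rewrite C0_funD C0_funN /=.
  have -> : a y - a y * ((t y)%:C)%C = a y * (((1 - t y)%:C)%C : C).
    by rewrite rmorphB/= rmorph1 mulrBr mulr1.
  have /andP[t0 t1] := t01 y; rewrite nmM nmR ger0_norm ?subr_ge0//.
  have [Ey|Ey] := pselect (E y); last by rewrite a0// nm0 mul0r ltW.
  have [Ky|Ky] := pselect (K y).
    have [x xF xy] := Kcov y Ky; have xp : x \in pts by [].
    have Sy : 4^-1 <= S y.
      rewrite /S (big_rem x)//=; apply: (@le_trans _ _ (be x y ^+ 2)).
        by move: xy; rewrite /=; nra.
      by rewrite lerDl; apply: sumr_ge0 => z _; exact: sqr_ge0.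
    have -> : t y = 1.
      by rewrite /t /M max_l// divff// gt_eqF// (lt_le_trans _ Sy)// invr_gt0 ltr0n.
    by rewrite subrr mulr0 ltW.
  have Gy : nm (a y) <= e.
    rewrite aG//; rewrite leNgt; apply/negP => h; apply: Ky; split; first exact: (EL Ey).
    exact: ltW.
  by have := nm_ge0 (a y); nra.
- move=> zeta y; rewrite big_map /= -a'E mulr_suml.
  rewrite big_seq [RHS]big_seq; apply: eq_bigr => x xp.
  have [Ey|Ey] := pselect (E y); last by rewrite a0// !(mul0r, mulr0).
  have Kx := ptsK x xp; have [_ _ _ _ hinj] := hbe x Kx.
  have [b0|b0] := eqVneq (be x y) 0.
    by rewrite /w b0 mul0r rmorph0 !(mulr0, mul0r).
  have [by1 hz] := hinj y b0.
  rewrite /transfer (@sum_count C _ (rts (f y)) y); last first.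
    move=> z; rewrite (mem_rts PQ Q0 fN) => /eqP fz zy.
    have -> : b x z = 0 by rewrite /b (hz z fz zy); case: asboolP.
    by rewrite conjC0 mul0r.
  rewrite count_rts by1 /b (asboolT Ey) conjCR mulr1n.
  by rewrite [RHS]mulrC !mulrA.
Qed.

End module.

End compact_left_action.

Section limits.
Context {R : realType}.
Local Notation C := (complex R).

Lemma lim_closed (T : Type) (F : set_system T) (FF : Filter F) (V W : normedModType C)
    (K : R) (L : T -> V -> W) (l : V -> W) :
  (\forall t \near F, forall x y, nm (L t x - L t y) <= K * nm (x - y)) ->
  (forall x y, nm (l x - l y) <= K * nm (x - y)) ->
  closed [set x | L t x @[t --> F] --> l x].
Proof.
move=> lipL lipl; apply: nm_closedI => x hx; apply/nm_cvgP => e e0.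
pose k := `|K| + 1; have k0 : 0 < k by rewrite ltr_wpDl.
have Kk : K <= k by have := ler_norm K; rewrite /k; lra.
have d0 : 0 < e / (3 * k) by rewrite divr_gt0// mulr_gt0.
have [y /= Ly xy] := hx _ d0; rewrite ltr_pdivlMr ?mulr_gt0// in xy.
have e30 : 0 < e / 3 by rewrite divr_gt0.
have /nm_cvgP/(_ _ e30) hy := Ly.
apply: filterS (filterI lipL hy) => t [ht hyt].
have h1 := nm_tri (l x) (l y) (L t x); have h2 := nm_tri (l y) (L t y) (L t x).
have h3 := lipl x y; have h4 := ht y x; rewrite (nmB y) in h4.
have n0 := nm_ge0 (x - y); have h5 := ler_wpM2r n0 Kk.
lra.
Qed.

Lemma eq_subalgebra (A B : cstarAlgType R) (g h : A -> B) : is_star_hom g -> is_star_hom h ->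
  is_closed_subalgebra [set x | g x = h x].
Proof.
move=> hg hh; have [gD gZ gM gS] := hg; have [hD hZ hM hS] := hh; split => /=.
- by apply: (@closed_eq _ _ _ 1) => x y; rewrite mul1r; exact: star_hom_lip.
- by rewrite !star_hom0.
- by move=> x y xe ye; rewrite gD hD gM hM xe ye.
- by move=> c x xe; rewrite gZ hZ xe.
- by move=> x xe; rewrite gS hS xe.
Qed.

Lemma near_cvg (T : Type) (F : set_system T) (FF : ProperFilter F) (V : completeNormedModType C)
    (u : T -> V) :
  (forall e : R, 0 < e -> exists l, \forall t \near F, nm (l - u t) < e) ->
  exists l : V, u @ F --> l.
Proof.
move=> h; suff /cvg_ex : cvg (u @ F) by [].
apply: cauchy_cvg; apply: cauchy_exP => e e0.
have eE : e = ((complex.Re e)%:C)%C by rewrite RRe_real// gtr0_real.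
have e1 : 0 < complex.Re e by rewrite -ltcR -eE.
have [l hl] := h _ e1; exists l.
by apply: filterS hl => t; rewrite -ball_normE/= normE eE ltcR.
Qed.

Lemma cvg_eq_lim (T : Type) (F : set_system T) (FF : ProperFilter F) (V : normedModType C)
    (u : T -> V) (l m : V) : u @ F --> l -> u @ F --> m -> l = m.
Proof. by move=> h1 h2; exact: (cvg_unique (@norm_hausdorff _ V) h1 h2). Qed.

Lemma nm_squeeze (T : Type) (F : set_system T) (FF : Filter F) (V W : normedModType C)
    (u : T -> V) (l : V) (v : T -> W) (m : W) (K : R) :
  (\forall t \near F, nm (m - v t) <= K * nm (l - u t)) -> u @ F --> l -> v @ F --> m.
Proof.
move=> h /nm_cvgP hu; apply/nm_cvgP => e e0; pose k := `|K| + 1.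
have k0 : 0 < k by rewrite ltr_wpDl.
have Kk : K <= k by have := ler_norm K; rewrite /k; lra.
have d0 : 0 < e / k by rewrite divr_gt0.
apply: filterS (filterI h (hu _ d0)) => t [h1 h2]; apply: (le_lt_trans h1).
rewrite ltr_pdivlMr// in h2; apply: le_lt_trans h2.
by rewrite mulrC ler_wpM2l// nm_ge0.
Qed.

Lemma closed_lim (T : Type) (F : set_system T) (FF : ProperFilter F) (V : normedModType C)
    (W : set V) (u : T -> V) (l : V) : closed W -> u @ F --> l ->
  (\forall t \near F, W (u t)) -> W l.
Proof.
move=> cW /nm_cvgP ul uW; apply: (closed_nm cW) => e e0.
by have [t [h1 h2]] := filter_ex (filterI (ul e e0) uW); exists (u t).
Qed.

End limits.

Section covariance.
Context {R : realType} {D : cstarAlgType R} (Z : bimodule D).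
Hypothesis PH : pre_hilbert Z.
Variables (A : cstarAlgType R) (rho : covariant_rep Z A).
Local Notation C := (complex R).

Lemma fr_op_compact (s : seq (Z * Z)) : is_compact_op (fr_op s).
Proof.
split; first by exists (fr_op (fr_swap s)) => x y; rewrite (fr_op_adj PH) /fr_swap -map_comp map_id_in// => -[].
move=> e e0; exists s => zeta; rewrite subrr !ip_normE -/(fr_op s zeta).
have -> : hn (0 : Z) = 0.
  by rewrite /hn ip_0r// nm0 sqrtr0.
have eE : e = ((complex.Re e)%:C)%C by rewrite RRe_real// gtr0_real.
have e1 : 0 < complex.Re e by rewrite -ltcR -eE.
by rewrite eE -rmorphM/= lecR mulr_ge0 ?hn_ge0// ltW.
Qed.

Lemma rep_fr (a : D) (s : seq (Z * Z)) : (forall zeta, bimod_lact a zeta = fr_op s zeta) ->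
  rep_i rho a = \sum_(p <- s) rep_S rho p.1 ** star (rep_S rho p.2).
Proof.
move=> /funext aE; have [iK [iKh iK1 iKc]] := rep_covariant rho.
rewrite iKc aE; last exact: fr_op_compact.
elim: s {aE} => [|p s ih].
  have [_ h _ _] := iKh _ _ (fr_op_compact [::]) (fr_op_compact [::]).
  have := h 0; rewrite scale0r big_nil => <-; congr iK; apply/funext => x.
  by rewrite /fr_op big_nil scaler0.
have [h _ _ _] := iKh _ _ (fr_op_compact [:: p]) (fr_op_compact s).
have -> : fr_op (p :: s) = fun x => fr_op [:: p] x + fr_op s x.
  by apply/funext => x; rewrite -(fr_op_cat [:: p]).
rewrite h ih big_cons; congr (_ + _); rewrite -iK1; congr iK.
by apply/funext => x; rewrite /fr_op big_seq1.
Qed.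

End covariance.

(** * The three invariant sets and the cutoffs on the Fatou set *)

Section dynamical_data.
Context {R : realType}.
Local Notation C := (complex R).
Local Notation sphere := (riemann_sphere R).
Variables (P Q : {poly C}).
Local Notation f := (@rational_map R P Q).
Hypotheses (PQ : coprimep P Q) (Q0 : Q != 0) (fN : ~ exists c, forall z, f z = c).
Local Notation tr := (transfer P Q).
Local Notation J := (julia f).
Local Notation F := (fatou f).
Local Notation S2 := [set: sphere].

Lemma tameS : tame f S2 S2 S2.
Proof. by apply: Tame; [rewrite setTI|exact: closedT|exact: openT|left| |]. Qed.

Lemma tameF : tame f F S2 F.
Proof.
apply: Tame; [by rewrite setTI|exact: closedT|exact: fatou_open|by right|by []|].
by move=> x; exact: fatouE.
Qed.

Lemma tameJ : tame f J J S2.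
Proof.
apply: Tame; [by rewrite setIT|exact: closed_julia|exact: openT|by left| |by []].
by move=> x; exact: juliaE.
Qed.

Definition perfect_branches (E : set sphere) := forall c (N : set sphere), E c ->
  branch_index f c <> 1%N -> nbhs c N -> exists x, [/\ N x, x <> c & E x].

Lemma perfectF : perfect_branches F.
Proof.
move=> c N Fc _ cN; have PF := sphere_dnbhs_proper c.
have nF : nbhs c F by apply: open_nbhs_nbhs; split => //; exact: fatou_open.
have h : \forall x \near c, x != c -> N x /\ F x.
  have Fc' : Filter (nbhs c) by exact: nbhs_filter.
  by apply: filterS (filterI cN nF).
have h1 : \forall x \near c^', [/\ N x, x <> c & F x].
  rewrite /dnbhs /within/=; have Fc' : Filter (nbhs c) by exact: nbhs_filter.
  by apply: (@filterS _ (nbhs c) _ _ _ _ h) => x hx xc; have [] := hx xc; split => //; exact/eqP.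
by have [x] := filter_ex h1; exists x.
Qed.

Lemma perfectS : perfect_branches S2.
Proof.
move=> c N _ _ cN; have PF := sphere_dnbhs_proper c.
have h1 : \forall x \near c^', [/\ N x, x <> c & S2 x].
  rewrite /dnbhs /within/=; have Fc' : Filter (nbhs c) by exact: nbhs_filter.
  by apply: (@filterS _ (nbhs c) _ _ _ _ cN) => x hx xc; split => //; exact/eqP.
by have [x] := filter_ex h1; exists x.
Qed.

Lemma perfectJ : perfect_branches J.
Proof. by move=> c N Jc bc cN; exact: branch_julia_not_isolated. Qed.

Section covariant.
Variables (E L U : set sphere).
Hypotheses (HE : tame f E L U) (pE : perfect_branches E).
Local Notation D := (C0 R E).
Local Notation Z := (graph_bimodule f E).

Lemma covariant_branch (A : cstarAlgType R) (i : D -> A) (S : Z -> A) (T : toeplitz i S) :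
  (forall a : D, (forall c, E c -> branch_index f c <> 1%N -> a c = 0) ->
     @compact_span R D Z A S (i a)) ->
  exists sigma : covariant_rep Z A, rep_i sigma = i /\ rep_S sigma = S.
Proof.
move=> h; have hc (a : D) : is_compact_op (@bimod_lact _ _ Z a) -> @compact_span R D Z A S (i a).
  move=> ca; apply: h => c Ec bc.
  apply: (lact_compact_branch PQ Q0 fN HE ca Ec bc) => N cN; exact: pE.
by exists (covariant_of_toeplitz (graph_pre_hilbert PQ Q0 fN HE) T hc).
Qed.

(** Quantified over all functions zeta, not only those in Z_E, so that the same identity can be read
    on the sphere, on F and on J, and multiplied by further functions. *)
Definition finite_rank_fun (a : sphere -> C) (s : seq ((sphere -> C) * (sphere -> C))) :=
  forall (zeta : sphere -> C) x, a x * zeta x =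
    \sum_(p <- s) tr (fun z => (p.2 z)^* * zeta z) (f x) * p.1 x.

Lemma rep_finite_rank (A : cstarAlgType R) (rho : covariant_rep Z A) (a : D)
    (s : seq ((sphere -> C) * (sphere -> C))) :
  (forall p, p \in s -> is_C0 E p.1 /\ is_C0 E p.2) -> finite_rank_fun a s ->
  rep_i rho a = \sum_(p <- s) rep_S rho (mkZ P Q E p.1) ** star (rep_S rho (mkZ P Q E p.2)).
Proof.
move=> sC0 hs; pose s' : seq (Z * Z) := [seq (mkZ P Q E p.1, mkZ P Q E p.2) | p <- s].
rewrite (@rep_fr _ _ _ (graph_pre_hilbert PQ Q0 fN HE) _ rho a s'); first by rewrite /s' big_map.
move=> zeta; apply: Z_ext => x.
rewrite (tf_lact a zeta) hs /fr_op /s' big_map (tf_sum s).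
apply: eq_big_seq => p ps; have [p1 p2] := sC0 p ps.
by rewrite (rank_one_tf PQ Q0 fN HE) !(tf_mkZ PQ Q0 HE).
Qed.

End covariant.

Lemma C0SP (g : sphere -> C) : is_C0 S2 g <-> continuous g.
Proof.
rewrite (is_C0P (tame_eq tameS) (tame_closed tameS) (tame_open tameS) (tame_or tameS)).
split=> [[G [cG _ gG _]]|cg]; last first.
  by exists g; split; [exact: cg|move=> x []|by []|move=> x []].
by rewrite (_ : g = G)//; apply/funext => x; exact: gG.
Qed.

Lemma C0FP (g : sphere -> C) : is_C0 F g <-> continuous g /\ forall x, J x -> g x = 0.
Proof.
rewrite (is_C0P (tame_eq tameF) (tame_closed tameF) (tame_open tameF) (tame_or tameF)).
split=> [[G [cG G0 gG g0]]|[cg g0]]; last by exists g; split.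
split; last exact: g0.
rewrite (_ : g = G)//; apply/funext => x; have [Fx|Fx] := pselect (F x); first exact: gG.
by rewrite g0// G0.
Qed.

Lemma C0J_ext (g : sphere -> C) : is_C0 J g -> exists2 G : sphere -> C, continuous G &
  forall x, J x -> G x = g x.
Proof. by move=> h; exact: (is_C0_closed_ext (@closed_julia R f) h). Qed.

Definition cutoff (h : sphere -> R) := [/\ continuous h, forall x, 0 <= h x <= 1 &
  forall x, J x -> h x = 0].

(* Cutoffs tending to 1 uniformly on the compact subsets of the Fatou set *)
Definition cuts : set_system (sphere -> R) := [set A | exists K : set sphere,
  [/\ compact K, K `<=` F & forall h, cutoff h -> (forall x, K x -> h x = 1) -> A h]].

Lemma cuts_filter : ProperFilter cuts.
Proof.
split.
  move=> [K [cK KF]]; have [|||h [ch h01 h0 h1]] := @urysohn_sphere R J K.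
  - exact: closed_julia.
  - by apply: compact_closed => //; exact: sphere_hausdorff.
  - by apply/seteqP; split => // x [/= Jx /KF].
  by move=> /(_ h); apply.
split.
- by exists set0; split => //; exact: compact0.
- move=> A B [K [cK KF KA]] [K' [cK' KF' KB]]; exists (K `|` K'); split.
  + exact: compactU.
  + by move=> x [/KF|/KF'].
  + by move=> h ch h1; split; [apply: KA|apply: KB] => // x Kx; apply: h1; [left|right].
- by move=> A B AB [K [cK KF KA]]; exists K; split => // h ch h1; apply/AB/KA.
Qed.

Lemma cuts_cutoff : \forall h \near cuts, cutoff h.
Proof. by exists set0; split => //; exact: compact0. Qed.

Lemma cuts_lim (g : sphere -> C) (e : R) : is_C0 F g -> 0 < e -> \forall h \near cuts,
  (forall x, nm (g x - g x * ((h x)%:C)%C) <= e) /\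
  (forall x, nm (g x - g x * ((h (f x))%:C)%C) <= e).
Proof.
move=> [g0 _ gv] e0; have [|K [cK KF Kg]] := gv ((e%:C)%C); first by rewrite ltcR.
(* Including f(K) makes both h and its composite with f equal to 1 on K; the latter governs the
   right action on Z. *)
exists (K `|` f @` K); split.
- apply: compactU => //; apply: continuous_compact => //.
  by apply: continuous_subspaceT => x; exact: f_continuous.
- by move=> x [/KF//|[y /KF Fy <-]]; exact/fatouE.
- move=> h [_ h01 _] h1.
  have small x (r : R) : 0 <= r <= 1 -> (K x -> r = 1) -> nm (g x - g x * ((r%:C)%C)) <= e.
    move=> /andP[r0 r1] Kr; have [Kx|Kx] := pselect (K x).
      by rewrite Kr// mulr1 subrr nm0 ltW.
    have [Fx|Fx] := pselect (F x); last by rewrite g0// mul0r subrr nm0 ltW.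
    have := Kg x Fx Kx; rewrite normE ltcR => gx.
    have -> : g x - g x * (r%:C)%C = g x * (((1 - r)%:C)%C) by rewrite rmorphB/= rmorph1 mulrBr mulr1.
    by rewrite nmM nmR ger0_norm ?subr_ge0//; have := nm_ge0 (g x); nra.
  by split=> x; apply: small => // Kx; apply: h1; [left|right; exists x].
Qed.

Definition rc (h : sphere -> R) (x : sphere) : C := ((h x)%:C)%C.

Lemma rc_cont h : continuous h -> continuous (rc h).
Proof. by move=> ch x; exact: (RC_cvg (nbhs_filter x) (ch x)). Qed.

Lemma mul_cont (g h : sphere -> C) : continuous g -> continuous h -> continuous (fun x => g x * h x).
Proof.
move=> cg ch x; have h1 : g y @[y --> x] --> g x := cg x; have h2 : h y @[y --> x] --> h x := ch x.
exact: (cvgM h1 h2).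
Qed.

Lemma comp_cont (g : sphere -> C) : continuous g -> continuous (fun x => g (f x)).
Proof. by move=> cg x; exact: (cvg_comp _ _ (f_continuous PQ Q0 (x := x)) (cg (f x))). Qed.

Lemma conj_cont (g : sphere -> C) : continuous g -> continuous (fun x => (g x)^*).
Proof. by move=> /C0SP cg; apply/C0SP; exact: is_C0_star. Qed.

Lemma C0F_mulr (g h : sphere -> C) : is_C0 F g -> continuous h -> is_C0 F (fun x => g x * h x).
Proof.
move=> /C0FP[cg g0] ch; apply/C0FP; split; first exact: mul_cont.
by move=> x Jx; rewrite g0// mul0r.
Qed.

Lemma C0F_comp (g : sphere -> C) : is_C0 F g -> is_C0 F (fun x => g (f x)).
Proof.
move=> /C0FP[cg g0]; apply/C0FP; split; first exact: comp_cont.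
by move=> x Jx; rewrite g0//; exact/juliaE.
Qed.

Lemma cutoff_C0 h : cutoff h -> is_C0 F (rc h).
Proof.
move=> [ch _ h0]; apply/C0FP; split; first exact: rc_cont.
by move=> x Jx; rewrite /rc h0.
Qed.

End dynamical_data.

#[global] Existing Instance cuts_filter.

(** * Representations given on functions *)

Section functional_representations.
Context {R : realType}.
Local Notation C := (complex R).
Local Notation sphere := (riemann_sphere R).
Variables (P Q : {poly C}).
Local Notation f := (@rational_map R P Q).
Hypotheses (PQ : coprimep P Q) (Q0 : Q != 0) (fN : ~ exists c, forall z, f z = c).
Local Notation tr := (transfer P Q).
Local Notation d := (rdeg P Q).
Variables (E L U : set sphere).
Hypothesis HE : tame f E L U.
Local Notation D := (C0 R E).
Local Notation Z := (graph_bimodule f E).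
Implicit Types (g h : sphere -> C).

Lemma mkC0K (a : D) : mkC0 E a = a.
Proof. by apply: C0_ext => x; rewrite mkC0E//; exact: C0P. Qed.

Lemma mkZK (xi : Z) : mkZ P Q E (tf xi) = xi.
Proof. by apply: Z_ext => x; rewrite (tf_mkZ PQ Q0 HE)//; exact: (tf_C0 PQ Q0 HE). Qed.

Lemma C0E_comp g : is_C0 E g -> is_C0 E (fun x => g (f x)).
Proof.
move=> /(is_C0P (tame_eq HE) (tame_closed HE) (tame_open HE) (tame_or HE))[G [cG G0 gG g0]].
apply/(is_C0P (tame_eq HE) (tame_closed HE) (tame_open HE) (tame_or HE)).
exists (fun x => G (f x)); split.
- exact: comp_cont.
- by move=> x Ux; apply: G0 => /(tame_invU HE).
- by move=> x Ex; apply: gG; apply/(invE HE).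
- by move=> x Ex; apply: g0 => /(invE HE).
Qed.

Lemma C0E_D g h : is_C0 E g -> is_C0 E h -> is_C0 E (fun x => g x + h x).
Proof. exact: is_C0D. Qed.

Lemma C0E_Z (c : C) g : is_C0 E g -> is_C0 E (fun x => c * g x).
Proof. exact: is_C0Z. Qed.

Lemma C0E_ip g h : is_C0 E g -> is_C0 E h -> is_C0 E (tr (fun x => (g x)^* * h x)).
Proof. by move=> g' h'; apply: (transfer_C0 PQ Q0 fN HE); exact: C0_conjM. Qed.

(* Toeplitz representations on functions, with xi in Z_E replaced by tf xi; I and S are
   irrelevant outside C_0(E). *)
Record fun_toeplitz (A : cstarAlgType R) (I S : (sphere -> C) -> A) : Prop := FunToeplitz {
  ft_ID : forall g h, is_C0 E g -> is_C0 E h -> I (fun x => g x + h x) = I g + I h;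
  ft_IZ : forall (c : C) g, is_C0 E g -> I (fun x => c * g x) = c *: I g;
  ft_IM : forall g h, is_C0 E g -> is_C0 E h -> I (fun x => g x * h x) = I g ** I h;
  ft_IS : forall g, is_C0 E g -> I (fun x => (g x)^*) = star (I g);
  ft_SD : forall g h, is_C0 E g -> is_C0 E h -> S (fun x => g x + h x) = S g + S h;
  ft_SZ : forall (c : C) g, is_C0 E g -> S (fun x => c * g x) = c *: S g;
  ft_iS : forall a g, is_C0 E a -> is_C0 E g -> I a ** S g = S (fun x => a x * g x);
  ft_Si : forall a g, is_C0 E a -> is_C0 E g -> S g ** I a = S (fun x => a (f x) * g x);
  ft_SS : forall g h, is_C0 E g -> is_C0 E h ->
    star (S g) ** S h = I (tr (fun x => (g x)^* * h x))
}.

Section of_rep.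
Variables (A : cstarAlgType R) (i : D -> A) (S : Z -> A).
Hypothesis T : toeplitz i S.

Definition fI g : A := i (mkC0 E g).
Definition fS g : A := S (mkZ P Q E g).

Lemma rep_fun_toeplitz : fun_toeplitz fI fS.
Proof.
have [iD iZ iM iS] := tp_hom T.
have tfm g : is_C0 E g -> tf (mkZ P Q E g) = g := @tf_mkZ _ _ _ PQ Q0 _ _ _ HE g.
split; rewrite /fI /fS.
- move=> g h g' h'; rewrite -iD; congr i; apply: C0_ext => x.
  by rewrite C0_funD !mkC0E//; exact: C0E_D.
- move=> c g g'; rewrite -iZ; congr i; apply: C0_ext => x.
  by rewrite C0_funZ !mkC0E//; exact: C0E_Z.
- move=> g h g' h'; rewrite -iM; congr i; apply: C0_ext => x.
  by rewrite C0_mulE !mkC0E//; exact: C0_mulfun.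
- move=> g g'; rewrite -iS; congr i; apply: C0_ext => x.
  by rewrite C0_starE !mkC0E//; exact: is_C0_star.
- move=> g h g' h'; rewrite -(tp_SD T); congr S; apply: Z_ext => x.
  by rewrite tfD !tfm//; exact: C0E_D.
- move=> c g g'; rewrite -(tp_SZ T); congr S; apply: Z_ext => x.
  by rewrite tfZ !tfm//; exact: C0E_Z.
- move=> a g a' g'; rewrite (tp_iS T); congr S; apply: Z_ext => x.
  by rewrite (tf_lact (mkC0 E a) (mkZ P Q E g)) !tfm// ?mkC0E//; exact: C0_mulfun.
- move=> a g a' g'; rewrite (tp_Si T); congr S; apply: Z_ext => x.
  by rewrite (tf_ract (mkZ P Q E g) (mkC0 E a)) !tfm// ?mkC0E//; apply: C0_mulfun => //; exact: C0E_comp.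
- move=> g h g' h'; rewrite (tp_SS T); congr i; apply: C0_ext => x.
  by rewrite (graph_ipE PQ Q0 fN HE) !tfm// mkC0E//; exact: C0E_ip.
Qed.

Lemma fI_nm g (M : R) : is_C0 E g -> 0 <= M -> (forall x, nm (g x) <= M) -> nm (fI g) <= M.
Proof.
move=> gC0 M0 gM; apply: le_trans (star_hom_contr (tp_hom T) _) _.
by apply: C0_nm_le => // x; rewrite mkC0E.
Qed.

(** The module norm gives the constant sqrt d; d + 1 dominates it and is free of roots. *)
Lemma fS_nm g (M : R) : is_C0 E g -> 0 <= M -> (forall x, nm (g x) <= M) ->
  nm (fS g) <= (d%:R + 1) * M.
Proof.
move=> gC0 M0 gM; apply: le_trans (tp_nm T _) _.
have d0 : (0 : R) <= d%:R by rewrite ler0n.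
rewrite -(@ler_pXn2r _ 2) ?nnegrE; [|by []|exact: hn_ge0|by rewrite mulr_ge0// addr_ge0].
rewrite hn_sqr.
have b x : nm (tf (mkZ P Q E g) x) <= M by rewrite (tf_mkZ PQ Q0 HE).
apply: le_trans (ip_bound PQ Q0 fN HE b) _; rewrite exprMn.
rewrite ler_wpM2r ?sqr_ge0//; nra.
Qed.

Lemma fI_dist g h (M : R) : is_C0 E g -> is_C0 E h -> 0 <= M ->
  (forall x, nm (g x - h x) <= M) -> nm (fI g - fI h) <= M.
Proof.
move=> gC0 hC0 M0 gh; apply: le_trans (star_hom_lip (tp_hom T) _ _) _.
by apply: C0_nm_le => // x; rewrite C0_funD C0_funN !mkC0E.
Qed.

Lemma fS_dist g h (M : R) : is_C0 E g -> is_C0 E h -> 0 <= M ->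
  (forall x, nm (g x - h x) <= M) -> nm (fS g - fS h) <= (d%:R + 1) * M.
Proof.
move=> gC0 hC0 M0 gh; have FT := rep_fun_toeplitz.
have -> : fS g - fS h = fS (fun x => g x + -1 * h x).
  by rewrite (ft_SD FT)// ?(ft_SZ FT)// ?scaleN1r//; exact: C0E_Z.
apply: fS_nm => //; first by apply: C0E_D => //; exact: C0E_Z.
by move=> x; rewrite mulN1r.
Qed.

Lemma fI_cvg (X : Type) (B : set_system X) (FB : Filter B) (u : X -> sphere -> C) g :
  is_C0 E g -> (\forall t \near B, is_C0 E (u t)) ->
  (forall e : R, 0 < e -> \forall t \near B, forall x, nm (g x - u t x) <= e) ->
  fI (u t) @[t --> B] --> fI g.
Proof.
move=> gC0 uC0 h; apply/nm_cvgP => e e0; have e20 : 0 < e / 2 by rewrite divr_gt0.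
apply: filterS (filterI uC0 (h _ e20)) => t [ut ht].
by apply: (@le_lt_trans _ _ (e / 2)); [apply: fI_dist => //; exact: ltW|lra].
Qed.

Lemma fS_cvg (X : Type) (B : set_system X) (FB : Filter B) (u : X -> sphere -> C) g :
  is_C0 E g -> (\forall t \near B, is_C0 E (u t)) ->
  (forall e : R, 0 < e -> \forall t \near B, forall x, nm (g x - u t x) <= e) ->
  fS (u t) @[t --> B] --> fS g.
Proof.
move=> gC0 uC0 h; apply/nm_cvgP => e e0.
have d1 : (0 : R) < d%:R + 1 by rewrite ltr_wpDl// ler0n.
have e20 : 0 < e / 2 / (d%:R + 1) by rewrite !divr_gt0.
apply: filterS (filterI uC0 (h _ e20)) => t [ut ht].
apply: (@le_lt_trans _ _ ((d%:R + 1) * (e / 2 / (d%:R + 1)))); first by apply: fS_dist => //; exact: ltW.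
by rewrite mulrCA divff ?mulr1 ?gt_eqF//; lra.
Qed.

End of_rep.

Lemma rep_gen_ind (A : cstarAlgType R) (rho : covariant_rep Z A) (W : set A) :
  is_cuntz_pimsner rho -> is_closed_subalgebra W ->
  (forall g, is_C0 E g -> W (fI (rep_i rho) g)) ->
  (forall g, is_C0 E g -> W (fS (rep_S rho) g)) -> forall x, W x.
Proof.
move=> [gen _] sW Wi WS x; rewrite (gen W sW)//.
- by move=> a; rewrite -(mkC0K a); apply: Wi; exact: C0P.
- by move=> xi; rewrite -(mkZK xi); apply: WS; exact: (tf_C0 PQ Q0 HE).
Qed.

Lemma fun_toeplitzP (A : cstarAlgType R) (I S : (sphere -> C) -> A) : fun_toeplitz I S ->
  toeplitz (fun a : D => I a) (fun xi : Z => S (tf xi)).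
Proof.
move=> T; have tfc (xi : Z) : is_C0 E (tf xi) := tf_C0 PQ Q0 HE xi.
split; first split.
- move=> a b; apply: (@etrans _ _ (I (fun x => a x + b x))).
    congr I; apply/funext => x; exact: (C0_funD a b x).
  by rewrite (ft_ID T)//; exact: C0P.
- move=> c a; apply: (@etrans _ _ (I (fun x => c * a x))).
    congr I; apply/funext => x; exact: (C0_funZ c a x).
  by rewrite (ft_IZ T)//; exact: C0P.
- by move=> a b; rewrite -(ft_IM T)//; exact: C0P.
- by move=> a; rewrite -(ft_IS T)//; exact: C0P.
- move=> xi eta; have -> : tf (xi + eta) = fun x => tf xi x + tf eta x by apply/funext => x; exact: tfD.
  by rewrite (ft_SD T).
- move=> c xi; have -> : tf (c *: xi) = fun x => c * tf xi x by apply/funext => x; exact: tfZ.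
  by rewrite (ft_SZ T).
- by move=> a xi; rewrite (ft_iS T); [|exact: C0P|exact: tfc].
- by move=> a xi; rewrite (ft_Si T); [|exact: C0P|exact: tfc].
- move=> xi eta; rewrite (ft_SS T); [|exact: tfc|exact: tfc]; congr I; apply/funext => x.
  by rewrite (graph_ipE PQ Q0 fN HE).
Qed.

Hypothesis pE : perfect_branches P Q E.

Lemma fun_covariant (A : cstarAlgType R) (I S : (sphere -> C) -> A) : fun_toeplitz I S ->
  (forall a, is_C0 E a -> (forall c, E c -> branch_index f c <> 1%N -> a c = 0) ->
     closed_span [set t | exists g h, [/\ is_C0 E g, is_C0 E h & t = S g ** star (S h)]] (I a)) ->
  exists sigma : covariant_rep Z A, (forall a : D, rep_i sigma a = I a) /\
    (forall xi : Z, rep_S sigma xi = S (tf xi)).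
Proof.
move=> T h; have [|sigma [si sS]] := covariant_branch PQ Q0 fN HE pE (fun_toeplitzP T).
  move=> a a0; have := h a (C0P a) a0; apply: closed_span_min.
    exact: closed_span_subspace.
  move=> _ [g [k [gC0 kC0 ->]]]; apply: sub_closed_span.
  by exists (mkZ P Q E g), (mkZ P Q E k); rewrite !(tf_mkZ PQ Q0 HE).
by exists sigma; rewrite si sS.
Qed.

(** Functions vanishing at the branch points are, by [lact_finite_rank], limits of functions of
    finite rank, and the span is closed. Covariance thus becomes a family of finite identities. *)
Lemma fun_covariant_finite_rank (A : cstarAlgType R) (I S : (sphere -> C) -> A) :
  fun_toeplitz I S ->
  (forall a s, is_C0 E a -> (forall p, p \in s -> is_C0 E p.1 /\ is_C0 E p.2) ->
     finite_rank_fun P Q a s -> I a = \sum_(p <- s) S p.1 ** star (S p.2)) ->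
  exists sigma : covariant_rep Z A, (forall a : D, rep_i sigma a = I a) /\
    (forall xi : Z, rep_S sigma xi = S (tf xi)).
Proof.
move=> T h; apply: fun_covariant => // a aC0 a0; set W := closed_span _.
have sW : closed_subspace W by exact: closed_span_subspace.
have [cW _ _ _] := sW; apply: (closed_nm cW) => e e0.
have e20 : 0 < e / 2 by rewrite divr_gt0.
have [|a' [s [sC0 aa' hs]]] := @lact_finite_rank _ _ _ PQ Q0 fN _ _ _ HE (mkC0 E a) _ e20.
  by move=> c Ec bc; rewrite mkC0E//; exact: a0.
exists (I a').
  rewrite (h a' s (C0P a') sC0 hs) big_seq.
  have [_ W0 WD _] := sW; apply: big_ind => // p ps.
  by apply: sub_closed_span; exists p.1, p.2; have [] := sC0 p ps.
have := star_hom_lip (tp_hom (fun_toeplitzP T)) (mkC0 E a) a'.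
rewrite mkC0E//; lra.
Qed.

Lemma rep_fun_finite_rank (A : cstarAlgType R) (rho : covariant_rep Z A) a s :
  is_C0 E a -> (forall p, p \in s -> is_C0 E p.1 /\ is_C0 E p.2) ->
  finite_rank_fun P Q a s ->
  fI (rep_i rho) a = \sum_(p <- s) fS (rep_S rho) p.1 ** star (fS (rep_S rho) p.2).
Proof.
move=> aC0 sC0 hs; apply: (rep_finite_rank PQ Q0 fN HE) => // zeta x.
by rewrite mkC0E.
Qed.

End functional_representations.

(** * The ideal generated by the functions vanishing on the Julia set *)

Section ideal_of_fatou.
Context {R : realType}.
Local Notation C := (complex R).
Local Notation sphere := (riemann_sphere R).
Variables (P Q : {poly C}).
Local Notation f := (@rational_map R P Q).
Hypotheses (PQ : coprimep P Q) (Q0 : Q != 0) (fN : ~ exists c, forall z, f z = c).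
Local Notation tr := (transfer P Q).
Local Notation J := (julia f).
Local Notation F := (fatou f).
Local Notation S2 := [set: sphere].
Local Notation cuts := (@cuts R P Q).
Let tS : tame f S2 S2 S2 := @tameS R P Q.
Let tF := tameF PQ Q0 fN.
Let tJ := tameJ PQ Q0 fN.

Variables (O : cstarAlgType R) (rho : covariant_rep (graph_bimodule f S2) O).
Hypothesis O_univ : is_cuntz_pimsner rho.
Local Notation K := (ideal_of_vanishing J rho).
Local Notation iO := (fI (rep_i rho)).
Local Notation SO := (fS (rep_S rho)).
Let T := rep_toeplitz rho.
Let FT := rep_fun_toeplitz PQ Q0 fN tS T.
Let CF : ProperFilter cuts := @cuts_filter R P Q.
Let CF' : Filter cuts. Proof. exact _. Qed.
Implicit Types (g : sphere -> C) (h : sphere -> R) (x y : O).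

Let FS g : is_C0 F g -> is_C0 S2 g.
Proof. by move=> /(C0FP PQ Q0 fN)[cg _]; apply/(C0SP P Q). Qed.
Let cS g : continuous g -> is_C0 S2 g. Proof. by move=> ?; apply/(C0SP P Q). Qed.
Let Sc g : is_C0 S2 g -> continuous g. Proof. by move/(C0SP P Q). Qed.
Let cutS h : cutoff P Q h -> is_C0 S2 (rc h).
Proof. by move=> /(cutoff_C0 PQ Q0 fN)/FS. Qed.

Lemma K_i g : is_C0 F g -> ideal_set K (iO g).
Proof.
move=> gF N [_ SN]; apply: SN; exists (mkC0 S2 g) => // z Jz.
by rewrite mkC0E; [case/(C0FP PQ Q0 fN): gF => _; exact|exact: FS].
Qed.

Lemma cut_iO g : is_C0 F g -> iO (fun z => g z * rc h z) @[h --> cuts] --> iO g.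
Proof.
move=> gF; apply: (fI_cvg T CF') => //; first exact: FS.
  apply: filterS (@cuts_cutoff R P Q) => h /(cutoff_C0 PQ Q0 fN)/FS hS.
  by apply: C0_mulfun => //; exact: FS.
by move=> e e0; apply: filterS (cuts_lim PQ Q0 fN gF e0) => h [].
Qed.

Lemma cut_SO g : is_C0 F g -> SO (fun z => g z * rc h z) @[h --> cuts] --> SO g.
Proof.
move=> gF; apply: (fS_cvg PQ Q0 fN tS T CF') => //; first exact: FS.
  apply: filterS (@cuts_cutoff R P Q) => h /(cutoff_C0 PQ Q0 fN)/FS hS.
  by apply: C0_mulfun => //; exact: FS.
by move=> e e0; apply: filterS (cuts_lim PQ Q0 fN gF e0) => h [].
Qed.

Lemma cut_SOf g : is_C0 F g -> SO (fun z => g z * rc h (f z)) @[h --> cuts] --> SO g.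
Proof.
move=> gF; apply: (fS_cvg PQ Q0 fN tS T CF') => //; first exact: FS.
  apply: filterS (@cuts_cutoff R P Q) => h /(cutoff_C0 PQ Q0 fN)/FS hS.
  by apply: C0_mulfun; [exact: FS|exact: (C0E_comp PQ Q0 tS)].
by move=> e e0; apply: filterS (cuts_lim PQ Q0 fN gF e0) => h [].
Qed.

Lemma cutoff_nm h : cutoff P Q h -> nm (iO (rc h)) <= 1.
Proof.
move=> ch; apply: (fI_nm T) => //; first exact: cutS.
by move=> z; have [_ /(_ z)/andP[h0 h1] _] := ch; rewrite nmR ger0_norm.
Qed.

(** 1 is a function on the sphere, so O is unital; this is what makes 1 - i(h) a contraction in
    [cutoff_contr]. *)
Lemma unit_O x : iO (fun=> 1) ** x = x /\ x ** iO (fun=> 1) = x.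
Proof.
have c1 : is_C0 S2 (fun _ : sphere => 1 : C) by apply: cS; exact: cst_continuous.
move: x; apply: (rep_gen_ind PQ Q0 tS O_univ) => /=.
- split => /=.
  + apply: closedI.
      apply: (@closed_eq _ _ _ (`|nm (iO (fun=> 1))| + 1)) => x y; last by have := nm_ge0 (x - y); have := normr_ge0 (nm (iO (fun=> 1))); nra.
      by apply: le_trans (smul_lipl _ _ _) _; rewrite ler_wpM2r ?nm_ge0//; have := ler_norm (nm (iO (fun=> 1))); lra.
    apply: (@closed_eq _ _ _ (`|nm (iO (fun=> 1))| + 1)) => x y; last by have := nm_ge0 (x - y); have := normr_ge0 (nm (iO (fun=> 1))); nra.
    by apply: le_trans (smul_lipr _ _ _) _; rewrite ler_wpM2r ?nm_ge0//; have := ler_norm (nm (iO (fun=> 1))); lra.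
  + by rewrite smul0 smul0l.
  + move=> x y [x1 x2] [y1 y2]; split; first by rewrite smulDr smulDl x1 x2 y1 y2.
    by rewrite smulA x1 -smulA y2.
  + by move=> c x [x1 x2]; rewrite smulZr smulZl x1 x2.
  + move=> x [x1 x2]; have <- : star (iO (fun=> 1)) = iO (fun=> 1).
      by rewrite -(ft_IS FT)//; congr iO; apply/funext => z; rewrite conjC1.
    by rewrite -!starM x1 x2.
- move=> g gC; rewrite -!(ft_IM FT)//; split; congr iO; apply/funext => z.
    by rewrite mul1r.
  by rewrite mulr1.
- move=> g gC; rewrite (ft_iS FT)// (ft_Si FT)//; split; congr SO; apply/funext => z.
    by rewrite mul1r.
  by rewrite mul1r.
Qed.

Lemma star_cut h : cutoff P Q h -> star (iO (rc h)) = iO (rc h).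
Proof.
move=> ch; rewrite -(ft_IS FT); last exact: cutS.
congr iO; apply/funext => z; exact: conjCR.
Qed.

Lemma cutoff_contr h x : cutoff P Q h -> nm (x - x ** iO (rc h)) <= nm x.
Proof.
move=> ch; have hS := cutS ch.
have c1 : is_C0 S2 (fun _ : sphere => 1 : C) by apply: cS; exact: cst_continuous.
rewrite -{1}[x](proj2 (unit_O x)) -smulBr; apply: le_trans (nm_smul _ _) _.
rewrite ler_piMr ?nm_ge0//; apply: (fI_dist T) => // z.
have [_ /(_ z)/andP[h0 h1] _] := ch.
have -> : 1 - rc h z = (((1 - h z)%:C)%C : C) by rewrite rmorphB/= rmorph1.
by rewrite nmR ger0_norm ?subr_ge0//; lra.
Qed.

Let N : set O := [set k | k ** iO (rc h) @[h --> cuts] --> k].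

Let N_closed : closed N.
Proof.
apply: (@lim_closed _ _ _ _ _ _ 1) => [|x y]; last by rewrite mul1r.
apply: filterS (@cuts_cutoff R P Q) => h ch x y; rewrite -smulBl mul1r.
apply: le_trans (nm_smul _ _) _; rewrite ler_piMr ?nm_ge0//; exact: cutoff_nm.
Qed.

Let N_D x y : N x -> N y -> N (x + y).
Proof.
move=> Nx Ny; rewrite /N/=; under eq_fun do rewrite smulDl.
exact: (cvgD Nx Ny).
Qed.

Let N_mul x y : N y -> N (x ** y).
Proof.
move=> Ny; apply: (nm_squeeze (K := nm x) CF' _ Ny); apply: filterE => h.
by rewrite -smulA -smulBr nm_smul.
Qed.

Let N_Z (c : C) x : N x -> N (c *: x).
Proof.
move=> Nx; apply: (nm_squeeze (K := nm c) CF' _ Nx); apply: filterE => h.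
by rewrite smulZl -scalerBr nmZ.
Qed.

Let N_i g : is_C0 F g -> N (iO g).
Proof.
move=> gF; apply: (cvg_near_eq _ (cut_iO gF)).
apply: filterS (@cuts_cutoff R P Q) => h ch.
by rewrite (ft_IM FT)//; [exact: FS|exact: cutS].
Qed.

Let N_S g : is_C0 F g -> N (SO g).
Proof.
move=> gF; apply: (cvg_near_eq _ (cut_SOf gF)).
apply: filterS (@cuts_cutoff R P Q) => h ch.
rewrite (ft_Si FT); [|exact: cutS|exact: FS]; congr SO; apply/funext => z.
by rewrite mulrC.
Qed.

Let N_Sstar g : is_C0 F g -> N (star (SO g)).
Proof.
move=> gF; apply: (nm_squeeze (K := 1) CF' _ (cut_SO gF)).
apply: filterS (@cuts_cutoff R P Q) => h ch; rewrite mul1r -(nm_star (SO g - _)) starB.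
apply: le_of_eq; congr (nm (_ - _)); rewrite -[LHS]starK starM starK; congr star.
rewrite (star_cut ch) (ft_iS FT); [|exact: cutS|exact: FS]; congr SO; apply/funext => z.
by rewrite mulrC.
Qed.

(** N is stable under multiplication on the left only. To place the ideal K inside N, the products
    i(g) x with arbitrary x in O are needed too. *)
Let M : set O := \bigcap_(g in is_C0 F) [set x | N (iO g ** x)].

Let M_all x : M x /\ M (star x).
Proof.
have M_closed : closed M.
  apply: closed_bigI => g _; apply: (@closed_preim _ _ _ (nm (iO g)) (smul (iO g))) => //.
  by move=> y z; exact: smul_lipl.
(* A cutoff is inserted: i(g) y is the limit of i(g) y i(h), and i(h) z lies in N because h is
   itself in C_0(F). *)
have M_mul y z : M y -> M z -> M (y ** z).
  move=> My Mz g gF; rewrite /= smulA.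
  apply: (@closed_lim _ _ cuts CF _ N (fun h => iO g ** y ** iO (rc h) ** z)) => //.
    apply: (nm_squeeze (K := nm z) CF' _ (My g gF)); apply: filterE => h.
    by rewrite -smulBl mulrC nm_smul.
  apply: filterS (@cuts_cutoff R P Q) => h ch; rewrite -smulA; apply: N_mul.
  by apply: Mz; exact: (cutoff_C0 PQ Q0 fN).
have M_i g : continuous g -> M (iO g).
  move=> cg a aF; rewrite /= -(ft_IM FT); [|exact: FS|exact: cS].
  by apply: N_i; exact: (C0F_mulr PQ Q0 fN).
move: x; apply: (rep_gen_ind PQ Q0 tS O_univ).
- split.
  + apply: closedI => //; apply: (@closed_preim _ _ _ 1 star) => // y z; exact: star_lip.
  + by rewrite star0; split=> g gF /=; rewrite smul0 /N/=; under eq_fun do rewrite smul0l; exact: cvg_cst.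
  + move=> y z [y1 y2] [z1 z2]; split; split.
    * by move=> g gF /=; rewrite smulDr; apply: N_D; [exact: y1|exact: z1].
    * by rewrite starD => g gF /=; rewrite smulDr; apply: N_D; [exact: y2|exact: z2].
    * exact: M_mul.
    * by rewrite starM; exact: M_mul.
  + move=> c y [y1 y2]; split.
      by move=> g gF /=; rewrite smulZr; apply: N_Z; exact: y1.
    by rewrite starZ => g gF /=; rewrite smulZr; apply: N_Z; exact: y2.
  + by move=> y [y1 y2]; rewrite starK.
- move=> g /Sc cg; split; first exact: M_i.
  by rewrite -(ft_IS FT); [apply: M_i; exact: conj_cont|exact: cS].
- move=> g /Sc cg; split => a aF /=.
    rewrite (ft_iS FT); [|exact: FS|exact: cS].
    by apply: N_S; exact: (C0F_mulr PQ Q0 fN).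
  (* Taking adjoints moves a to a composite with f, which is in C_0(F) by invariance of the Fatou
     set. *)
  have -> : iO a ** star (SO g) = star (SO (fun z => (a (f z))^* * g z)).
    rewrite -[iO a]starK -starM -(ft_IS FT); last exact: FS.
    by rewrite (ft_Si FT (FS (is_C0_star aF)) (cS cg)).
  apply: N_Sstar.
  exact: (C0F_mulr PQ Q0 fN (C0F_comp PQ Q0 fN (is_C0_star aF)) cg).
Qed.

Let K_N k : ideal_set K k -> N k.
Proof.
move=> Kk; have N0 : N 0 by rewrite /N/=; under eq_fun do rewrite smul0l; exact: cvg_cst.
(* N itself need not be a two-sided ideal; the smaller set is one, and it is closed and contains the
   generators by [M_all]. *)
suff : [set k | N k /\ forall y, N (k ** y)] k by case.
apply: Kk; split; last first.
  move=> _ [b b0 <-]; have bF : is_C0 F b.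
    by apply/(C0FP PQ Q0 fN); split => //; apply: Sc; exact: C0P.
  rewrite -(mkC0K b) -/(fI _ b); split; first exact: N_i.
  by move=> y; have [h _] := M_all y; exact: h.
split.
- have -> : [set k | N k /\ forall y, N (k ** y)] = N `&` \bigcap_(y in setT) [set k | N (k ** y)].
    by apply/seteqP; split => z [h1 h2]; split => // y; [move=> _; exact: h2|exact: h2].
  apply: closedI => //; apply: closed_bigI => y _.
  by apply: (@closed_preim _ _ _ (nm y) (fun k => k ** y)) => // u v; exact: smul_lipr.
- by split => // y; rewrite smul0l.
- by move=> y z [y1 y2] [z1 z2]; split => [|w]; [exact: N_D|rewrite smulDl; exact: N_D].
- by move=> c y [y1 y2]; split => [|w]; [exact: N_Z|rewrite smulZl; exact: N_Z].
- move=> y z [y1 y2]; split; split => [|w].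
  + exact: y2.
  + by rewrite -smulA; exact: y2.
  + exact: N_mul.
  + by rewrite -smulA; exact: N_mul.
Qed.

Lemma K_approx_unital : approx_unital K.
Proof.
move=> k /K_N/nm_cvgP hk e e0.
have [h [ch hh]] := filter_ex (filterI (@cuts_cutoff R P Q) (hk e e0)).
exists (iO (rc h)); first by apply: K_i; exact: (cutoff_C0 PQ Q0 fN).
by split => //; [exact: star_cut|move=> y; exact: cutoff_contr].
Qed.

Lemma K_S g : is_C0 F g -> ideal_set K (SO g).
Proof.
move=> gF; have [cK _ _ _ KM] := ideal_closed_ideal K.
apply: (@closed_lim _ _ cuts CF _ K _ _ cK (cut_SO gF)).
apply: filterS (@cuts_cutoff R P Q) => h ch.
have -> : SO (fun z => g z * rc h z) = iO (rc h) ** SO g.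
  rewrite (ft_iS FT); [|exact: cutS|exact: FS]; congr SO; apply/funext => z; exact: mulrC.
by have [] := KM _ (SO g) (K_i (cutoff_C0 PQ Q0 fN ch)).
Qed.

End ideal_of_fatou.

(** * The quotient by the Fatou ideal *)

Section quotient_by_fatou.
Context {R : realType}.
Local Notation C := (complex R).
Local Notation sphere := (riemann_sphere R).
Variables (P Q : {poly C}).
Local Notation f := (@rational_map R P Q).
Hypotheses (PQ : coprimep P Q) (Q0 : Q != 0) (fN : ~ exists c, forall z, f z = c).
Local Notation tr := (transfer P Q).
Local Notation J := (julia f).
Local Notation F := (fatou f).
Local Notation S2 := [set: sphere].
Let tS : tame f S2 S2 S2 := @tameS R P Q.
Let tF := tameF PQ Q0 fN.
Let tJ := tameJ PQ Q0 fN.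

Variables (O : cstarAlgType R) (rho : covariant_rep (graph_bimodule f S2) O).
Hypothesis O_univ : is_cuntz_pimsner rho.
Variables (OJ : cstarAlgType R) (rhoJ : covariant_rep (graph_bimodule f J) OJ).
Hypothesis OJ_univ : is_cuntz_pimsner rhoJ.
Local Notation K := (ideal_of_vanishing J rho).
Local Notation iO := (fI (rep_i rho)).
Local Notation SO := (fS (rep_S rho)).
Local Notation iJ := (fI (rep_i rhoJ)).
Local Notation SJ := (fS (rep_S rhoJ)).
Let FT := rep_fun_toeplitz PQ Q0 fN tS (rep_toeplitz rho).
Let FTJ := rep_fun_toeplitz PQ Q0 fN tJ (rep_toeplitz rhoJ).
Implicit Types (g h : sphere -> C).

Let cS g : continuous g -> is_C0 S2 g. Proof. by move=> ?; apply/(C0SP P Q). Qed.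
Let Sc g : is_C0 S2 g -> continuous g. Proof. by move/(C0SP P Q). Qed.

Definition cutJ g (x : sphere) : C := if `[< J x >] then g x else 0.

Lemma cutJE g x : J x -> cutJ g x = g x.
Proof. by move=> Jx; rewrite /cutJ (asboolT Jx). Qed.

Lemma cutJ0 g x : ~ J x -> cutJ g x = 0.
Proof. by move=> Jx; rewrite /cutJ (asboolF Jx). Qed.

Lemma cutJ_C0 g : is_C0 S2 g -> is_C0 J (cutJ g).
Proof. by move=> /Sc cg; apply: (cut_C0 tJ cg) => x []. Qed.

Lemma cutJ_tr g h g' h' : (forall x, J x -> g x = g' x) -> (forall x, J x -> h x = h' x) ->
  forall y, J y -> tr (fun x => (g x)^* * h x) y = tr (fun x => (g' x)^* * h' x) y.
Proof.
move=> gg hh y Jy; apply: (eq_transfer PQ Q0 fN) => x fx.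
have Jx : J x by apply/(juliaE PQ Q0 fN); rewrite fx.
by rewrite gg// hh.
Qed.

Lemma cutJ_op (op : C -> C -> C) g h : op 0 0 = 0 ->
  cutJ (fun x => op (g x) (h x)) = fun x => op (cutJ g x) (cutJ h x).
Proof. by move=> o0; apply/funext => x; rewrite /cutJ; case: asboolP. Qed.

Let I1 g := iJ (cutJ g).
Let S1 g := SJ (cutJ g).

Let FT1 : fun_toeplitz P Q S2 I1 S1.
Proof.
split; rewrite /I1 /S1.
- move=> g h gC hC; rewrite (cutJ_op (op := fun a b => a + b)) ?addr0//.
  by rewrite (ft_ID FTJ)//; exact: cutJ_C0.
- move=> c g gC; rewrite (cutJ_op (op := fun a _ => c * a) g g) ?mulr0//.
  by rewrite (ft_IZ FTJ)//; exact: cutJ_C0.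
- move=> g h gC hC; rewrite (cutJ_op (op := fun a b => a * b)) ?mulr0//.
  by rewrite (ft_IM FTJ)//; exact: cutJ_C0.
- move=> g gC; rewrite (cutJ_op (op := fun a _ => a^*) g g) ?conjC0//.
  by rewrite (ft_IS FTJ)//; exact: cutJ_C0.
- move=> g h gC hC; rewrite (cutJ_op (op := fun a b => a + b)) ?addr0//.
  by rewrite (ft_SD FTJ)//; exact: cutJ_C0.
- move=> c g gC; rewrite (cutJ_op (op := fun a _ => c * a) g g) ?mulr0//.
  by rewrite (ft_SZ FTJ)//; exact: cutJ_C0.
- move=> a g aC gC; rewrite (ft_iS FTJ (cutJ_C0 aC) (cutJ_C0 gC)); congr SJ.
  by rewrite (cutJ_op (op := fun a b => a * b)) ?mulr0.
- move=> a g aC gC; rewrite (ft_Si FTJ (cutJ_C0 aC) (cutJ_C0 gC)); congr SJ.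
  apply/funext => x; have [Jx|Jx] := pselect (J x); last by rewrite !(cutJ0 _ Jx) mulr0.
  by rewrite !cutJE//; exact/(juliaE PQ Q0 fN).
- move=> g h gC hC; rewrite (ft_SS FTJ (cutJ_C0 gC) (cutJ_C0 hC)); congr iJ.
  apply/funext => y; have [Jy|Jy] := pselect (J y).
    by rewrite [RHS]cutJE//; apply: cutJ_tr => // x Jx; exact: cutJE.
  rewrite [RHS]cutJ0//; apply: (transfer_invE PQ Q0 fN tJ) => // x Jx.
  by rewrite (cutJ0 h Jx) mulr0.
Qed.

(** Fibres over points of J lie in J, so a finite-rank identity on the sphere restricts to one on J;
    hence restriction followed by O_J is covariant. *)
Lemma restriction_hom : exists Phi : O -> OJ, [/\ is_star_hom Phi,
  forall g, is_C0 S2 g -> Phi (iO g) = iJ (cutJ g) &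
  forall g, is_C0 S2 g -> Phi (SO g) = SJ (cutJ g)].
Proof.
have [|sigma [si sS]] := fun_covariant_finite_rank PQ Q0 fN tS (perfectS (P := P) (Q := Q)) FT1.
  move=> a s aC sC hs; pose s' := [seq (cutJ p.1, cutJ p.2) | p <- s].
  have sC' p : p \in s' -> is_C0 J p.1 /\ is_C0 J p.2.
    by move=> /mapP[q /sC[q1 q2] ->]; split; exact: cutJ_C0.
  rewrite /I1 (rep_fun_finite_rank PQ Q0 fN tJ rhoJ (cutJ_C0 aC) sC').
    by rewrite /s' big_map.
  move=> zeta x; rewrite /s' big_map; have [Jx|Jx] := pselect (J x).
    rewrite cutJE// hs; apply: eq_bigr => p _; rewrite /= [cutJ p.1 x]cutJE//; congr (_ * _).
    apply: (eq_transfer PQ Q0 fN) => y fy.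
    have Jy : J y by apply/(juliaE PQ Q0 fN); rewrite fy; exact/(juliaE PQ Q0 fN).
    by rewrite cutJE.
  by rewrite cutJ0// mul0r big1// => p _; rewrite /= [cutJ p.1 x]cutJ0// mulr0.
have [_ /(_ _ sigma)[Phi [hPhi Pi PS]]] := O_univ.
exists Phi; split => // g gC; first by rewrite /fI Pi si /I1 mkC0E.
by rewrite /fS PS sS /S1 (tf_mkZ PQ Q0 tS).
Qed.

Let HK := K_approx_unital PQ Q0 fN O_univ.
Local Notation q := (qmap HK).

Lemma q_iO g h : is_C0 S2 g -> is_C0 S2 h -> (forall x, J x -> g x = h x) -> q (iO g) = q (iO h).
Proof.
move=> gC hC gh; apply/qmap_eq.
have h'C : is_C0 S2 (fun x => -1 * h x) by exact: C0E_Z.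
have -> : iO g - iO h = iO (fun x => g x + -1 * h x).
  by rewrite (ft_ID FT)// (ft_IZ FT)// scaleN1r.
apply: (K_i PQ Q0 fN); apply/(C0FP PQ Q0 fN); split; first by apply: Sc; exact: C0E_D.
by move=> x Jx; rewrite gh// mulN1r subrr.
Qed.

Lemma q_SO g h : is_C0 S2 g -> is_C0 S2 h -> (forall x, J x -> g x = h x) -> q (SO g) = q (SO h).
Proof.
move=> gC hC gh; apply/qmap_eq.
have h'C : is_C0 S2 (fun x => -1 * h x) by exact: C0E_Z.
have -> : SO g - SO h = SO (fun x => g x + -1 * h x).
  by rewrite (ft_SD FT)// (ft_SZ FT)// scaleN1r.
apply: (K_S PQ Q0 fN); apply/(C0FP PQ Q0 fN); split; first by apply: Sc; exact: C0E_D.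
by move=> x Jx; rewrite gh// mulN1r subrr.
Qed.

Let ext_ex g : exists G : sphere -> C, is_C0 J g -> is_C0 S2 G /\ forall x, J x -> G x = g x.
Proof.
have [gC|gC] := pselect (is_C0 J g); last by exists 0.
by have [G cG Gg] := C0J_ext gC; exists G => _; split => //; exact: cS.
Qed.

Let ext g := projT1 (cid (ext_ex g)).
Let extC g : is_C0 J g -> is_C0 S2 (ext g).
Proof. by rewrite /ext; case: cid => G /= h /h[]. Qed.
Let extE g x : is_C0 J g -> J x -> ext g x = g x.
Proof. by rewrite /ext; case: cid => G /= h /h[_]; apply. Qed.

Let I2 g := q (iO (ext g)).
Let S2' g := q (SO (ext g)).

(** Two extensions of a function from J differ by a function vanishing on J, which dies in O / K; so
    the chosen extension [ext] is additive and multiplicative there, though not on the sphere. *)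
Let FT2 : fun_toeplitz P Q J I2 S2'.
Proof.
have [qD qZ qM qS] := qmap_hom HK.
split; rewrite /I2 /S2'.
- move=> g h gC hC; have e1 := extC gC; have e2 := extC hC; have gh := C0E_D gC hC.
  rewrite -qD -(ft_ID FT)//; apply: q_iO => [||x Jx]; [exact: extC|exact: C0E_D|].
  by rewrite !extE.
- move=> c g gC; have e1 := extC gC; have gh := C0E_Z c gC.
  rewrite -qZ -(ft_IZ FT)//; apply: q_iO => [||x Jx]; [exact: extC|exact: C0E_Z|].
  by rewrite !extE.
- move=> g h gC hC; have e1 := extC gC; have e2 := extC hC; have gh := C0_mulfun gC hC.
  rewrite -qM -(ft_IM FT)//; apply: q_iO => [||x Jx]; [exact: extC|exact: C0_mulfun|].
  by rewrite !extE.
- move=> g gC; have e1 := extC gC; have gh := is_C0_star gC.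
  rewrite -qS -(ft_IS FT)//; apply: q_iO => [||x Jx]; [exact: extC|exact: is_C0_star|].
  by rewrite !extE.
- move=> g h gC hC; have e1 := extC gC; have e2 := extC hC; have gh := C0E_D gC hC.
  rewrite -qD -(ft_SD FT)//; apply: q_SO => [||x Jx]; [exact: extC|exact: C0E_D|].
  by rewrite !extE.
- move=> c g gC; have e1 := extC gC; have gh := C0E_Z c gC.
  rewrite -qZ -(ft_SZ FT)//; apply: q_SO => [||x Jx]; [exact: extC|exact: C0E_Z|].
  by rewrite !extE.
- move=> a g aC gC; have e1 := extC aC; have e2 := extC gC; have ag := C0_mulfun aC gC.
  rewrite -qM (ft_iS FT)//; apply: q_SO => [||x Jx]; [exact: C0_mulfun|exact: extC|].
  by rewrite !extE.
- move=> a g aC gC; have e1 := extC aC; have e2 := extC gC.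
  have ag := C0_mulfun (C0E_comp PQ Q0 tJ aC) gC.
  rewrite -qM (ft_Si FT)//; apply: q_SO => [||x Jx].
  + by apply: C0_mulfun => //; exact: (C0E_comp PQ Q0 tS).
  + exact: extC.
  + by rewrite !extE//; exact/(juliaE PQ Q0 fN).
- move=> g h gC hC; have e1 := extC gC; have e2 := extC hC.
  have gh := C0E_ip PQ Q0 fN tJ gC hC.
  rewrite -qS -qM (ft_SS FT)//; apply: q_iO => [||y Jy].
  + exact: (C0E_ip PQ Q0 fN tS).
  + exact: extC.
  + by rewrite [RHS]extE//; apply: cutJ_tr => // x Jx; rewrite extE.
Qed.

(* The branch points outside J are finitely many, hence can be separated from J. *)
Let ext_branch (a : sphere -> C) : is_C0 J a -> (forall c : sphere, J c -> branch_index f c <> 1%N -> a c = 0) ->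
  exists G : sphere -> C, [/\ is_C0 S2 G, forall x, J x -> G x = a x &
    forall c : sphere, branch_index f c <> 1%N -> G c = 0].
Proof.
move=> aC a0; pose B := [set x | branch_index f x != 1%N /\ ~ J x].
have cB : closed B.
  by apply: sphere_closed_finite; apply: sub_finite_set (branch_finite PQ Q0 fN) => x [].
have [|h [ch h01 h0 h1]] := urysohn_sphere cB (@closed_julia R f).
  by apply/seteqP; split => // x [[_ nJ]].
exists (fun x => ext a x * rc h x); split.
- by apply: C0_mulfun; [exact: extC|apply: cS; exact: rc_cont].
- by move=> x Jx; rewrite extE// /rc h1// mulr1.
- move=> c bc; have [Jc|Jc] := pselect (J c); first by rewrite extE// a0// mul0r.
  by rewrite /rc h0 ?mulr0//; split => //; exact/eqP.
Qed.

(** For covariance, a function on J that vanishes at the branch points of J is extended to one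
    vanishing at all branch points. It is approximated by finite-rank functions on the sphere, whose
    relation holds in O and is pushed to O / K. *)
Lemma extension_hom : exists Psi : OJ -> qalg HK, [/\ is_star_hom Psi,
  forall g, is_C0 S2 g -> Psi (iJ (cutJ g)) = q (iO g) &
  forall g, is_C0 S2 g -> Psi (SJ (cutJ g)) = q (SO g)].
Proof.
have [qD qZ qM qS] := qmap_hom HK.
have [|tau [ti tS']] := fun_covariant PQ Q0 fN tJ (perfectJ PQ Q0 fN) FT2.
  move=> a aC a0; set W := closed_span _.
  have sW : closed_subspace W by exact: closed_span_subspace.
  have [cW W0 WD _] := sW; apply: (closed_nm cW) => e e0.
  have e20 : 0 < e / 2 by rewrite divr_gt0.
  have [G [GC Ga Gb]] := ext_branch aC a0.
  have [|a' [s [sC aa' hs]]] := lact_finite_rank PQ Q0 fN tS (a := mkC0 S2 G) e20.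
    by move=> c _ bc; rewrite mkC0E//; exact: Gb.
  exists (q (iO a')).
    rewrite (rep_fun_finite_rank PQ Q0 fN tS rho (C0P a') sC hs).
    rewrite big_seq; elim/big_ind : _ => [|x y Wx Wy|p ps].
    - by rewrite (star_hom0 (qmap_hom HK)).
    - by rewrite qD; exact: WD.
    have [p1 p2] := sC p ps; rewrite qM qS; apply: sub_closed_span.
    (* Modulo K, p.1 and p.2 may be replaced by the chosen extensions of their restrictions to J. *)
    exists (cutJ p.1), (cutJ p.2); split; [exact: cutJ_C0|exact: cutJ_C0|].
    rewrite /S2'; congr (_ ** star _).
      apply: q_SO => // [|x Jx]; first by apply: extC; exact: cutJ_C0.
      by rewrite extE ?cutJE//; exact: cutJ_C0.
    apply: q_SO => // [|x Jx]; first by apply: extC; exact: cutJ_C0.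
    by rewrite extE ?cutJE//; exact: cutJ_C0.
  have -> : I2 a = q (iO G).
    by apply: q_iO => // [|x Jx]; [exact: extC|rewrite extE// Ga].
  apply: le_lt_trans (star_hom_lip (qmap_hom HK) _ _) _.
  apply: le_lt_trans (star_hom_lip (rep_i_hom rho) _ _) _.
  by rewrite mkC0K; lra.
have [_ /(_ _ tau)[Psi [hPsi Pi PS]]] := OJ_univ.
exists Psi; split => // g gC; have gJ := cutJ_C0 gC.
  rewrite {1}/fI Pi ti mkC0E// /I2; apply: q_iO => // [|x Jx]; first exact: extC.
  by rewrite extE// cutJE.
rewrite {1}/fS PS tS' (tf_mkZ PQ Q0 tJ)// /S2'; apply: q_SO => // [|x Jx]; first exact: extC.
by rewrite extE// cutJE.
Qed.

Lemma julia_restrict_cutJ b : rep_i rhoJ (julia_restrict f b) = iJ (cutJ b).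
Proof.
rewrite /fI; congr (rep_i rhoJ _); apply: C0_ext => x; rewrite mkC0E; last exact: cutJ_C0 (C0P b).
have [Jx|Jx] := pselect (J x); first by rewrite cutJE// julia_restrictE.
by rewrite cutJ0//; case: (C0P (julia_restrict f b)) => ->.
Qed.

Lemma julia_graph_restrict_cutJ xi :
  rep_S rhoJ (julia_graph_restrict xi) = SJ (cutJ (tf xi)).
Proof.
rewrite /fS; congr (rep_S rhoJ _); apply: Z_ext => x.
have xC := tf_C0 PQ Q0 tS xi.
rewrite (tf_mkZ PQ Q0 tJ); last exact: cutJ_C0 xC.
have [Jx|Jx] := pselect (J x).
  by rewrite cutJE// /tf julia_graph_restrictE//; apply/(graphP tJ).
rewrite cutJ0//; have [h _ _] := tf_C0 PQ Q0 tJ (julia_graph_restrict xi); exact: h.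
Qed.

(** The map [Phi] given by restriction kills K and descends to [phi]; extension provides [Psi], and
    both composites are the identity on generators. *)
Theorem quotient_iso : exists phi : ideal_quotient K -> OJ,
  [/\ is_star_iso phi,
      forall b, phi (quot_map K (rep_i rho b)) = rep_i rhoJ (julia_restrict f b) &
      forall xi, phi (quot_map K (rep_S rho xi)) = rep_S rhoJ (julia_graph_restrict xi)].
Proof.
have [Phi [hPhi Pi PS]] := restriction_hom; have [Psi [hPsi Qi QS]] := extension_hom.
have [PD PZ PM Pst] := hPhi.
have [qD qZ qM qS] := qmap_hom HK.
have PhiK x : ideal_set K x -> Phi x = 0.
  move=> Kx; apply: (Kx [set x | Phi x = 0]); split; last first.
    move=> _ [b b0 <-] /=; rewrite -(mkC0K b) -/(fI _ b) Pi; last exact: C0P.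
    rewrite (_ : cutJ b = fun=> 0 * 0); last first.
      apply/funext => x'; rewrite mulr0; have [Jx|Jx] := pselect (J x'); last exact: cutJ0.
      by rewrite cutJE//; exact: b0.
    have z0 : is_C0 J (fun _ : sphere => 0 : C) by exact: is_C0_0.
    by rewrite (ft_IZ FTJ)// scale0r.
  split => /=.
  - apply: (@closed_eq _ _ _ 1) => x' y; first by rewrite mul1r; exact: star_hom_lip.
    by rewrite subrr nm0 mul1r nm_ge0.
  - exact: star_hom0.
  - by move=> y z y0 z0; rewrite PD y0 z0 addr0.
  - by move=> c y y0; rewrite PZ y0 scaler0.
  - by move=> y z y0; rewrite !PM y0 smul0 smul0l.
have PhiE x y : q x = q y -> Phi x = Phi y.
  by move/qmap_eq/PhiK => h; apply/eqP; rewrite -subr_eq0 -(star_homB _ _ hPhi) h.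
pose lift (u : qalg HK) : O := projT1 (cid (qmap_surj u)).
have liftK u : q (lift u) = u by rewrite /lift; case: cid.
pose phi (u : qalg HK) : OJ := Phi (lift u).
have phiE x : phi (q x) = Phi x by apply: PhiE; rewrite liftK.
have hphi : is_star_hom phi.
  split.
  - by move=> u v; rewrite -[u]liftK -[v]liftK -qD !phiE PD.
  - by move=> c u; rewrite -[u]liftK -qZ !phiE PZ.
  - by move=> u v; rewrite -[u]liftK -[v]liftK -qM !phiE PM.
  - by move=> u; rewrite -[u]liftK -qS !phiE Pst.
have PsiPhi x : Psi (Phi x) = q x.
  have sub := eq_subalgebra (star_hom_comp hPhi hPsi) (qmap_hom HK).
  apply: (rep_gen_ind PQ Q0 tS O_univ sub) => g gC /=.
    by rewrite Pi// Qi.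
  by rewrite PS// QS.
have hid : is_star_hom (@idfun OJ) by split.
have phiPsi y : phi (Psi y) = y.
  have sub := eq_subalgebra (star_hom_comp hPsi hphi) hid.
  apply: (rep_gen_ind PQ Q0 tJ OJ_univ sub) => g gC /=.
    have gE : g = cutJ (ext g).
      apply/funext => x; have [Jx|Jx] := pselect (J x); first by rewrite cutJE// extE.
      by rewrite cutJ0//; case: gC => ->.
    by rewrite gE Qi ?phiE ?Pi//; exact: extC.
  have gE : g = cutJ (ext g).
    apply/funext => x; have [Jx|Jx] := pselect (J x); first by rewrite cutJE// extE.
    by rewrite cutJ0//; case: gC => ->.
  by rewrite gE QS ?phiE ?PS//; exact: extC.
exists phi; split.
- split; first exact: hphi.
  exists Psi; first by move=> u; rewrite -[u]liftK phiE PsiPhi.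
  exact: phiPsi.
- move=> b; rewrite -[quot_map K _]/(q _) phiE julia_restrict_cutJ -Pi; last exact: C0P.
  by rewrite /fI mkC0K.
- move=> xi; rewrite -[quot_map K _]/(q _) phiE julia_graph_restrict_cutJ -PS; last exact: (tf_C0 PQ Q0 tS xi).
  by rewrite /fS (mkZK PQ Q0 tS).
Qed.

End quotient_by_fatou.

(** * The Fatou ideal up to Morita equivalence *)

Section morita_of_isomorphism.
Context {R : realType}.
Local Notation C := (complex R).

Lemma ip_norm_cstar (A X : cstarAlgType R) (ip : X -> X -> A) (x : X) :
  nm (ip x x) = nm x ^+ 2 -> ip_norm ip x = ((nm x)%:C)%C.
Proof.
move=> h; rewrite /ip_norm normE h rmorphXn/= sqrCK//.
by rewrite -[0]/((0%:C)%C) lecR nm_ge0.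
Qed.

Lemma ip_complete_cstar (A X : cstarAlgType R) (ip : X -> X -> A) :
  (forall x, nm (ip x x) = nm x ^+ 2) -> ip_complete ip.
Proof.
move=> ipE u hu; have [|l hl] := nm_cauchy (u := u).
  move=> e e0; have [|N hN] := hu ((e%:C)%C); first by rewrite ltcR.
  exists N => m n Nm Nn; have := hN m n Nm Nn.
  by rewrite (ip_norm_cstar (ipE _)) ltcR.
exists l => e e0.
have eE : e = ((complex.Re e)%:C)%C by rewrite RRe_real// gtr0_real.
have e1 : 0 < complex.Re e by rewrite -ltcR -eE.
have /nm_cvgP/(_ _ e1)[N _ hN] := hl; exists N => n Nn.
by rewrite (ip_norm_cstar (ipE _)) eE ltcR nmB; exact: hN.
Qed.

(** A itself is the imprimitivity bimodule, with B acting on the left through the inverse of psi;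
    the hypothesis on products x^* y is its fullness. *)
Lemma star_iso_morita (A B : cstarAlgType R) (psi : A -> B) : is_star_iso psi ->
  (forall a : A, closed_span [set c : A | exists x y : A, c = star x ** y] a) ->
  morita_equivalent B A.
Proof.
move=> [hpsi [phi psiK phiK]] full; have [pD pZ pM pS] := hpsi.
have hphi : is_star_hom phi.
  split.
  - by move=> x y; apply: (can_inj psiK); rewrite pD !phiK.
  - by move=> c x; apply: (can_inj psiK); rewrite pZ !phiK.
  - by move=> x y; apply: (can_inj psiK); rewrite pM !phiK.
  - by move=> x; apply: (can_inj psiK); rewrite pS !phiK.
have [qD qZ qM qS] := hphi.
have psi_nm x : nm (psi x) = nm x.
  apply/le_anti/andP; split; first exact: star_hom_contr.
  by rewrite -{1}[x]psiK; exact: star_hom_contr.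
exists A, (fun b x => phi b ** x), (fun x a => x ** a), (fun x y => psi (x ** star y)),
  (fun x y => star x ** y).
have spanP a : closed_span [set b | exists x y, b = psi (x ** star y)] (psi a).
  have sW := closed_subspace_preim (K := 1) (g := psi) (fun x y => _) pD
    (fun c x => ex_intro _ c (pZ c x)) (closed_span_subspace [set b | exists x y, b = psi (x ** star y)]).
  apply: (closed_span_min (sW _) _ (full a)).
    by move=> x y; rewrite mul1r; exact: star_hom_lip.
  move=> _ [x [y ->]] /=; apply: sub_closed_span; exists (star x), (star y).
  by rewrite starK.
split; first split.
- split => /=.
  + by move=> a b x; rewrite qD smulDl.
  + by move=> a x y; rewrite smulDr.
  + by move=> c a x; rewrite qZ smulZl.
  + by move=> c a x; rewrite smulZr.
  + by move=> a b x; rewrite qM smulA.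
  + by move=> x y z; rewrite smulDl pD.
  + by move=> c x y; rewrite smulZl pZ.
  + by move=> a x y; rewrite -smulA pM phiK.
  + by move=> x y; rewrite -pS starM starK.
  + by move=> x; exists (psi (star x)); rewrite -pS starK -pM.
  + move=> x x0; rewrite -[x]starK (@cstar_eq0 _ _ (star x)) ?star0// starK.
    by apply: (can_inj psiK); rewrite x0 star_hom0.
  + by apply: ip_complete_cstar => x; rewrite psi_nm nm_cstarr.
- apply/seteqP; split => // b _; rewrite -[b]phiK; exact: spanP.
- split; last by apply/seteqP; split => // a _; exact: full.
  split => /=.
  + by move=> x y b; rewrite smulDl.
  + by move=> x a b; rewrite smulDr.
  + by move=> c x b; rewrite smulZl.
  + by move=> c x b; rewrite smulZr.
  + by move=> x a b; rewrite smulA.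
  + by move=> x y z; rewrite smulDr.
  + by move=> c x y; rewrite smulZr.
  + by move=> x y b; rewrite smulA.
  + by move=> x y; rewrite starM starK.
  + by move=> x; exists x.
  + by move=> x /cstar_eq0.
  + by apply: ip_complete_cstar => x; rewrite nm_cstar.
- by move=> a x b; rewrite smulA.
- split; first by move=> a x y; rewrite qS starM smulA.
  by move=> b x y; rewrite starM starK smulA.
- by move=> x y z; rewrite psiK smulA.
Qed.

Lemma isometry_closed_range (A B : cstarAlgType R) (psi : A -> B) : is_star_hom psi ->
  (forall x, nm (psi x) = nm x) -> closed (range psi).
Proof.
move=> hpsi iso; apply: nm_closedI => y hy.
have e0 n : (0 : R) < n.+1%:R^-1 by rewrite invr_gt0.
have /choice[u hu] n : exists x, nm (y - psi x) < n.+1%:R^-1.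
  by have [_ [x _ <-]] := hy _ (e0 n); exists x.
have small (e : R) : 0 < e -> exists N, forall n, (N <= n)%N -> nm (y - psi (u n)) < e.
  move=> ep; have [N hN] : exists N, N.+1%:R^-1 < e.
    exists (Num.truncn e^-1); rewrite invf_plt ?posrE//.
    exact: truncnS_gt.
  exists N => n Nn; apply: lt_trans (hu n) (le_lt_trans _ hN).
  by rewrite lef_pV2 ?posrE// ler_nat.
have [|l hl] := nm_cauchy (u := u).
  move=> e ep; have e20 : 0 < e / 2 by rewrite divr_gt0.
  have [N hN] := small _ e20; exists N => m n Nm Nn.
  rewrite -iso (star_homB _ _ hpsi).
  have := nm_tri (psi (u m)) y (psi (u n)); rewrite (nmB _ y).
  have := hN m Nm; have := hN n Nn; lra.
exists l => //; apply/eqP; rewrite -subr_eq0; apply/eqP/nm_small_eq0 => e ep.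
have e20 : 0 < e / 2 by rewrite divr_gt0.
have [N hN] := small _ e20; have /nm_cvgP/(_ _ e20)[M _ hM] := hl.
have h1 := hN _ (leq_maxl N M); have /= h2 := hM _ (leq_maxr N M).
have h3 := nm_tri (psi l) (psi (u (maxn N M))) y.
rewrite -(star_homB _ _ hpsi) iso (nmB (psi (u _)) y) in h3.
lra.
Qed.

End morita_of_isomorphism.

Section multiplier_limit.
Context {R : realType} (A : cstarAlgType R).

(** The bound k carries convergence from D to the whole algebra, and convergence of the adjoints
    supplies the adjoint of the limit. *)
Lemma mult_of_net (T : Type) (F : set_system T) (FF : ProperFilter F) (a : T -> A) (k : R)
    (D : set A) : (\forall t \near F, nm (a t) <= k) ->
  (forall W : set A, closed W -> D `<=` W -> forall x, W x) ->
  (forall x, D x -> exists l : A, a t ** x @[t --> F] --> l) ->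
  (forall x, D x -> exists l : A, star (a t) ** x @[t --> F] --> l) ->
  exists M : mult, (forall x, a t ** x @[t --> F] --> M x) /\
    (forall x, star (a t) ** x @[t --> F] --> star M x).
Proof.
move=> ak dense cD cD'.
have ext (b : T -> A) : (\forall t \near F, nm (b t) <= k) ->
    (forall x, D x -> exists l : A, b t ** x @[t --> F] --> l) ->
    forall x, exists l : A, b t ** x @[t --> F] --> l.
  move=> bk cb; apply: dense => //; apply: nm_closedI => x hx; apply: near_cvg => e e0.
  pose K := `|k| + 1; have K0 : 0 < K by rewrite ltr_wpDl.
  have e20 : 0 < e / 2 by rewrite divr_gt0.
  have d0 : 0 < e / 2 / K by rewrite divr_gt0.
  have [y [l /nm_cvgP/(_ _ e20) hl] xy] := hx _ d0; exists l.
  apply: filterS (filterI bk hl) => t [bt lt].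
  have := nm_tri l (b t ** y) (b t ** x); rewrite -smulBr.
  have := nm_smul (b t) (y - x); rewrite (nmB y); rewrite ltr_pdivlMr// in xy.
  have := nm_ge0 (x - y); have := ler_norm k; rewrite /K in xy; nra.
have sk : \forall t \near F, nm (star (a t)) <= k.
  by apply: filterS ak => t; rewrite nm_star.
have /choice[l hl] := ext a ak cD; have /choice[l' hl'] := ext _ sk cD'.
have adj t : adj_fun (smul (a t)) (smul (star (a t))) by move=> x y; rewrite starM smulA.
have bnd (b : T -> A) : (\forall t \near F, nm (b t) <= k) ->
    \forall t \near F, forall x, nm (b t ** x) <= k * nm x.
  apply: filterS => t h x; apply: le_trans (nm_smul _ _) _.
  by rewrite ler_wpM2r ?nm_ge0.
have [lM ll] := mult_of_limit FF adj (bnd a ak) hl hl'.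
have [lM' _] := mult_of_limit FF (fun t => adj_fun_sym (adj t)) (bnd _ sk) hl' hl.
exists (Mult lM); split => // x.
by rewrite (@mult_star_uniq _ _ (Mult lM) (Mult lM')).
Qed.

End multiplier_limit.

(** * Functions on the sphere as multipliers of the Fatou algebra *)

Section fatou_multipliers.
Context {R : realType}.
Local Notation C := (complex R).
Local Notation sphere := (riemann_sphere R).
Variables (P Q : {poly C}).
Local Notation f := (@rational_map R P Q).
Hypotheses (PQ : coprimep P Q) (Q0 : Q != 0) (fN : ~ exists c, forall z, f z = c).
Local Notation tr := (transfer P Q).
Local Notation J := (julia f).
Local Notation F := (fatou f).
Local Notation S2 := [set: sphere].
Local Notation cuts := (@cuts R P Q).
Let tF := tameF PQ Q0 fN.
Let CF : ProperFilter cuts := @cuts_filter R P Q.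
Let CF' : Filter cuts. Proof. exact _. Qed.

Variables (OF : cstarAlgType R) (rhoF : covariant_rep (graph_bimodule f F) OF).
Hypothesis OF_univ : is_cuntz_pimsner rhoF.
Local Notation iF := (fI (rep_i rhoF)).
Local Notation SF := (fS (rep_S rhoF)).
Let T := rep_toeplitz rhoF.
Let FT := rep_fun_toeplitz PQ Q0 fN tF T.
Implicit Types (c g : sphere -> C) (h : sphere -> R) (x y : OF).

Let cutF h : cutoff P Q h -> is_C0 F (rc h). Proof. exact: (cutoff_C0 PQ Q0 fN). Qed.
Let mulF g c : is_C0 F g -> continuous c -> is_C0 F (fun z => g z * c z).
Proof. exact: (C0F_mulr PQ Q0 fN). Qed.
Let cutcont h : cutoff P Q h -> continuous (rc h). Proof. by move=> [? _ _]; exact: rc_cont. Qed.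
Let mulFl c g : is_C0 F g -> continuous c -> is_C0 F (fun z => c z * g z).
Proof.
move=> gF cc; rewrite (_ : (fun z => c z * g z) = fun z => g z * c z); first exact: mulF.
by apply/funext => z; rewrite mulrC.
Qed.
Let Fcont g : is_C0 F g -> continuous g. Proof. by move=> /(C0FP PQ Q0 fN)[]. Qed.
Let compF c : is_C0 F c -> is_C0 F (fun z => c (f z)). Proof. exact: (C0F_comp PQ Q0 fN). Qed.

Lemma fatou_cut_i g : is_C0 F g -> iF (fun z => g z * rc h z) @[h --> cuts] --> iF g.
Proof.
move=> gF; apply: (fI_cvg T CF') => //.
  by apply: filterS (@cuts_cutoff R P Q) => h ch; apply: mulF => //; exact: cutcont.
by move=> e e0; apply: filterS (cuts_lim PQ Q0 fN gF e0) => h [].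
Qed.

Lemma fatou_cut_S g : is_C0 F g -> SF (fun z => g z * rc h z) @[h --> cuts] --> SF g.
Proof.
move=> gF; apply: (fS_cvg PQ Q0 fN tF T CF') => //.
  by apply: filterS (@cuts_cutoff R P Q) => h ch; apply: mulF => //; exact: cutcont.
by move=> e e0; apply: filterS (cuts_lim PQ Q0 fN gF e0) => h [].
Qed.

Lemma fatou_cut_Sf g : is_C0 F g -> SF (fun z => g z * rc h (f z)) @[h --> cuts] --> SF g.
Proof.
move=> gF; apply: (fS_cvg PQ Q0 fN tF T CF') => //.
  apply: filterS (@cuts_cutoff R P Q) => h ch; apply: mulF => //.
  by apply: (comp_cont PQ Q0); exact: cutcont.
by move=> e e0; apply: filterS (cuts_lim PQ Q0 fN gF e0) => h [].
Qed.

Lemma fatou_star_cut h : cutoff P Q h -> star (iF (rc h)) = iF (rc h).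
Proof.
move=> ch; rewrite -(ft_IS FT); last exact: cutF.
congr iF; apply/funext => z; exact: conjCR.
Qed.

Lemma fatou_cutoff_nm h : cutoff P Q h -> nm (iF (rc h)) <= 1.
Proof.
move=> ch; apply: (fI_nm T) => //; first exact: cutF.
by move=> z; have [_ /(_ z)/andP[h0 h1] _] := ch; rewrite nmR ger0_norm.
Qed.

Let W : set OF := [set x | iF (rc h) ** x @[h --> cuts] --> x].

Let W_closed : closed W.
Proof.
apply: (@lim_closed _ _ _ _ _ _ 1) => [|x y]; last by rewrite mul1r.
apply: filterS (@cuts_cutoff R P Q) => h ch x y; rewrite -smulBr mul1r.
by apply: le_trans (nm_smul _ _) _; rewrite ler_piMl ?nm_ge0//; exact: fatou_cutoff_nm.
Qed.

Let W_mul x y : W x -> W (x ** y).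
Proof.
move=> Wx; apply: (nm_squeeze (K := nm y) CF' _ Wx); apply: filterE => h.
by rewrite smulA -smulBl mulrC nm_smul.
Qed.

Let W_D x y : W x -> W y -> W (x + y).
Proof.
move=> Wx Wy; rewrite /W/=; under eq_fun do rewrite smulDr.
exact: (cvgD Wx Wy).
Qed.

Let W_Z (c : C) x : W x -> W (c *: x).
Proof.
move=> Wx; apply: (nm_squeeze (K := nm c) CF' _ Wx); apply: filterE => h.
by rewrite smulZr -scalerBr nmZ.
Qed.

Let W_i g : is_C0 F g -> W (iF g).
Proof.
move=> gF; apply: (cvg_near_eq _ (fatou_cut_i gF)).
apply: filterS (@cuts_cutoff R P Q) => h ch; rewrite -(ft_IM FT (cutF ch) gF).
by congr iF; apply/funext => z; rewrite mulrC.
Qed.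

Lemma fatou_unit x : iF (rc h) ** x @[h --> cuts] --> x.
Proof.
(* W is not visibly stable under [star], so both membership statements are carried through the
   induction on generators. *)
suff [] : W x /\ W (star x) by [].
move: x; apply: (rep_gen_ind PQ Q0 tF OF_univ).
- split.
  + apply: closedI => //; apply: (@closed_preim _ _ _ 1 star) => // y z; exact: star_lip.
  + by rewrite star0; split; rewrite /W/=; under eq_fun do rewrite smul0; exact: cvg_cst.
  + move=> x y [x1 x2] [y1 y2]; rewrite starD starM; split; split.
    * exact: W_D.
    * exact: W_D.
    * exact: W_mul.
    * exact: W_mul.
  + by move=> c x [x1 x2]; rewrite starZ; split; exact: W_Z.
  + by move=> x [x1 x2]; rewrite starK.
- by move=> g gF; rewrite -(ft_IS FT)//; split; apply: W_i => //; exact: is_C0_star.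
- move=> g gF; split.
    apply: (cvg_near_eq _ (fatou_cut_S gF)).
    apply: filterS (@cuts_cutoff R P Q) => h ch; rewrite (ft_iS FT (cutF ch) gF).
    by congr SF; apply/funext => z; rewrite mulrC.
  apply: (nm_squeeze (K := 1) CF' _ (fatou_cut_Sf gF)).
  apply: filterS (@cuts_cutoff R P Q) => h ch; rewrite mul1r -(nm_star (SF g - _)) starB.
  apply: le_of_eq; congr (nm (_ - _)); rewrite -(fatou_star_cut ch) -starM.
  rewrite (ft_Si FT (cutF ch) gF); congr (star (SF _)); apply/funext => z.
  by rewrite mulrC.
Qed.

Lemma fatou_dense (V : set OF) : closed V ->
  (forall c y, is_C0 F c -> V (iF c ** y)) -> forall x, V x.
Proof.
move=> cV hV x; apply: (@closed_lim _ _ cuts CF _ V _ _ cV (@fatou_unit x)).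
by apply: filterS (@cuts_cutoff R P Q) => h ch; apply: hV; exact: cutF.
Qed.

Lemma fatou_faithful x y : (forall c, is_C0 F c -> iF c ** x = iF c ** y) -> x = y.
Proof.
move=> h; apply: (@cvg_eq_lim _ _ cuts CF _ _ _ _ (@fatou_unit x)).
apply: (cvg_near_eq _ (@fatou_unit y)).
by apply: filterS (@cuts_cutoff R P Q) => k ck; rewrite h//; exact: cutF.
Qed.

Lemma fatou_mult_ext (L M : @mult R OF) : (forall c, is_C0 F c -> L (iF c) = M (iF c)) -> L = M.
Proof.
move=> h; apply: mult_ext; apply: fatou_dense => [|c y cF]; last by rewrite !mult_fM h.
apply: (@closed_eq _ _ _ (nm L + nm M)) => x y; rewrite -mult_fB.
  by apply: le_trans (mult_nm_ub _ _) _; have := nm_ge0 M; have := nm_ge0 (x - y); nra.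
by apply: le_trans (mult_nm_ub _ _) _; have := nm_ge0 L; have := nm_ge0 (x - y); nra.
Qed.

(** Evaluates M at any y, seen after multiplication by i(c), from the values of its adjoint at
    functions alone; [fatou_faithful] then removes i(c). *)
Lemma fatou_mulC (M : @mult R OF) c y : is_C0 F c ->
  iF c ** M y = star (star M (iF (fun z => (c z)^*))) ** y.
Proof.
move=> cF; rewrite mult_starP starK (ft_IS FT)// starK //.
Qed.

Let dom : set OF := [set x | exists c y, is_C0 F c /\ x = iF c ** y].

Let dom_dense (V : set OF) : closed V -> dom `<=` V -> forall x, V x.
Proof. by move=> cV hV; apply: fatou_dense => // c y cF; apply: hV; exists c, y. Qed.

(** M is the strict limit of i(g h) over the cutoffs h, since g itself need not be in C_0(F). Only
    its values at functions are recorded; they determine it by [fatou_mult_ext]. *)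
Lemma mult_i_ex g : exists M : @mult R OF, continuous g -> forall c, is_C0 F c ->
  M (iF c) = iF (fun z => g z * c z) /\ star M (iF c) = iF (fun z => (g z)^* * c z).
Proof.
have [cg|] := pselect (continuous g); last by exists 0.
have [B [B0 gB]] := is_C0_bounded (proj2 (C0SP P Q g) cg).
have hr h : cutoff P Q h -> is_C0 F (fun z => g z * rc h z).
  by move=> ch; exact: (mulFl (cutF ch) cg).
pose a h := iF (fun z => g z * rc h z).
have cvg1 c : is_C0 F c -> a h ** iF c @[h --> cuts] --> iF (fun z => g z * c z).
  move=> cF; apply: (cvg_near_eq _ (fatou_cut_i (mulFl cF cg))).
  apply: filterS (@cuts_cutoff R P Q) => h ch; rewrite -(ft_IM FT (hr _ ch) cF).
  by congr iF; apply/funext => z; rewrite mulrAC.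
have cvg2 c : is_C0 F c -> star (a h) ** iF c @[h --> cuts] --> iF (fun z => (g z)^* * c z).
  move=> cF; apply: (cvg_near_eq _ (fatou_cut_i (mulFl cF (conj_cont P Q cg)))).
  apply: filterS (@cuts_cutoff R P Q) => h ch.
  rewrite -(ft_IS FT (hr _ ch)) -(ft_IM FT (is_C0_star (hr _ ch)) cF).
  by congr iF; apply/funext => z; rewrite rmorphM /= conjCR mulrAC.
have cvgr (b : (sphere -> R) -> OF) l y : b @ cuts --> l -> b h ** y @[h --> cuts] --> l ** y.
  move=> bl; apply: (nm_squeeze (K := nm y) CF' _ bl); apply: filterE => h.
  by rewrite -smulBl mulrC nm_smul.
have [||||M [M1 M2]] := @mult_of_net _ _ _ _ CF a (complex.Re B) dom.
- apply: filterS (@cuts_cutoff R P Q) => h ch; apply: (fI_nm T); first exact: hr.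
    by rewrite -lecR RRe_real ?gtr0_real// ltW.
  move=> z; rewrite nmM nmR; have [_ /(_ z)/andP[h0 h1] _] := ch; rewrite ger0_norm//.
  have : nm (g z) <= complex.Re B by rewrite -lecR -normE RRe_real ?gtr0_real.
  by have := nm_ge0 (g z); nra.
- exact: dom_dense.
- move=> _ [c [y [cF ->]]]; exists (iF (fun z => g z * c z) ** y).
  by under eq_fun do rewrite smulA; apply: cvgr; exact: cvg1.
- move=> _ [c [y [cF ->]]]; exists (iF (fun z => (g z)^* * c z) ** y).
  by under eq_fun do rewrite smulA; apply: cvgr; exact: cvg2.
exists M => _ c cF; split.
  exact: (@cvg_eq_lim _ _ cuts CF _ _ _ _ (M1 _) (cvg1 c cF)).
exact: (@cvg_eq_lim _ _ cuts CF _ _ _ _ (M2 _) (cvg2 c cF)).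
Qed.

(** The strict limit of the S_(g h) over the cutoffs h. Right multiplication by i(c) brings in c
    composed with f, left multiplication c itself, whence the two different formulas. *)
Lemma mult_S_ex g : exists M : @mult R OF, continuous g -> forall c, is_C0 F c ->
  M (iF c) = SF (fun z => g z * c (f z)) /\ star M (iF c) = star (SF (fun z => (c z)^* * g z)).
Proof.
have [cg|] := pselect (continuous g); last by exists 0.
have [B [B0 gB]] := is_C0_bounded (proj2 (C0SP P Q g) cg).
have hr h : cutoff P Q h -> is_C0 F (fun z => g z * rc h z).
  by move=> ch; exact: (mulFl (cutF ch) cg).
pose a h := SF (fun z => g z * rc h z).
have cvg1 c : is_C0 F c -> a h ** iF c @[h --> cuts] --> SF (fun z => g z * c (f z)).
  move=> cF; apply: (cvg_near_eq _ (fatou_cut_S (mulFl (compF cF) cg))).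
  apply: filterS (@cuts_cutoff R P Q) => h ch; rewrite (ft_Si FT cF (hr _ ch)).
  by congr SF; apply/funext => z; rewrite mulrA [_ * g z]mulrC.
have cvg2 c : is_C0 F c -> star (a h) ** iF c @[h --> cuts] --> star (SF (fun z => (c z)^* * g z)).
  move=> cF; apply: (nm_squeeze (K := 1) CF' _ (fatou_cut_S (mulF (is_C0_star cF) cg))).
  apply: filterS (@cuts_cutoff R P Q) => h ch; rewrite mul1r -[X in _ <= X]nm_star starB.
  apply: le_of_eq; congr (nm (_ - _)).
  rewrite -[iF c]starK -starM -(ft_IS FT cF) (ft_iS FT (is_C0_star cF) (hr _ ch)).
  by congr (star (SF _)); apply/funext => z; rewrite mulrA.
have cvgr (b : (sphere -> R) -> OF) l y : b @ cuts --> l -> b h ** y @[h --> cuts] --> l ** y.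
  move=> bl; apply: (nm_squeeze (K := nm y) CF' _ bl); apply: filterE => h.
  by rewrite -smulBl mulrC nm_smul.
have [||||M [M1 M2]] := @mult_of_net _ _ _ _ CF a (((rdeg P Q)%:R + 1) * complex.Re B) dom.
- apply: filterS (@cuts_cutoff R P Q) => h ch; apply: (fS_nm PQ Q0 fN tF T); first exact: hr.
    by rewrite -lecR RRe_real ?gtr0_real// ltW.
  move=> z; rewrite nmM nmR; have [_ /(_ z)/andP[h0 h1] _] := ch; rewrite ger0_norm//.
  have : nm (g z) <= complex.Re B by rewrite -lecR -normE RRe_real ?gtr0_real.
  by have := nm_ge0 (g z); nra.
- exact: dom_dense.
- move=> _ [c [y [cF ->]]]; exists (SF (fun z => g z * c (f z)) ** y).
  by under eq_fun do rewrite smulA; apply: cvgr; exact: cvg1.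
- move=> _ [c [y [cF ->]]]; exists (star (SF (fun z => (c z)^* * g z)) ** y).
  by under eq_fun do rewrite smulA; apply: cvgr; exact: cvg2.
exists M => _ c cF; split.
  exact: (@cvg_eq_lim _ _ cuts CF _ _ _ _ (M1 _) (cvg1 c cF)).
exact: (@cvg_eq_lim _ _ cuts CF _ _ _ _ (M2 _) (cvg2 c cF)).
Qed.

Definition mult_i g : @mult R OF := projT1 (cid (mult_i_ex g)).
Definition mult_S g : @mult R OF := projT1 (cid (mult_S_ex g)).

Lemma mult_iE g c : continuous g -> is_C0 F c -> mult_i g (iF c) = iF (fun z => g z * c z).
Proof. by rewrite /mult_i; case: cid => M /= h cg cF; have [] := h cg c cF. Qed.

Lemma mult_i_star g c : continuous g -> is_C0 F c ->
  star (mult_i g) (iF c) = iF (fun z => (g z)^* * c z).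
Proof. by rewrite /mult_i; case: cid => M /= h cg cF; have [] := h cg c cF. Qed.

Lemma mult_SE g c : continuous g -> is_C0 F c -> mult_S g (iF c) = SF (fun z => g z * c (f z)).
Proof. by rewrite /mult_S; case: cid => M /= h cg cF; have [] := h cg c cF. Qed.

Lemma mult_S_star g c : continuous g -> is_C0 F c ->
  star (mult_S g) (iF c) = star (SF (fun z => (c z)^* * g z)).
Proof. by rewrite /mult_S; case: cid => M /= h cg cF; have [] := h cg c cF. Qed.

#[local] Opaque mult_i mult_S.

Lemma mult_i_S (a g : sphere -> C) : continuous a -> is_C0 F g -> mult_i a (SF g) = SF (fun z => a z * g z).
Proof.
move=> ca gF; apply: fatou_faithful => c cF; have cF' := is_C0_star cF.
have acF := mulFl cF' (conj_cont P Q ca).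
rewrite (fatou_mulC _ _ cF) (mult_i_star ca cF') -(ft_IS FT acF).
rewrite (ft_iS FT (is_C0_star acF) gF) (ft_iS FT cF (mulFl gF ca)).
by congr SF; apply/funext => z; rewrite rmorphM /= !conjCK mulrCA mulrA.
Qed.

Lemma mult_S_S g (h : sphere -> C) : continuous g -> is_C0 F h ->
  star (mult_S g) (SF h) = iF (tr (fun z => (g z)^* * h z)).
Proof.
move=> cg hF; apply: fatou_faithful => c cF; have cF' := is_C0_star cF.
have ghF := mulFl hF (conj_cont P Q cg).
rewrite (fatou_mulC _ _ cF) starK (mult_SE cg cF') (ft_SS FT (mulFl (compF cF') cg) hF).
rewrite -(ft_IM FT cF (transfer_C0 PQ Q0 fN tF ghF)).
congr iF; apply/funext => y; rewrite -transferZ; apply: (eq_transfer PQ Q0 fN) => x fx.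
by rewrite rmorphM /= conjCK fx mulrAC mulrC mulrA.
Qed.

Lemma mult_fun_toeplitz : fun_toeplitz P Q S2 mult_i mult_S.
Proof.
have Sc := fun g => proj1 (C0SP P Q g).
have cD (g h : sphere -> C) : continuous g -> continuous h -> continuous (fun z => g z + h z).
  by move=> cg ch; apply: Sc; exact: C0E_D (proj2 (C0SP P Q g) cg) (proj2 (C0SP P Q h) ch).
have cZ (k : C) g : continuous g -> continuous (fun z => k * g z).
  by move=> cg; apply: Sc; exact: C0E_Z (proj2 (C0SP P Q g) cg).
split.
- move=> g h /Sc cg /Sc ch; apply: fatou_mult_ext => c cF.
  rewrite [LHS](mult_iE (cD _ _ cg ch) cF) multD.
  rewrite [X in X + _](mult_iE cg cF) [X in _ + X](mult_iE ch cF).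
  rewrite -(ft_ID FT (mulFl cF cg) (mulFl cF ch)).
  by congr iF; apply/funext => z; rewrite mulrDl.
- move=> k g /Sc cg; apply: fatou_mult_ext => c cF.
  rewrite [LHS](mult_iE (cZ _ _ cg) cF) multZ [X in _ *: X](mult_iE cg cF).
  rewrite -(ft_IZ FT _ (mulFl cF cg)).
  by congr iF; apply/funext => z; rewrite mulrA.
- move=> g h /Sc cg /Sc ch; apply: fatou_mult_ext => c cF.
  rewrite [LHS](mult_iE (mul_cont cg ch) cF) multM.
  rewrite [X in mfun _ X](mult_iE ch cF) [RHS](mult_iE cg (mulFl cF ch)).
  by congr iF; apply/funext => z; rewrite mulrA.
- move=> g /Sc cg; apply: fatou_mult_ext => c cF.
  by rewrite [RHS](mult_i_star cg cF) [LHS](mult_iE (conj_cont P Q cg) cF).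
- move=> g h /Sc cg /Sc ch; apply: fatou_mult_ext => c cF.
  rewrite [LHS](mult_SE (cD _ _ cg ch) cF) multD.
  rewrite [X in X + _](mult_SE cg cF) [X in _ + X](mult_SE ch cF).
  rewrite -(ft_SD FT (mulFl (compF cF) cg) (mulFl (compF cF) ch)).
  by congr SF; apply/funext => z; rewrite mulrDl.
- move=> k g /Sc cg; apply: fatou_mult_ext => c cF.
  rewrite [LHS](mult_SE (cZ _ _ cg) cF) multZ [X in _ *: X](mult_SE cg cF).
  rewrite -(ft_SZ FT _ (mulFl (compF cF) cg)).
  by congr SF; apply/funext => z; rewrite mulrA.
- move=> a g /Sc ca /Sc cg; apply: fatou_mult_ext => c cF.
  rewrite [RHS](mult_SE (mul_cont ca cg) cF) multM.
  rewrite [X in mfun _ X](mult_SE cg cF) [LHS](mult_i_S ca (mulFl (compF cF) cg)).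
  by congr SF; apply/funext => z; rewrite mulrA.
- move=> a g /Sc ca /Sc cg; apply: fatou_mult_ext => c cF.
  rewrite [RHS](mult_SE (mul_cont (comp_cont PQ Q0 ca) cg) cF) multM.
  rewrite [X in mfun _ X](mult_iE ca cF) [LHS](mult_SE cg (mulFl cF ca)).
  by congr SF; apply/funext => z; rewrite mulrCA mulrA.
- move=> g h /Sc cg /Sc ch; apply: fatou_mult_ext => c cF.
  have ct := transfer_continuous PQ Q0 fN (mul_cont (conj_cont P Q cg) ch).
  rewrite [RHS](mult_iE ct cF) multM [X in mfun _ X](mult_SE ch cF).
  rewrite [LHS](mult_S_S cg (mulFl (compF cF) ch)).
  congr iF; apply/funext => y; rewrite mulrC -transferZ; apply: (eq_transfer PQ Q0 fN) => x fx.
  by rewrite fx [RHS]mulrC mulrA.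
Qed.

Lemma fatou_mul_mult_S c g y : is_C0 F c -> continuous g ->
  iF c ** mult_S g y = SF (fun z => c z * g z) ** y.
Proof.
move=> cF cg; rewrite (fatou_mulC _ _ cF) (mult_S_star cg (is_C0_star cF)) starK.
by congr (SF _ ** y); apply/funext => z; rewrite conjCK.
Qed.

(** Multiplied by i(k) on the left and evaluated at i(c), with k and c in C_0(F), the claim becomes
    the finite-rank relation of O_F for the function k a c and the pairs (k p.1, conj(c) p.2). *)
Lemma mult_finite_rank (a : sphere -> C) s : continuous a ->
  (forall p, p \in s -> continuous p.1 /\ continuous p.2) -> finite_rank_fun P Q a s ->
  mult_i a = \sum_(p <- s) mult_S p.1 ** star (mult_S p.2).
Proof.
move=> ca sc hs; apply: fatou_mult_ext => c cF; rewrite (mult_iE ca cF).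
apply: fatou_faithful => k kF.
have -> : (\sum_(p <- s) mult_S p.1 ** star (mult_S p.2)) (iF c) =
    \sum_(p <- s) mult_S p.1 (star (mult_S p.2) (iF c)).
  by elim: s {sc hs} => [|p s ih]; rewrite ?big_nil ?mult0// !big_cons multD multM ih.
rewrite smul_sumr -(ft_IM FT kF (mulFl cF ca)).
pose s' := [seq ((fun z => k z * p.1 z), (fun z => (c z)^* * p.2 z)) | p <- s].
rewrite (@rep_fun_finite_rank _ _ _ PQ Q0 fN _ _ _ tF _ rhoF _ s').
- rewrite /s' big_map; apply: eq_big_seq => p ps; have [p1 p2] := sc p ps.
  by rewrite (fatou_mul_mult_S _ kF p1) (mult_S_star p2 cF).
- exact: (mulF kF (mul_cont ca (Fcont cF))).
- move=> _ /mapP[p ps ->] /=; have [p1 p2] := sc p ps.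
  by split; [exact: (mulF kF p1)|exact: (mulF (is_C0_star cF) p2)].
- move=> zeta x; rewrite /s' big_map -!mulrA (hs (fun z => c z * zeta z)) mulr_sumr.
  apply: eq_bigr => p _ /=; rewrite mulrCA; congr (_ * _).
  apply: (eq_transfer PQ Q0 fN) => z _; by rewrite rmorphM /= conjCK -mulrA mulrCA.
Qed.

End fatou_multipliers.

(** * The Fatou algebra as the ideal *)

Section fatou_ideal.
Context {R : realType}.
Local Notation C := (complex R).
Local Notation sphere := (riemann_sphere R).
Variables (P Q : {poly C}).
Local Notation f := (@rational_map R P Q).
Hypotheses (PQ : coprimep P Q) (Q0 : Q != 0) (fN : ~ exists c, forall z, f z = c).
Local Notation tr := (transfer P Q).
Local Notation J := (julia f).
Local Notation F := (fatou f).
Local Notation S2 := [set: sphere].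
Let tS : tame f S2 S2 S2 := @tameS R P Q.
Let tF := tameF PQ Q0 fN.

Variables (O : cstarAlgType R) (rho : covariant_rep (graph_bimodule f S2) O).
Hypothesis O_univ : is_cuntz_pimsner rho.
Variables (OF : cstarAlgType R) (rhoF : covariant_rep (graph_bimodule f F) OF).
Hypothesis OF_univ : is_cuntz_pimsner rhoF.
Local Notation K := (ideal_of_vanishing J rho).
Local Notation iO := (fI (rep_i rho)).
Local Notation SO := (fS (rep_S rho)).
Local Notation iF := (fI (rep_i rhoF)).
Local Notation SF := (fS (rep_S rhoF)).
Let FT := rep_fun_toeplitz PQ Q0 fN tS (rep_toeplitz rho).
Let FTF := rep_fun_toeplitz PQ Q0 fN tF (rep_toeplitz rhoF).
Implicit Types (g c : sphere -> C).

Let FS g : is_C0 F g -> is_C0 S2 g.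
Proof. by move=> /(C0FP PQ Q0 fN)[cg _]; apply/(C0SP P Q). Qed.
Let Sc g : is_C0 S2 g -> continuous g. Proof. by move/(C0SP P Q). Qed.
Let Fcont g : is_C0 F g -> continuous g. Proof. by move=> /(C0FP PQ Q0 fN)[]. Qed.
Let mulF g c : is_C0 F g -> continuous c -> is_C0 F (fun z => g z * c z).
Proof. exact: (C0F_mulr PQ Q0 fN). Qed.
Let compF c : is_C0 F c -> is_C0 F (fun z => c (f z)). Proof. exact: (C0F_comp PQ Q0 fN). Qed.

(** Elements of C_0(F) are represented as functions on the sphere that vanish off F, so extension by
    0 changes no formula and the relations of O apply verbatim. *)
Let FT1 : fun_toeplitz P Q F iO SO.
Proof.
split.
- by move=> g h /FS gF /FS hF; exact: (ft_ID FT gF hF).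
- by move=> c g /FS gF; exact: (ft_IZ FT c gF).
- by move=> g h /FS gF /FS hF; exact: (ft_IM FT gF hF).
- by move=> g /FS gF; exact: (ft_IS FT gF).
- by move=> g h /FS gF /FS hF; exact: (ft_SD FT gF hF).
- by move=> c g /FS gF; exact: (ft_SZ FT c gF).
- by move=> a g /FS aF /FS gF; exact: (ft_iS FT aF gF).
- by move=> a g /FS aF /FS gF; exact: (ft_Si FT aF gF).
- by move=> g h /FS gF /FS hF; exact: (ft_SS FT gF hF).
Qed.

Lemma fatou_inclusion : exists psi : OF -> O, [/\ is_star_hom psi,
  forall g, is_C0 F g -> psi (iF g) = iO g & forall g, is_C0 F g -> psi (SF g) = SO g].
Proof.
have [|sigma [si sS]] := fun_covariant_finite_rank PQ Q0 fN tF (perfectF (P := P) (Q := Q)) FT1.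
  move=> a s aF sF hs; apply: (rep_fun_finite_rank PQ Q0 fN tS rho (FS aF) _ hs).
  by move=> p /sF[p1 p2]; split; exact: FS.
have [_ /(_ _ sigma)[psi [hpsi Pi PS]]] := OF_univ.
exists psi; split => [//|g gF|g gF]; first by rewrite {1}/fI Pi si mkC0E.
by rewrite {1}/fS PS sS (tf_mkZ PQ Q0 tF).
Qed.

Lemma fatou_multiplier_rep : exists chi : O -> @mult R OF, [/\ is_star_hom chi,
  forall g, continuous g -> chi (iO g) = mult_i PQ Q0 fN OF_univ g &
  forall g, continuous g -> chi (SO g) = mult_S PQ Q0 fN OF_univ g].
Proof.
have T := mult_fun_toeplitz PQ Q0 fN OF_univ.
have [|sigma [si sS]] := fun_covariant_finite_rank PQ Q0 fN tS (perfectS (P := P) (Q := Q)) T.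
  move=> a s /Sc ca sC hs; apply: (mult_finite_rank PQ Q0 fN OF_univ ca _ hs).
  by move=> p /sC[p1 p2]; split; exact: Sc.
have [_ /(_ _ sigma)[chi [hchi Pi PS]]] := O_univ.
exists chi; split => [//|g /(C0SP P Q) gC|g /(C0SP P Q) gC].
  by rewrite {1}/fI Pi si mkC0E.
by rewrite {1}/fS PS sS (tf_mkZ PQ Q0 tS).
Qed.

Section inclusion.
Variable psi : OF -> O.
Hypotheses (hpsi : is_star_hom psi) (psi_i : forall g, is_C0 F g -> psi (iF g) = iO g)
  (psi_S : forall g, is_C0 F g -> psi (SF g) = SO g).

(* psi x acts on O_F by multipliers as left multiplication by x, of norm nm x. *)
Lemma fatou_inclusion_nm x : nm (psi x) = nm x.
Proof.
apply/le_anti/andP; split; first exact: star_hom_contr.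
have [chi [hchi chi_i chi_S]] := fatou_multiplier_rep.
suff chiE : chi (psi x) = lmul x.
  by apply: le_trans (lmul_nm x) _; rewrite -chiE; exact: star_hom_contr.
have sub := eq_subalgebra (star_hom_comp hpsi hchi) (@lmul_hom _ OF).
apply: (rep_gen_ind PQ Q0 tF OF_univ sub) => g gF; rewrite /=.
  rewrite (psi_i gF) (chi_i _ (Fcont gF)); apply: (fatou_mult_ext PQ Q0 fN OF_univ) => c cF.
  by rewrite [LHS](mult_iE PQ Q0 fN OF_univ (Fcont gF) cF) /= -(ft_IM FTF gF cF).
rewrite (psi_S gF) (chi_S _ (Fcont gF)); apply: (fatou_mult_ext PQ Q0 fN OF_univ) => c cF.
rewrite [LHS](mult_SE PQ Q0 fN OF_univ (Fcont gF) cF) /= (ft_Si FTF cF gF).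
by congr SF; apply/funext => z; rewrite mulrC.
Qed.

Lemma fatou_inclusion_ideal x : ideal_set K (psi x).
Proof.
have [cK K0 KD KZ KM] := ideal_closed_ideal K; have [pD pZ pM pS] := hpsi.
have sub : is_closed_subalgebra [set x | ideal_set K (psi x)].
  split => /=.
  - by apply: (closed_preim (K := 1)) cK => y z; rewrite mul1r; exact: star_hom_lip.
  - by rewrite star_hom0.
  - move=> y z Ky Kz; rewrite pD pM; split; first exact: KD.
    by have [] := KM _ (psi z) Ky.
  - by move=> c y Ky; rewrite pZ; exact: KZ.
  - by move=> y Ky; rewrite pS; exact: (@ideal_star _ _ K _ Ky).
apply: (rep_gen_ind PQ Q0 tF OF_univ sub) => g gF /=.
  by rewrite psi_i//; exact: (K_i PQ Q0 fN).
by rewrite psi_S//; exact: (K_S PQ Q0 fN).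
Qed.

Let ranger x : range psi (psi x). Proof. by exists x. Qed.

Let range_star y : range psi y -> range psi (star y).
Proof. by have [_ _ _ pS] := hpsi; move=> [x _ <-]; rewrite -pS. Qed.

Let range_closed : closed (range psi).
Proof. exact: isometry_closed_range hpsi fatou_inclusion_nm. Qed.

Let mul_range_dense y : (forall c, is_C0 F c -> range psi (y ** iO c)) ->
  forall x, range psi (y ** psi x).
Proof.
have [_ _ pM _] := hpsi.
move=> hy; apply: (fatou_dense PQ Q0 fN OF_univ) => [|c x cF].
  apply: (closed_preim (K := nm y) (g := fun x => y ** psi x)) range_closed => u v.
  apply: le_trans (smul_lipl _ _ _) _; rewrite ler_wpM2l ?nm_ge0//.
  exact: star_hom_lip.
by rewrite pM psi_i// smulA; have [z _ <-] := hy c cF; rewrite -pM.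
Qed.

(** Elements i(c) x are dense in O_F, so it is enough that y i(c) is in the range for generators y
    and c in C_0(F): i(g) i(c) is i of g c, S_g i(c) is S of (c composed with f) times g, and the
    case of star S_g reduces to conj(c) g. All of these functions are in C_0(F). *)
Lemma fatou_range_ideal y x : range psi (y ** psi x) /\ range psi (psi x ** y).
Proof.
have [pD pZ pM pS] := hpsi.
pose N : set O := \bigcap_(x in [set: OF]) [set y | range psi (y ** psi x)].
suff [h1 h2] : N y /\ N (star y).
  split; first exact: h1.
  by rewrite -[psi x ** y]starK starM -pS; apply: range_star; exact: h2.
have cN : closed N.
  apply: closed_bigI => z _; apply: (closed_preim (K := nm (psi z)) (g := fun y => y ** psi z)) range_closed.
  by move=> u v; exact: smul_lipr.
have N_D u v : N u -> N v -> N (u + v).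
  move=> hu hv z _; rewrite /= smulDl.
  by have [a _ <-] := hu z I; have [b _ <-] := hv z I; rewrite -pD; exact: ranger.
have N_M u v : N u -> N v -> N (u ** v).
  by move=> hu hv z _; rewrite /= -smulA; have [a _ <-] := hv z I; exact: hu.
have N_Z (c : C) u : N u -> N (c *: u).
  by move=> hu z _; rewrite /= smulZl; have [a _ <-] := hu z I; rewrite -pZ; exact: ranger.
have N_i g : continuous g -> N (iO g).
  move=> cg z _; apply: mul_range_dense => c cF.
  rewrite -(ft_IM FT ((C0SP P Q g).2 cg) (FS cF)).
  rewrite (_ : (fun x => _) = fun z => c z * g z); last by apply/funext => t; rewrite mulrC.
  by rewrite -(psi_i (mulF cF cg)).
move: y; apply: (rep_gen_ind PQ Q0 tS O_univ).
- split.
  + apply: closedI => //; apply: (@closed_preim _ _ _ 1 star) => // u v; exact: star_lip.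
  + by rewrite star0; split => z _; rewrite /= smul0l; exists 0 => //; exact: star_hom0.
  + move=> u v [u1 u2] [v1 v2]; rewrite starD starM.
    by split; split; [exact: N_D|exact: N_D|exact: N_M|exact: N_M].
  + by move=> c u [u1 u2]; rewrite starZ; split; exact: N_Z.
  + by move=> u [u1 u2]; rewrite starK.
- move=> g gC; split; first exact: (N_i g (Sc gC)).
  by rewrite -(ft_IS FT gC); apply: N_i; exact: (conj_cont P Q (Sc gC)).
- move=> g gC; split => z _; apply: mul_range_dense => c cF.
    rewrite (ft_Si FT (FS cF) gC).
    by rewrite -(psi_S (mulF (compF cF) (Sc gC))).
  rewrite -[iO c]starK -starM -(ft_IS FT (FS cF)) (ft_iS FT (FS (is_C0_star cF)) gC).
  by apply: range_star; rewrite -(psi_S (mulF (is_C0_star cF) (Sc gC))).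
Qed.

Lemma fatou_ideal_range k : ideal_set K k -> range psi k.
Proof.
have [pD pZ pM pS] := hpsi.
apply; split; last first.
  move=> _ [b b0 <-]; have bF : is_C0 F b.
    by apply/(C0FP PQ Q0 fN); split => //; apply: Sc; exact: C0P.
  by rewrite -(mkC0K b) -/(fI _ b) -(psi_i bF).
split.
- exact: range_closed.
- by exists 0 => //; exact: star_hom0.
- by move=> _ _ [x _ <-] [y _ <-]; rewrite -pD.
- by move=> c _ [x _ <-]; rewrite -pZ.
- by move=> _ y [x _ <-]; have [h1 h2] := fatou_range_ideal y x.
Qed.

End inclusion.

(** The equivalence comes from an isomorphism onto K: psi is isometric, its range is a closed ideal
    containing the generators of K, and it maps into K. *)
Theorem ideal_morita : morita_equivalent (ideal_alg K) OF.
Proof.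
have [psi [hpsi psi_i psi_S]] := fatou_inclusion; have [pD pZ pM pS] := hpsi.
have Kpsi := fatou_inclusion_ideal hpsi psi_i psi_S.
pose psiK x : ideal_alg K := IdealAlg (asboolT (Kpsi x)).
have psi_nm := fatou_inclusion_nm hpsi psi_i psi_S.
have /choice[phi phiE] (k : ideal_alg K) : exists x, psi x = ideal_val k.
  by have [x _ <-] := fatou_ideal_range hpsi psi_i psi_S (ideal_algP k); exists x.
apply: (@star_iso_morita R OF (ideal_alg K) psiK).
  split.
    split.
    - by move=> x y; apply: ideal_val_inj; rewrite ideal_valD /= pD.
    - by move=> c x; apply: ideal_val_inj; rewrite ideal_valZ /= pZ.
    - by move=> x y; apply: ideal_val_inj; rewrite /= pM.
    - by move=> x; apply: ideal_val_inj; rewrite /= pS.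
  exists phi => [x|k]; last by apply: ideal_val_inj; exact: phiE.
  apply/eqP; rewrite -subr_eq0; apply/eqP/nm0_eq0.
  by rewrite -psi_nm (star_homB _ _ hpsi) phiE subrr nm0.
apply: (fatou_dense PQ Q0 fN OF_univ).
  by have [] := closed_span_subspace [set c : OF | exists x y, c = star x ** y].
move=> c y cF; apply: sub_closed_span; exists (iF (fun z => (c z)^*)), y.
by rewrite (ft_IS FTF cF) starK.
Qed.

End fatou_ideal.

Theorem theorem5p1 (R : realType) (P Q : {poly (complex R)})
    (f : riemann_sphere R -> riemann_sphere R)
    (coprimePQ : coprimep P Q) (Q_neq0 : Q != 0)
    (f_def : f = rational_map P Q)
    (f_nonconst : ~ exists c, forall z, f z = c)
    (julia_neq0 : julia f !=set0) (fatou_neq0 : fatou f !=set0)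
    (* O, OF, OJ are O_f(E) for E the sphere, the Fatou set, the Julia set *)
    (O OF OJ : cstarAlgType R)
    (rho : covariant_rep (graph_bimodule f [set: riemann_sphere R]) O)
    (rhoF : covariant_rep (graph_bimodule f (fatou f)) OF)
    (rhoJ : covariant_rep (graph_bimodule f (julia f)) OJ)
    (O_univ : is_cuntz_pimsner rho)
    (OF_univ : is_cuntz_pimsner rhoF)
    (OJ_univ : is_cuntz_pimsner rhoJ) :
  let K := ideal_of_vanishing (julia f) rho in
  morita_equivalent (ideal_alg K) OF /\
  exists phi : ideal_quotient K -> OJ,
    [/\ is_star_iso phi,
        forall b, phi (quot_map K (rep_i rho b)) = rep_i rhoJ (julia_restrict f b) &
        forall xi, phi (quot_map K (rep_S rho xi)) =
                   rep_S rhoJ (julia_graph_restrict xi)].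
Proof.
subst f.
split; first exact: (ideal_morita coprimePQ Q_neq0 f_nonconst O_univ OF_univ).
exact: (quotient_iso coprimePQ Q_neq0 f_nonconst O_univ OJ_univ).
Qed.
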